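(* Let $\alpha\in(1,2)$ and let $X$ be a solution of $$X_t=x_0+L_t+\int_0^t\mu(X_s)\,ds,\qquad t\ge0,$$ where $L$ is a one-dimensional symmetric $\alpha$-stable process and $\mu\in K_\eta^f$ for some $\eta\in(0,\alpha-1)$. Then there exists a jointly continuous (in $(t,x)$) occupation density $(\ell_t^x)_{t\ge0}^{x\in\mathbb{R}}$ of $X$.
   Context: Symmetric $\alpha$-stable process: a one-dimensional Lévy process $L$ with $L_0=0$ and $\mathbb{E}[e^{i\xi L_t}]=e^{-t|\xi|^\alpha}$. Kato class: for a signed measure $\nu$ on $\mathbb{R}$ with total variation measure $|\nu|$ and $\eta\in(0,1)$ put $M_\nu^\eta(r)=\sup_{x\in\mathbb{R}}\int_{B(x,r)}\frac{|\nu|(dy)}{|x-y|^{1-\eta}}$. $K_\eta$ is the set of signed measures $\nu$ with $\lim_{r\downarrow0}M_\nu^\eta(r)=0$, and $K_\eta^f$ is the set of finite measures in $K_\eta$. Mollification: fix a non-negative, radial (even) $\varphi\in\mathcal{C}^\infty(\mathbb{R})$ with $\mathrm{supp}(\varphi)=[-1,1]$, $\int\varphi=1$; put $\varphi_n(x)=2^n\varphi(2^nx)$ and $\mu_n(x)=\int_{\mathbb{R}}\varphi_n(x-y)\mu(dy)$. Solution (for a signed measure $\mu\in K_{\alpha-1}$): a càdlàg process $X$ is a solution with initial condition $x_0\in\mathbb{R}$ if there is a continuous process $(A_t)_{t\ge0}$ such that a.s. $X_t=x_0+L_t+A_t$ for all $t\ge0$, where (1) $\int_0^t\mu_n(X_s)ds$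 converges to $A_t$ in probability, uniformly in $t$ over finite intervals; (2) there is a subsequence $\{n_k\}$ such that $\sup_k\int_0^t|\mu_{n_k}(X_s)|ds<\infty$ a.s. for each $t>0$; (3) under $\mathbb{P}$, $L_0=0$ and $L$ is a symmetric $\alpha$-stable process on $(\Omega,(\mathcal{F}_t)_{t\ge0})$. Occupation density: the density $\ell_t^x$ with respect to Lebesgue measure of the occupation measure $B\mapsto \mathrm{Leb}(\{0\le s\le t:X_s\in B\})$; thus a.s. $\int_0^tf(X_s)ds=\int_{\mathbb{R}}f(x)\ell_t^x\,dx$, $t\ge0$, for all bounded Borel $f$. Joint continuity means that almost surely $(t,x)\mapsto\ell_t^x$ is continuous. *)

(* Defs.v *)
From mathcomp Require Import all_boot all_order all_algebra.
From mathcomp Require Import all_classical all_reals all_analysis.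
From mathcomp Require Import complex.

Set Implicit Arguments.
Unset Strict Implicit.
Unset Printing Implicit Defensive.

Import Order.TTheory GRing.Theory Num.Theory.
Import numFieldNormedType.Exports.

Local Open Scope classical_set_scope.
Local Open Scope ring_scope.

Section signed_measures.
Context {R : realType}.
Implicit Type nu : {charge set (measurableTypeR R) -> \bar R}.

(* A Hahn decomposition R = hahn_pos `|` hahn_neg of nu is chosen; the Jordan
   parts below do not depend on the choice (Hahn_decomposition_uniq). *)
Definition hahn_pos nu := projT1 (cid (Hahn_decomposition nu)).

Definition hahn_neg nu := projT1 (cid (projT2 (cid (Hahn_decomposition nu)))).

Lemma hahn_posneg nu : hahn_decomposition nu (hahn_pos nu) (hahn_neg nu).
Proof. exact: projT2 (cid (projT2 (cid (Hahn_decomposition nu)))). Qed.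

Definition total_variation_measure nu
    : {measure set (measurableTypeR R) -> \bar R} :=
  charge_variation (hahn_posneg nu).

Definition charge_integral nu (f : R -> R) : R :=
  \int[jordan_pos (hahn_posneg nu)]_y f y
  - \int[jordan_neg (hahn_posneg nu)]_y f y.

(* The inverse is taken in \bar R, so that for eta < 1 the kernel is +oo at
   y = x and an atom of nu makes the integral infinite; powR or inversion in R
   would give the value 0 there. *)
Definition kato_modulus nu (eta r : R) : \bar R :=
  ereal_sup (range (fun x : R =>
    \int[total_variation_measure nu]_(y in (ball x r : set (measurableTypeR R)))
       ((`|x - y| `^ (1 - eta))%:E^-1)))%E.

(* Charges are finite signed measures, hence this is the finite Kato class. *)
Definition finite_kato_class (eta : R) nu : Prop :=
  kato_modulus nu eta r @[r --> 0^'+] --> 0%E.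

End signed_measures.

Section mollification.
Context {R : realType}.

Definition mollifier (phi : R -> R) : Prop :=
  [/\ forall n x, derivable (derive1n n phi) x 1,
      forall x, 0 <= phi x,
      forall x, phi (- x) = phi x,
      closure [set x | phi x != 0] = [set` `[-1, 1]] &
      (\int[lebesgue_measure]_x (phi x)%:E = 1)%E].

Definition mollifier_n (phi : R -> R) (n : nat) (x : R) : R :=
  2 ^+ n * phi (2 ^+ n * x).

Definition mollification (phi : R -> R)
    (mu : {charge set (measurableTypeR R) -> \bar R}) (n : nat) (x : R) : R :=
  charge_integral mu (fun y => mollifier_n phi n (x - y)).

End mollification.

(* A real-valued process indexed by [0, +oo[ is a function R -> T -> R of which
   only the values at nonnegative times are used. *)
Section processes.
Context {d : measure_display} {T : measurableType d} {R : realType}.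
Variable P : probability T R.
Implicit Types (F : R -> set (set T)) (X L A : R -> T -> R).

Definition filtration F : Prop :=
  [/\ forall t, 0 <= t -> sigma_algebra setT (F t),
      forall t, 0 <= t -> F t `<=` measurable &
      forall s t, 0 <= s -> s <= t -> F s `<=` F t].

Definition adapted F X : Prop :=
  forall t, 0 <= t ->
  forall B : set (measurableTypeR R), measurable B -> F t (X t @^-1` B).

Definition cadlag_path (f : R -> R) : Prop :=
  (forall t, 0 <= t -> f s @[s --> t^'+] --> f t) /\
  (forall t, 0 < t -> exists l : R, f s @[s --> t^'-] --> l).

Definition increment L (s t : R) (w : T) : R := L t w - L s w.

Definition charfun (Y : T -> R) (xi : R) : R[i] :=
  Complex (fine 'E_P[fun w => cos (xi * Y w)])
          (fine 'E_P[fun w => sin (xi * Y w)]).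

Definition levy_process F L : Prop :=
  [/\ adapted F L,
      {ae P, forall w, L 0 w = 0},
      {ae P, forall w, cadlag_path (L ^~ w)},
      (forall s t, 0 <= s -> s <= t ->
         forall (E : set T) (B : set (measurableTypeR R)),
         F s E -> measurable B ->
         (P (E `&` increment L s t @^-1` B) = P E * P (increment L s t @^-1` B))%E) &
      (forall s t, 0 <= s -> s <= t ->
         forall B : set (measurableTypeR R), measurable B ->
         P (increment L s t @^-1` B) = P (L (t - s) @^-1` B))].

Definition symmetric_stable_process (alpha : R) F L : Prop :=
  levy_process F L /\
  forall t, 0 <= t -> forall xi : R,
    charfun (L t) xi = (expR (- t * `|xi| `^ alpha))%:C%C.

Definition ucp_limit (Y : nat -> R -> T -> R) A : Prop :=
  forall t, 0 <= t -> forall e, 0 < e ->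
  P [set w | (e%:E < ereal_sup [set `|Y n s w - A s w|%:E | s in `[0%R, t]])%E]
    @[n --> \oo] --> 0%E.

Definition sde_solution (alpha : R) F L (phi : R -> R)
    (mu : {charge set (measurableTypeR R) -> \bar R}) (x0 : R) X : Prop :=
  [/\ filtration F,
      symmetric_stable_process alpha F L,
      adapted F X,
      (forall w, cadlag_path (X ^~ w)) &
      exists A : R -> T -> R,
      [/\ (forall t, 0 <= t -> measurable_fun setT (A t)) /\
            (forall w, {within `[0, +oo[, continuous (A ^~ w)}),
          {ae P, forall w, forall t, 0 <= t -> X t w = x0 + L t w + A t w},
          ucp_limit (fun n t w =>
            \int[lebesgue_measure]_(s in `[0, t])
              mollification phi mu n (X s w)) A &
          exists2 nk : nat -> nat, {homo nk : i j / (i < j)%N} &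
            forall t, 0 < t ->
            {ae P, forall w, (ereal_sup (range (fun k =>
               \int[lebesgue_measure]_(s in `[0%R, t])
                 `|mollification phi mu (nk k) (X s w)|%:E)) < +oo)%E}]].

Definition occupation_measure X (t : R) (w : T)
    (B : set (measurableTypeR R)) : \bar R :=
  lebesgue_measure ([set` `[0, t]] `&` (X ^~ w) @^-1` B).

Definition occupation_density X (ell : R -> R -> T -> R) : Prop :=
  (forall t x, 0 <= t -> measurable_fun setT (ell t x)) /\
  {ae P, forall w, forall t, 0 <= t ->
    [/\ measurable_fun (setT : set (measurableTypeR R)) (fun x => ell t x w),
        forall x, 0 <= ell t x w &
        forall B : set (measurableTypeR R), measurable B ->
          occupation_measure X t w B =
          (\int[lebesgue_measure]_(x in B) (ell t x w)%:E)%E]}.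

Definition jointly_continuous (ell : R -> R -> T -> R) : Prop :=
  {ae P, forall w, {within [set p : R * R | 0 <= p.1],
    continuous (fun p : R * R => ell p.1 p.2 w)}}.

End processes.

(* Main.v *)
(* Let p_e(x) = e / (e^2 + x^2), so that p_e / pi is an approximate identity as
   e tends to 0.  The Fourier transform of the law of L_t bounds E G(x + L_t)
   and E G'(x + L_t), for G = p_e, by C t^-kappa and C t^-kappa |x|^(eta - 1)
   with kappa < 1 and C independent of e; for G = p_(e/2) - p_e there is an
   additional factor e^gamma.  Replacing the drift of X by an approximation
   mu_k(X_r) dr, Duhamel's formula compares E[zeta G(X_t)], for zeta measurable
   at time s, with the free evolution, and the difference is controlled by
   E[zeta |mu_k|(X_r) |X_r - z|^(eta - 1)].  By the Kato condition convolution
   with |x|^(eta - 1) and multiplication by |mu_k| form a bounded operation, so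
   on short time windows this term is absorbed by iteration.
   Hence the additive functionals int_0^t (p_(e/2) - p_e)(X_r - z) dr have
   conditional second moments of order e^gamma, and by a John-Nirenberg argument
   exponential tails.  Borel-Cantelli over e = 2^-n and a grid of points z gives
   locally uniform convergence of pi^-1 int_0^t p_e(X_r - x) dr as e = 2^-n
   tends to 0; the limit is the jointly continuous occupation density. *)

Require Import Defs.
From HB Require Import structures.
From mathcomp Require Import all_boot all_order all_algebra.
From mathcomp Require Import all_classical all_reals all_analysis.
From mathcomp Require Import measurable_realfun lra ring zify.

Set Implicit Arguments.
Unset Strict Implicit.
Unset Printing Implicit Defensive.

Import Order.TTheory GRing.Theory Num.Theory.
Import numFieldNormedType.Exports.

Local Open Scope classical_set_scope.
Local Open Scope ring_scope.

(** No Markov property is at hand, and [A] is only a continuous limit of integrals of mollified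
    drifts. So every estimate is conditional on a past sigma-algebra and passes through a substitute
    path with drift [mu_k]. Returning to [X] costs constants that depend on the truncation of the
    singular kernel and on a level [m] for the variation of the drifts, against an error that
    vanishes only as [k] grows. Hence the order of choices: test function, truncation and [m] first,
    [k] last. The level [m] makes the term to be absorbed finite a priori; each iteration halves its
    contribution. The final bound contains neither [m], nor [k], nor the truncation, because the
    Kato bound is uniform in [k] and in the truncation. The exponent is
    [kappa = (1 + eta + 2 g) / alpha] with [g = (alpha - 1 - eta) / 4]. Interpolating two gradient
    bounds with weights [eta] and [1 - eta] produces [1 + eta]; one [g] makes the frequency integral
    converge, the other buys the factor [e ^ g]. For this [g], the condition [kappa < 1] is exactly
    [eta < alpha - 1]. *)

Section toolkit.
Context d (T : measurableType d) (R : realType).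
Variable mu : {measure set T -> \bar R}.

Lemma bounded_integrable (D : set T) (f : T -> R) (c : R) :
  measurable D -> (mu D < +oo)%E -> measurable_fun D f ->
  (forall x, D x -> `|f x| <= c) -> mu.-integrable D (EFin \o f).
Proof.
move=> mD Dfin mf fc.
apply: (@le_integrable _ _ _ mu D mD _ (cst c%:E)).
- exact/measurable_EFinP.
- move=> x Dx /=; rewrite lee_fin (le_trans (fc x Dx))// ler_norm//.
- apply/integrableP; split; first exact: measurable_cst.
  by rewrite integral_cst// lte_mul_pinfty// ?abse_ge0.
Qed.

Lemma Rintegral_le_bound (D : set T) (f : T -> R) (c : R) :
  measurable D -> (mu D < +oo)%E -> measurable_fun D f ->
  (forall x, D x -> `|f x| <= c) ->
  `|\int[mu]_(x in D) f x| <= c * fine (mu D).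
Proof.
move=> mD Dfin mf fc.
have intf := bounded_integrable mD Dfin mf fc.
apply: (le_trans (le_normr_Rintegral mD intf)).
rewrite -Rintegral_cst//; apply: le_Rintegral => //.
- exact: (integrable_norm intf).
- apply/integrableP; split; first exact: measurable_cst.
  by rewrite integral_cst// lte_mul_pinfty// ?abse_ge0.
Qed.

End toolkit.

(** * Improper integrals on the half-line and exchange of integrals *)

Section improper.
Context {R : realType}.
Notation mu := (@lebesgue_measure R).

Lemma FTC_improper (F f : R -> R) :
  {within `[0, +oo[, continuous f} ->
  (forall x : R, 0 < x -> is_derive x 1 F (f x)) ->
  F x @[x --> 0^'+] --> F 0 ->
  mu.-integrable `[0, +oo[ (EFin \o f) ->
  F n%:R @[n --> \oo] --> (0 : R) ->
  \int[mu]_(x in `[0, +oo[) f x = - F 0.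
Proof.
move=> cf dF F0 intf Foo.
pose g (n : nat) x := (f \_ `[0, n%:R]) x.
have Fn n : (0 < n)%N -> (\int[mu]_(x in `[0%R, +oo[) (g n x)%:E = (F n%:R - F 0)%:E)%E.
  move=> n0.
  rewrite /g.
  transitivity (\int[mu]_(x in `[0%R, +oo[) ((EFin \o f) \_ `[0%R, n%:R]%classic) x)%E.
    by apply: eq_integral => x _; rewrite restrict_EFin.
  rewrite -integral_mkcondr.
  rewrite (_ : (`[0%R, +oo[ `&` `[0%R, n%:R])%classic = `[0%R, n%:R]%classic); last first.
    apply/seteqP; split=> x /=; rewrite !in_itv/= ?andbT; first by case.
    by move=> /andP[-> ->].
  rewrite (@continuous_FTC2 _ f F)//.
  - by rewrite ltr0n.
  - by apply: continuous_subspaceW cf; apply: subset_itvl; rewrite bnd_simp.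
  - split => //.
    + by move=> x; rewrite in_itv/= => /andP[x0 _]; have [] := dF _ x0.
    + apply: cvg_at_left_filter.
      have n0' : (0 : R) < n%:R by rewrite ltr0n.
      have [Fx _] := dF _ n0'.
      exact/differentiable_continuous/derivable1_diffP.
  - move=> x; rewrite in_itv/= => /andP[x0 _].
    by rewrite derive1E; apply/derive_val; exact: dF.
have lim : (\int[mu]_(x in `[0%R, +oo[) (g n x)%:E)%E @[n --> \oo] --> (\int[mu]_(x in `[0%R, +oo[) (f x)%:E)%E.
  have := @dominated_convergence _ _ _ mu `[0, +oo[%classic _ (fun n => EFin \o g n) (EFin \o f) (EFin \o (fun x => `|f x|)).
  case => //.
  - move=> n; apply/measurable_EFinP; apply/measurable_restrict => //.
    have /measurable_EFinP mf := measurable_int _ intf.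
    by apply: measurable_funS mf => //; exact: subIsetl.
  - exact: (measurable_int _ intf).
  - apply: aeW => x; rewrite /= in_itv/= andbT => x0.
    apply: cvg_near_cst.
    near=> n.
    rewrite /g patchE mem_set//= in_itv/= x0/=.
    near: n; exact: nbhs_infty_ger.
  - exact: (integrable_norm intf).
  - apply: aeW => x n _ /=; rewrite lee_fin /g patchE; case: ifP => // _.
    by rewrite normr0.
rewrite /Rintegral (_ : (- F 0) = fine (- F 0)%:E)//; congr fine.
apply: (cvg_unique _ lim) => //.
have : (EFin \o (fun n : nat => F n%:R - F 0)) n @[n --> \oo] --> (0 - F 0)%:E.
  apply: cvg_EFin; first by near=> n.
  by apply: cvgB => //; exact: cvg_cst.
rewrite sub0r; apply: cvg_trans.
apply: near_eq_cvg; near=> n; rewrite /= Fn//; near: n; exact: nbhs_infty_gt.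
Unshelve. all: by end_near.
Qed.
End improper.

Section swap.
Context d1 d2 (T1 : measurableType d1) (T2 : measurableType d2) (R : realType).

(** A majorant in [y] alone gives integrability on the product because [m1] has total mass [1]; the
    restriction to [D] is carried by an indicator inside the integrand. *)
Lemma Rintegral_swap (m1 : probability T1 R) (m2 : {sigma_finite_measure set T2 -> \bar R})
    (D : set T2) (F : T1 -> T2 -> R) (g : T2 -> R) :
  measurable D ->
  measurable_fun [set: T1 * T2] (fun p => F p.1 p.2) ->
  m2.-integrable D (EFin \o g) ->
  (forall x y, D y -> `|F x y| <= g y) ->
  \int[m1]_x (\int[m2]_(y in D) F x y) = \int[m2]_(y in D) (\int[m1]_x F x y).
Proof.
move=> mD mF ig Fg.
have mFx x : measurable_fun [set: T2] (F x).
  exact: (measurableT_comp mF (measurable_pair1 x)).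
have mFy y : measurable_fun [set: T1] (F ^~ y).
  exact: (measurableT_comp mF (measurable_pair2 y)).
pose H (p : T1 * T2) := (F p.1 p.2 * \1_D p.2).
have mH : measurable_fun [set: T1 * T2] (EFin \o H).
  apply/measurable_EFinP; apply: measurable_funM => //.
  by apply: measurableT_comp => //; exact: measurable_snd.
have ge0 y : D y -> 0 <= g y.
  by move=> Dy; apply: le_trans (Fg point y Dy).
have Hint x : (\int[m2]_y (EFin \o H) (x, y) = \int[m2]_(y in D) (F x y)%:E)%E.
  rewrite [RHS]integral_mkcond; apply: eq_integral => y _.
  by rewrite /H /= restrict_EFin/= patchE indicE; case: ifPn => yD;
    rewrite ?mulr1 ?mulr0.
have Hint2 x : (\int[m2]_y `|(EFin \o H) (x, y)| <= \int[m2]_(y in D) (g y)%:E)%E.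
  rewrite [leRHS]integral_mkcond; apply: ge0_le_integral => //.
  - apply: measurableT_comp => //; apply: measurableT_comp mH (measurable_pair1 x).
  - apply/(measurable_restrictT _ mD); exact: (measurable_int _ ig).
  - move=> y _; rewrite /H /= patchE indicE; case: ifPn => yD /=.
      by rewrite mulr1 lee_fin Fg//; exact: set_mem.
    by rewrite mulr0 normr0.
have gfin : (\int[m2]_(y in D) (g y)%:E < +oo)%E.
  have /integrableP[_] := ig; under eq_integral => y yD.
    rewrite /= ger0_norm; last by apply: ge0; exact: set_mem.
    over.
  by [].
have iH : (m1 \x m2)%E.-integrable setT (EFin \o H).
  apply/integrable12ltyP => //=.
  apply: (@le_lt_trans _ _ (\int[m1]_x (cst (\int[m2]_(y in D) (g y)%:E) x))%E).
    apply: ge0_le_integral => //.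
    - by move=> x _; exact: integral_ge0.
    - apply: (measurable_fun_fubini_tonelli_F (fun z => `|(EFin \o H) z|%E)) => //.
      exact: measurableT_comp.
    - by move=> x _; exact: Hint2.
  rewrite integral_cst//; apply: le_lt_trans gfin.
  rewrite -[leRHS]mule1; apply: lee_wpmul2l; last exact: probability_le1.
  by apply: integral_ge0 => y Dy; rewrite lee_fin; exact: ge0.
have iFx x : m2.-integrable D (EFin \o F x).
  apply: (le_integrable mD _ _ ig).
    by apply/measurable_EFinP; exact: measurable_funTS.
  by move=> y Dy /=; rewrite lee_fin (le_trans (Fg x y Dy))// ler_norm.
have iFy y : D y -> m1.-integrable setT (EFin \o F ^~ y).
  move=> Dy; apply: (@bounded_integrable _ _ _ _ _ _ (g y)) => //=.
    by rewrite probability_setT ltry.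
  by move=> x _; exact: Fg.
rewrite /Rintegral; congr fine.
transitivity (\int[m1]_x \int[m2]_y (EFin \o H) (x, y))%E.
  apply: eq_integral => x _; rewrite Hint fineK//.
  exact: (integrable_fin_num mD (iFx x)).
rewrite (Fubini iH).
rewrite [RHS]integral_mkcond; apply: eq_integral => y _.
rewrite /H /= patchE indicE; case: ifPn => yD.
  under eq_integral do rewrite mulr1.
  rewrite fineK//; apply: integrable_fin_num => //.
  by apply: iFy; exact: set_mem.
by under eq_integral do rewrite mulr0; rewrite integral0.
Qed.

End swap.

Lemma is_derive_cvg {R : realType} (f : R -> R) (x df : R) :
  is_derive x 1 f df -> f z @[z --> x] --> f x.
Proof. by move=> [Fx _]; exact/differentiable_continuous/derivable1_diffP. Qed.

(** * Power bounds and an integrable weight at high frequencies *)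

Section powers.
Context {R : realType}.
Implicit Types (x y q s xi : R).

(** For [q] in this range [y ^ q <= 1 + y ^ 2], and the second-order Taylor bound of the exponential
    dominates that. The cap [2] covers all exponents [(p + 1 + g) / al] met below. *)
Lemma expRN_le_powR y q : 0 < y -> 0 <= q <= 2 -> expR (- y) <= 3 * y `^ (- q).
Proof.
move=> y0 /andP[q0 q2].
have H : y `^ q <= 3 * expR y.
  have H1 : 1 + y ^+ 2 / 2 <= expR y by have := expR_ge1Dxn 1 (ltW y0).
  have H2 : y `^ q <= 1 + y ^+ 2.
    have [y1|y1] := leP y 1.
      have -> : 1 = 1 `^ q :> R by rewrite powR1.
      apply: (@le_trans _ _ (1 `^ q)); last by rewrite lerDl sqr_ge0.
      by apply: ge0_ler_powR => //; rewrite nnegrE// ltW.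
    rewrite -(powR_mulrn 2 (ltW y0)).
    apply: le_trans (_ : y `^ 2 <= _); last by rewrite lerDr.
    exact: (ler_powR (ltW y1)).
  have := expR_gt0 y; lra.
rewrite expRN powRN ler_pdivlMr ?powR_gt0//.
by rewrite mulrC ler_pdivrMr ?expR_gt0.
Qed.

(** A common majorant for all frequency integrals. Its decay barely exceeds the threshold of
    integrability, so a bound by [wt] loses only [g] in the numerator of the power of [s]. *)
Definition wt (g xi : R) : R := (1 + xi) `^ (- (1 + g)).

Lemma wt_ge0 g xi : 0 <= wt g xi. Proof. exact: powR_ge0. Qed.

Lemma powR_cvgy0 (g : R) : 0 < g -> (1 + x) `^ (- g) @[x --> +oo] --> (0 : R).
Proof.
move=> g0; apply/cvgrPdist_lt => e e0; near=> x.
have x0 : 0 < x by near: x; exact: nbhs_pinfty_gt.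
rewrite sub0r normrN ger0_norm ?powR_ge0// powRN.
rewrite -[ltRHS]invrK ltf_pV2 ?posrE ?invr_gt0 ?powR_gt0 ?addr_gt0//.
have -> : e^-1 = (e^-1 `^ g^-1) `^ g.
  by rewrite -powRrM mulVf ?gt_eqF// powRr1// invr_ge0 ltW.
apply: gt0_ltr_powR => //.
- by rewrite nnegrE powR_ge0.
- by rewrite nnegrE ltW// addr_gt0.
- rewrite -ltrBlDl; near: x; apply: nbhs_pinfty_gt; exact: num_real.
Unshelve. all: by end_near.
Qed.

Lemma is_derive_powR1D (a x : R) : 0 < 1 + x ->
  is_derive x 1 (fun y : R => (1 + y) `^ a) (a * (1 + x) `^ (a - 1)).
Proof.
move=> x0.
have h1 := is_derive1_powR a x0.
have h2 : is_derive x (1:R) (fun y : R => 1 + y) 1.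
  rewrite -[X in is_derive _ _ _ X]add0r; exact: is_deriveD.
by have := is_derive1_comp h1 h2; rewrite mulr1.
Qed.

Lemma is_derive_wt g xi : 0 < g -> 0 < 1 + xi ->
  is_derive xi 1 (fun x => - g^-1 * (1 + x) `^ (- g)) (wt g xi).
Proof.
move=> g0 xi0.
have h3 := is_derive_powR1D (- g) xi0.
have := is_deriveZ (- g^-1) h3.
have -> : - g^-1 *: (- g * (1 + xi) `^ (- g - 1)) = wt g xi.
  by rewrite /wt opprD addrC [- 1 - g]addrC /GRing.scale/= mulrA mulNr mulrN opprK mulVf ?mul1r ?gt_eqF// addrC.
by [].
Qed.

Lemma integral_wt g : 0 < g ->
  (\int[@lebesgue_measure R]_(x in `[0%R, +oo[) (wt g x)%:E = (g^-1)%:E)%E.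
Proof.
move=> g0.
rewrite (@ge0_continuous_FTC2y _ (wt g) (fun x => - g^-1 * (1 + x) `^ (- g)) 0 0).
- by rewrite sub0e addr0 powR1 mulr1 EFinN oppeK.
- by move=> x _; exact: wt_ge0.
- apply: derivable_within_continuous => x; rewrite in_itv/= andbT => x0.
  have x1 : 0 < 1 + x by lra.
  by have [] := is_derive_powR1D (- (1 + g)) x1.
- rewrite -[X in _ --> X](mulr0 (- g^-1)); apply: cvgM; first exact: cvg_cst.
  exact: powR_cvgy0.
- move=> x x0; have [] // := @is_derive_wt g x g0 _; lra.
- apply: cvg_at_right_filter.
  have h : is_derive (0 : R) 1 (fun x => - g^-1 * (1 + x) `^ (- g)) (wt g 0).
    by apply: is_derive_wt => //; lra.
  exact: (is_derive_cvg h).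
- move=> x; rewrite in_itv/= andbT => x0.
  rewrite derive1E; apply/derive_val; apply: is_derive_wt => //; lra.
Qed.

(** Used with [m = 1] for [xi <= 1] and with [m = xi] beyond; the constant is [2 ^ (1 + g) <= 4]. *)
Lemma wt_ge g xi m : 0 < g <= 1 -> 0 <= xi -> 1 <= m -> 1 + xi <= 2 * m ->
  m `^ (- (1 + g)) <= 4 * wt g xi.
Proof.
move=> /andP[g0 g1] xi0 m1 xim; rewrite /wt !powRN.
have m0 : 0 < m by lra.
have x0 : 0 < 1 + xi by lra.
rewrite ler_pdivlMr ?powR_gt0// mulrC ler_pdivrMr ?powR_gt0//.
apply: (@le_trans _ _ ((2 * m) `^ (1 + g))).
  by apply: ge0_ler_powR; rewrite ?nnegrE; lra.
rewrite powRM; [|lra|lra].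
apply: ler_wpM2r; first exact: powR_ge0.
apply: (@le_trans _ _ (2 `^ 2)); first by apply: ler_powR; lra.
by rewrite powR_mulrn; lra.
Qed.

(** For [xi > 1], [expRN_le_powR] is applied to [y = s * xi ^ al] with the exponent for which
    [xi ^ p * y ^ (- q)] becomes [s ^ (- q) * xi ^ (- (1 + g))]. For [xi <= 1] the left side is at
    most [1], while [s <= 1] makes the power of [s] at least [1]. The constant [12] is the [3] of
    the exponential bound times the [4] of [wt_ge]. *)
Lemma powR_expR_le_wt (al g p s xi : R) : 0 < al -> 0 < g <= 1 -> 0 <= p ->
  (p + 1 + g) / al <= 2 -> 0 < s <= 1 -> 0 <= xi ->
  xi `^ p * expR (- (s * xi `^ al)) <= 12 * s `^ (- ((p + 1 + g) / al)) * wt g xi.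
Proof.
move=> al0 g01 p0 q2 /andP[s0 s1] xi0.
have q0 : 0 <= (p + 1 + g) / al by apply: divr_ge0; lra.
have [xi1|xi1] := leP xi 1.
  have h1 : xi `^ p * expR (- (s * xi `^ al)) <= 1.
    have h1 : xi `^ p <= 1.
      rewrite (_ : 1 = 1 `^ p); last by rewrite powR1.
      by apply: ge0_ler_powR; rewrite ?nnegrE.
    have h2 : expR (- (s * xi `^ al)) <= 1.
      by rewrite expR_le1 oppr_le0 mulr_ge0 ?powR_ge0// ltW.
    by rewrite -[leRHS]mulr1; apply: ler_pM => //; rewrite ?powR_ge0 ?expR_ge0.
  have h2 : 1 <= s `^ (- ((p + 1 + g) / al)).
    rewrite -[leLHS](@powRr0 _ s); apply: ger_powR; lra.
  have h3 := @wt_ge g xi 1 g01 xi0 (lexx _) ltac:(lra).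
  rewrite powR1 in h3.
  have h4 := wt_ge0 g xi.
  nra.
have h3 := @wt_ge g xi xi g01 xi0 (ltW xi1) ltac:(lra).
have y0 : 0 < s * xi `^ al by rewrite mulr_gt0// powR_gt0//; lra.
have h1 := @expRN_le_powR _ ((p + 1 + g) / al) y0.
have {}h1 := h1 ltac:(by rewrite q0).
have E : xi `^ p * (s * xi `^ al) `^ (- ((p + 1 + g) / al)) =
    s `^ (- ((p + 1 + g) / al)) * xi `^ (- (1 + g)).
  rewrite powRM ?powR_ge0//; last lra.
  rewrite -powRrM mulrCA -powRD; last by apply/implyP => _; lra.
  by congr (_ * _ `^ _); field; rewrite gt_eqF.
apply: (@le_trans _ _ (3 * (s `^ (- ((p + 1 + g) / al)) * xi `^ (- (1 + g))))).
  by rewrite -E mulrCA; apply: ler_wpM2l => //; exact: powR_ge0.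
have := powR_ge0 s (- ((p + 1 + g) / al)); nra.
Qed.

Lemma wt_integrable g : 0 < g ->
  (@lebesgue_measure R).-integrable `[0, +oo[ (EFin \o wt g).
Proof.
move=> g0; apply/integrableP; split.
  apply/measurable_EFinP.
  apply: (measurable_funS measurableT) => //.
  by apply: (measurableT_comp (measurable_powR _)); exact: measurable_funD.
under eq_integral => x _ do rewrite /= ger0_norm ?wt_ge0//.
by rewrite integral_wt// ltry.
Qed.

Lemma wt_bound (g : R) (f : R -> R) (C : R) : 0 < g ->
  measurable_fun (`[0%R, +oo[%classic : set R) f ->
  (forall x : R, 0 <= x -> `|f x| <= C * wt g x) ->
  (@lebesgue_measure R).-integrable `[0, +oo[ (EFin \o f) /\
  `|\int[@lebesgue_measure R]_(x in `[0, +oo[) f x| <= C / g.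
Proof.
move=> g0 mf fC.
have iw := wt_integrable g0.
have iCw : (@lebesgue_measure R).-integrable `[0, +oo[ (EFin \o (fun x => C * wt g x)).
  rewrite (_ : _ \o _ = (fun x => C%:E * (EFin \o wt g) x)%E)//.
  exact: integrableZl.
have intf : (@lebesgue_measure R).-integrable `[0, +oo[ (EFin \o f).
  apply: (le_integrable _ _ _ iCw) => //; first exact/measurable_EFinP.
  move=> x; rewrite /= in_itv/= andbT => x0; rewrite lee_fin.
  exact: le_trans (fC x x0) (ler_norm _).
split => //.
apply: (le_trans (le_normr_Rintegral _ intf)) => //.
apply: (@le_trans _ _ (\int[@lebesgue_measure R]_(x in `[0, +oo[) (C * wt g x))).
  apply: le_Rintegral => //; first exact: (integrable_norm intf).
  by move=> x; rewrite /= in_itv/= andbT => x0; exact: fC.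
rewrite RintegralZl// /Rintegral integral_wt//.
Qed.

End powers.

(** * Interpolation of power bounds, and the primitive behind an integration by parts *)

Section interpolation.
Context {R : realType}.

Lemma powR_split (A t : R) : 0 <= A -> A `^ t * A `^ (1 - t) = A.
Proof.
move=> A0; have E : t + (1 - t) = 1 by lra.
by rewrite -powRD ?E ?powRr1// oner_eq0.
Qed.

(* Geometric mean, with exponents [t] and [1 - t], of the two hypotheses. *)
Lemma interpolation (K X A s t a b : R) :
  0 <= K -> 0 <= X -> 0 <= A -> 0 < s -> 0 < t < 1 ->
  K <= A * s `^ (- a) -> X * K <= A * s `^ (- b) ->
  K * X `^ (1 - t) <= A * s `^ (- (t * a + (1 - t) * b)).
Proof.
move=> K0 X0 A0 s0 /andP[t0 t1] h1 h2.
have -> : K * X `^ (1 - t) = K `^ t * (X * K) `^ (1 - t).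
  by rewrite powRM// mulrCA powR_split// mulrC.
apply: (@le_trans _ _ ((A * s `^ (- a)) `^ t * (A * s `^ (- b)) `^ (1 - t))).
  apply: ler_pM; [exact: powR_ge0|exact: powR_ge0| |].
    by apply: ge0_ler_powR; rewrite ?nnegrE//; [lra|rewrite mulr_ge0 ?powR_ge0].
  apply: ge0_ler_powR; rewrite ?nnegrE//; [lra|by rewrite mulr_ge0|by rewrite mulr_ge0 ?powR_ge0].
rewrite (powRM t) ?powR_ge0// (powRM (1 - t)) ?powR_ge0//.
rewrite mulrACA powR_split// -!powRrM -powRD; last by rewrite (gt_eqF s0) implybT.
rewrite (_ : - a * t + - b * (1 - t) = - (t * a + (1 - t) * b)); last ring.
exact: lexx.
Qed.

(** The derivative splits into a cosine term without the factor [x] and [x] times the integrand of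
    [sintr_law]. Integrated over the half-line, it trades the factor [x] for derivatives of the
    profile. *)
Lemma is_derive_kernel (k : R -> R) (dk al s x xi : R) : 0 < al ->
  is_derive xi 1 k dk -> 0 < xi ->
  is_derive xi 1 (fun z => z * k z * expR (- (s * z `^ al)) * cos (z * x))
   ((k xi + xi * dk - s * al * xi `^ al * k xi) * expR (- (s * xi `^ al)) * cos (xi * x)
     - x * (xi * k xi * expR (- (s * xi `^ al)) * sin (xi * x))).
Proof.
move=> al0 dkE xi0.
have h1 := is_derive1_powR al xi0.
have h2 := @is_derive1_comp R expR (- (s \*: powR (R:=R) ^~ al)) xi _ _ (is_derive_expR _) (is_deriveN (is_deriveZ s h1)).
have h3 := @is_derive1_comp R cos (x \*: id) xi _ _ (is_derive_cos _) (is_deriveZ x (is_derive_id xi (1 : R))).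
have h4 := is_deriveM (is_deriveM (is_deriveM (is_derive_id xi (1:R)) dkE) h2) h3.
have E : (fun z : R => z * k z * expR (- (s * z `^ al)) * cos (z * x)) =
    (((id * k) * (expR \o - (s \*: powR (R:=R) ^~ al))) * (cos \o (x \*: id))).
  by apply/funext => z; rewrite fctE /= !fctE /GRing.scale/= (mulrC z x).
rewrite {}E; move: h4; set D := (X in is_derive _ _ _ X -> _) => h4.
rewrite (_ : _ - _ = D)// /D /= /GRing.scale/= (mulrC xi x).
rewrite -[xi `^ al in X in (_ + _ - X * _) * _ * _](@mulr_powRB1 _ xi al) ?(ltW xi0)//.
by rewrite !fctE/=; ring.
Qed.

End interpolation.

(** * Fourier bounds for the stable law *)

Section fourier.
Context {R : realType}.
Notation mu := (@lebesgue_measure R).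
Variables (al eta g : R).
Hypotheses (al1 : 1 < al) (al2 : al < 2) (eta0 : 0 < eta).
Hypothesis g0 : 0 < g.
Hypothesis g_small : 4 * g <= al - 1 - eta.
Notation kap := ((1 + eta + 2 * g) / al).

Variables (k dk : R -> R) (c p : R).
Hypothesis (p0 : 0 <= p) (pg : p <= g) (c0 : 0 <= c).
Hypothesis dkE : forall x : R, is_derive x 1 k (dk x).
Hypothesis dkC : continuous dk.
Hypothesis kb : forall xi : R, 0 <= xi -> `|k xi| <= c * xi `^ p.
Hypothesis dkb : forall xi : R, 0 <= xi -> `|xi * dk xi| <= c * xi `^ p.
(** The bounds with [c'] provide domination, integrability and the vanishing of boundary terms. In
    the application [c'] grows like [e ^ (-3)], whereas the estimates retain only [c], which stays
    controlled as the scale [e] tends to [0]. *)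
Variable c' : R.
Hypothesis kc' : forall xi : R, 0 <= xi -> `|k xi| <= c' * wt g xi.
Hypothesis xikc' : forall xi : R, 0 <= xi -> `|xi * k xi| <= c' * wt g xi.

Definition costr (f : R -> R) (x : R) : R :=
  \int[mu]_(xi in `[0, +oo[) (f xi * cos (xi * x)).
(* Minus the derivative of the cosine transform [costr f]. *)
Definition sintr (f : R -> R) (x : R) : R :=
  \int[mu]_(xi in `[0, +oo[) (xi * f xi * sin (xi * x)).

Variables (nu : probability (measurableTypeR R) R) (s : R).
Hypothesis s01 : 0 < s <= 1.
Hypothesis nu_cos : forall xi,
  \int[nu]_y cos (xi * y) = expR (- (s * `|xi| `^ al)).
Hypothesis nu_sin : forall xi, \int[nu]_y sin (xi * y) = 0.

Ltac slra := move: al1 al2 eta0 g0 g_small p0 pg c0; lra.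
Ltac snra := move: al1 al2 eta0 g0 g_small p0 pg c0; nra.

Let g1 : g <= 1.
Proof. slra. Qed.
Notation e xi := (expR (- (s * xi `^ al))).

Lemma k_continuous : continuous k.
Proof. by move=> x; exact: (is_derive_cvg (dkE x)). Qed.

Lemma continuous_cosM (x : R) : continuous (fun xi : R => cos (xi * x)).
Proof.
move=> xi; apply: continuous_comp; last exact: continuous_cos.
by apply: cvgMl; exact: cvg_id.
Qed.

Lemma continuous_sinM (x : R) : continuous (fun xi : R => sin (xi * x)).
Proof.
move=> xi; apply: continuous_comp; last exact: continuous_sin.
by apply: cvgMl; exact: cvg_id.
Qed.

Lemma integral_nu_cos (x xi : R) : 0 <= xi ->
  \int[nu]_y cos (xi * (x + y)) = e xi * cos (xi * x).
Proof.
move=> xi0.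
have bnd (f : R -> R) : measurable_fun setT f -> (forall x, `|f x| <= 1) ->
    nu.-integrable setT (EFin \o f).
  move=> mf f1; apply: (@bounded_integrable _ _ _ _ _ _ 1) => //.
  by rewrite (le_lt_trans (probability_le1 _ _))// ltry.
have mc a : measurable_fun [set: R] (fun y => cos (a * y)).
  apply: continuous_measurable_fun => y; apply: continuous_comp; last exact: continuous_cos.
  by apply: cvgMr; exact: cvg_id.
have ms a : measurable_fun [set: R] (fun y => sin (a * y)).
  apply: continuous_measurable_fun => y; apply: continuous_comp; last exact: continuous_sin.
  by apply: cvgMr; exact: cvg_id.
have ic a := bnd _ (mc a) (fun y => cos_max (a * y)).
have ins a := bnd _ (ms a) (fun y => sin_max (a * y)).
under eq_Rintegral do rewrite mulrDr cosD.
rewrite RintegralB//; last 2 first.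
- by apply: (@integrableZl _ _ _ _ _ _ (cos (xi * x)) _ (ic xi)).
- by apply: (@integrableZl _ _ _ _ _ _ (sin (xi * x)) _ (ins xi)).
rewrite !RintegralZl//.
by rewrite nu_cos nu_sin mulr0 subr0 mulrC ger0_norm.
Qed.

Lemma integral_nu_sin (x xi : R) : 0 <= xi ->
  \int[nu]_y sin (xi * (x + y)) = e xi * sin (xi * x).
Proof.
move=> xi0.
have bnd (f : R -> R) : measurable_fun setT f -> (forall x, `|f x| <= 1) ->
    nu.-integrable setT (EFin \o f).
  move=> mf f1; apply: (@bounded_integrable _ _ _ _ _ _ 1) => //.
  by rewrite (le_lt_trans (probability_le1 _ _))// ltry.
have mc a : measurable_fun [set: R] (fun y => cos (a * y)).
  apply: continuous_measurable_fun => y; apply: continuous_comp; last exact: continuous_cos.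
  by apply: cvgMr; exact: cvg_id.
have ms a : measurable_fun [set: R] (fun y => sin (a * y)).
  apply: continuous_measurable_fun => y; apply: continuous_comp; last exact: continuous_sin.
  by apply: cvgMr; exact: cvg_id.
have ic a := bnd _ (mc a) (fun y => cos_max (a * y)).
have ins a := bnd _ (ms a) (fun y => sin_max (a * y)).
under eq_Rintegral do rewrite mulrDr sinD.
rewrite RintegralD//; last 2 first.
- by apply: (@integrableZl _ _ _ _ _ _ (sin (xi * x)) _ (ic xi)).
- by apply: (@integrableZl _ _ _ _ _ _ (cos (xi * x)) _ (ins xi)).
rewrite !RintegralZl//.
by rewrite nu_cos nu_sin mulr0 addr0 mulrC ger0_norm.
Qed.

(** Fubini, with [c' * wt] as majorant, moves the mean inside the frequency integral, where it
    produces the characteristic function of the stable law. *)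
Lemma costr_law x :
  \int[nu]_y costr k (x + y) =
  \int[mu]_(xi in `[0, +oo[) (k xi * e xi * cos (xi * x)).
Proof.
rewrite /costr.
rewrite (@Rintegral_swap _ _ _ _ _ nu mu _ (fun y xi => k xi * cos (xi * (x + y))) (fun xi => c' * wt g xi))//.
- apply: eq_Rintegral => xi; rewrite inE/= in_itv/= andbT => xi0.
  rewrite RintegralZl//.
    by rewrite integral_nu_cos// mulrA.
  apply: (@bounded_integrable _ _ _ _ _ _ 1) => //.
  + by rewrite (le_lt_trans (probability_le1 _ _))// ltry.
  + apply: continuous_measurable_fun => y; apply: continuous_comp; last exact: continuous_cos.
    by apply: cvgMr; apply: cvgD; [exact: cvg_cst|exact: cvg_id].
  + by move=> y _; exact: cos_max.
- apply: measurable_funM.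
    apply: (measurableT_comp (continuous_measurable_fun k_continuous)).
    exact: measurable_snd.
  apply: (measurableT_comp (continuous_measurable_fun (@continuous_cos R))).
  apply: measurable_funM; first exact: measurable_snd.
  by apply: measurable_funD => //; exact: measurable_fst.
- exact: integrableZl (wt_integrable g0).
- move=> y xi; rewrite /= in_itv/= andbT => xi0.
  rewrite normrM; apply: le_trans (kc' xi0).
  by rewrite -[leRHS]mulr1; apply: ler_wpM2l => //; exact: cos_max.
Qed.

Lemma sintr_law x :
  \int[nu]_y sintr k (x + y) =
  \int[mu]_(xi in `[0, +oo[) (xi * k xi * e xi * sin (xi * x)).
Proof.
rewrite /sintr.
rewrite (@Rintegral_swap _ _ _ _ _ nu mu _ (fun y xi => xi * k xi * sin (xi * (x + y))) (fun xi => c' * wt g xi))//.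
- apply: eq_Rintegral => xi; rewrite inE/= in_itv/= andbT => xi0.
  rewrite RintegralZl//.
    by rewrite integral_nu_sin// mulrA.
  apply: (@bounded_integrable _ _ _ _ _ _ 1) => //.
  + by rewrite (le_lt_trans (probability_le1 _ _))// ltry.
  + apply: continuous_measurable_fun => y; apply: continuous_comp; last exact: continuous_sin.
    by apply: cvgMr; apply: cvgD; [exact: cvg_cst|exact: cvg_id].
  + by move=> y _; exact: sin_max.
- apply: measurable_funM.
    apply: measurable_funM; first exact: measurable_snd.
    apply: (measurableT_comp (continuous_measurable_fun k_continuous)).
    exact: measurable_snd.
  apply: (measurableT_comp (continuous_measurable_fun (@continuous_sin R))).
  apply: measurable_funM; first exact: measurable_snd.
  by apply: measurable_funD => //; exact: measurable_fst.
- exact: integrableZl (wt_integrable g0).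
- move=> y xi; rewrite /= in_itv/= andbT => xi0.
  rewrite normrM; apply: le_trans (xikc' xi0).
  by rewrite -[leRHS]mulr1; apply: ler_wpM2l => //; exact: sin_max.
Qed.
Lemma powR_within_continuous (a : R) : 0 < a ->
  {within `[0, +oo[, continuous (fun x : R => x `^ a)}.
Proof.
move=> a0; apply/continuous_within_itvcyP; split.
  by move=> x; rewrite in_itv/= andbT => x0; exact: (is_derive_cvg (is_derive1_powR a x0)).
rewrite powR0 ?gt_eqF//; exact: powR_cvg0.
Qed.

Let me : measurable_fun [set: R] (fun xi : R => e xi).
Proof.
apply: (measurableT_comp (continuous_measurable_fun (@continuous_expR R))).
by apply: measurableT_comp => //; apply: measurable_funM => //; exact: measurable_powR.
Qed.

Let mk : measurable_fun [set: R] k.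
Proof. exact: continuous_measurable_fun k_continuous. Qed.

(** The natural exponent is [(p + 1 + g) / al]. As [p <= g] and [s <= 1], it may be enlarged to
    [kap], the exponent dictated by the gradient. *)
Lemma costr_law_bound x :
  `|\int[nu]_y costr k (x + y)| <= 12 * c / g * s `^ (- kap).
Proof.
have /andP[s0 s1] := s01.
rewrite costr_law.
have mc := continuous_measurable_fun (@continuous_cosM x).
have [||_ h] := @wt_bound _ g (fun xi => k xi * e xi * cos (xi * x))
   (c * (12 * s `^ (- ((p + 1 + g) / al)))) g0.
- by apply: measurable_funTS; apply: measurable_funM => //; exact: measurable_funM.
- move=> xi xi0; rewrite !normrM (ger0_norm (expR_ge0 _)).
  apply: (@le_trans _ _ (c * xi `^ p * e xi * 1)).
    apply: ler_pM; [by apply: mulr_ge0; rewrite ?expR_ge0|by []| | exact: cos_max].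
    by apply: ler_wpM2r; [exact: expR_ge0|exact: kb].
  rewrite mulr1 -mulrA -[leRHS]mulrA; apply: ler_wpM2l => //.
  apply: powR_expR_le_wt => //; [slra|by rewrite g0 g1| rewrite ler_pdivrMr; slra].
apply: (le_trans h).
rewrite mulrCA !mulrA -[leLHS]mulrA -[leLHS]mulrA [_ / g]mulrC !mulrA.
apply: ler_wpM2l; first by rewrite divr_ge0 ?mulr_ge0// ltW.
apply: ger_powR => //; rewrite lerN2 ler_pM2r ?invr_gt0; slra.
Qed.

(** The additional factor [xi] adds [1 / al] to the exponent. Since [al < 2], the result exceeds [1]
    and would not be integrable in time; it is only one endpoint of an interpolation. *)
Lemma sintr_law_bound1 x :
  `|\int[nu]_y sintr k (x + y)| <= 12 * c / g * s `^ (- ((p + 2 + g) / al)).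
Proof.
have /andP[s0 s1] := s01.
rewrite sintr_law.
have ms := continuous_measurable_fun (@continuous_sinM x).
have mxk : measurable_fun [set: R] (fun xi => xi * k xi) by apply: measurable_funM.
have [||_ h] := @wt_bound _ g (fun xi => xi * k xi * e xi * sin (xi * x))
   (c * (12 * s `^ (- ((p + 2 + g) / al)))) g0.
- by apply: measurable_funTS; apply: measurable_funM => //; exact: measurable_funM.
- move=> xi xi0; rewrite !normrM (ger0_norm (expR_ge0 _)) (ger0_norm xi0).
  apply: (@le_trans _ _ (c * xi `^ (p + 1) * e xi * 1)).
    apply: ler_pM; [by rewrite !mulr_ge0 ?expR_ge0|by []| | exact: sin_max].
    apply: ler_wpM2r; first exact: expR_ge0.
    rewrite powRD; last by apply/implyP => /eqP; slra.
    by rewrite powRr1// mulrA mulrC ler_wpM2r// kb.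
  rewrite mulr1 -mulrA -[leRHS]mulrA; apply: ler_wpM2l => //.
  rewrite (_ : p + 2 + g = p + 1 + 1 + g); last slra.
  apply: powR_expR_le_wt => //; [slra|by rewrite g0 g1|slra| rewrite ler_pdivrMr; slra].
apply: (le_trans h).
by rewrite le_eqVlt; apply/orP; left; apply/eqP; ring.
Qed.

Let a' (xi : R) := (k xi + xi * dk xi - s * al * xi `^ al * k xi) * e xi.

(** The factor [y = s * xi ^ al] produced by differentiating the exponential is absorbed by half of
    it, as [y * exp (- y) <= 2 * exp (- y / 2)]; hence [s / 2] on the right. The constant is
    [2 + 2 * al <= 6]. *)
Lemma ibp_kernel_bound (xi : R) : 0 <= xi ->
  `|a' xi| <= (6 * c) * (12 * (s / 2) `^ (- ((p + 1 + g) / al))) * wt g xi.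
Proof.
have /andP[s0 s1] := s01.
move=> xi0; rewrite /a' normrM (ger0_norm (expR_ge0 _)).
rewrite -[leRHS]mulrA.
have h0 : xi `^ p * expR (- (s / 2 * xi `^ al)) <= 12 * (s / 2) `^ (- ((p + 1 + g) / al)) * wt g xi.
  apply: powR_expR_le_wt => //; [slra|by rewrite g0 g1| rewrite ler_pdivrMr; slra|slra].
apply: (@le_trans _ _ (6 * c * (xi `^ p * expR (- (s / 2 * xi `^ al))))); last first.
  by apply: ler_wpM2l => //; rewrite mulr_ge0.
set y := s * xi `^ al.
have y0 : 0 <= y by rewrite mulr_ge0 ?powR_ge0// ltW.
rewrite (_ : s / 2 * xi `^ al = y / 2); last by rewrite /y; slra.
have h1 : y * expR (- y) <= 2 * expR (- (y / 2)).
  have h : y <= 2 * expR (y / 2) by have := expR_ge1Dx (y / 2); slra.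
  rewrite (_ : - y = - (y / 2) + - (y / 2)); last slra.
  rewrite expRD mulrA; apply: ler_wpM2r; first exact: expR_ge0.
  by rewrite expRN ler_pdivrMr ?expR_gt0.
have h2 : expR (- y) <= expR (- (y / 2)) by rewrite ler_expR; slra.
have kbx := kb xi0; have dkbx := dkb xi0.
have pp := powR_ge0 xi p.
have cp : 0 <= c * xi `^ p by rewrite mulr_ge0.
apply: (@le_trans _ _ ((2 * (c * xi `^ p) + al * y * (c * xi `^ p)) * expR (- y))).
  apply: ler_wpM2r; first exact: expR_ge0.
  apply: (le_trans (ler_normB _ _)); apply: lerD.
    by apply: (le_trans (ler_normD _ _)); slra.
  rewrite normrM (_ : s * al * xi `^ al = al * y); last by rewrite /y; ring.
  rewrite ger0_norm; last by rewrite mulr_ge0//; slra.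
  by apply: ler_wpM2l => //; rewrite mulr_ge0//; slra.
rewrite (_ : _ * expR (- y) = (c * xi `^ p) * (2 * expR (- y) + al * (y * expR (- y)))); last ring.
rewrite (_ : 6 * c * _ = (c * xi `^ p) * (6 * expR (- (y / 2)))); last ring.
apply: ler_wpM2l => //.
have := expR_ge0 (- (y / 2)); have := expR_ge0 (- y).
have : 0 <= y * expR (- y) by rewrite mulr_ge0 ?expR_ge0.
snra.
Qed.

Lemma half_powR_le : 2^-1 `^ (- ((p + 1 + g) / al)) <= (4 : R).
Proof.
apply: (@le_trans _ _ (2^-1 `^ (- 2))).
  apply: ger_powR; first by apply/andP; split; lra.
  by rewrite lerN2 ler_pdivrMr; slra.
by rewrite powRN powR_mulrn ?invr_ge0// exprVn invrK; lra.
Qed.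

(* An integration by parts turns the decay in [xi] into the factor [1 / x]. *)
Lemma sintr_law_bound2 x :
  `|x| * `|\int[nu]_y sintr k (x + y)| <= 288 * c / g * s `^ (- ((p + 1 + g) / al)).
Proof.
have /andP[s0 s1] := s01.
rewrite sintr_law.
have ma' : measurable_fun [set: R] a'.
  apply: measurable_funM => //; apply: measurable_funB.
    apply: measurable_funD => //; apply: measurable_funM => //.
    exact: continuous_measurable_fun.
  by apply: measurable_funM => //; apply: measurable_funM => //; exact: measurable_powR.
have mc := continuous_measurable_fun (@continuous_cosM x).
have ms := continuous_measurable_fun (@continuous_sinM x).
have mxk : measurable_fun [set: R] (fun xi => xi * k xi) by apply: measurable_funM.
have [||ia' ba'] := @wt_bound _ g (fun xi => a' xi * cos (xi * x))
   ((6 * c) * (12 * (s / 2) `^ (- ((p + 1 + g) / al)))) g0.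
- by apply: measurable_funTS; exact: measurable_funM.
- move=> xi xi0; rewrite normrM; apply: le_trans (ibp_kernel_bound xi0).
  by rewrite -[leRHS]mulr1 ler_wpM2l// cos_max.
have [||ins _] := @wt_bound _ g (fun xi => xi * k xi * e xi * sin (xi * x)) c' g0.
- by apply: measurable_funTS; apply: measurable_funM => //; exact: measurable_funM.
- move=> xi xi0; rewrite normrM; apply: le_trans (xikc' xi0).
  rewrite -[leRHS]mulr1 ler_pM// ?sin_max// normrM -[leRHS]mulr1 ler_wpM2l//.
  by rewrite ger0_norm ?expR_ge0// expR_le1 oppr_le0 mulr_ge0 ?powR_ge0// ltW.
have isx : mu.-integrable `[0, +oo[ (EFin \o (fun xi => x * (xi * k xi * e xi * sin (xi * x)))).
  by apply: (integrableZl _ x ins).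
have cpw := @powR_within_continuous al ltac:(slra).
have ce : {within `[0, +oo[, continuous (fun xi => e xi)}.
  move=> xi; apply: (@continuous_comp (subspace _)); last exact: continuous_expR.
  by apply: cvgN; apply: cvgM; [exact: cvg_cst|exact: cpw].
have cT (f : R -> R) : continuous f -> {within `[0, +oo[, continuous f}.
  exact: continuous_subspaceT.
have ck := cT _ k_continuous.
have cdk := cT _ dkC.
have cid : {within `[0, +oo[, continuous (@id R)} by apply: cT => ?; exact: cvg_id.
have cc := cT _ (@continuous_cosM x).
have cs := cT _ (@continuous_sinM x).
pose FF (xi : R) := xi * k xi * e xi * cos (xi * x).
pose ff (xi : R) := a' xi * cos (xi * x) - x * (xi * k xi * e xi * sin (xi * x)).
have g10 : 0 < 1 + g by slra.
have al0 : 0 < al by slra.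
have cff : {within `[0, +oo[, continuous ff}.
  move=> xi; apply: cvgB.
    apply: cvgM; last exact: cc.
    apply: cvgM; last exact: ce.
    apply: cvgB.
      by apply: cvgD; [exact: ck|apply: cvgM; [exact: cid|exact: cdk]].
    by apply: cvgM; [apply: cvgM; [exact: cvg_cst|exact: cpw]|exact: ck].
  apply: cvgM; first exact: cvg_cst.
  apply: cvgM; last exact: cs.
  by apply: cvgM; [apply: cvgM; [exact: cid|exact: ck]|exact: ce].
have dFF (xi : R) : 0 < xi -> is_derive xi 1 FF (ff xi).
  exact: is_derive_kernel al0 (dkE xi).
have FF0 : FF xi @[xi --> 0^'+] --> FF 0.
  have cF : {within `[0, +oo[, continuous (fun xi => xi * k xi * e xi * cos (xi * x))}.
    move=> xi; apply: cvgM; last exact: cc.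
    by apply: cvgM; [apply: cvgM; [exact: cid|exact: ck]|exact: ce].
  by have /continuous_within_itvcyP[] := cF.
have iff : mu.-integrable `[0, +oo[ (EFin \o ff) by apply: (integrableB _ ia' isx).
have FFoo : FF n%:R @[n --> \oo] --> (0 : R).
  apply/norm_cvg0P.
  apply: (@squeeze_cvgr _ _ _ _ (cst 0) (fun n : nat => c' * wt g n%:R)).
  + near=> n; rewrite /FF /= normr_ge0/=; have n0 : 0 <= n%:R :> R by rewrite ler0n.
    apply: le_trans (xikc' n0).
    rewrite -mulrA normrM -[leRHS]mulr1 ler_wpM2l// normrM -[leRHS]mulr1 ler_pM// ?cos_max//.
    by rewrite ger0_norm ?expR_ge0// expR_le1 oppr_le0 mulr_ge0 ?powR_ge0// ltW.
  + exact: cvg_cst.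
  + rewrite -[X in _ --> X](mulr0 c'); apply: cvgM; first exact: cvg_cst.
    exact: (cvg_comp _ _ (@cvgr_idn R) (powR_cvgy0 g10)).
have {}E := FTC_improper cff dFF FF0 iff FFoo.
(* The factor [xi] makes the primitive vanish at [0], so no boundary term remains. *)
have {}E : x * \int[mu]_(xi in `[0, +oo[) (xi * k xi * e xi * sin (xi * x)) =
    \int[mu]_(xi in `[0, +oo[) (a' xi * cos (xi * x)).
  move: E; rewrite /FF !mul0r oppr0 /ff RintegralB// RintegralZl// => /eqP.
  by rewrite subr_eq0 => /eqP.
rewrite -normrM E; apply: (le_trans ba').
rewrite powRM ?(ltW s0) ?invr_ge0//.
have h := half_powR_le.
(* [288 = 6 * 12 * 4], where [4] pays for the replacement of [s / 2] by [s]. *)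
rewrite (_ : 288 * c / g * _ = 72 * c * (s `^ (- ((p + 1 + g) / al)) * 4) / g); last ring.
apply: ler_wpM2r; first by rewrite invr_ge0 ltW.
rewrite (_ : 6 * c * _ = 72 * c * (s `^ (- ((p + 1 + g) / al)) * 2^-1 `^ (- ((p + 1 + g) / al)))); last ring.
by rewrite ler_wpM2l ?mulr_ge0// ler_wpM2l ?powR_ge0.
Unshelve. all: by end_near.
Qed.

(** Interpolation with weights [eta] and [1 - eta] between the bound without decay in [x] and the
    one with decay [1 / |x|]. The numerators combine to [eta * (p + 2 + g) + (1 - eta) * (p + 1 + g)
    = p + 1 + g + eta], which is at most that of [kap]. *)
Lemma sintr_law_bound x :
  `|\int[nu]_y sintr k (x + y)| * `|x| `^ (1 - eta) <= 288 * c / g * s `^ (- kap).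
Proof.
have /andP[s0 s1] := s01.
have A0 : 0 <= 288 * c / g := divr_ge0 (mulr_ge0 (ler0n _ _) c0) (ltW g0).
have h2 := sintr_law_bound2 x.
have h1 := sintr_law_bound1 x.
have {}h1 : `|\int[nu]_y sintr k (x + y)| <= 288 * c / g * s `^ (- ((p + 2 + g) / al)).
  apply: (le_trans h1); apply: ler_wpM2r; first exact: powR_ge0.
  by rewrite ler_wpM2r ?invr_ge0 ?ler_wpM2r// ?ltW//; lra.
have eta1 : 0 < eta < 1 by apply/andP; split; slra.
apply: (le_trans (interpolation (normr_ge0 _) (normr_ge0 _) A0 s0 eta1 h1 h2)).
apply: ler_wpM2l => //.
apply: ger_powR; first by rewrite s0.
rewrite (_ : eta * _ + _ = (p + 1 + g + eta) / al); last by field; slra.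
by rewrite lerN2 ler_pM2r ?invr_gt0; slra.
Qed.

End fourier.

(** * The Poisson kernel *)

Section poisson.
Context {R : realType}.
Notation mu := (@lebesgue_measure R).
Implicit Types (e x xi g : R).

(* [pk e] is [pi] times the Cauchy density of scale [e], and the cosine
   transform of [expR (- (e * xi))]. *)
Definition pk e x : R := e / (e ^+ 2 + x ^+ 2).
Definition dpk e x : R := - (2 * e * x) / (e ^+ 2 + x ^+ 2) ^+ 2.

Lemma pk_den e x : 0 < e -> 0 < e ^+ 2 + x ^+ 2.
Proof. by move=> e0; rewrite ltr_wpDr ?sqr_ge0 ?exprn_gt0. Qed.

Lemma is_derive_pk e x : 0 < e -> is_derive x 1 (pk e) (dpk e x).
Proof.
move=> e0; have d0 := pk_den x e0.
have h : is_derive x (1 : R) (fun y : R => e ^+ 2 + y ^+ 2) (2 * x).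
  by apply: is_derive_eq; rewrite /GRing.scale/=; ring.
have h2 := is_deriveZ e (@is_deriveV R (fun y : R => e ^+ 2 + y ^+ 2) x _ _ (lt0r_neq0 d0) h).
rewrite (_ : dpk e x = e *: (- (e ^+ 2 + x ^+ 2) ^- 2 *: (2 * x)))//.
by rewrite /dpk /GRing.scale/=; field; lra.
Qed.

Lemma is_derive_dpk e x : 0 < e -> is_derive x 1 (dpk e)
  (- (2 * e) / (e ^+ 2 + x ^+ 2) ^+ 2 + 8 * e * x ^+ 2 / (e ^+ 2 + x ^+ 2) ^+ 3).
Proof.
move=> e0; have d0 := pk_den x e0.
have h : is_derive x (1 : R) (fun y : R => e ^+ 2 + y ^+ 2) (2 * x).
  by apply: is_derive_eq; rewrite /GRing.scale/=; ring.
have hV := @is_deriveV R (fun y : R => e ^+ 2 + y ^+ 2) x _ _ (lt0r_neq0 d0) h.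
have h2 := is_deriveZ (- (2 * e)) (is_deriveM (is_derive_id x (1 : R)) (is_deriveM hV hV)).
have E : dpk e = - (2 * e) \*: (id * ((fun y : R => (e ^+ 2 + y ^+ 2)^-1) * (fun y : R => (e ^+ 2 + y ^+ 2)^-1))).
  apply/funext => y; have dy := pk_den y e0.
  by rewrite /dpk /= !fctE /GRing.scale/=; field; lra.
rewrite {}E; move: h2; set D := (X in is_derive _ _ _ X -> _) => h2.
rewrite (_ : _ + _ = D)// /D /= /GRing.scale/= !fctE/= /GRing.scale/=; field; lra.
Qed.

Lemma pk_ge0 e x : 0 < e -> 0 <= pk e x.
Proof. by move=> e0; rewrite divr_ge0// ?(ltW (pk_den _ e0))// ltW. Qed.

Lemma pk_le e x : 0 < e -> pk e x <= e^-1.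
Proof.
move=> e0; have d0 := pk_den x e0.
rewrite /pk ler_pdivrMr// mulrDr expr2 mulrA mulVf ?gt_eqF// mul1r lerDl.
by rewrite mulr_ge0 ?sqr_ge0// invr_ge0 ltW.
Qed.

Lemma dpk_le e x : 0 < e -> `|dpk e x| <= e ^- 2.
Proof.
move=> e0; have d0 := pk_den x e0.
rewrite /dpk normrM normrN (ger0_norm (_ : 0 <= _ ^-1)); last first.
  by rewrite invr_ge0 exprn_ge0// ltW.
rewrite ler_pdivrMr ?exprn_gt0//.
have h1 : `|2 * e * x| <= e ^+ 2 + x ^+ 2.
  rewrite ler_norml; apply/andP; split.
    by have := sqr_ge0 (e + x); rewrite sqrrD; nra.
  by have := sqr_ge0 (e - x); rewrite sqrrB; nra.
apply: (le_trans h1).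
rewrite expr2 mulrA -[leLHS]mul1r ler_pM2r//.
rewrite mulrDr mulVf ?lt0r_neq0 ?mulr_gt0// lerDl mulr_ge0 ?sqr_ge0//.
by rewrite invr_ge0 mulr_ge0// ltW.
Qed.

Lemma ddpk_le e x : 0 < e -> `|- (2 * e) / (e ^+ 2 + x ^+ 2) ^+ 2
   + 8 * e * x ^+ 2 / (e ^+ 2 + x ^+ 2) ^+ 3| <= 10 * e * (e ^- 2) ^+ 2.
Proof.
move=> e0; have d0 := pk_den x e0.
have i0 : 0 < (e ^+ 2 + x ^+ 2)^-1 by rewrite invr_gt0.
have i1 : (e ^+ 2 + x ^+ 2)^-1 <= e ^- 2.
  by rewrite lef_pV2 ?posrE ?exprn_gt0// lerDl sqr_ge0.
have i2 : x ^+ 2 * (e ^+ 2 + x ^+ 2)^-1 <= 1.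
  by rewrite ler_pdivrMr// mul1r lerDr sqr_ge0.
rewrite -!exprVn.
set i := (e ^+ 2 + x ^+ 2)^-1 in i0 i1 i2 *.
rewrite exprVn.
have i3 : i ^+ 2 <= (e ^- 2) ^+ 2 by rewrite ler_sqr// nnegrE ?ltW// invr_gt0 exprn_gt0.
rewrite (_ : _ * i ^+ 3 = 8 * e * (x ^+ 2 * i) * i ^+ 2); last ring.
have x2 : 0 <= x ^+ 2 * i by rewrite mulr_ge0 ?sqr_ge0// ltW.
have ei : 0 <= e * i ^+ 2 by rewrite mulr_ge0 ?sqr_ge0// ltW.
have : e * i ^+ 2 <= e * (e ^- 2) ^+ 2 by rewrite ler_wpM2l// ltW.
move: (x ^+ 2 * i) i2 x2 => y y1 y0 h.
rewrite ler_norml; apply/andP; split; nra.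
Qed.

Lemma bounded_derive_lipschitz (f df : R -> R) (c : R) :
  (forall x, is_derive x 1 f (df x)) -> (forall x, `|df x| <= c) ->
  forall x y, `|f x - f y| <= c * `|x - y|.
Proof.
move=> fd fc.
have H (x y : R) : x < y -> `|f x - f y| <= c * `|x - y|.
  move=> xy.
  have [z _ E] := @MVT _ f df x y xy (fun z _ => fd z)
    (derivable_within_continuous (fun z _ => @ex_derive _ _ _ _ _ _ _ (fd z))).
  by rewrite distrC E normrM distrC ler_wpM2r.
move=> x y; have [xy|yx|->] := ltgtP x y.
- exact: H.
- by rewrite distrC [in leRHS]distrC; exact: H.
- by rewrite !subrr normr0 mulr0.
Qed.

Lemma wt_cvg0 g (u : nat -> R) (C : R) : 0 < g ->
  (forall n, `|u n| <= C * wt g n%:R) -> u n @[n --> \oo] --> (0 : R).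
Proof.
move=> g0 uC; apply/norm_cvg0P.
apply: (@squeeze_cvgr _ _ _ _ (cst 0) (fun n : nat => C * wt g n%:R)).
- by near=> n; rewrite /= normr_ge0/=; exact: uC.
- exact: cvg_cst.
- rewrite -[X in _ --> X](mulr0 C); apply: cvgM; first exact: cvg_cst.
  have h : 0 < 1 + g by lra.
  exact: (cvg_comp _ _ (@cvgr_idn R) (powR_cvgy0 h)).
Unshelve. all: by end_near.
Qed.

(** After multiplication by [(1 + xi) ^ (1 + g)] the left polynomial is at most
    [(1 + xi) ^ 3 <= 8 * (1 + xi ^ 3)], and the cubic Taylor term of the exponential absorbs it:
    [48 = 8 * 6]. The factor [1 + xi] treats the profile and [xi] times the profile together. *)
Lemma expR_wt g e xi : 0 < g <= 1 -> 0 < e <= 1 -> 0 <= xi ->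
  (1 + xi) * expR (- (e * xi)) <= 48 / e ^+ 3 * wt g xi.
Proof.
move=> /andP[g0 g1] /andP[e0 e1] xi0.
have H0 : 0 < 1 + xi by lra.
rewrite /wt powRN ler_pdivlMr ?powR_gt0//.
rewrite expRN mulrAC ler_pdivrMr ?expR_gt0//.
have h1 : (1 + xi) `^ (1 + g) <= (1 + xi) ^+ 2.
  by rewrite -powR_mulrn ?(ltW H0)//; apply: ler_powR; lra.
have h2 : 1 + (e * xi) ^+ 3 / 6 <= expR (e * xi).
  by have := @expR_ge1Dxn _ (e * xi) 2 (mulr_ge0 (ltW e0) xi0).
have h3 : (1 + xi) ^+ 3 <= 8 * (1 + xi ^+ 3).
  by have [x1|x1] := leP xi 1; nra.
apply: (@le_trans _ _ ((1 + xi) ^+ 3)).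
  by rewrite (exprS _ 2) ler_wpM2l// ltW.
apply: (le_trans h3).
rewrite mulrAC ler_pdivlMr ?exprn_gt0//.
apply: (@le_trans _ _ (48 * (1 + (e * xi) ^+ 3 / 6))); last by rewrite ler_wpM2l.
have e3 : e ^+ 3 <= 1 by rewrite exprn_ile1// ltW.
rewrite exprMn; have := exprn_ge0 3 (ltW e0); have := exprn_ge0 3 xi0; nra.
Qed.

Definition kexp e xi : R := expR (- (e * xi)).

Lemma is_derive_kexp e xi : is_derive xi 1 (kexp e) (- e * kexp e xi).
Proof.
rewrite /kexp; apply: is_derive_eq.
by rewrite /GRing.scale/=; ring.
Qed.

Lemma kexp_cont e : continuous (kexp e).
Proof. by move=> x; exact: (is_derive_cvg (is_derive_kexp e x)). Qed.

Lemma kexp_ge0 e xi : 0 <= kexp e xi. Proof. exact: expR_ge0. Qed.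

Lemma kexp_wt g e xi : 0 < g <= 1 -> 0 < e <= 1 -> 0 <= xi ->
  `|kexp e xi| <= 48 / e ^+ 3 * wt g xi /\
  `|xi * kexp e xi| <= 48 / e ^+ 3 * wt g xi.
Proof.
move=> g01 e01 xi0; have := expR_wt g01 e01 xi0.
rewrite -/(kexp e xi) normrM (ger0_norm xi0) ger0_norm ?kexp_ge0//.
have := kexp_ge0 e xi; nra.
Qed.

Lemma costr_kexp e x : 0 < e <= 1 -> costr (kexp e) x = pk e x.
Proof.
move=> /[dup] e01 /andP[e0 e1].
have d0 := pk_den x e0.
(* Real part of [exp (b * xi) / b] for the complex number [b = - e + i x]. *)
pose F xi := kexp e xi * (x * sin (xi * x) - e * cos (xi * x)) / (e ^+ 2 + x ^+ 2).
have dF xi : is_derive xi 1 F (kexp e xi * cos (xi * x)).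
  rewrite /F /kexp; apply: is_derive_eq.
  by rewrite /GRing.scale/=; field; lra.
have g01 : 0 < (1 : R) <= 1 by rewrite ltr01 lexx.
have cf : continuous (fun xi => kexp e xi * cos (xi * x)).
  by move=> xi; apply: cvgM; [exact: kexp_cont|exact: continuous_cosM].
rewrite /costr (@FTC_improper _ F).
- by rewrite /F mul0r sin0 cos0 /kexp mulr0 oppr0 expR0 /pk; field; lra.
- exact: continuous_subspaceT.
- by apply: cvg_at_right_filter; exact: (is_derive_cvg (dF 0)).
- have [||+ _] := @wt_bound R 1 (fun xi => kexp e xi * cos (xi * x)) (48 / e ^+ 3) ltr01.
  + by apply: measurable_funTS; exact: continuous_measurable_fun.
  + move=> xi xi0; have [h _] := kexp_wt g01 e01 xi0; apply: le_trans h.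
    by rewrite normrM -[leRHS]mulr1 ler_wpM2l// cos_max.
  + by [].
- apply: (@wt_cvg0 1 _ ((`|x| + e) / (e ^+ 2 + x ^+ 2) * (48 / e ^+ 3))) => // n.
  have [h _] := kexp_wt g01 e01 (ler0n R n).
  rewrite /F -mulrA mulrC normrM -[leRHS]mulrA; apply: ler_pM => //.
  have id0 : 0 <= (e ^+ 2 + x ^+ 2)^-1 by rewrite invr_ge0 ltW.
  rewrite normrM (ger0_norm id0); apply: ler_wpM2r => //.
  apply: (le_trans (ler_normB _ _)); rewrite !normrM (gtr0_norm e0).
  by apply: lerD; rewrite -[leRHS]mulr1 ler_wpM2l ?sin_max ?cos_max// ltW.
Qed.

Lemma sintr_kexp e x : 0 < e <= 1 -> sintr (kexp e) x = - dpk e x.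
Proof.
move=> /[dup] e01 /andP[e0 e1].
have d0 := pk_den x e0.
set d := e ^+ 2 + x ^+ 2 in d0.
(* Imaginary part of [exp (b * xi) * (xi / b - 1 / b ^ 2)] for [b = - e + i x]. *)
pose F xi := - (kexp e xi * ((xi * e / d + (e ^+ 2 - x ^+ 2) / d ^+ 2) * sin (xi * x)
   + (xi * x / d + 2 * e * x / d ^+ 2) * cos (xi * x))).
have dF xi : is_derive xi 1 F (xi * kexp e xi * sin (xi * x)).
  rewrite /F /kexp; apply: is_derive_eq.
  by rewrite /GRing.scale/= /d; field; rewrite -/d; lra.
have g01 : 0 < (1 : R) <= 1 by rewrite ltr01 lexx.
have cf : continuous (fun xi => xi * kexp e xi * sin (xi * x)).
  move=> xi; apply: cvgM; last exact: continuous_sinM.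
  by apply: cvgM; [exact: cvg_id|exact: kexp_cont].
rewrite /sintr (@FTC_improper _ F).
- rewrite /F !mul0r sin0 cos0 /kexp mulr0 oppr0 expR0 /dpk -/d.
  by rewrite mulr0 mulr1 mul1r !add0r opprK mulNr opprK.
- exact: continuous_subspaceT.
- by apply: cvg_at_right_filter; exact: (is_derive_cvg (dF 0)).
- have [||+ _] := @wt_bound R 1 (fun xi => xi * kexp e xi * sin (xi * x)) (48 / e ^+ 3) ltr01.
  + by apply: measurable_funTS; exact: continuous_measurable_fun.
  + move=> xi xi0; have [_ h] := kexp_wt g01 e01 xi0; apply: le_trans h.
    by rewrite normrM -[leRHS]mulr1 ler_wpM2l// sin_max.
  + by [].
- pose C := (e / d + `|e ^+ 2 - x ^+ 2| / d ^+ 2) + (`|x| / d + `|2 * e * x| / d ^+ 2).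
  apply: (@wt_cvg0 1 _ (C * (48 / e ^+ 3))) => // n.
  have h := expR_wt g01 e01 (ler0n R n).
  have n0 : 0 <= n%:R :> R by [].
  have id0 : 0 <= d^-1 by rewrite invr_ge0 ltW.
  have id2 : 0 <= (d ^+ 2)^-1 by rewrite invr_ge0 sqr_ge0.
  rewrite /F normrN mulrC normrM (ger0_norm (kexp_ge0 _ _)).
  rewrite -[leRHS]mulrA.
  apply: (@le_trans _ _ (C * ((1 + n%:R) * kexp e n%:R))); last first.
    by apply: ler_wpM2l => //; rewrite /C !addr_ge0// mulr_ge0// ltW.
  rewrite mulrA; apply: ler_wpM2r; first exact: kexp_ge0.
  apply: (le_trans (ler_normD _ _)).
  rewrite [C * _]mulrDl; apply: lerD; rewrite normrM -[leRHS]mulr1; apply: ler_pM; rewrite ?sin_max ?cos_max//.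
    apply: (le_trans (ler_normD _ _)).
    rewrite !normrM (ger0_norm id0) (ger0_norm id2) (ger0_norm (ltW e0)) (ger0_norm n0).
    have : 0 <= e / d by rewrite mulr_ge0// ltW.
    have : 0 <= `|e ^+ 2 - x ^+ 2| / d ^+ 2 by rewrite mulr_ge0.
    nra.
  apply: (le_trans (ler_normD _ _)).
  rewrite normrM (normrM n%:R) (ger0_norm id0) (normrM _ (d ^+ 2)^-1) (ger0_norm id2) (ger0_norm n0).
  have : 0 <= `|x| / d by rewrite mulr_ge0.
  have : 0 <= `|2 * e * x| / d ^+ 2 by rewrite mulr_ge0.
  nra.
Qed.

Definition stable_law (al : R) (nu : probability (measurableTypeR R) R) (s : R) :=
  (forall xi, \int[nu]_y cos (xi * y) = expR (- (s * `|xi| `^ al))) /\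
  (forall xi, \int[nu]_y sin (xi * y) = 0).

(* The two estimates that Duhamel's formula needs. The constant [A] is
   uniform in [e] for [pk e] and of order [e `^ g] for [pk (e / 2) - pk e]. *)
Definition law_test (al eta kap : R) (G dG : R -> R) (A : R) :=
  forall (nu : probability (measurableTypeR R) R) s, 0 < s <= 1 ->
    stable_law al nu s -> forall x,
  `|\int[nu]_y G (x + y)| <= A * s `^ (- kap) /\
  `|\int[nu]_y dG (x + y)| * `|x| `^ (1 - eta) <= A * s `^ (- kap).

(** The profile [exp (- e * xi)] satisfies the hypotheses of the Fourier bounds with [p = 0] and
    [c = 1] for every [e], because it is at most [1] and so is [e * xi] times it. This is the
    uniformity in [e]. *)
Lemma pk_law_test (al eta g e : R) : 1 < al -> al < 2 -> 0 < eta -> 0 < g ->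
  4 * g <= al - 1 - eta -> 0 < e <= 1 ->
  law_test al eta ((1 + eta + 2 * g) / al) (pk e) (dpk e) (288 / g).
Proof.
move=> al1 al2 eta0 g0 gs e01 nu s s01 [nuc nus] x.
have [e0 e1] := andP e01.
have g01 : 0 < g <= 1 by lra.
have dk (xi : R) := is_derive_kexp e xi.
have dkC : continuous (fun xi => - e * kexp e xi).
  by move=> xi; apply: cvgM; [exact: cvg_cst|exact: kexp_cont].
have kb xi : 0 <= xi -> `|kexp e xi| <= 1 * xi `^ 0.
  move=> xi0; rewrite powRr0 mulr1 ger0_norm ?kexp_ge0// /kexp expR_le1 oppr_le0.
  by rewrite mulr_ge0// ltW.
have dkb xi : 0 <= xi -> `|xi * (- e * kexp e xi)| <= 1 * xi `^ 0.
  move=> xi0; rewrite powRr0 mulr1 mulrA mulrN mulNr normrN ger0_norm; last first.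
    by rewrite !mulr_ge0 ?kexp_ge0// ltW.
  rewrite /kexp expRN ler_pdivrMr ?expR_gt0// mul1r mulrC.
  by have := expR_ge1Dx (e * xi); lra.
have kw xi (xi0 : 0 <= xi) := (kexp_wt g01 e01 xi0).1.
have xikw xi (xi0 : 0 <= xi) := (kexp_wt g01 e01 xi0).2.
have h1 := costr_law_bound al1 al2 eta0 g0 gs (lexx 0) (ltW g0) ler01 dk kb kw s01 nuc nus x.
have h2 := sintr_law_bound al1 al2 eta0 g0 gs (lexx 0) (ltW g0) ler01 dk dkC kb dkb xikw s01 nuc nus x.
have s0 := powR_ge0 s (- ((1 + eta + 2 * g) / al)).
have ig : 0 < g^-1 by rewrite invr_gt0.
under eq_Rintegral do rewrite -costr_kexp//.
split.
  apply: (le_trans h1); rewrite mulr1; apply: ler_wpM2r => //.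
  by apply: ler_wpM2r; [exact: ltW|rewrite ler_nat].
have E : \int[nu]_y dpk e (x + y) = - \int[nu]_y sintr (kexp e) (x + y).
  rewrite -mulN1r -RintegralZl//.
    by apply: eq_Rintegral => y _; rewrite sintr_kexp// mulN1r opprK.
  apply: (@bounded_integrable _ _ _ _ _ _ (e ^- 2)) => //.
  + by rewrite (le_lt_trans (probability_le1 _ _))// ltry.
  + under eq_fun do rewrite sintr_kexp//.
    apply: measurableT_comp => //; apply: (@measurableT_comp _ _ _ _ _ _ (dpk e)); last exact: measurable_funD.
    by apply: continuous_measurable_fun => y; exact: (is_derive_cvg (is_derive_dpk y e0)).
  + by move=> y _; rewrite sintr_kexp// normrN dpk_le.
by move: h2; rewrite E normrN mulr1.
Qed.

(** The inequality [min 1 y <= y ^ g], applied to [y = e * xi]: the source of the gain [e ^ g]. *)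
Lemma le_powR1 (y z g : R) : 0 <= y -> 0 <= g <= 1 -> z <= 1 -> z <= y -> z <= y `^ g.
Proof.
move=> y0 /andP[g0 g1] z1 zy; have [y1|y1] := leP y 1; last first.
  apply: (le_trans z1); rewrite (_ : 1 = y `^ 0); last by rewrite powRr0.
  by apply: ler_powR => //; exact: ltW.
move: y0; rewrite le_eqVlt => /predU1P[y0|y0].
  by apply: le_trans (powR_ge0 _ _); rewrite -y0 in zy.
by apply: (le_trans zy); apply: ger1_powR => //; rewrite y0.
Qed.

(** With [v = exp (- e * xi / 2)] the profile is [v - v ^ 2], which is at most both [1] and
    [e * xi], hence at most [(e * xi) ^ g]; its logarithmic derivative term satisfies the same bound
    twice. The Fourier bounds then apply with [p = g] and [c = 2 * e ^ g], and [576 = 2 * 288]. *)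
Lemma pkB_law_test (al eta g e : R) : 1 < al -> al < 2 -> 0 < eta -> 0 < g ->
  4 * g <= al - 1 - eta -> 0 < e <= 1 ->
  law_test al eta ((1 + eta + 2 * g) / al) (fun x => pk (e / 2) x - pk e x)
    (fun x => dpk (e / 2) x - dpk e x) (576 / g * e `^ g).
Proof.
move=> al1 al2 eta0 g0 gs e01 nu s s01 [nuc nus] x.
have [e0 e1] := andP e01.
have f01 : 0 < e / 2 <= 1 by lra.
have f0 : 0 < e / 2 by lra.
have g01 : 0 < g <= 1 by lra.
have g01' : 0 <= g <= 1 by lra.
have kdiff (t y : R) : 0 < y -> y <= 1 -> 1 - t / 2 <= y ->
    [/\ 0 <= y - y ^+ 2, y - y ^+ 2 <= 1 & y - y ^+ 2 <= t].
  by move=> *; split; nra.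
pose k xi := kexp (e / 2) xi - kexp e xi.
pose dk xi := - (e / 2) * kexp (e / 2) xi - (- e * kexp e xi).
have dkE (xi : R) : is_derive xi 1 k (dk xi).
  exact: (is_deriveB (is_derive_kexp (e / 2) xi) (is_derive_kexp e xi)).
have dkC : continuous dk.
  by move=> xi; apply: cvgB; (apply: cvgM; [exact: cvg_cst|exact: kexp_cont]).
have kE xi : kexp e xi = kexp (e / 2) xi ^+ 2.
  by rewrite /kexp expr2 -expRD; congr expR; lra.
have ha xi : 0 <= xi -> [/\ kexp (e / 2) xi <= 1, 0 < kexp (e / 2) xi,
    1 - e * xi / 2 <= kexp (e / 2) xi & e * xi / 2 * kexp (e / 2) xi <= 1].
  move=> xi0; rewrite /kexp; split.
  - by rewrite expR_le1 oppr_le0 mulr_ge0// ltW.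
  - exact: expR_gt0.
  - by have := expR_ge1Dx (- (e / 2 * xi)); lra.
  - rewrite expRN ler_pdivrMr ?expR_gt0// mul1r.
    by have := expR_ge1Dx (e / 2 * xi); lra.
have yE xi : 0 <= xi -> (e * xi) `^ g = e `^ g * xi `^ g by move=> xi0; rewrite powRM// ltW.
have pg0 (xi : R) : 0 <= e `^ g * xi `^ g by rewrite mulr_ge0 ?powR_ge0.
have kb xi : 0 <= xi -> `|k xi| <= (2 * e `^ g) * xi `^ g.
  move=> xi0; have [h1 h2 h3 h4] := ha _ xi0.
  have y0 : 0 <= e * xi by rewrite mulr_ge0// ltW.
  apply: (@le_trans _ _ (e `^ g * xi `^ g)); last by have := pg0 xi; lra.
  rewrite -yE//; rewrite /k kE.
  have [a1 a2 a3] := kdiff (e * xi) _ h2 h1 h3.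
  by apply: le_powR1 => //; rewrite ger0_norm.
have dkb xi : 0 <= xi -> `|xi * dk xi| <= (2 * e `^ g) * xi `^ g.
  move=> xi0; have [h1 h2 h3 h4] := ha _ xi0.
  have y0 : 0 <= e * xi by rewrite mulr_ge0// ltW.
  rewrite (_ : xi * dk xi = e * xi * kexp (e / 2) xi ^+ 2 - e * xi / 2 * kexp (e / 2) xi); last first.
    by rewrite /dk kE; field.
  apply: (le_trans (ler_normB _ _)).
  rewrite -[leRHS]mulrA -yE// (_ : 2 * _ = (e * xi) `^ g + (e * xi) `^ g); last by rewrite -mulr2n mulr_natl.
  apply: lerD; apply: le_powR1 => //.
  - rewrite ger0_norm; last by rewrite mulr_ge0// sqr_ge0.
    rewrite -kE /kexp expRN ler_pdivrMr ?expR_gt0// mul1r.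
    by have := expR_ge1Dx (e * xi); lra.
  - rewrite ger0_norm; last by rewrite mulr_ge0// sqr_ge0.
    by rewrite -[leRHS]mulr1 ler_wpM2l// expr_le1// ltW.
  - by rewrite ger0_norm//; nra.
  - by rewrite ger0_norm; nra.
pose C := 48 / (e / 2) ^+ 3 + 48 / e ^+ 3.
have kw xi : 0 <= xi -> `|k xi| <= C * wt g xi.
  move=> xi0; apply: (le_trans (ler_normB _ _)); rewrite mulrDl.
  by apply: lerD; [have [] := kexp_wt g01 f01 xi0|have [] := kexp_wt g01 e01 xi0].
have xikw xi : 0 <= xi -> `|xi * k xi| <= C * wt g xi.
  move=> xi0; rewrite mulrBr; apply: (le_trans (ler_normB _ _)); rewrite mulrDl.
  by apply: lerD; [have [] := kexp_wt g01 f01 xi0|have [] := kexp_wt g01 e01 xi0].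
have c0 : 0 <= 2 * e `^ g by rewrite mulr_ge0 ?powR_ge0.
have h1 := costr_law_bound al1 al2 eta0 g0 gs (ltW g0) (lexx g) c0 dkE kb kw s01 nuc nus x.
have h2 := sintr_law_bound al1 al2 eta0 g0 gs (ltW g0) (lexx g) c0 dkE dkC kb dkb xikw s01 nuc nus x.
have ic (f : R) : 0 < f <= 1 -> forall y, mu.-integrable `[0, +oo[ (EFin \o (fun xi => kexp f xi * cos (xi * y))).
  move=> ff y; have [||//] := @wt_bound R g (fun xi => kexp f xi * cos (xi * y)) (48 / f ^+ 3) g0.
  + apply: measurable_funTS; apply: continuous_measurable_fun => xi.
    by apply: cvgM; [exact: kexp_cont|exact: continuous_cosM].
  + move=> xi xi0; have [h _] := kexp_wt g01 ff xi0; apply: le_trans h.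
    by rewrite normrM -[leRHS]mulr1 ler_wpM2l// cos_max.
have is' (f : R) : 0 < f <= 1 -> forall y, mu.-integrable `[0, +oo[ (EFin \o (fun xi => xi * kexp f xi * sin (xi * y))).
  move=> ff y; have [||//] := @wt_bound R g (fun xi => xi * kexp f xi * sin (xi * y)) (48 / f ^+ 3) g0.
  + apply: measurable_funTS; apply: continuous_measurable_fun => xi.
    by apply: cvgM; [apply: cvgM; [exact: cvg_id|exact: kexp_cont]|exact: continuous_sinM].
  + move=> xi xi0; have [_ h] := kexp_wt g01 ff xi0; apply: le_trans h.
    by rewrite normrM -[leRHS]mulr1 ler_wpM2l// sin_max.
have cE y : costr k y = pk (e / 2) y - pk e y.
  rewrite -!costr_kexp// /costr -RintegralB//; last 2 first.
  - exact: ic.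
  - exact: ic.
  by apply: eq_Rintegral => xi _; rewrite /k mulrBl.
have sE y : sintr k y = - (dpk (e / 2) y - dpk e y).
  rewrite opprB -[dpk e y]opprK addrC -!sintr_kexp// /sintr -RintegralB//; last 2 first.
  - exact: is'.
  - exact: is'.
  by apply: eq_Rintegral => xi _; rewrite /k mulrBr mulrBl.
have s0 := powR_ge0 s (- ((1 + eta + 2 * g) / al)).
have ig : 0 < g^-1 by rewrite invr_gt0.
have cs : 288 * (2 * e `^ g) / g = 576 / g * e `^ g by ring.
split.
  under eq_Rintegral do rewrite -cE.
  apply: (le_trans h1); rewrite -cs; apply: ler_wpM2r => //.
  apply: ler_wpM2r; first exact: ltW.
  by apply: ler_wpM2r; [exact: c0|rewrite ler_nat].
have E : \int[nu]_y (dpk (e / 2) (x + y) - dpk e (x + y)) = - \int[nu]_y sintr k (x + y).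
  rewrite -mulN1r -RintegralZl//.
    by apply: eq_Rintegral => y _; rewrite sE mulN1r opprK.
  apply: (@bounded_integrable _ _ _ _ _ _ ((e / 2) ^- 2 + e ^- 2)) => //.
  + by rewrite (le_lt_trans (probability_le1 _ _))// ltry.
  + under eq_fun do rewrite sE.
    apply: measurableT_comp => //; apply: measurable_funB.
      apply: (@measurableT_comp _ _ _ _ _ _ (dpk (e / 2))); last exact: measurable_funD.
      by apply: continuous_measurable_fun => y; exact: (is_derive_cvg (is_derive_dpk y f0)).
    apply: (@measurableT_comp _ _ _ _ _ _ (dpk e)); last exact: measurable_funD.
    by apply: continuous_measurable_fun => y; exact: (is_derive_cvg (is_derive_dpk y e0)).
  + by move=> y _; rewrite sE normrN (le_trans (ler_normB _ _))// lerD// dpk_le.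
by rewrite E normrN -cs.
Qed.

Lemma integral_affine (x e : R) (f : R -> R) : 0 < e -> continuous f -> (forall z, 0 <= f z) ->
  (\int[mu]_z (f z)%:E = \int[mu]_z (f (x + e * z) * e)%:E)%E.
Proof.
move=> e0 cf f0.
have dE z : is_derive z (1 : R) (fun y : R => x + e * y) e.
  by apply: is_derive_eq; rewrite /GRing.scale/=; ring.
have F' : (fun y : R => x + e * y)^`()%classic = cst e.
  by apply/funext => z; rewrite derive1E; apply/derive_val.
rewrite (@increasing_ge0_integration_by_substitutionT _ (fun y => x + e * y)); last 9 first.
- by move=> y z yz; rewrite ltrD2l ltr_pM2l.
- by rewrite F'; exact: cst_continuous.
- by rewrite F'; exact: is_cvg_cst.
- by rewrite F'; exact: is_cvg_cst.
- by move=> y; have [] := dE y.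
- apply/cvgrNyPle => A; near=> z.
  rewrite -lerBrDl mulrC -ler_pdivlMr//; near: z; apply: nbhs_ninfty_le; exact: num_real.
- apply/cvgryPge => A; near=> z.
  rewrite -lerBlDl mulrC -ler_pdivrMr//; near: z; apply: nbhs_pinfty_ge; exact: num_real.
- exact: cf.
- exact: f0.
by apply: eq_integral => z _; rewrite F'.
Unshelve. all: by end_near.
Qed.

(** Rescaling moves the dependence on [e] into the argument of [f] and leaves the fixed integrable
    weight [1 / (1 + z ^ 2)], so one majorant serves all scales. *)
Lemma pk_conv e x (f : R -> R) : 0 < e -> continuous f -> (forall z, 0 <= f z) ->
  (\int[mu]_z (pk e (x - z) * f z)%:E =
   \int[mu]_z ((oneDsqr z)^-1 * f (x + e * z))%:E)%E.
Proof.
move=> e0 cf f0.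
have c1 : continuous (fun z => pk e (x - z) * f z).
  move=> z; apply: cvgM; last exact: cf.
  apply: (@continuous_comp _ _ _ (fun z => x - z) (pk e)).
    by apply: cvgB; [exact: cvg_cst|exact: cvg_id].
  exact: (is_derive_cvg (is_derive_pk _ e0)).
have c2 z : 0 <= pk e (x - z) * f z by rewrite mulr_ge0 ?pk_ge0.
rewrite [LHS](integral_affine x e0 c1 c2).
apply: eq_integral => z _; congr EFin.
have h : 0 < oneDsqr z by apply: lt_le_trans (oneDsqr_ge1 z).
rewrite opprD addNKr /pk /oneDsqr sqrrN exprMn.
rewrite /oneDsqr in h; rewrite (_ : e ^+ 2 + e ^+ 2 * z ^+ 2 = e ^+ 2 * (1 + z ^+ 2)); last ring.
by field; rewrite !gt_eqF.
Qed.

Lemma integral_oneDsqrV : (\int[mu]_z ((oneDsqr z)^-1)%:E = pi%:E)%E.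
Proof.
rewrite ge0_symfun_integralT//.
- rewrite (_ : [set x | _] = `[0%R, +oo[%classic); last first.
    by apply/seteqP; split => z /=; rewrite in_itv/= andbT.
  by rewrite integral0y_oneDsqr -EFinM; congr EFin; field.
- exact: continuous_oneDsqrV.
- by move=> z /=; rewrite /oneDsqr sqrrN.
Qed.

Lemma integral_pk e x : 0 < e -> (\int[mu]_z (pk e (x - z))%:E = pi%:E)%E.
Proof.
move=> e0; rewrite -integral_oneDsqrV.
have := @pk_conv e x (cst 1) e0 (@cst_continuous _ _ _) (fun _ => ler01).
under eq_integral do rewrite /= mulr1.
by move=> ->; apply: eq_integral => z _; rewrite /= mulr1.
Qed.

End poisson.

(** * Occupation functionals and the truncated Kato kernel *)

Section weighted_occupation.
Context {R : realType} d (T : measurableType d) (P : probability T R).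
Notation mu := (@lebesgue_measure R).
Variables (rho Y : R -> T -> R).
Hypothesis rho0 : forall r w, 0 <= rho r w.
Hypothesis mrho : measurable_fun [set: measurableTypeR R * T] (fun p => rho p.1 p.2).
Hypothesis mY : measurable_fun [set: measurableTypeR R * T] (fun p => Y p.1 p.2 : measurableTypeR R).
Local Open Scope ereal_scope.

(** The occupation measure of [Y], averaged over the probability space with a random density [rho]
    in time. Later [rho] carries the conditioning variable, a cutoff and the time window. *)
Definition occ (f : R -> \bar R) : \bar R :=
  \int[mu]_r \int[P]_w ((rho r w)%:E * f (Y r w)).

Let mint (f : R -> \bar R) : measurable_fun [set: measurableTypeR R] f ->
  measurable_fun [set: measurableTypeR R * T] (fun p => (rho p.1 p.2)%:E * f (Y p.1 p.2)).
Proof.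
move=> mf; apply: emeasurable_funM; first exact/measurable_EFinP.
exact: (measurableT_comp mf mY).
Qed.

Let mintw (f : R -> \bar R) r : measurable_fun [set: measurableTypeR R] f ->
  measurable_fun [set: T] (fun w => (rho r w)%:E * f (Y r w)).
Proof.
by move=> mf; exact: (measurableT_comp (mint mf) (measurable_pair1 r)).
Qed.

Let mintr (f : R -> \bar R) : measurable_fun [set: measurableTypeR R] f -> (forall x, 0 <= f x) ->
  measurable_fun [set: measurableTypeR R] (fun r => \int[P]_w ((rho r w)%:E * f (Y r w))).
Proof.
move=> mf f0.
apply: (measurable_fun_fubini_tonelli_F (fun p : measurableTypeR R * T => (rho p.1 p.2)%:E * f (Y p.1 p.2))).
  exact: mint.
by move=> p; rewrite mule_ge0// lee_fin.
Qed.

Let i0 (f : R -> \bar R) r w : (forall x, 0 <= f x) -> 0 <= (rho r w)%:E * f (Y r w).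
Proof. by move=> f0; rewrite mule_ge0// lee_fin. Qed.

Lemma occ_ge0 f : (forall x, 0 <= f x) -> 0 <= occ f.
Proof. by move=> f0; do 2 (apply: integral_ge0 => ? _); exact: i0. Qed.

Lemma le_occ f g : measurable_fun [set: measurableTypeR R] f ->
  measurable_fun [set: measurableTypeR R] g ->
  (forall x, 0 <= f x) -> (forall x, f x <= g x) -> occ f <= occ g.
Proof.
move=> mf mg f0 fg.
have g0 x : 0 <= g x by exact: le_trans (f0 x) (fg x).
apply: ge0_le_integral => //.
- by move=> r _; apply: integral_ge0 => w _; exact: i0.
- exact: mintr.
- exact: mintr.
- move=> r _; apply: ge0_le_integral => //.
  + by move=> w _; exact: i0.
  + exact: mintw.
  + exact: mintw.
  + by move=> w _; rewrite lee_wpmul2l// lee_fin.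
Qed.

Lemma occZ (c : R) f : (0 <= c)%R -> measurable_fun [set: measurableTypeR R] f ->
  (forall x, 0 <= f x) -> occ (fun x => c%:E * f x) = c%:E * occ f.
Proof.
move=> c0 mf f0; rewrite /occ -ge0_integralZl_EFin//.
- apply: eq_integral => r _; rewrite -ge0_integralZl_EFin//.
  + by apply: eq_integral => w _; rewrite muleCA.
  + by move=> w _; exact: i0.
  + exact: mintw.
- by move=> r _; apply: integral_ge0 => w _; exact: i0.
- exact: mintr.
Qed.

Section parametric.
Variable F : R * R -> \bar R.
Hypothesis mF : measurable_fun [set: measurableTypeR R * measurableTypeR R] F.
Hypothesis F0 : forall p, 0 <= F p.

Let mYz : measurable_fun [set: (measurableTypeR R * T) * measurableTypeR R]
    (fun q => (rho q.1.1 q.1.2)%:E * F (Y q.1.1 q.1.2, q.2)).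
Proof.
apply: emeasurable_funM.
  by apply/measurable_EFinP; exact: (measurableT_comp mrho measurable_fst).
apply: (measurableT_comp mF); apply/measurable_fun_pairP; split => /=.
  exact: (measurableT_comp mY measurable_fst).
exact: measurable_snd.
Qed.

Let G (q : measurableTypeR R * measurableTypeR R) : \bar R :=
  \int[P]_w ((rho q.1 w)%:E * F (Y q.1 w, q.2)).

Let mG : measurable_fun [set: measurableTypeR R * measurableTypeR R] G.
Proof.
apply: (measurable_fun_fubini_tonelli_F (fun q : (measurableTypeR R * measurableTypeR R) * T =>
   (rho q.1.1 q.2)%:E * F (Y q.1.1 q.2, q.1.2))).
  apply: (measurableT_comp mYz (_ : measurable_fun setT (fun q : (measurableTypeR R * measurableTypeR R) * T => ((q.1.1, q.2), q.1.2)))).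
  apply/measurable_fun_pairP; split => /=.
    apply/measurable_fun_pairP; split => /=; last exact: measurable_snd.
    exact: (measurableT_comp measurable_fst measurable_fst).
  exact: (measurableT_comp measurable_snd measurable_fst).
by move=> q; rewrite mule_ge0// lee_fin.
Qed.

Let G0 q : 0 <= G q.
Proof. by apply: integral_ge0 => w _; rewrite mule_ge0// lee_fin. Qed.

Lemma measurable_occ :
  measurable_fun [set: measurableTypeR R] (fun z => occ (fun x => F (x, z))).
Proof. exact: (measurable_fun_fubini_tonelli_G (m1 := mu) G mG G0). Qed.

Lemma occ_tonelli :
  occ (fun x => \int[mu]_z F (x, z)) = \int[mu]_z occ (fun x => F (x, z)).
Proof.
rewrite /occ.
transitivity (\int[mu]_r \int[mu]_z \int[P]_w ((rho r w)%:E * F (Y r w, z))).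
  apply: eq_integral => r _.
  rewrite (fubini_tonelli (m1 := mu) (m2 := P) (fun q : measurableTypeR R * T => (rho r q.2)%:E * F (Y r q.2, q.1)))//=.
  - apply: eq_integral => w _; rewrite ge0_integralZl_EFin//.
    exact: (measurableT_comp mF (measurable_pair1 _)).
  - apply: (measurableT_comp mYz (_ : measurable_fun setT (fun q : measurableTypeR R * T => ((r, q.2), q.1)))).
    apply/measurable_fun_pairP; split => /=; last exact: measurable_fst.
    by apply/measurable_fun_pairP; split => /=; [exact: measurable_cst|exact: measurable_snd].
  - by move=> q; rewrite mule_ge0// lee_fin.
exact: (@fubini_tonelli _ _ _ _ R mu mu G mG G0).
Qed.

End parametric.

Lemma limn_einf_le (u : (\bar R)^nat) C : (forall n, u n <= C) -> limn_einf u <= C.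
Proof.
move=> uC; rewrite limn_einf_lim; apply: lime_le; first exact: is_cvg_einfs.
near=> n; apply: le_trans (uC n).
by apply: ereal_inf_lbound; exists n => //=.
Unshelve. all: by end_near.
Qed.

Lemma le_limn_einf (u : (\bar R)^nat) l : u n @[n --> \oo] --> l -> l <= limn_einf u.
Proof. by move=> /cvg_limn_einf_sup[->]. Qed.

Lemma measurable_limn_einf d' (T' : measurableType d') (f : nat -> T' -> \bar R) :
  (forall n, measurable_fun setT (f n)) ->
  measurable_fun setT (fun x => limn_einf (f ^~ x)).
Proof.
move=> mf; rewrite /limn_einf; apply: measurableT_comp => //.
by apply: measurable_fun_limn_esup => // n; exact: measurableT_comp.
Qed.

Lemma occ_fatou (f : nat -> R -> \bar R) (g : R -> \bar R) (C : \bar R) :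
  (forall n, measurable_fun [set: measurableTypeR R] (f n)) ->
  (forall n x, 0 <= f n x) ->
  measurable_fun [set: measurableTypeR R] g ->
  (forall x, 0 <= g x) ->
  (forall x, f n x @[n --> \oo] --> g x) ->
  (forall n, occ (f n) <= C) -> occ g <= C.
Proof.
move=> mf f0 mg g0 fg fC.
apply: (@le_trans _ _ (limn_einf (fun n => occ (f n)))); last exact: limn_einf_le.
apply: le_trans (fatou mu measurableT (fun n => mintr (mf n) (f0 n)) _); last first.
  by move=> n r _; apply: integral_ge0 => w _; exact: i0.
apply: ge0_le_integral => //.
- by move=> r _; apply: integral_ge0 => w _; exact: i0.
- exact: mintr.
- apply: measurable_limn_einf => n; exact: mintr.
move=> r _.
apply: le_trans (fatou P measurableT (fun n => mintw r (mf n)) _); last first.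
  by move=> n w _; exact: i0.
apply: ge0_le_integral => //.
- by move=> w _; exact: i0.
- exact: mintw.
- apply: measurable_limn_einf => n; exact: mintw.
move=> w _; apply: le_limn_einf.
by apply: cvgeZl => //; exact: fg.
Qed.

End weighted_occupation.

Section truncated_kernel.
Context {R : realType}.
Implicit Types (a x y eta : R).

(* The Kato kernel [|x| `^ (eta - 1)] truncated at distance [a], hence
   bounded and Lipschitz. *)
Definition kc eta a x : R := (Num.max a `|x|) `^ (eta - 1).

Lemma kc_ge0 eta a x : 0 <= kc eta a x. Proof. exact: powR_ge0. Qed.

Lemma kcN eta a x : kc eta a (- x) = kc eta a x.
Proof. by rewrite /kc normrN. Qed.

Lemma npowR_antitone (s t q : R) : 0 < s -> s <= t -> q <= 0 -> t `^ q <= s `^ q.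
Proof.
move=> s0 st q0; rewrite -(opprK q) !(powRN _ (- q)).
have t0 := lt_le_trans s0 st.
rewrite lef_pV2 ?posrE ?powR_gt0//.
by apply: ge0_ler_powR; rewrite ?nnegrE ?oppr_ge0 ?(ltW s0) ?(ltW t0).
Qed.

Lemma kc_le eta a x : 0 < eta < 1 -> 0 < a -> kc eta a x <= a `^ (eta - 1).
Proof.
move=> e01 a0; apply: npowR_antitone => //; [by rewrite le_max lexx|lra].
Qed.

(** For [a <= s <= t] the difference of the powers is [s ^ (eta - 1) * (1 - (s / t) ^ (1 - eta))].
    As [s / t <= 1] and [1 - eta <= 1], the second factor is at most [1 - s / t <= (t - s) / a]. The
    truncation [max a |x|] is itself 1-Lipschitz. *)
Lemma kc_lipschitz eta a x y : 0 < eta < 1 -> 0 < a ->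
  `|kc eta a x - kc eta a y| <= a `^ (eta - 1) / a * `|x - y|.
Proof.
move=> e01 a0.
have H (s t : R) : a <= s -> s <= t ->
    s `^ (eta - 1) - t `^ (eta - 1) <= a `^ (eta - 1) / a * (t - s).
  move=> as_ st; have s0 : 0 < s by exact: lt_le_trans as_.
  have t0 : 0 < t by exact: lt_le_trans st.
  have -> : s `^ (eta - 1) - t `^ (eta - 1) = s `^ (eta - 1) * (1 - (s / t) `^ (1 - eta)).
    have -> : t `^ (eta - 1) = s `^ (eta - 1) * (s / t) `^ (1 - eta).
      rewrite powRM ?invr_ge0 ?ltW// -(powR_inv1 (ltW t0)) -powRrM mulN1r opprB.
      rewrite mulrA -powRD; last by rewrite (gt_eqF s0) implybT.
      by rewrite (_ : eta - 1 + (1 - eta) = 0) ?powRr0 ?mul1r//; ring.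
    by rewrite mulrBr mulr1.
  have h1 : 1 - (s / t) `^ (1 - eta) <= (t - s) / a.
    have st1 : 0 < s / t <= 1 by rewrite divr_gt0//= ler_pdivrMr// mul1r.
    have := ger1_powR st1 (_ : 1 - eta <= 1); have -> : 1 - eta <= 1 by lra.
    move=> /(_ isT) h; apply: (@le_trans _ _ (1 - s / t)); first by rewrite lerB.
    have -> : 1 - s / t = (t - s) / t by field; rewrite gt_eqF.
    rewrite ler_wpM2l ?subr_ge0// lef_pV2 ?posrE//; exact: le_trans st.
  have h2 : s `^ (eta - 1) <= a `^ (eta - 1) by apply: npowR_antitone => //; lra.
  have h3 : 0 <= 1 - (s / t) `^ (1 - eta).
    rewrite subr_ge0 -[leRHS](_ : 1 `^ (1 - eta) = 1); last by rewrite powR1.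
    apply: ge0_ler_powR; rewrite ?nnegrE ?ler01//; [lra|by rewrite divr_ge0// ltW|].
    by rewrite ler_pdivrMr// mul1r.
  have h4 := powR_ge0 s (eta - 1).
  rewrite mulrAC -mulrA; exact: ler_pM.
set s := Num.max a `|x|; set t := Num.max a `|y|.
have as_ : a <= s by rewrite le_max lexx.
have at_ : a <= t by rewrite le_max lexx.
have st : `|s - t| <= `|x - y|.
  apply: (@le_trans _ _ (Num.norm (`|x| - `|y|))); last exact: ler_dist_dist.
  rewrite /s /t; have [h1|h1] := leP a `|x|; have [h2|h2] := leP a `|y|; rewrite ?subrr ?normr0// ler_norml;
  by have := ler_norm (`|x| - `|y|); have := ler_norm (- (`|x| - `|y|)); rewrite normrN => *; apply/andP; split; lra.
have c0 : 0 <= a `^ (eta - 1) / a by rewrite divr_ge0 ?powR_ge0// ltW.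
apply: (@le_trans _ _ (a `^ (eta - 1) / a * `|s - t|)); last by rewrite ler_wpM2l.
rewrite /kc -/s -/t; have [st'|ts'] := leP s t.
  rewrite ger0_norm; last by rewrite subr_ge0; apply: npowR_antitone => //; [exact: lt_le_trans as_|lra].
  by rewrite distrC ger0_norm ?subr_ge0// H.
rewrite distrC ger0_norm; last first.
  by rewrite subr_ge0; apply: npowR_antitone; [exact: lt_le_trans at_|exact: ltW|lra].
by rewrite (ger0_norm (_ : 0 <= s - t)) ?subr_ge0 ?H// ltW.
Qed.

Lemma kc_continuous eta a : 0 < eta < 1 -> 0 < a -> continuous (kc eta a).
Proof.
move=> e01 a0 x; apply/cvgrPdist_lt => e e0.
set c := a `^ (eta - 1) / a.
have c0 : 0 < c by rewrite divr_gt0// powR_gt0.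
near=> y.
apply: (le_lt_trans (kc_lipschitz _ _ e01 a0)); rewrite -/c mulrC -ltr_pdivlMr//.
near: y; apply: (@cvgr_dist_lt _ _ _ _ _ id); [exact: cvg_id|exact: divr_gt0].
Unshelve. all: by end_near.
Qed.

Lemma kc_le_kernel eta a x : 0 < eta < 1 -> 0 < a ->
  ((kc eta a x)%:E <= ((`|x| `^ (1 - eta))%:E)^-1)%E.
Proof.
move=> e01 a0; have [->|x0] := eqVneq x 0.
  rewrite normr0 powR0; last by rewrite gt_eqF//; lra.
  by rewrite inve0 leey.
have nx : 0 < `|x| by rewrite normr_gt0.
rewrite inver gt_eqF ?powR_gt0// lee_fin -powRN opprB.
by apply: npowR_antitone => //; [rewrite le_max lexx orbT|lra].
Qed.

(** Combines a uniform bound, used for [|x| < a], with a singular one, used beyond. In the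
    application [C] explodes as [e] tends to [0]; the condition on [a] says that the truncation
    distance is small enough to compensate. *)
Lemma le_kc eta a x (K B C : R) : 0 < eta < 1 -> 0 < a -> 0 <= K -> K <= C ->
  C <= B * a `^ (eta - 1) -> K * `|x| `^ (1 - eta) <= B -> K <= B * kc eta a x.
Proof.
move=> e01 a0 K0 KC CB KB; rewrite /kc.
have [ax|xa] := leP a `|x|; last exact: le_trans CB.
have nx : 0 < `|x| by exact: lt_le_trans ax.
by rewrite -opprB powRN ler_pdivlMr ?powR_gt0.
Qed.

End truncated_kernel.

(** * Absorption of the drift term by iteration *)

Section density_bound.
Context {R : realType} d (T : measurableType d) (P : probability T R).
Notation mu := (@lebesgue_measure R).
Variables (rho Y : R -> T -> R).
Hypothesis rho0 : forall r w, 0 <= rho r w.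
Hypothesis mrho : measurable_fun [set: measurableTypeR R * T] (fun p => rho p.1 p.2).
Hypothesis mY : measurable_fun [set: measurableTypeR R * T] (fun p => Y p.1 p.2 : measurableTypeR R).
Notation occ := (occ P rho Y).
Implicit Types (a x y z e eps : R).
Variables (eta : R) (b : nat -> R -> R) (Cb : nat -> R) (M u c0 m0 : R).
Hypothesis eta01 : 0 < eta < 1.
Hypothesis b0 : forall k x, 0 <= b k x.
Hypothesis bC : forall k, continuous (b k).
Hypothesis bb : forall k x, b k x <= Cb k.
Hypothesis M0 : 0 <= M.
Hypothesis u0 : 0 <= u.
Hypothesis c00 : 0 <= c0.
Hypothesis m00 : 0 <= m0.
Hypothesis bM : forall a k x, 0 < a ->
  (\int[mu]_z (kc eta a (x - z) * b k z)%:E <= M%:E)%E.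
Hypothesis c0M : c0 * M <= 2^-1.
(** The quantifiers are ordered for the iteration: [a] depends on [e] alone, [k] may depend on
    [eps], and one [k] serves all [z], so that the inequality can be integrated against a test
    function of [z]. *)
Hypothesis H1 : forall e, 0 < e <= 1 -> exists2 a : R, 0 < a &
  forall eps : R, 0 < eps -> exists k, forall z,
   (occ (fun x => (pk e (x - z))%:E) <=
    (u + eps)%:E + c0%:E * occ (fun x => (kc eta a (x - z) * b k x)%:E))%E.
Hypothesis H2 : forall k, (occ (fun x => (b k x)%:E) <= m0%:E)%E.

Let mcont (f : R -> R) : continuous f -> measurable_fun [set: measurableTypeR R] (EFin \o f).
Proof. by move=> cf; apply/measurable_EFinP; exact: continuous_measurable_fun. Qed.

Let mcont2 (f g : R -> R) : continuous f -> continuous g ->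
  measurable_fun [set: measurableTypeR R * measurableTypeR R] (fun p => (f (p.1 - p.2) * g p.2)%:E).
Proof.
move=> cf cg; apply/measurable_EFinP; apply: measurable_funM.
  apply: (measurableT_comp (continuous_measurable_fun cf)).
  by apply: measurable_funB; [exact: measurable_fst|exact: measurable_snd].
exact: (measurableT_comp (continuous_measurable_fun cg) measurable_snd).
Qed.

Let ckc a : 0 < a -> continuous (kc eta a).
Proof. exact: kc_continuous. Qed.

Let cpk e : 0 < e -> continuous (@pk R e).
Proof. by move=> e0 x; exact: (is_derive_cvg (is_derive_pk x e0)). Qed.

Let csub (f : R -> R) z : continuous f -> continuous (fun x => f (x - z)).
Proof.
move=> cf x; apply: (@continuous_comp _ _ _ (fun x => x - z) f); last exact: cf.
by apply: cvgB; [exact: cvg_id|exact: cvg_cst].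
Qed.

Let csub' (f : R -> R) z : continuous f -> continuous (fun x => f (z - x)).
Proof.
move=> cf x; apply: (@continuous_comp _ _ _ (fun x => z - x) f); last exact: cf.
by apply: cvgB; [exact: cvg_cst|exact: cvg_id].
Qed.

Definition kconv a (f : R -> R) (y : R) : R := \int[mu]_z (kc eta a (y - z) * f z).

Section one_function.
Variables (f : R -> R) (Cf F : R).
Hypothesis f0 : forall x, 0 <= f x.
Hypothesis fC : continuous f.
Hypothesis fb : forall x, f x <= Cf.
Hypothesis F0 : 0 <= F.
Hypothesis fF : (\int[mu]_z (f z)%:E <= F%:E)%E.

Let if_ : mu.-integrable setT (EFin \o f).
Proof.
apply/integrableP; split; first exact: mcont.
under eq_integral => x _ do rewrite /= ger0_norm//.
exact: le_lt_trans fF (ltry _).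
Qed.

Lemma kconvE a y : 0 < a ->
  (\int[mu]_z (kc eta a (y - z) * f z)%:E = (kconv a f y)%:E)%E.
Proof.
move=> a0; rewrite /kconv /Rintegral fineK//.
have i : mu.-integrable setT (fun z => (a `^ (eta - 1))%:E * (f z)%:E)%E.
  exact: integrableZl.
apply: integrable_fin_num => //; apply: (le_integrable _ _ _ i) => //.
  by apply: mcont => z; apply: cvgM; [exact: (@csub' _ y (ckc a0))|exact: fC].
move=> z _ /=; rewrite lee_fin !normrM (ger0_norm (f0 _)) (ger0_norm (kc_ge0 _ _ _)).
by rewrite ler_wpM2r// (le_trans (kc_le _ eta01 a0))// ler_norm.
Qed.

Lemma kconv_ge0 a y : 0 <= kconv a f y.
Proof. by apply: Rintegral_ge0 => z _; rewrite mulr_ge0// kc_ge0. Qed.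

Lemma kconv_continuous a : 0 < a -> continuous (kconv a f).
Proof.
move=> a0 x; apply/cvgrPdist_lt => e e0.
pose c := a `^ (eta - 1) / a.
have cpos : 0 < c by rewrite divr_gt0// powR_gt0.
have F1 : 0 < F + 1 by rewrite ltr_wpDl.
have i y : mu.-integrable setT (EFin \o (fun z => kc eta a (y - z) * f z)).
  apply/integrableP; split.
    by apply: mcont => z; apply: cvgM; [exact: (@csub' _ y (ckc a0))|exact: fC].
  under eq_integral => z _ do rewrite /= ger0_norm ?mulr_ge0 ?kc_ge0//.
  by rewrite kconvE// ltry.
have L y : `|kconv a f x - kconv a f y| <= c * `|x - y| * (F + 1).
  rewrite /kconv -RintegralB//.
  have iB : mu.-integrable setT (EFin \o (fun z => kc eta a (x - z) * f z - kc eta a (y - z) * f z)).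
    by have := integrableB measurableT (i x) (i y).
  apply: (le_trans (le_normr_Rintegral measurableT iB)).
  have i2 : mu.-integrable setT (EFin \o (fun z => c * `|x - y| * f z)).
    by have := integrableZl measurableT (c * `|x - y|) if_.
  apply: (@le_trans _ _ (\int[mu]_z (c * `|x - y| * f z))).
    apply: le_Rintegral => //; first exact: (integrable_norm iB).
    move=> z _; rewrite -mulrBl normrM (ger0_norm (f0 _)) ler_wpM2r//.
    apply: (le_trans (kc_lipschitz _ _ eta01 a0)).
    by rewrite opprB addrA subrK -/c.
  rewrite RintegralZl//; apply: ler_wpM2l; first by rewrite mulr_ge0// ltW.
  rewrite /Rintegral -lee_fin fineK; last exact: integrable_fin_num if_.
  by apply: (le_trans fF); rewrite lee_fin lerDl.
near=> y.
apply: (le_lt_trans (L y)).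
rewrite -ltr_pdivlMr// mulrC -ltr_pdivlMr//.
near: y; apply: (@cvgr_dist_lt _ _ _ _ _ id); [exact: cvg_id|].
by apply: divr_gt0 => //; exact: divr_gt0.
Unshelve. all: by end_near.
Qed.

Lemma kconv_le a y : 0 < a -> kconv a f y <= a `^ (eta - 1) * F.
Proof.
move=> a0; rewrite -lee_fin -kconvE//.
apply: (@le_trans _ _ (\int[mu]_z ((a `^ (eta - 1))%:E * (f z)%:E))%E).
  apply: ge0_le_integral => //.
  - by move=> z _; rewrite lee_fin mulr_ge0// kc_ge0.
  - by apply: mcont => z; apply: cvgM; [exact: (@csub' _ y (ckc a0))|exact: fC].
  - by apply: measurable_funeM; exact: mcont.
  - by move=> z _; rewrite -EFinM lee_fin ler_wpM2r// kc_le.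
rewrite ge0_integralZl_EFin ?powR_ge0//; last 2 first.
- by move=> z _; rewrite lee_fin.
- exact: mcont.
by rewrite EFinM lee_wpmul2l// lee_fin powR_ge0.
Qed.

Lemma pk_conv_cvg x :
  (\int[mu]_z (pk (n.+1%:R^-1) (x - z) * f z)%:E @[n --> \oo] --> (pi * f x)%:E)%E.
Proof.
have e0 n : 0 < n.+1%:R^-1 :> R by rewrite invr_gt0.
have i1 : mu.-integrable setT (fun z => (Cf%:E * ((oneDsqr z)^-1)%:E))%E.
  apply: integrableZl => //; apply/integrableP; split.
    by apply: mcont; exact: continuous_oneDsqrV.
  under eq_integral => z _.
    rewrite /= ger0_norm; last by rewrite invr_ge0 (le_trans _ (oneDsqr_ge1 z)).
    over.
  by rewrite integral_oneDsqrV ltry.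
have -> : (pi * f x)%:E = (\int[mu]_z ((oneDsqr z)^-1 * f x)%:E)%E.
  under eq_integral do rewrite mulrC EFinM.
  rewrite ge0_integralZl_EFin//.
  - by rewrite integral_oneDsqrV -EFinM mulrC.
  - by apply: mcont; exact: continuous_oneDsqrV.
rewrite (_ : (fun n : nat => _) = (fun n : nat => (\int[mu]_z ((oneDsqr z)^-1 * f (x + n.+1%:R^-1 * z))%:E)%E)); last first.
  by apply/funext => n; rewrite pk_conv.
have [] // := @dominated_convergence _ _ _ mu setT measurableT
  (fun n z => ((oneDsqr z)^-1 * f (x + n.+1%:R^-1 * z))%:E) (fun z => ((oneDsqr z)^-1 * f x)%:E)
  (fun z => (Cf%:E * ((oneDsqr z)^-1)%:E))%E.
- move=> n; apply: mcont => z; apply: cvgM; first exact: continuous_oneDsqrV.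
  apply: (@continuous_comp _ _ _ (fun z => x + n.+1%:R^-1 * z) f); last exact: fC.
  by apply: cvgD; [exact: cvg_cst|apply: cvgM; [exact: cvg_cst|exact: cvg_id]].
- by apply: mcont => z; apply: cvgM; [exact: continuous_oneDsqrV|exact: cvg_cst].
- apply: aeW => z _; apply: cvg_EFin; first by near=> n.
  apply: cvgM; first exact: cvg_cst.
  apply: (@cvg_comp _ _ _ (fun n : nat => x + n.+1%:R^-1 * z) f); last exact: fC.
  have h : x + n.+1%:R^-1 * z @[n --> \oo] --> x + 0 * z.
    apply: cvgD; first exact: cvg_cst.
    by apply: cvgM; [exact: cvg_harmonic|exact: cvg_cst].
  by rewrite mul0r addr0 in h; exact: h.
- apply: aeW => z n _; rewrite -EFinM /= lee_fin.
  have o0 : 0 <= (oneDsqr z)^-1 by rewrite invr_ge0 (le_trans _ (oneDsqr_ge1 z)).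
  by rewrite ger0_norm ?mulr_ge0// mulrC ler_wpM2r.
Unshelve. all: by end_near.
Qed.

(** Integrating [H1] against [f z] turns the Poisson kernel into its convolution with [f], and the
    truncated kernel into [kconv]. Then [eps] tends to [0] for each scale, and the scale tends to
    [0] by Fatou's lemma; the limit is [pi * f], and [pi >= 1] is discarded. *)
Lemma occ_step (C : R) : 0 <= C ->
  (forall a k, 0 < a -> (occ (fun y => (b k y * kconv a f y)%:E) <= C%:E)%E) ->
  (occ (EFin \o f) <= (u * F + c0 * C)%:E)%E.
Proof.
move=> C0 HC.
pose g n x := (\int[mu]_z (pk (n.+1%:R^-1) (x - z) * f z)%:E)%E.
have e0 n : 0 < n.+1%:R^-1 :> R by rewrite invr_gt0.
have mpk n := mcont2 (cpk (e0 n)) fC.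
have pkf0 n p : (0 <= (pk (n.+1%:R^-1) (p.1 - p.2) * f p.2)%:E)%E.
  by rewrite lee_fin mulr_ge0// pk_ge0.
have mg n : measurable_fun [set: measurableTypeR R] (g n).
  exact: (measurable_fun_fubini_tonelli_F (m2 := mu) _ (mpk n)).
have key n : (occ (g n) <= (u * F + c0 * C)%:E)%E.
  have e01 : 0 < (n.+1%:R^-1 : R) <= 1 by rewrite e0/= invf_le1// ler1n.
  have [a a0 Ha] := H1 e01.
  rewrite /g (occ_tonelli P rho0 mrho mY (mpk n) (pkf0 n)).
  apply/lee_addgt0Pr => eps eps0.
  have F1 : 0 < F + 1 by rewrite ltr_wpDl.
  have [k Hk] := Ha (eps / (F + 1)) (divr_gt0 eps0 F1).
  have mk : measurable_fun [set: measurableTypeR R * measurableTypeR R]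
      (fun p => (kc eta a (p.1 - p.2) * f p.2 * b k p.1)%:E).
    rewrite (_ : (fun p => _) = (fun p => (kc eta a (p.1 - p.2) * f p.2)%:E * (b k p.1)%:E)%E)//.
    apply: emeasurable_funM; first exact: (mcont2 (ckc a0) fC).
    exact: (measurableT_comp (mcont (@bC k)) measurable_fst).
  have k0 (p : R * R) : (0 <= (kc eta a (p.1 - p.2) * f p.2 * b k p.1)%:E)%E.
    by rewrite lee_fin !mulr_ge0// kc_ge0.
  have mkb z : measurable_fun [set: measurableTypeR R] (fun x => (kc eta a (x - z) * b k x)%:E).
    by apply: mcont => x; apply: cvgM; [exact: (@csub _ z (ckc a0))|exact: bC].
  have Ez z : occ (fun x => (kc eta a (x - z) * f z * b k x)%:E) =
      ((f z)%:E * occ (fun x => (kc eta a (x - z) * b k x)%:E))%E.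
    transitivity (occ (fun x => (f z)%:E * (kc eta a (x - z) * b k x)%:E)%E).
      by congr occ; apply/funext => x; rewrite -EFinM; congr EFin; ring.
    apply: (occZ P rho0 mrho mY (f0 z) (mkb z)).
    by move=> x; rewrite lee_fin mulr_ge0// kc_ge0.
  have mocc : measurable_fun [set: measurableTypeR R] (fun z => occ (fun x => (kc eta a (x - z) * f z * b k x)%:E)).
    exact: (measurable_occ P rho0 mrho mY mk k0).
  apply: (@le_trans _ _ (\int[mu]_z ((u + eps / (F + 1))%:E * (f z)%:E + c0%:E * occ (fun x => (kc eta a (x - z) * f z * b k x)%:E))))%E.
    apply: ge0_le_integral; first exact: measurableT.
    - by move=> z _; apply: occ_ge0 => // x; exact: (pkf0 n (x, z)).
    - exact: (measurable_occ P rho0 mrho mY (mpk n) (pkf0 n)).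
    - apply: emeasurable_funD; first by apply: measurable_funeM; exact: mcont.
      exact: measurable_funeM.
    - move=> z _.
      have -> : occ (fun x => (pk (n.+1%:R^-1) (x - z) * f z)%:E) = ((f z)%:E * occ (fun x => (pk (n.+1%:R^-1) (x - z))%:E))%E.
        transitivity (occ (fun x => (f z)%:E * (pk (n.+1%:R^-1) (x - z))%:E)%E).
          by congr occ; apply/funext => x; rewrite -EFinM mulrC.
        apply: (occZ P rho0 mrho mY (f0 z)).
          by apply: mcont; exact: (@csub _ _ (cpk (e0 n))).
        by move=> x; rewrite lee_fin pk_ge0.
      apply: (le_trans (lee_wpmul2l _ (Hk z))); first by rewrite lee_fin.
      rewrite Ez ge0_muleDr; last 2 first.
      + by rewrite lee_fin addr_ge0// divr_ge0// ltW.
      + by rewrite mule_ge0 ?lee_fin// occ_ge0// => x; rewrite lee_fin mulr_ge0// kc_ge0.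
      by rewrite muleC leeD// muleCA.
  rewrite ge0_integralD//; last 4 first.
  - by move=> z _; rewrite mule_ge0// lee_fin// addr_ge0// divr_ge0// ltW.
  - by apply: measurable_funeM; exact: mcont.
  - by move=> z _; rewrite mule_ge0 ?lee_fin// occ_ge0// => x; exact: (k0 (x, z)).
  - exact: measurable_funeM.
  rewrite ge0_integralZl_EFin//; last 3 first.
  - by move=> z _; rewrite lee_fin.
  - exact: mcont.
  - by rewrite addr_ge0// divr_ge0// ltW.
  rewrite ge0_integralZl_EFin//; last first.
    by move=> z _; apply: occ_ge0 => // x; exact: (k0 (x, z)).
  rewrite -(occ_tonelli P rho0 mrho mY mk k0).
  have -> : occ (fun x => (\int[mu]_z (kc eta a (x - z) * f z * b k x)%:E)%E) = occ (fun y => (b k y * kconv a f y)%:E).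
    congr occ; apply/funext => x.
    under eq_integral do rewrite mulrC EFinM.
    rewrite ge0_integralZl_EFin//; first by rewrite kconvE.
    - by move=> z _; rewrite lee_fin mulr_ge0// kc_ge0.
    - by apply: mcont => z; apply: cvgM; [exact: (@csub' _ x (ckc a0))|exact: fC].
  apply: (@le_trans _ _ ((u + eps / (F + 1))%:E * F%:E + c0%:E * C%:E))%E.
    apply: leeD; apply: lee_wpmul2l => //; rewrite ?lee_fin//.
      by rewrite addr_ge0// divr_ge0// ltW.
    exact: HC.
  rewrite -!EFinM -!EFinD lee_fin mulrDl.
  have : eps / (F + 1) * F <= eps by rewrite -mulrA ler_piMr ?(ltW eps0)// mulrC ler_pdivrMr// mul1r lerDl.
  lra.
have h : (occ (fun x => pi%:E * (f x)%:E) <= (u * F + c0 * C)%:E)%E.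
  apply: (occ_fatou rho0 mrho mY mg) => //.
  - by move=> n x; apply: integral_ge0 => z _; exact: (pkf0 n (x, z)).
  - by apply: measurable_funeM; exact: mcont.
  - by move=> x; rewrite mule_ge0// lee_fin// pi_ge0.
  - exact: pk_conv_cvg.
apply: le_trans h; apply: le_occ => //.
- exact: mcont.
- by apply: measurable_funeM; exact: mcont.
- move=> x; rewrite -EFinM lee_fin -[leLHS]mul1r ler_wpM2r//.
  by have := @pi_ge2 R; lra.
Qed.

End one_function.

(** One iteration keeps the class of admissible functions. By Tonelli and the evenness of [kc], the
    mass is multiplied by [M], and so is the bound on all truncated potentials. The supremum bound
    deteriorates with [a] and [k], but it enters only as a finite constant. *)
Lemma kernel_product_bounds a k (f : R -> R) (Cf F B : R) : 0 < a ->
  (forall x, 0 <= f x) -> continuous f -> (forall x, f x <= Cf) -> 0 <= F ->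
  (\int[mu]_z (f z)%:E <= F%:E)%E -> 0 <= B ->
  (forall a x, 0 < a -> (\int[mu]_z (kc eta a (x - z) * f z)%:E <= B%:E)%E) ->
  let f' (y : R) := b k y * kconv a f y in
  [/\ forall x, 0 <= f' x, continuous f',
     forall x, f' x <= Cb k * (a `^ (eta - 1) * F),
     (\int[mu]_z (f' z)%:E <= (M * F)%:E)%E &
     forall a' x, 0 < a' -> (\int[mu]_z (kc eta a' (x - z) * f' z)%:E <= (B * M)%:E)%E].
Proof.
move=> a0 f0 fC fb F0 fF B0 fB f'.
have kv0 y : 0 <= kconv a f y by exact: kconv_ge0.
have kvC := kconv_continuous f0 fC F0 fF a0.
have kvE y := kconvE f0 fC fF y a0.
have f'0 x : 0 <= f' x by rewrite mulr_ge0.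
have f'C : continuous f' by move=> y; apply: cvgM; [exact: bC|exact: kvC].
have m3 : measurable_fun [set: measurableTypeR R * measurableTypeR R]
    (fun p => (kc eta a (p.1 - p.2) * f p.2 * b k p.1)%:E).
  rewrite (_ : (fun p => _) = (fun p => (kc eta a (p.1 - p.2) * f p.2)%:E * (b k p.1)%:E)%E)//.
  apply: emeasurable_funM; first exact: (mcont2 (ckc a0) fC).
  exact: (measurableT_comp (mcont (@bC k)) measurable_fst).
have m30 (p : R * R) : (0 <= (kc eta a (p.1 - p.2) * f p.2 * b k p.1)%:E)%E.
  by rewrite lee_fin !mulr_ge0// kc_ge0.
split => //.
- by move=> x; apply: ler_pM => //; exact: kconv_le.
- apply: (@le_trans _ _ (\int[mu]_y \int[mu]_z (kc eta a (y - z) * f z * b k y)%:E)%E).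
    apply: ge0_le_integral; first exact: measurableT.
    + by move=> y _; rewrite lee_fin.
    + exact: mcont.
    + exact: (measurable_fun_fubini_tonelli_F (m2 := mu) _ m3 m30).
    + move=> y _; under eq_integral do rewrite mulrC EFinM.
      rewrite ge0_integralZl_EFin//.
      * by rewrite kvE.
      * by move=> z _; rewrite lee_fin mulr_ge0// kc_ge0.
      * by apply: mcont => z; apply: cvgM; [exact: (@csub' _ y (ckc a0))|exact: fC].
  have E : (\int[mu]_y \int[mu]_z (kc eta a (y - z) * f z * b k y)%:E =
      \int[mu]_z \int[mu]_y (kc eta a (y - z) * f z * b k y)%:E)%E.
    exact: (fubini_tonelli (m1 := mu) (m2 := mu) _ m3 m30).
  rewrite {}E.
  apply: (@le_trans _ _ (\int[mu]_z (M%:E * (f z)%:E))%E).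
    apply: ge0_le_integral => //.
    + by move=> z _; apply: integral_ge0 => y _; rewrite lee_fin !mulr_ge0// kc_ge0.
    + exact: (measurable_fun_fubini_tonelli_G (m1 := mu) _ m3 m30).
    + by apply: measurable_funeM; exact: mcont.
    + move=> z _ /=.
      apply: (@le_trans _ _ ((f z)%:E * \int[mu]_y (kc eta a (z - y) * b k y)%:E)%E).
        rewrite -ge0_integralZl_EFin//; last 2 first.
        * by move=> y _; rewrite lee_fin mulr_ge0// kc_ge0.
        * by apply: mcont => y; apply: cvgM; [exact: (@csub' _ z (ckc a0))|exact: bC].
        rewrite le_eqVlt; apply/orP; left; apply/eqP; apply: eq_integral => y _.
        by rewrite -EFinM -(kcN eta a (z - y)) opprB; congr EFin; ring.
      by rewrite muleC lee_wpmul2r ?lee_fin//; exact: bM.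
  rewrite ge0_integralZl_EFin//; last 2 first.
  - by move=> z _; rewrite lee_fin.
  - exact: mcont.
  by rewrite EFinM lee_wpmul2l.
- move=> a' x a'0.
  apply: (@le_trans _ _ (\int[mu]_z (B%:E * (kc eta a' (x - z) * b k z)%:E))%E).
    have mkb : measurable_fun [set: measurableTypeR R] (fun z => (kc eta a' (x - z) * b k z)%:E).
      by apply: mcont => y; apply: cvgM; [exact: (@csub' _ x (ckc a'0))|exact: bC].
    apply: ge0_le_integral => //.
    + by move=> z _; rewrite lee_fin mulr_ge0// kc_ge0.
    + by apply: mcont => y; apply: cvgM; [exact: (@csub' _ x (ckc a'0))|exact: f'C].
    + exact: measurable_funeM.
    + move=> z _; rewrite -EFinM lee_fin /f' mulrA mulrC ler_wpM2r// ?mulr_ge0 ?kc_ge0//.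
      by rewrite -lee_fin -kvE fB.
  rewrite ge0_integralZl_EFin//; last 2 first.
  - by move=> z _; rewrite lee_fin mulr_ge0// kc_ge0.
  - by apply: mcont => y; apply: cvgM; [exact: (@csub' _ x (ckc a'0))|exact: bC].
  by rewrite EFinM; apply: lee_wpmul2l; [rewrite lee_fin|exact: bM].
Qed.

(* Each step replaces [f] by [b k] times the convolution of [f] with the
   truncated kernel, and gains the factor [c0 * M <= 2^-1]. *)
Lemma occ_iter (j : nat) : forall (f : R -> R) (Cf F B : R),
  (forall x, 0 <= f x) -> continuous f -> (forall x, f x <= Cf) -> 0 <= F ->
  (\int[mu]_z (f z)%:E <= F%:E)%E -> 0 <= B ->
  (forall a x, 0 < a -> (\int[mu]_z (kc eta a (x - z) * f z)%:E <= B%:E)%E) ->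
  (occ (EFin \o f) <= (2 * u * F + 2^-1 ^+ j * (c0 * m0 * B))%:E)%E.
Proof.
(* In the base case the convolution is at most [B] pointwise, so [H2] bounds the term to be absorbed
   by [B * m0]. *)
elim: j => [|j IH] f Cf F B f0 fC fb F0 fF B0 fB.
  apply: (le_trans (occ_step f0 fC fb F0 fF (mulr_ge0 B0 m00) _)).
    move=> a k a0.
    apply: (@le_trans _ _ (occ (fun y => B%:E * (b k y)%:E))%E).
      have [h1 h2 _ _ _] := @kernel_product_bounds a k f Cf F B a0 f0 fC fb F0 fF B0 fB.
      apply: le_occ => //.
      + exact: mcont.
      + by apply: measurable_funeM; exact: mcont.
      + move=> y; rewrite -EFinM lee_fin mulrC ler_wpM2r//.
        by rewrite -lee_fin -(kconvE f0 fC fF y a0) fB.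
    rewrite occZ//; last 2 first.
    - exact: mcont.
    - by move=> x; rewrite lee_fin.
    by rewrite EFinM lee_wpmul2l.
  rewrite lee_fin expr0 mul1r; have := mulr_ge0 u0 F0; have := m00; lra.
pose C := 2 * u * (M * F) + 2^-1 ^+ j * (c0 * m0 * (B * M)).
have C0 : 0 <= C by rewrite /C addr_ge0// !mulr_ge0// exprn_ge0.
apply: (le_trans (occ_step f0 fC fb F0 fF C0 _)).
  move=> a k a0.
  have [h1 h2 h3 h4 h5] := @kernel_product_bounds a k f Cf F B a0 f0 fC fb F0 fF B0 fB.
  by apply: (IH _ _ _ _ h1 h2 h3 _ h4 _ h5); rewrite mulr_ge0.
rewrite lee_fin /C exprS.
have -> : u * F + c0 * (2 * u * (M * F) + 2^-1 ^+ j * (c0 * m0 * (B * M))) =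
   u * F + (c0 * M) * (2 * (u * F) + 2^-1 ^+ j * (c0 * m0 * B)) by ring.
have X0 : 0 <= 2 * (u * F) + 2^-1 ^+ j * (c0 * m0 * B).
  by rewrite addr_ge0 ?mulr_ge0// exprn_ge0.
have := ler_wpM2r X0 c0M; lra.
Qed.

(** The iteration is started from the kernel times [b k], whose mass is at most [M]. Its potential
    bound [a ^ (eta - 1) * M] depends on [a], but together with [m0] it is multiplied by
    [2 ^ (- j)], so both disappear as [j] grows. *)
Lemma occ_kernel_bound a k z : 0 < a ->
  (occ (fun x => (kc eta a (x - z) * b k x)%:E) <= (2 * u * M)%:E)%E.
Proof.
move=> a0.
have ap := powR_ge0 a (eta - 1).
have f0 x : 0 <= kc eta a (x - z) * b k x by rewrite mulr_ge0// kc_ge0.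
have fC : continuous (fun x => kc eta a (x - z) * b k x).
  by move=> x; apply: cvgM; [exact: (@csub _ z (ckc a0))|exact: bC].
have fb x : kc eta a (x - z) * b k x <= a `^ (eta - 1) * Cb k.
  by apply: ler_pM => //; [exact: kc_ge0|exact: kc_le].
have fM : (\int[mu]_x (kc eta a (x - z) * b k x)%:E <= M%:E)%E.
  under eq_integral.
    move=> x _; rewrite -(kcN eta a (x - z)) opprB; over.
  exact: bM.
have fB a' x : 0 < a' ->
    (\int[mu]_y (kc eta a' (x - y) * (kc eta a (y - z) * b k y))%:E <= (a `^ (eta - 1) * M)%:E)%E.
  move=> a'0.
  apply: (@le_trans _ _ (\int[mu]_y ((a `^ (eta - 1))%:E * (kc eta a' (x - y) * b k y)%:E))%E).
    have mkb : measurable_fun [set: measurableTypeR R] (fun z => (kc eta a' (x - z) * b k z)%:E).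
      by apply: mcont => y; apply: cvgM; [exact: (@csub' _ x (ckc a'0))|exact: bC].
    apply: ge0_le_integral => //.
    + by move=> y _; rewrite lee_fin !mulr_ge0// kc_ge0.
    + by apply: mcont => y; apply: cvgM; [exact: (@csub' _ x (ckc a'0))|exact: fC].
    + exact: measurable_funeM.
    + move=> y _; rewrite -EFinM lee_fin mulrCA ler_wpM2r// ?mulr_ge0 ?kc_ge0//.
      exact: kc_le.
  rewrite ge0_integralZl_EFin//; last 2 first.
  - by move=> y _; rewrite lee_fin mulr_ge0// kc_ge0.
  - by apply: mcont => y; apply: cvgM; [exact: (@csub' _ x (ckc a'0))|exact: bC].
  by rewrite EFinM; apply: lee_wpmul2l; [rewrite lee_fin|exact: bM].
apply/lee_addgt0Pr => eps eps0.
set K := c0 * m0 * (a `^ (eta - 1) * M).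
have K0 : 0 <= K by rewrite !mulr_ge0.
(* Since [2 ^ j > j], any [j >= K / eps] is large enough. *)
have [j hj] : exists j : nat, 2^-1 ^+ j * K <= eps.
  exists (Num.bound (K / eps)).
  have h : K / eps < (Num.bound (K / eps))%:R by rewrite archi_boundP// divr_ge0// ltW.
  rewrite exprVn ler_pdivrMl ?exprn_gt0// -ler_pdivrMr//.
  apply: (le_trans (ltW h)); rewrite -natrX ler_nat.
  exact/ltnW/ltn_expl.
have aM0 : 0 <= a `^ (eta - 1) * M by rewrite mulr_ge0.
apply: (le_trans (occ_iter j f0 fC fb M0 fM aM0 fB)).
by rewrite -EFinD lee_fin lerD2l.
Qed.

End density_bound.

(** * A chain rule for primitives of bounded measurable functions *)

Section quadratic_increments.
Context {R : realType}.
Notation mu := (@lebesgue_measure R).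
Implicit Types (a b c s t x y : R).

(** Over [n + 1] equal subintervals the increments sum to at most [K * (t - s) ^ 2 / (n + 1)]. *)
Lemma quadratic_increments_eq (f : R -> R) s t K : s <= t ->
  (forall x y, s <= x -> x <= y -> y <= t -> `|f y - f x| <= K * (y - x) ^+ 2) ->
  f t = f s.
Proof.
move=> st h.
have K0 : 0 <= K * (t - s) ^+ 2 by apply: le_trans (h s t _ _ _).
apply/eqP; rewrite -subr_eq0 -normr_le0; apply/ler_addgt0Pr => e e0; rewrite add0r.
pose n := (Num.bound (K * (t - s) ^+ 2 / e)).
have nn : K * (t - s) ^+ 2 / e < n.+1%:R.
  apply: (@lt_trans _ _ n%:R); last by rewrite ltr_nat.
  by rewrite archi_boundP// divr_ge0// ltW.
pose p i : R := s + i%:R * ((t - s) / n.+1%:R).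
have n0 : (0 : R) < n.+1%:R by rewrite ltr0n.
have d0 : 0 <= (t - s) / n.+1%:R by rewrite divr_ge0 ?subr_ge0.
have pS i : p i.+1 = p i + (t - s) / n.+1%:R by rewrite /p -natr1; ring.
have pn : p n.+1 = t by rewrite /p; field; rewrite gt_eqF.
have ps i : s <= p i by rewrite /p lerDl mulr_ge0.
have pt i : (i <= n.+1)%N -> p i <= t.
  by move=> im; rewrite -pn /p lerD2l ler_wpM2r// ler_nat.
have H i : (i <= n.+1)%N -> `|f (p i) - f s| <= i%:R * (K * ((t - s) / n.+1%:R) ^+ 2).
  elim: i => [|i IH] im; first by rewrite {1}/p !mul0r addr0 subrr normr0.
  rewrite (_ : f _ - _ = (f (p i.+1) - f (p i)) + (f (p i) - f s)); last ring.
  apply: (le_trans (ler_normD _ _)); rewrite -natr1 mulrDl mul1r addrC lerD ?IH 1?ltnW//.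
  apply: (le_trans (h _ _ (ps i) _ (pt _ im))); first by rewrite pS lerDl.
  by rewrite pS addrAC subrr add0r.
have := H _ (leqnn _); rewrite pn => /le_trans; apply.
rewrite (_ : _ * _ = K * (t - s) ^+ 2 / n.+1%:R); last by field; rewrite gt_eqF.
by rewrite ler_pdivrMr// [leRHS]mulrC -ler_pdivrMr// ltW.
Qed.

Let fin a b : (mu `[a, b] < +oo)%E.
Proof. by rewrite /= lebesgue_measure_itv/= lte_fin; case: ifP => // _; rewrite -EFinB ltry. Qed.

Let len a b : a <= b -> fine (mu `[a, b]) = b - a.
Proof.
move=> ab; rewrite /= lebesgue_measure_itv/= lte_fin; case: ltgtP ab => //= -> _.
by rewrite subrr.
Qed.

Lemma integrable_itv (f : R -> R) a b C : measurable_fun [set: R] f ->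
  (forall x, a <= x <= b -> `|f x| <= C) -> mu.-integrable `[a, b] (EFin \o f).
Proof.
move=> mf fC; apply: (@bounded_integrable _ _ _ mu _ f C) => //; first exact: fin.
  exact: measurable_funTS.
Qed.

Lemma Rintegral_itv_le (f : R -> R) a b C : a <= b -> measurable_fun [set: R] f ->
  (forall x, a <= x <= b -> `|f x| <= C) ->
  `|\int[mu]_(x in `[a, b]) f x| <= C * (b - a).
Proof.
move=> ab mf fC; rewrite -len//.
apply: (@Rintegral_le_bound _ _ _ mu _ f C) => //; first exact: fin.
  exact: measurable_funTS.
Qed.

Lemma Rintegral_itvD (f : R -> R) a b e : a <= b -> b <= e ->
  mu.-integrable `[a, e] (EFin \o f) ->
  \int[mu]_(x in `[a, e]) f x - \int[mu]_(x in `[a, b]) f x = \int[mu]_(x in `[b, e]) f x.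
Proof.
move=> ab be fi; rewrite Rintegral_itvB ?bnd_simp//.
apply: Rintegral_itv_obnd_cbnd.
by apply: integrableS fi => //; apply: subset_itvr; rewrite bnd_simp.
Qed.

Lemma lipschitz_cont (f : R -> R) K : (forall x y, x <= y -> `|f y - f x| <= K * (y - x)) ->
  continuous f.
Proof.
move=> fK x; apply/cvgrPdist_lt => e e0.
have K1 : 0 < Num.max K 1 by rewrite lt_max ltr01 orbT.
have fK' y : `|f x - f y| <= Num.max K 1 * `|x - y|.
  have [xy|/ltW yx] := leP x y.
    rewrite distrC; apply: (le_trans (fK _ _ xy)); rewrite distrC.
    by rewrite (ger0_norm (_ : 0 <= y - x)) ?subr_ge0// ler_wpM2r ?subr_ge0// le_max lexx.
  apply: (le_trans (fK _ _ yx)).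
  by rewrite ger0_norm ?subr_ge0// ler_wpM2r ?subr_ge0// le_max lexx.
near=> y; apply: (le_lt_trans (fK' y)); rewrite mulrC -ltr_pdivlMr//.
near: y; apply: (@cvgr_dist_lt _ _ _ _ _ id); [exact: cvg_id|exact: divr_gt0].
Unshelve. all: by end_near.
Qed.

Section primitive.
Variables (beta : R -> R) (s Cb : R).
Hypothesis mbeta : measurable_fun [set: R] beta.
Hypothesis betaC : forall x, `|beta x| <= Cb.

Let C0 : 0 <= Cb. Proof. exact: le_trans (betaC 0). Qed.

Lemma primitiveB x y : s <= x -> x <= y ->
  \int[mu]_(r in `[s, y]) beta r - \int[mu]_(r in `[s, x]) beta r = \int[mu]_(r in `[x, y]) beta r.
Proof. by move=> sx xy; apply: Rintegral_itvD => //; apply: (@integrable_itv _ _ _ Cb). Qed.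

Lemma primitive_lipschitz x y : x <= y ->
  `|\int[mu]_(r in `[s, y]) beta r - \int[mu]_(r in `[s, x]) beta r| <= Cb * (y - x).
Proof.
move=> xy.
have z v : v < s -> \int[mu]_(r in `[s, v]) beta r = 0.
  by move=> vs; rewrite set_itv_ge ?Rintegral_set0// bnd_simp -ltNge.
have [sx|xs] := leP s x.
  by rewrite primitiveB//; apply: Rintegral_itv_le.
rewrite (z x xs) subr0; have [sy|ys] := leP s y.
  apply: (@le_trans _ _ (Cb * (y - s))); first exact: Rintegral_itv_le.
  by rewrite ler_wpM2l// lerB// ltW.
by rewrite z// normr0 mulr_ge0// subr_ge0.
Qed.

Lemma primitive_continuous : continuous (fun t => \int[mu]_(r in `[s, t]) beta r).
Proof. exact: lipschitz_cont primitive_lipschitz. Qed.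

(* The primitive of [beta] need not be differentiable: the difference of the
   two sides has quadratically small increments, hence is constant. *)
Lemma chain_rule (G dG : R -> R) (c K t : R) :
  (forall x, is_derive x (1 : R) G (dG x)) ->
  (forall x y, `|dG x - dG y| <= K * `|x - y|) -> s <= t ->
  G (c + \int[mu]_(r in `[s, t]) beta r) - G c =
  \int[mu]_(r in `[s, t]) (dG (c + \int[mu]_(v in `[s, r]) beta v) * beta r).
Proof.
move=> GE dGK st.
have K0 : 0 <= K by have := le_trans (normr_ge0 _) (dGK 1 0); rewrite subr0 normr1 mulr1.
pose B (t : R) := \int[mu]_(r in `[s, t]) beta r.
have Bs : B s = 0.
  by have := primitiveB (lexx s) (lexx s); rewrite subrr /B set_itv1 Rintegral_set1.
have cB : continuous B by exact: primitive_continuous.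
have cdG : continuous dG.
  apply: (@lipschitz_cont _ K) => x y xy; apply: (le_trans (dGK _ _)).
  by rewrite ger0_norm ?subr_ge0.
pose q r := dG (c + B r) * beta r.
have mq : measurable_fun [set: R] q.
  apply: measurable_funM => //; apply: continuous_measurable_fun => x.
  apply: (@continuous_comp _ _ _ (fun r => c + B r) dG); last exact: cdG.
  by apply: cvgD; [exact: cvg_cst|exact: cB].
have qC x : s <= x <= t -> `|q x| <= (`|dG c| + K * (Cb * (t - s))) * Cb.
  move=> /andP[sx xt]; rewrite normrM; apply: ler_pM => //.
  have := dGK (c + B x) c; rewrite addrAC subrr add0r => h1.
  have : `|B x| <= Cb * (t - s).
    rewrite -[B x]subr0 -Bs; apply: (le_trans (primitive_lipschitz sx)).
    by rewrite ler_wpM2l// lerB.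
  have := ler_normD (dG c) (dG (c + B x) - dG c); rewrite addrC subrK.
  move=> h2 h3; apply: (le_trans h2); rewrite lerD2l; apply: (le_trans h1).
  exact: ler_wpM2l.
have iq : mu.-integrable `[s, t] (EFin \o q) by exact: integrable_itv mq qC.
pose f r := G (c + B r) - \int[mu]_(v in `[s, r]) q v.
suff : f t = f s.
  rewrite /f Bs addr0 set_itv1 Rintegral_set1 subr0 => h.
  by rewrite -h /B opprB addrC subrK.
have MVT x y : `|G y - G x - dG x * (y - x)| <= K * (y - x) ^+ 2.
  have [e [h1 h2]] : exists e, `|e - x| <= `|y - x| /\ G y - G x = dG e * (y - x).
    have GC : continuous G by move=> z; exact: (is_derive_cvg (GE z)).
    have [xy|/ltW yx] := leP x y.
      have [e] := @MVT_segment R G dG x y xy (fun z _ => GE z) (continuous_subspaceT GC).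
      rewrite in_itv/= => /andP[e1 e2] ->; exists e; split => //.
      by rewrite !ger0_norm ?subr_ge0// lerB.
    have [e] := @MVT_segment R G dG y x yx (fun z _ => GE z) (continuous_subspaceT GC).
    rewrite in_itv/= => /andP[e1 e2] h; exists e; split => //.
      by rewrite distrC (distrC y) !ger0_norm ?subr_ge0// lerB.
    by rewrite -opprB h; ring.
  rewrite h2 -mulrBl normrM -real_normK ?num_real// expr2 mulrA ler_wpM2r//.
  by apply: (le_trans (dGK _ _)); rewrite ler_wpM2l.
(* The first part of the constant is the Taylor remainder of [G] over an increment of size at most
   [Cb * (y - x)]; the second is the variation of [dG] inside the integral over [[x, y]]. *)
apply: (@quadratic_increments_eq _ _ _ (K * Cb ^+ 2 + K * Cb * Cb) st) => x y sx xy yt.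
have iqy : mu.-integrable `[s, y] (EFin \o q).
  by apply: integrableS iq => //; apply: subset_itvl; rewrite bnd_simp.
have iqx : mu.-integrable `[x, y] (EFin \o q).
  by apply: integrableS iqy => //; apply: subset_itvr; rewrite bnd_simp.
have -> : f y - f x = (G (c + B y) - G (c + B x) - dG (c + B x) * (B y - B x)) -
    (\int[mu]_(r in `[x, y]) q r - dG (c + B x) * (B y - B x)).
  by rewrite -(Rintegral_itvD sx xy iqy) /f; ring.
apply: (le_trans (ler_normB _ _)); rewrite mulrDl lerD//.
  have := MVT (c + B x) (c + B y); rewrite opprD addrACA subrr add0r => /le_trans; apply.
  rewrite -mulrA ler_wpM2l// -exprMn -real_normK ?num_real// ler_sqr ?nnegrE ?mulr_ge0 ?subr_ge0//.
  exact: primitive_lipschitz.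
have ib : mu.-integrable `[x, y] (EFin \o beta).
  exact: integrable_itv mbeta (fun x _ => betaC x).
have mb : measurable_fun [set: R] (fun r => dG (c + B x) * beta r) by exact: measurable_funM.
have ib' : mu.-integrable `[x, y] (EFin \o (fun r => dG (c + B x) * beta r)).
  apply: (integrable_itv mb (C := `|dG (c + B x)| * Cb)) => r _.
  by rewrite normrM ler_wpM2l.
have mxy : measurable (`[x, y]%classic : set (measurableTypeR R)) by exact: measurable_itv.
have E : \int[mu]_(r in `[x, y]) q r - dG (c + B x) * (B y - B x) =
    \int[mu]_(r in `[x, y]) (q r - dG (c + B x) * beta r).
  have EB : B y - B x = \int[mu]_(r in `[x, y]) beta r by exact: primitiveB.
  rewrite {}EB.
  transitivity (\int[mu]_(r in `[x, y]) q r - \int[mu]_(r in `[x, y]) (dG (c + B x) * beta r)).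
    by congr (_ - _); apply/esym; apply: (RintegralZl _ mxy ib).
  by apply/esym; apply: (RintegralB mxy iqx ib').
rewrite {}E.
rewrite expr2 !mulrA; apply: Rintegral_itv_le => //.
  by apply: measurable_funB => //; apply: measurable_funM.
move=> r /andP[xr ry]; rewrite -mulrBl normrM -(mulrA (K * Cb)) (mulrC Cb) mulrA.
apply: ler_pM => //; apply: (le_trans (dGK _ _)); rewrite -mulrA ler_wpM2l//.
rewrite opprD addrACA subrr add0r; apply: (le_trans (primitive_lipschitz xr)).
by rewrite ler_wpM2l// lerB.
Qed.

End primitive.
End quadratic_increments.

(** * Joint measurability of processes and of parametric integrals *)

Section joint_measurability.
Context {R : realType} d (T : measurableType d).

(** The process is sampled at the next point of the mesh [1 / (n + 1)], chosen strictly to the right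
    of [v], so that right continuity gives the pointwise limit. *)
Lemma right_continuous_measurable (Y : R -> T -> R) :
  (forall v, measurable_fun [set: T] (Y v)) ->
  (forall w v, Y s w @[s --> v^'+] --> Y v w) ->
  measurable_fun [set: measurableTypeR R * T] (fun p => Y p.1 p.2 : measurableTypeR R).
Proof.
move=> mY rc.
pose q (n : nat) (v : R) : R := (Num.floor (v * n.+1%:R) + 1)%:~R / n.+1%:R.
have n0 n : (0 : R) < n.+1%:R by rewrite ltr0n.
have qgt n v : v < q n v.
  by rewrite /q ltr_pdivlMr//; exact: floorD1_gt.
have qle n v : q n v <= v + n.+1%:R^-1.
  rewrite /q ler_pdivrMr// mulrDl mulVf ?gt_eqF// intrD lerD2r.
  exact: floor_le_tmp.
apply: (@measurable_fun_cvg _ _ _ _ (fun n (p : measurableTypeR R * T) => Y (q n p.1) p.2)).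
- move=> n _ B mB; rewrite setTI.
  rewrite (_ : _ @^-1` B = \bigcup_(i : int) ([set v : measurableTypeR R | Num.floor (v * n.+1%:R) = i]
     `*` (Y ((i + 1)%:~R / n.+1%:R) @^-1` B))); last first.
    apply/seteqP; split => [[v w] /= h|[v w] /= [i _] [/= <-]//].
    by exists (Num.floor (v * n.+1%:R)).
  apply: countable_bigcupT_measurable; first exact: countableP.
  move=> i; apply: measurableX; last by rewrite -[X in measurable X]setTI; exact: mY.
  rewrite (_ : [set _ | _] = [set` `[(i%:~R / n.+1%:R : R), (i + 1)%:~R / n.+1%:R[]).
    exact: measurable_itv.
  apply/seteqP; split => v /=; rewrite in_itv/= ler_pdivrMr// ltr_pdivlMr//.
    by move=> <-; rewrite floor_le_tmp floorD1_gt.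
  by move=> /andP[h1 h2]; apply: floor_def; rewrite h1.
- move=> [v w] _ /=.
  apply: (cvg_comp (q ^~ v) (fun s => Y s w) _ (rc w v)).
  move=> S [e /= e0 eS].
  near=> n; apply: eS => /=; last exact: qgt.
  rewrite distrC ger0_norm ?subr_ge0; last exact/ltW/qgt.
  apply: (@le_lt_trans _ _ n.+1%:R^-1); first by rewrite lerBlDl.
  near: n; exact: near_infty_natSinv_lt (PosNum e0).
Unshelve. all: by end_near.
Qed.

(** Positive and negative parts are treated by Tonelli, so measurability holds without
    integrability; [fine] gives [0] wherever the difference is infinite. *)
Lemma measurable_Rintegral_param d' (T' : measurableType d') (m : {sigma_finite_measure set T' -> \bar R})
  (D : set T') (f : T' -> T -> R) : measurable D ->
  measurable_fun [set: T' * T] (fun p => f p.1 p.2) ->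
  measurable_fun [set: T] (fun w => \int[m]_(r in D) f r w).
Proof.
move=> mD mf.
pose g (p : T' * T) : \bar R := ((f p.1 p.2)%:E * (\1_D p.1)%:E)%E.
have mg : measurable_fun setT g.
  apply: emeasurable_funM; first exact/measurable_EFinP.
  apply/measurable_EFinP.
  exact: (measurableT_comp (measurable_indic mD) measurable_fst).
have E w : \int[m]_(r in D) f r w = fine (\int[m]_r g (r, w))%E.
  rewrite /Rintegral integral_mkcond; congr fine; apply: eq_integral => r _.
  by rewrite /g /= epatch_indic.
under eq_fun do rewrite E integralE.
apply: measurableT_comp => //; apply: emeasurable_funB.
  rewrite (_ : (fun w => _) = fubini_G m (g^\+)%E); last first.
    by apply/funext => w; apply: eq_integral => r _; rewrite !funeposE.
  by apply: measurable_fun_fubini_tonelli_G; [exact: measurable_funepos|exact: funepos_ge0].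
rewrite (_ : (fun w => _) = fubini_G m (g^\-)%E); last first.
  by apply/funext => w; apply: eq_integral => r _; rewrite !funenegE.
by apply: measurable_fun_fubini_tonelli_G; [exact: measurable_funeneg|exact: funeneg_ge0].
Qed.

End joint_measurability.

(** * Expectations under independence *)

Section independence.
Context {R : realType} d (T : measurableType d) (P : probability T R).
Context d' (V : measurableType d').
Variables (W : T -> V) (Y : {mfun T >-> measurableTypeR R}).
Hypothesis mW : measurable_fun [set: T] W.
Hypothesis WY : forall C B, measurable C -> measurable B ->
  P (W @^-1` C `&` Y @^-1` B) = (P (W @^-1` C) * P (Y @^-1` B))%E.

(** Independence identifies the joint law with the product of the laws by uniqueness on rectangles;
    Tonelli does the rest. *)
Lemma ge0_expectation_independent (h : V * measurableTypeR R -> \bar R) :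
  measurable_fun setT h -> (forall p, 0 <= h p)%E ->
  (\int[P]_w h (W w, Y w) = \int[P]_w \int[distribution P Y]_y h (W w, y))%E.
Proof.
move=> mh h0.
have mWY : measurable_fun [set: T] (fun w => (W w, Y w) : V * measurableTypeR R).
  exact: measurable_fun_pair.
have mmW : W \in (mfun : {pred T -> V}) by rewrite inE.
have mmWY : (fun w => (W w, Y w) : V * measurableTypeR R) \in
   (mfun : {pred T -> V * measurableTypeR R}) by rewrite inE.
pose W' : {mfun T >-> V} := mfun_Sub mmW.
pose WY' : {mfun T >-> (V * measurableTypeR R)%type} := mfun_Sub mmWY.
transitivity (\int[distribution P WY']_p h p)%E.
  by rewrite ge0_integral_distribution.
transitivity (\int[(distribution P W' \x distribution P Y)%E]_p h p)%E.
  apply/esym/eq_measure_integral => A mA _.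
  apply: product_measure_unique => //.
rewrite fubini_tonelli1//= ge0_integral_distribution//.
- exact: (measurable_fun_fubini_tonelli_F (m2 := distribution P Y) h mh h0).
- by move=> v; exact: integral_ge0.
Qed.

(** Adding the constant [C] makes [h] nonnegative; it is subtracted again on both sides. *)
Lemma expectation_independent (h : V -> R -> R) (C : R) :
  measurable_fun [set: V * measurableTypeR R] (fun p => h p.1 p.2) ->
  (forall v y, `|h v y| <= C) ->
  \int[P]_w h (W w) (Y w) = \int[P]_w \int[distribution P Y]_y h (W w) y.
Proof.
move=> mh hC.
have hC0 v y : 0 <= h v y + C by have := hC v y; rewrite ler_norml => /andP[]; lra.
have fin (Q : probability (measurableTypeR R) R) : (Q setT < +oo)%E.
  by rewrite (le_lt_trans (probability_le1 _ _))// ltry.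
have finP : (P setT < +oo)%E by rewrite (le_lt_trans (probability_le1 _ _))// ltry.
have mWY : measurable_fun [set: T] (fun w => (W w, Y w) : V * measurableTypeR R).
  exact: measurable_fun_pair.
have iW : P.-integrable setT (EFin \o (fun w => h (W w) (Y w))).
  apply: (@bounded_integrable _ _ _ P _ _ C) => //.
  exact: (measurableT_comp mh mWY).
have iy w : (distribution P Y).-integrable setT (EFin \o h (W w)).
  apply: (@bounded_integrable _ _ _ _ _ _ C) => //.
  exact: (measurableT_comp mh (measurable_pair1 (W w))).
have mhC : measurable_fun [set: V * measurableTypeR R] (fun p => (h p.1 p.2 + C)%:E).
  by apply/measurable_EFinP; apply: measurable_funD.
have H := ge0_expectation_independent mhC (fun p => hC0 p.1 p.2).
pose J w := \int[distribution P Y]_y h (W w) y.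
have EJ w : (\int[distribution P Y]_y (h (W w) y + C)%:E = (J w + C)%:E)%E.
  rewrite integralD_EFin//; last exact: finite_measure_integrable_cst.
  rewrite integral_cst//= probability_setT mule1 EFinD; congr (_ + _)%E.
  by rewrite /J /Rintegral fineK//; exact: (integrable_fin_num measurableT (iy w)).
have mJ : measurable_fun setT (EFin \o (fun w => J w + C)).
  rewrite (_ : _ \o _ = fun w => \int[distribution P Y]_y (h (W w) y + C)%:E)%E; last first.
    by apply/funext => w; rewrite EJ.
  apply: (@measurableT_comp _ _ _ _ _ _ (fun v => \int[distribution P Y]_y (h v y + C)%:E)%E _ W) => //.
  exact: (measurable_fun_fubini_tonelli_F (m2 := distribution P Y) _ mhC (fun p => hC0 p.1 p.2)).
have JC w : `|J w| <= C.
  rewrite -[leRHS]mulr1 -(_ : fine (distribution P Y setT) = 1); last by rewrite probability_setT.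
  apply: (@Rintegral_le_bound _ _ _ (distribution P Y)) => //.
  exact: (measurableT_comp mh (measurable_pair1 (W w))).
have iJ : P.-integrable setT (EFin \o J).
  apply: (@bounded_integrable _ _ _ P _ _ C) => //.
  move/measurable_EFinP: mJ => mJ.
  rewrite (_ : J = fun w => (J w + C) - C); last by apply/funext => w; rewrite addrK.
  exact: measurable_funB.
have iC : P.-integrable setT (EFin \o (cst C : T -> R)) by exact: finite_measure_integrable_cst.
have : \int[P]_w (h (W w) (Y w) + C) = \int[P]_w (J w + C).
  by rewrite /Rintegral H; congr fine; apply: eq_integral => w _; rewrite EJ.
rewrite (RintegralD measurableT iW iC) (RintegralD measurableT iJ iC).
exact: addIr.
Qed.

End independence.

Section law_of_increments.
Context {R : realType} d (T : measurableType d) (P : probability T R).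
Variable GG : set (set T).
Hypothesis sG : sigma_algebra setT GG.
Hypothesis Gm : GG `<=` measurable.

Lemma sub_sigma_measurable d' (V : measurableType d') (f : T -> V) :
  measurable_fun [set: g_sigma_algebraType GG] f <->
  (forall B, measurable B -> GG (f @^-1` B)).
Proof.
split => [mf B mB|h _ B mB].
  have := mf measurableT B mB; rewrite setTI /measurable/= /g_sigma_algebraType.
  by rewrite (sigma_algebra_id sG).
by rewrite setTI; apply: sub_sigma_algebra; exact: h.
Qed.

Lemma sub_sigma_measurable_fun d' (V : measurableType d') (f : T -> V) :
  measurable_fun [set: g_sigma_algebraType GG] f -> measurable_fun [set: T] f.
Proof.
move=> /sub_sigma_measurable h _ B mB; rewrite setTI; exact/Gm/h.
Qed.

Variable Y : {mfun T >-> measurableTypeR R}.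
Hypothesis ind : forall E B, GG E -> measurable B ->
  P (E `&` Y @^-1` B) = (P E * P (Y @^-1` B))%E.
Variables (al eta kap s : R).
Hypothesis s01 : 0 < s <= 1.
Hypothesis lawY : stable_law al (distribution P Y) s.
Variables (xi Z : T -> R) (c : R).
Hypothesis mxi : measurable_fun [set: g_sigma_algebraType GG] xi.
Hypothesis mZ : measurable_fun [set: g_sigma_algebraType GG] (Z : T -> measurableTypeR R).
Hypothesis xic : forall w, `|xi w| <= c.

Let finP : (P setT < +oo)%E.
Proof. by rewrite (le_lt_trans (probability_le1 _ _))// ltry. Qed.

Let cb (f : R -> R) : continuous f -> measurable_fun [set: measurableTypeR R] (f : measurableTypeR R -> measurableTypeR R).
Proof. exact: continuous_measurable_fun. Qed.

Lemma expectation_independent_sum (G : R -> R) (C0 : R) : continuous G ->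
  (forall x, `|G x| <= C0) ->
  \int[P]_w (xi w * G (Z w + Y w)) =
  \int[P]_w (xi w * \int[distribution P Y]_y G (Z w + y)) /\
  P.-integrable setT (EFin \o (fun w => xi w * \int[distribution P Y]_y G (Z w + y))).
Proof.
move=> cG GC.
have c0 : 0 <= c by apply: le_trans (xic point).
have C00 : 0 <= C0 by apply: le_trans (GC 0).
pose W w : measurableTypeR R * measurableTypeR R := (xi w, Z w).
have mW : measurable_fun [set: g_sigma_algebraType GG] W by exact: measurable_fun_pair.
(* The lemma on independence asks for a function bounded on the whole product space, whereas [xi] is
   bounded only along its values; clipping at [c] changes nothing there. *)
pose clip (x : R) := Num.max (- c) (Num.min c x).
have clipE x : `|x| <= c -> clip x = x.
  by rewrite ler_norml => /andP[h1 h2]; rewrite /clip min_r// max_r.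
have clip_le x : `|clip x| <= c.
  rewrite /clip ler_norml; apply/andP; split; first by rewrite le_max lexx.
  by rewrite ge_max ge_min lexx andbT; lra.
pose h (v : measurableTypeR R * measurableTypeR R) (y : R) := clip v.1 * G (v.2 + y).
have mclip : measurable_fun [set: measurableTypeR R] clip.
  by apply: measurable_maxr => //; apply: measurable_minr.
have mh : measurable_fun [set: (measurableTypeR R * measurableTypeR R) * measurableTypeR R] (fun p => h p.1 p.2).
  apply: measurable_funM.
    apply: (measurableT_comp mclip).
    exact: (measurableT_comp measurable_fst measurable_fst).
  apply: (measurableT_comp (cb cG)); apply: measurable_funD; last exact: measurable_snd.
  exact: (measurableT_comp measurable_snd measurable_fst).
have hC v y : `|h v y| <= c * C0 by rewrite normrM ler_pM.
have iG z : (distribution P Y).-integrable setT (EFin \o (fun y => G (z + y))).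
  apply: (@bounded_integrable _ _ _ (distribution P Y) _ _ C0) => //.
  by apply: (measurableT_comp (cb cG)); apply: measurable_funD.
have E w : \int[distribution P Y]_y h (W w) y = xi w * \int[distribution P Y]_y G (Z w + y).
  by rewrite /h/= clipE// RintegralZl.
split.
  have mW' := sub_sigma_measurable_fun mW.
  have := @expectation_independent R d T P _ _ W Y mW' _ h (c * C0) mh hC.
  have HI : (forall C B, measurable C -> measurable B ->
     P (W @^-1` C `&` Y @^-1` B) = (P (W @^-1` C) * P (Y @^-1` B))%E).
    by move=> C B mC mB; apply: ind => //; move/sub_sigma_measurable : mW; exact.
  move=> /(_ HI) H.
  transitivity (\int[P]_w h (W w) (Y w)).
    by apply: eq_Rintegral => w _; rewrite /h/= clipE.
  by rewrite H; apply: eq_Rintegral => w _; rewrite E.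
apply: (@bounded_integrable _ _ _ P _ _ (c * C0)) => //.
  under eq_fun do rewrite -E.
  apply: (@measurableT_comp _ _ _ _ _ _ (fun v => \int[distribution P Y]_y h v y) _ W).
    apply: (measurable_Rintegral_param (distribution P Y) (f := fun y v => h v y)) => //.
    apply: (measurableT_comp mh (_ : measurable_fun setT (fun q : measurableTypeR R * (measurableTypeR R * measurableTypeR R) => (q.2, q.1)))).
    by apply/measurable_fun_pairP; split => /=; [exact: measurable_snd|exact: measurable_fst].
  exact: sub_sigma_measurable_fun.
move=> w _; rewrite normrM ler_pM//.
rewrite -[leRHS]mulr1 -(_ : fine (distribution P Y setT) = 1); last by rewrite probability_setT.
apply: (@Rintegral_le_bound _ _ _ (distribution P Y)) => //.
by apply: (measurableT_comp (cb cG)); apply: measurable_funD.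
Qed.

(** With [xi] and [Z] frozen, the mean over the independent increment is what [law_test] controls at
    the point [Z w]. For [dG], [le_kc] replaces the singular weight by the truncated kernel. *)
Lemma law_test_expectation (G dG : R -> R) (A a C0 C1 : R) : law_test al eta kap G dG A ->
  0 < eta < 1 -> 0 < a -> 0 <= A -> 0 <= kap ->
  continuous G -> continuous dG -> (forall x, `|G x| <= C0) -> (forall x, `|dG x| <= C1) ->
  C1 <= A * a `^ (eta - 1) ->
  `|\int[P]_w (xi w * G (Z w + Y w))| <= A * s `^ (- kap) * \int[P]_w `|xi w| /\
  `|\int[P]_w (xi w * dG (Z w + Y w))| <= A * s `^ (- kap) * \int[P]_w (`|xi w| * kc eta a (Z w)).
Proof.
move=> test e01 a0 A0 k0 cG cdG GC dGC CA.
have c0 : 0 <= c by apply: le_trans (xic point).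
have As : 0 <= A * s `^ (- kap) by rewrite mulr_ge0 ?powR_ge0.
(* Thanks to this, the uniform bound [C1] also stays below [A * s ^ (- kap) * a ^ (eta - 1)], as
   [le_kc] requires near the singularity. *)
have s1 : 1 <= s `^ (- kap).
  rewrite powRN -[leLHS]invr1 lef_pV2 ?posrE ?powR_gt0//; last by case/andP: s01.
  case/andP: s01 => s0 sle1; have <- : 1 `^ kap = 1 :> R by rewrite powR1.
  apply: ge0_ler_powR => //.
  - by rewrite nnegrE ltW.
  - by rewrite nnegrE ler01.
have mxi' := sub_sigma_measurable_fun mxi.
have mZ' := sub_sigma_measurable_fun mZ.
have ix : P.-integrable setT (EFin \o (fun w => `|xi w|)).
  apply: (@bounded_integrable _ _ _ P _ _ c) => //; first exact: measurableT_comp.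
  by move=> w _; rewrite normr_id.
have ik : P.-integrable setT (EFin \o (fun w => `|xi w| * kc eta a (Z w))).
  apply: (@bounded_integrable _ _ _ P _ _ (c * a `^ (eta - 1))) => //.
    apply: measurable_funM; first exact: measurableT_comp.
    exact: (measurableT_comp (cb (kc_continuous e01 a0)) mZ').
  by move=> w _; rewrite normrM normr_id (ger0_norm (kc_ge0 _ _ _)) ler_pM// ?kc_ge0// kc_le.
split.
  have [-> h2] := expectation_independent_sum cG GC.
  rewrite -RintegralZl//; apply: (le_trans (le_normr_Rintegral _ _)) => //.
  apply: le_Rintegral => //.
  - exact: (integrable_norm h2).
  - by apply: (integrableZl measurableT _ ix).
  - move=> w _; rewrite normrM mulrC ler_wpM2r//.
    by have [] := test _ _ s01 lawY (Z w).
have [-> h2] := expectation_independent_sum cdG dGC.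
rewrite -RintegralZl//; apply: (le_trans (le_normr_Rintegral _ _)) => //.
apply: le_Rintegral => //.
- exact: (integrable_norm h2).
- by apply: (integrableZl measurableT _ ik).
move=> w _; rewrite normrM mulrCA ler_wpM2l//.
have [_ h] := test _ _ s01 lawY (Z w).
apply: (@le_kc _ eta a (Z w) _ _ C1 e01 a0 _ _ _ h) => //.
- rewrite -[leRHS]mulr1 -(_ : fine (distribution P Y setT) = 1); last by rewrite probability_setT.
  apply: (@Rintegral_le_bound _ _ _ (distribution P Y)) => //.
  by apply: (measurableT_comp (cb cdG)); apply: measurable_funD.
- by apply: (le_trans CA); rewrite ler_wpM2r ?powR_ge0// ler_peMr.
Qed.

End law_of_increments.

(** * Smoothing by the increments of the stable process *)

Section levy.
Context {R : realType} d (T : measurableType d) (P : probability T R).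
Variables (F : R -> set (set T)) (L : R -> T -> R) (al : R).
Hypothesis filF : filtration F.
Hypothesis levyL : symmetric_stable_process P al F L.

Lemma levy_measurable t : 0 <= t -> measurable_fun [set: T] (L t : T -> measurableTypeR R).
Proof.
move=> t0; case: levyL => -[aL _ _ _ _] _ _ B mB; rewrite setTI.
by case: filF => _ h _; apply: (h t t0); exact: aL.
Qed.

Lemma increment_stable_law (Y : {mfun T >-> measurableTypeR R}) r t : 0 <= r -> r <= t ->
  (Y : T -> R) = increment L r t -> stable_law al (distribution P Y) (t - r).
Proof.
move=> r0 rt YE; case: levyL => -[_ _ _ _ st] ch.
have tr : 0 <= t - r by rewrite subr_ge0.
have mL : (L (t - r) : T -> measurableTypeR R) \in (mfun : {pred T -> measurableTypeR R}).
  by rewrite inE; exact: levy_measurable.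
pose L' : {mfun T >-> measurableTypeR R} := @mfun_Sub _ _ T (measurableTypeR R) (L (t - r)) mL.
have H (g : R -> R) : continuous g -> (forall x, `|g x| <= 1) ->
   \int[distribution P Y]_y g y = fine 'E_P[fun w => g (L (t - r) w)]%E.
  move=> cg g1; rewrite /Rintegral; congr fine.
  transitivity (\int[distribution P L']_y (g y)%:E)%E.
    apply: eq_measure_integral => A mA _.
    change (P (Y @^-1` A) = P (L (t - r) @^-1` A)).
  rewrite YE;   exact: (st r t r0 rt A mA).
  rewrite integral_distribution//=.
  - by rewrite unlock.
  - by apply/measurable_EFinP; exact: continuous_measurable_fun.
  - apply: (@bounded_integrable _ _ _ P _ _ 1) => //.
      by rewrite (le_lt_trans (probability_le1 _ _))// ltry.
    by apply: (measurableT_comp (continuous_measurable_fun cg)); exact: levy_measurable.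
split => xi.
  rewrite (H (fun y => cos (xi * y))).
  - by have := ch _ tr xi; rewrite /charfun => -[-> _]; rewrite mulNr.
  - by move=> y; apply: continuous_comp; [apply: cvgMr; exact: cvg_id|exact: continuous_cos].
  - by move=> x; exact: cos_max.
rewrite (H (fun y => sin (xi * y))).
- by have := ch _ tr xi; rewrite /charfun => -[_ ->].
- by move=> y; apply: continuous_comp; [apply: cvgMr; exact: cvg_id|exact: continuous_sin].
- by move=> x; exact: sin_max.
Qed.

End levy.

Section test_functions.
Context {R : realType} d (T : measurableType d) (P : probability T R).
Variables (al eta kap : R).
Hypothesis e01 : 0 < eta < 1.
Hypothesis kap0 : 0 <= kap.

(** Only [A] survives in the final estimates. [C] and [K] express regularity, and the last condition
    fixes a truncation distance [a] compatible with the size of [dG]. *)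
Definition test_function (G dG : R -> R) (A a C K : R) :=
  [/\ law_test al eta kap G dG A,
      forall x, is_derive x (1 : R) G (dG x),
      forall x, `|G x| <= C,
      forall x y, `|dG x - dG y| <= K * `|x - y| &
      forall x, `|dG x| <= A * a `^ (eta - 1)].

(** The property of the driving process on which Duhamel's formula rests: averaging over the
    increment after time [r], conditionally on the past of [r], gives the singular power of
    [t - r]. *)
Definition smoothing_increments (F : R -> set (set T)) (L : R -> T -> R) :=
  forall r t, 0 <= r -> r < t -> t - r <= 1 ->
  forall (xi Z : T -> R) c,
  measurable_fun [set: g_sigma_algebraType (F r)] xi ->
  measurable_fun [set: g_sigma_algebraType (F r)] (Z : T -> measurableTypeR R) ->
  (forall w, `|xi w| <= c) ->
  forall G dG A a C K, 0 < a -> test_function G dG A a C K ->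
  `|\int[P]_w (xi w * G (Z w + (L t w - L r w)))| <= A * (t - r) `^ (- kap) * \int[P]_w `|xi w| /\
  `|\int[P]_w (xi w * dG (Z w + (L t w - L r w)))| <=
    A * (t - r) `^ (- kap) * \int[P]_w (`|xi w| * kc eta a (Z w)).

Lemma test_function_continuous G dG A a C K : test_function G dG A a C K ->
  continuous G /\ continuous dG.
Proof.
move=> [_ GE _ dGK _]; split; first by move=> x; exact: (is_derive_cvg (GE x)).
apply: (@lipschitz_cont _ _ K) => x y xy; apply: (le_trans (dGK _ _)).
by rewrite ger0_norm ?subr_ge0.
Qed.

(** At nonnegative times the clamping by [Num.max 0] is invisible, and independence of the increment
    from [F r] is part of the definition of a Lévy process. *)
Lemma levy_smoothing F L : filtration F -> symmetric_stable_process P al F L ->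
  smoothing_increments (fun v => F (Num.max 0 v)) (fun v => L (Num.max 0 v)).
Proof.
move=> filF levyL r t r0 rt tr xi Z c; rewrite (max_r r0) => mxi mZ xic G dG A a C K a0 tf.
have t0 : 0 <= t by exact: le_trans (ltW rt).
rewrite (max_r t0); have [cG cdG] := test_function_continuous tf.
case: tf => tf GE GC dGK dGC.
have mY : (increment L r t : T -> measurableTypeR R) \in (mfun : {pred T -> measurableTypeR R}).
  rewrite inE; apply: measurable_funB; exact: (levy_measurable filF levyL).
pose Y : {mfun T >-> measurableTypeR R} := @mfun_Sub _ _ T (measurableTypeR R) (increment L r t) mY.
have law := increment_stable_law filF levyL (Y := Y) r0 (ltW rt) erefl.
have s01 : 0 < t - r <= 1 by rewrite subr_gt0 rt.
have A0 : 0 <= A.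
  have h : 0 < a `^ (eta - 1) by rewrite powR_gt0.
  by rewrite -(pmulr_lge0 _ h); exact: le_trans (dGC 0).
case: filF => sF FT FF.
apply: (@law_test_expectation R d T P (F r) (sF r r0) (FT r r0) Y _ al eta kap (t - r) s01 law
  xi Z c mxi mZ xic G dG A a C (A * a `^ (eta - 1)) tf e01 a0) => //.
move=> E B FE mB; case: levyL => -[_ _ _ ind _] _.
exact: (ind r t r0 (ltW rt) E B FE mB).
Qed.

End test_functions.

Lemma ae_eq_Rintegral {R : realType} d (T : measurableType d) (P : probability T R) (f g : T -> R) :
  measurable_fun setT f -> measurable_fun setT g -> {ae P, forall w, f w = g w} ->
  \int[P]_w f w = \int[P]_w g w.
Proof.
move=> mf mg fg; rewrite /Rintegral; congr fine; apply: ae_eq_integral => //.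
- exact/measurable_EFinP.
- exact/measurable_EFinP.
- by apply: filterS fg => w /= -> .
Qed.

Section singular_time_kernel.
Context {R : realType}.
Notation mu := (@lebesgue_measure R).
Implicit Types (kap r h t u x y : R).

Lemma is_derive_powR_shift (q r x : R) : r < x ->
  is_derive x (1 : R) (fun t : R => (t - r) `^ q) (q * (x - r) `^ (q - 1)).
Proof.
move=> rx; have xr : 0 < x - r by rewrite subr_gt0.
have h1 : is_derive x (1 : R) (fun t : R => t - r) 1.
  by apply: is_derive_eq; rewrite subr0.
have := @is_derive1_comp R (fun u : R => u `^ q) (fun t : R => t - r) x _ _ (is_derive1_powR q xr) h1.
by rewrite mulr1.
Qed.

(** The fundamental theorem applies on []r + 1 / (n + 1), r + h]], away from the singularity;
    Fatou's lemma passes to the whole interval and yields the inequality, which is the direction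
    used. *)
Lemma powR_singular_integral kap r h : 0 <= kap < 1 -> 0 <= h ->
  (\int[mu]_(t in `]r, (r + h)%R]) ((t - r) `^ (- kap))%:E <= (h `^ (1 - kap) / (1 - kap))%:E)%E.
Proof.
move=> /andP[k0 k1] h0.
have k1' : 0 < 1 - kap by lra.
pose f t := (t - r) `^ (- kap).
have mf : measurable_fun [set: R] f.
  apply: (@measurableT_comp _ _ _ _ _ _ (@powR R ^~ (- kap))) => //.
  exact: measurable_funB.
pose D (n : nat) : set R := `]r + n.+1%:R^-1, r + h]%classic.
pose g (n : nat) t : \bar R := ((f t * \1_(D n) t)%:E).
have mg n : measurable_fun [set: measurableTypeR R] (g n).
  have mD : measurable (D n : set (measurableTypeR R)) by exact: measurable_itv.
  by apply/measurable_EFinP; exact: (measurable_funM mf (measurable_indic mD)).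
have g0 n t : (0 <= g n t)%E by rewrite lee_fin mulr_ge0// powR_ge0.
have gC n : (\int[mu]_t g n t <= (h `^ (1 - kap) / (1 - kap))%:E)%E.
  have C0 : 0 <= h `^ (1 - kap) / (1 - kap) by rewrite divr_ge0 ?powR_ge0// ltW.
  have -> : (\int[mu]_t g n t = \int[mu]_(t in D n) (f t)%:E)%E.
    by rewrite [RHS]integral_mkcond; apply: eq_integral => t _; rewrite epatch_indic /g EFinM.
  have n0 : (0 : R) < n.+1%:R^-1 by rewrite invr_gt0.
  have [hn|hn] := leP h n.+1%:R^-1.
    by rewrite /D set_itv_ge ?integral_set0 ?lee_fin// bnd_simp -leNgt lerD2l.
  have rx x : r + n.+1%:R^-1 <= x -> r < x by move=> hx; apply: lt_le_trans hx; rewrite ltrDl.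
  pose Fp t := (t - r) `^ (1 - kap) / (1 - kap).
  have dF x : r < x -> is_derive x (1 : R) Fp (f x).
    move=> hx; rewrite /Fp.
    have := is_deriveM (is_derive_powR_shift (1 - kap) hx) (is_derive_cst ((1 - kap)^-1) x (1 : R)).
    set Dv := (X in is_derive _ _ _ X -> _).
    have -> : Dv = f x.
      rewrite /Dv /f scaler0 add0r /GRing.scale/=.
      rewrite (_ : 1 - kap - 1 = - kap); last ring.
      by field; rewrite gt_eqF.
    exact.
  have cf x : r < x -> {for x, continuous f}.
    move=> hx; have [+ _] := is_derive_powR_shift (- kap) hx.
    by move=> /derivable1_diffP/differentiable_continuous.
  have rh : r + n.+1%:R^-1 < r + h by rewrite ltrD2l.
  rewrite /D integral_itv_obnd_cbnd; last by apply/measurable_EFinP; exact: measurable_funTS.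
  rewrite (@continuous_FTC2 _ f Fp _ _ rh).
  - rewrite lee_fin /Fp addrAC subrr add0r lerBlDr lerDl divr_ge0 ?powR_ge0//.
    exact: ltW.
  - apply: continuous_in_subspaceT => x; rewrite inE/= in_itv/= => /andP[hx _].
    exact/cf/rx.
  - split.
    + by move=> x; rewrite in_itv/= => /andP[hx _]; have [] := dF x (rx x (ltW hx)).
    + apply: cvg_at_right_filter; exact: (is_derive_cvg (dF _ (rx _ (lexx _)))).
    + apply: cvg_at_left_filter; exact: (is_derive_cvg (dF _ (rx _ (ltW rh)))).
  - move=> x; rewrite in_itv/= => /andP[hx _].
    by rewrite derive1E; apply/derive_val; exact: dF _ (rx _ (ltW hx)).
rewrite integral_mkcond.
apply: (@le_trans _ _ (limn_einf (fun n => \int[mu]_t g n t))%E); last exact: limn_einf_le.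
apply: le_trans (fatou mu measurableT mg _); last by move=> n t _; exact: g0.
apply: ge0_le_integral => //.
- by move=> t _; apply: erestrict_ge0 => u _; rewrite lee_fin powR_ge0.
- by apply/(measurable_restrictT _ (measurable_itv _)); apply/measurable_EFinP; exact: measurable_funTS.
- by apply: measurable_limn_einf.
move=> t _; apply: le_limn_einf; apply: cvg_near_cst.
have H : \forall n \near \oo, r < t -> r + n.+1%:R^-1 < t.
  have [tr|tr] := ltP r t; last by near=> n.
  have tr0 : 0 < t - r by rewrite subr_gt0.
  near=> n => _; rewrite addrC -ltrBrDr; near: n.
  exact: near_infty_natSinv_lt (PosNum tr0).
near=> n; rewrite epatch_indic /g -EFinM; congr ((_ * _)%:E).
rewrite !indicE; congr (_%:R); congr nat_of_bool.
apply/idP/idP => /set_mem; rewrite /D/= !in_itv/= => /andP[h1 h2]; apply/mem_set; rewrite /= in_itv/= h2 andbT.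
  by apply: lt_trans h1; rewrite ltrDl invr_gt0.
by move: h1; near: n.
Unshelve. all: by end_near.
Qed.

End singular_time_kernel.

(** * Paths with a controlled drift on a short time window *)

Section controlled_paths.
Context {R : realType} d (T : measurableType d).
Notation mu := (@lebesgue_measure R).
Variables (F : R -> set (set T)) (X : R -> T -> R) (b : nat -> R -> R) (Cb : nat -> R).
Hypothesis sF : forall v, sigma_algebra setT (F v).
Hypothesis FT : forall v, F v `<=` measurable.
Hypothesis FF : forall s t, s <= t -> F s `<=` F t.
Hypothesis mX : forall v, measurable_fun [set: g_sigma_algebraType (F v)] (X v : T -> measurableTypeR R).
Hypothesis rcX : forall w v, X s w @[s --> v^'+] --> X v w.
Hypothesis cb : forall k, continuous (b k).
Hypothesis bC : forall k x, `|b k x| <= Cb k.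
Implicit Types (s t v r m x y z : R) (w : T) (k j : nat).

Lemma filtration_measurable s t d' (V : measurableType d') (f : T -> V) : s <= t ->
  measurable_fun [set: g_sigma_algebraType (F s)] f ->
  measurable_fun [set: g_sigma_algebraType (F t)] f.
Proof.
move=> st /(sub_sigma_measurable (sF s)) h; apply/(sub_sigma_measurable (sF t)) => B mB.
exact/(FF st)/h.
Qed.

Lemma filtration_measurableT s d' (V : measurableType d') (f : T -> V) :
  measurable_fun [set: g_sigma_algebraType (F s)] f -> measurable_fun [set: T] f.
Proof. exact: (sub_sigma_measurable_fun (sF s) (@FT s)). Qed.

Lemma right_continuous_stop (f : R -> R) r : (forall v, f s @[s --> v^'+] --> f v) ->
  forall v, f (Num.min s r) @[s --> v^'+] --> f (Num.min v r).
Proof.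
move=> rc v; have [vr|rv] := ltP v r.
  apply: cvg_trans (rc v); apply: near_eq_cvg; near=> s.
  by rewrite min_l//; near: s; exact: nbhs_right_le.
apply: cvg_near_cst; near=> s.
by rewrite min_r//; near: s; apply: filterS (nbhs_right_ge v) => s; exact: le_trans.
Unshelve. all: by end_near.
Qed.

(** Progressive measurability stated through the stopped time [min p.1 r], so that the second factor
    of the product carries the sigma-algebra [F r]. *)
Lemma progressively_measurable (Y : R -> T -> R) r :
  (forall v, measurable_fun [set: g_sigma_algebraType (F v)] (Y v : T -> measurableTypeR R)) ->
  (forall w v, Y s w @[s --> v^'+] --> Y v w) ->
  measurable_fun [set: measurableTypeR R * g_sigma_algebraType (F r)]
    (fun p => Y (Num.min p.1 r) p.2 : measurableTypeR R).
Proof.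
move=> mY rc.
apply: (@right_continuous_measurable R _ (g_sigma_algebraType (F r)) (fun v w => Y (Num.min v r) w)).
  by move=> v; apply: filtration_measurable (mY _); rewrite ge_min lexx orbT.
by move=> w v; exact: (right_continuous_stop (rc w)).
Qed.

Lemma process_measurable (Y : R -> T -> R) :
  (forall v, measurable_fun [set: g_sigma_algebraType (F v)] (Y v : T -> measurableTypeR R)) ->
  (forall w v, Y s w @[s --> v^'+] --> Y v w) ->
  measurable_fun [set: measurableTypeR R * T] (fun p => Y p.1 p.2 : measurableTypeR R).
Proof.
move=> mY rc; apply: right_continuous_measurable rc => v.
exact: filtration_measurableT (mY v).
Qed.

Lemma stop_integral (f : R -> R) s t r : t <= r ->
  \int[mu]_(v in `[s, t]) f v = \int[mu]_(v in `[s, t]) f (Num.min v r).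
Proof.
move=> tr; apply: eq_Rintegral => v; rewrite inE/= in_itv/= => /andP[_ vt].
by rewrite min_l// (le_trans vt).
Qed.

Lemma mpath w : measurable_fun [set: R] (X ^~ w : R -> R).
Proof.
exact: (measurableT_comp (process_measurable mX rcX) (measurable_pair2 w)).
Qed.

Let mb k : measurable_fun [set: measurableTypeR R] (b k : measurableTypeR R -> measurableTypeR R).
Proof. by apply: continuous_measurable_fun; exact: cb. Qed.

Lemma mbX k w : measurable_fun [set: R] (fun v => b k (X v w)).
Proof. by exact: (measurableT_comp (mb k) (mpath w)). Qed.

Lemma mnbX k w : measurable_fun [set: R] (fun v => `|b k (X v w)|).
Proof. by apply: measurableT_comp => //; exact: mbX. Qed.

Definition variation k v w : R := \int[mu]_(u in `[0, v]) `|b k (X u w)|.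

Lemma variation_measurable k v :
  measurable_fun [set: g_sigma_algebraType (F v)] (variation k v : T -> measurableTypeR R).
Proof.
rewrite (_ : variation k v = fun w => \int[mu]_(u in `[0, v]) `|b k (X (Num.min u v) w)|); last first.
  by apply/funext => w; apply: (stop_integral (fun u => `|b k (X u w)|)).
apply: (@measurable_Rintegral_param R _ (g_sigma_algebraType (F v)) _ _ mu _ (fun u w => `|b k (X (Num.min u v) w)|)) => //.
apply: measurableT_comp => //; apply: (measurableT_comp (mb k)).
exact: progressively_measurable.
Qed.

Lemma variation_continuous k w : continuous (variation k ^~ w).
Proof.
apply: (@primitive_continuous R (fun u => `|b k (X u w)|) 0 (Cb k)) => [|x].
  exact: mnbX.
by rewrite normr_id.
Qed.

Lemma variation_mono k w s t : s <= t -> variation k s w <= variation k t w.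
Proof.
move=> st; rewrite /variation; have [s0|s0] := ltP s 0.
  by rewrite set_itv_ge ?Rintegral_set0 ?Rintegral_ge0// bnd_simp -ltNge.
rewrite -subr_ge0 (@primitiveB _ _ 0 (Cb k)) ?Rintegral_ge0//; first exact: mnbX.
by move=> x; rewrite normr_id.
Qed.

(* Depends on the past of [X] only, which keeps the truncated drift adapted. *)
Definition cutoff m v w : R := (`[< forall k, variation k v w <= m >])%:R.

Lemma cutoff01 m v w : 0 <= cutoff m v w <= 1.
Proof. by rewrite /cutoff; case: asbool; rewrite ?lexx ler01. Qed.

Lemma cutoff_ge0 m v w : 0 <= cutoff m v w. Proof. by case/andP: (cutoff01 m v w). Qed.

Lemma cutoff_le1 m v w : cutoff m v w <= 1. Proof. by case/andP: (cutoff01 m v w). Qed.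

Lemma cutoff_mono m s t w : s <= t -> cutoff m t w <= cutoff m s w.
Proof.
move=> st; rewrite /cutoff; case: asboolP => h1; case: asboolP => h2 //.
by case: h2 => k; apply: le_trans (h1 k); exact: variation_mono.
Qed.

Lemma cutoff_measurable d' (T' : measurableType d') (tau : T' -> R) (om : T' -> T) m :
  (forall k, measurable_fun [set: T'] (fun p => variation k (tau p) (om p))) ->
  measurable_fun [set: T'] (fun p => cutoff m (tau p) (om p)).
Proof.
move=> mV.
rewrite (_ : (fun p => _) = \1_(\bigcap_k [set p | variation k (tau p) (om p) <= m])); last first.
  apply/funext => p; rewrite /cutoff indicE; congr (_%:R); congr nat_of_bool.
  by apply/asboolP/idP; [move=> h; apply/mem_set => k _; exact: h|move=> /set_mem h k; exact: (h k)].
apply: measurable_indic; apply: bigcap_measurableType => k _.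
rewrite -[X in measurable X]setTI.
exact: (measurable_fun_le measurableT (mV k) (@measurable_cst _ _ _ _ setT m)).
Qed.

Definition drift k m v w : R := cutoff m v w * b k (X v w).

Lemma drift_le k m v w : `|drift k m v w| <= Cb k.
Proof.
rewrite /drift normrM (ger0_norm (cutoff_ge0 _ _ _)) -[leRHS]mul1r.
by apply: ler_pM => //; apply: cutoff_le1.
Qed.

Lemma variation_rc w k v : variation k s w @[s --> v^'+] --> variation k v w.
Proof. by apply: cvg_at_right_filter; exact: variation_continuous. Qed.

Lemma cutoff_joint m :
  measurable_fun [set: measurableTypeR R * T] (fun p => cutoff m p.1 p.2).
Proof.
apply: (@cutoff_measurable _ (measurableTypeR R * T)%type fst snd) => k.
apply: process_measurable; first exact: variation_measurable.
by move=> w v; exact: variation_rc.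
Qed.

Lemma drift_joint k m :
  measurable_fun [set: measurableTypeR R * T] (fun p => drift k m p.1 p.2).
Proof.
apply: measurable_funM; first exact: cutoff_joint.
exact: (measurableT_comp (mb k) (process_measurable mX rcX)).
Qed.

Lemma drift_stop k m r :
  measurable_fun [set: measurableTypeR R * g_sigma_algebraType (F r)]
    (fun p => drift k m (Num.min p.1 r) p.2).
Proof.
apply: measurable_funM.
  apply: (@cutoff_measurable _ (measurableTypeR R * g_sigma_algebraType (F r))%type
     (fun p => Num.min p.1 r) snd) => j.
  apply: progressively_measurable; first exact: variation_measurable.
  by move=> w v; exact: variation_rc.
by apply: (measurableT_comp (mb k)); exact: progressively_measurable.
Qed.

Lemma drift_path k m w : measurable_fun [set: R] (fun v => drift k m v w).
Proof. exact: (measurableT_comp (drift_joint k m) (measurable_pair2 w)). Qed.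

Lemma drift_adapted k m v : measurable_fun [set: g_sigma_algebraType (F v)] (drift k m v).
Proof.
have := measurableT_comp (drift_stop k m (r := v)) (measurable_pair1 v).
by apply: eq_measurable_fun => w _ /=; rewrite minxx.
Qed.

Variable s0 : R.

Definition push k m t w : R := \int[mu]_(v in `[s0, t]) drift k m v w.

Lemma push_continuous k m w : continuous (push k m ^~ w).
Proof.
by apply: (@primitive_continuous R (fun u => drift k m u w) s0 (Cb k)) => [|x]; [exact: drift_path|exact: drift_le].
Qed.

Lemma push_adapted k m t :
  measurable_fun [set: g_sigma_algebraType (F t)] (push k m t : T -> measurableTypeR R).
Proof.
rewrite (_ : push k m t = fun w => \int[mu]_(v in `[s0, t]) drift k m (Num.min v t) w); last first.
  by apply/funext => w; apply: (stop_integral (fun u => drift k m u w)).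
apply: (@measurable_Rintegral_param R _ (g_sigma_algebraType (F t)) _ _ mu _ (fun u w => drift k m (Num.min u t) w)) => //.
exact: drift_stop.
Qed.

Lemma push_joint k m :
  measurable_fun [set: measurableTypeR R * T] (fun p => push k m p.1 p.2 : measurableTypeR R).
Proof.
apply: process_measurable; first exact: push_adapted.
by move=> w v; apply: cvg_at_right_filter; exact: push_continuous.
Qed.

(** The cutoff decreases in time with values [0] and [1]: if it is active at [t], it equals [1] all
    along [[s0, t]]. *)
Lemma push_active k m t w : 0 <= s0 -> s0 <= t -> cutoff m t w != 0 ->
  push k m t w = \int[mu]_(v in `[0, t]) b k (X v w) - \int[mu]_(v in `[0, s0]) b k (X v w).
Proof.
move=> s00 s0t act.
rewrite (@primitiveB _ _ 0 (Cb k)) => //; last first.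
  exact: mbX.
apply: eq_Rintegral => v; rewrite inE/= in_itv/= => /andP[_ vt].
rewrite /drift; suff -> : cutoff m v w = 1 by rewrite mul1r.
have := cutoff_mono m w vt; move: act; rewrite /cutoff.
by case: asbool => /=; rewrite ?eqxx// => _; case: asbool => //; rewrite ler10.
Qed.

(** Let [tau] be the last active time. An active [v] close to [tau] has variation at most [m];
    between [v] and [tau] the boundedness of [b k] leaves an arbitrarily small amount, and after
    [tau] the drift vanishes. *)
Lemma drift_variation k m t w : 0 <= m ->
  (\int[mu]_(v in `[0%R, t]) `|drift k m v w|%:E <= m%:E)%E.
Proof.
move=> m0.
have C0 : 0 <= Cb k by apply: le_trans (bC k 0).
have fin a c : (mu `[a, c]%classic < +oo)%E.
  by rewrite /= lebesgue_measure_itv/= lte_fin; case: ifP => // _; rewrite -EFinB ltry.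
have md : measurable_fun [set: R] (fun v => `|drift k m v w|).
  by apply: measurableT_comp => //; exact: drift_path.
have [t0|t0] := ltP t 0.
  by rewrite set_itv_ge ?integral_set0 ?lee_fin// bnd_simp -ltNge.
have i1 : mu.-integrable `[0, t] (EFin \o (fun v => `|drift k m v w|)).
  by apply: (integrable_itv md (C := Cb k)) => v _; rewrite normr_id drift_le.
rewrite -[leLHS]fineK; last exact: integrable_fin_num i1.
rewrite lee_fin -/(Rintegral _ _ _).
pose S := [set v | 0 <= v <= t /\ cutoff m v w != 0].
have [[v0 Sv0]|S0] := pselect (S !=set0); last first.
  rewrite (_ : Rintegral _ _ _ = 0)//.
  transitivity (\int[mu]_(x in `[0, t]) (0 : R)); last by rewrite Rintegral_cst// mul0r.
  apply: eq_Rintegral => v; rewrite inE/= in_itv/= => vt.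
  rewrite /drift; have [->|h] := eqVneq (cutoff m v w) 0; first by rewrite mul0r normr0.
  by exfalso; apply: S0; exists v.
have supS : has_sup S by split; [exists v0|exists t => v [/andP[]]].
apply/ler_addgt0Pr => e e0.
have e1 : 0 < e / (Cb k + 1) by rewrite divr_gt0// ltr_wpDl.
have [v [/andP[v1 v2] vact] vsup] := sup_adherent e1 supS.
pose tau := sup S.
have vtau : v <= tau by apply: sup_upper_bound => //; split => //; rewrite v1.
have taut : tau <= t by apply: sup_le_ub; [exists v0|move=> y [/andP[]]].
rewrite -[X in X <= _](subrK (\int[mu]_(x in `[0, v]) `|drift k m x w|)).
rewrite (@primitiveB _ _ 0 (Cb k)) => //; last by move=> x; rewrite normr_id drift_le.
rewrite addrC; apply: lerD.
  apply: (@le_trans _ _ (variation k v w)).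
    apply: le_Rintegral => //.
    - by apply: (integrable_itv md (C := Cb k)) => x _; rewrite normr_id drift_le.
    - by apply: (integrable_itv (mnbX k w) (C := Cb k)) => x _; rewrite normr_id.
    - move=> x _; rewrite /drift normrM (ger0_norm (cutoff_ge0 _ _ _)) ler_piMl//.
      exact: cutoff_le1.
  move: vact; rewrite /cutoff; case: asboolP => [h _|]; last by rewrite eqxx.
  exact: h.
have E : \int[mu]_(x in `[v, t]) `|drift k m x w| <= Cb k * (tau - v).
  have dC x : `| `|drift k m x w| | <= Cb k by rewrite normr_id drift_le.
  have h := @primitiveB R (fun x => `|drift k m x w|) v (Cb k) md dC tau t vtau taut.
  have h2 : \int[mu]_(r in `[tau, t]) `|drift k m r w| = 0.
    rewrite -Rintegral_itv_obnd_cbnd; last first.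
      apply: (@integrableS _ _ _ mu `[tau, t]) => //.
        by apply: subset_itvr; rewrite bnd_simp.
      by apply: (integrable_itv md (C := Cb k)) => x _.
    transitivity (\int[mu]_(x in `]tau, t]) (0 : R)); last by rewrite Rintegral_cst// mul0r.
    apply: eq_Rintegral => y; rewrite inE/= in_itv/= => /andP[tauy yt].
    rewrite /drift; have [->|yact] := eqVneq (cutoff m y w) 0; first by rewrite mul0r normr0.
    exfalso; have := tauy; apply/negP; rewrite -leNgt; apply: sup_upper_bound => //.
    by split => //; rewrite yt andbT; exact: (le_trans v1 (le_trans vtau (ltW tauy))).
  move: h; rewrite h2 => /subr0_eq ->.
  apply: (le_trans (ler_norm _)).
  exact: (Rintegral_itv_le vtau md (fun x _ => dC x)).
apply: (le_trans E); apply: (@le_trans _ _ (Cb k * (e / (Cb k + 1)))).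
  by rewrite ler_wpM2l//; move: vsup; rewrite -/tau; lra.
by rewrite mulrCA ler_piMr ?(ltW e0)// ler_pdivrMr ?ltr_wpDl// mul1r lerDl.
Qed.

Variables (P : probability T R) (A L : R -> T -> R) (x0 al eta kap : R).
Hypothesis e01 : 0 < eta < 1.
Hypothesis kap01 : 0 <= kap < 1.
Hypothesis mA : forall v, measurable_fun [set: T] (A v : T -> measurableTypeR R).
Hypothesis cA : forall w, continuous (A ^~ w).
Hypothesis mL : forall v, measurable_fun [set: g_sigma_algebraType (F v)] (L v : T -> measurableTypeR R).
Hypothesis XLA : {ae P, forall w, forall t, 0 <= t -> X t w = x0 + L t w + A t w}.
Hypothesis smooth : smoothing_increments P al eta kap F L.
Hypothesis s00 : 0 <= s0.
Variables (zeta : T -> R) (Cz : R).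
Hypothesis mzeta : measurable_fun [set: g_sigma_algebraType (F s0)] zeta.
Hypothesis zeta0 : forall w, 0 <= zeta w.
Hypothesis zetaC : forall w, zeta w <= Cz.

(* The drift [A] of [X] is frozen at time [s0] and replaced by the absolutely
   continuous [push]. *)
Definition proxy k m t w : R := X t w - (A t w - A s0 w) + push k m t w.

Lemma A_joint : measurable_fun [set: measurableTypeR R * T] (fun p => A p.1 p.2 : measurableTypeR R).
Proof.
apply: right_continuous_measurable => // w v.
by apply: cvg_at_right_filter; exact: cA.
Qed.

Lemma proxy_joint k m :
  measurable_fun [set: measurableTypeR R * T] (fun p => proxy k m p.1 p.2 : measurableTypeR R).
Proof.
apply: measurable_funD; last exact: push_joint.
apply: measurable_funB; first exact: process_measurable.
apply: measurable_funB; first exact: A_joint.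
exact: (measurableT_comp (mA s0) measurable_snd).
Qed.

Let Cz0 : 0 <= Cz. Proof. exact: le_trans (zeta0 point) (zetaC point). Qed.

Let mzetaT : measurable_fun [set: T] zeta. Proof. exact: filtration_measurableT mzeta. Qed.

Let nzeta w : `|zeta w| <= Cz. Proof. by rewrite ger0_norm. Qed.

Let Cb0 k : 0 <= Cb k. Proof. exact: le_trans (bC k 0). Qed.

Let finP : (P setT < +oo)%E.
Proof. by rewrite (le_lt_trans (probability_le1 _ _))// ltry. Qed.

Let cmeas (f : R -> R) : continuous f -> measurable_fun [set: measurableTypeR R] (f : measurableTypeR R -> measurableTypeR R).
Proof. exact: continuous_measurable_fun. Qed.

(** * Duhamel's formula for the proxy *)

Section duhamel.
Variables (G dG : R -> R) (Ag a C K : R).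
Hypothesis a0 : 0 < a.
Hypothesis tf : test_function al eta kap G dG Ag a C K.

Let cG : continuous G. Proof. by have [] := test_function_continuous tf. Qed.
Let cdG : continuous dG. Proof. by have [] := test_function_continuous tf. Qed.

Definition response k m z r : R :=
  \int[P]_w (zeta w * `|drift k m r w| * kc eta a (proxy k m r w - z)).

Lemma response_integrand_measurable k m z :
  measurable_fun [set: measurableTypeR R * T]
    (fun p => zeta p.2 * `|drift k m p.1 p.2| * kc eta a (proxy k m p.1 p.2 - z)).
Proof.
apply: measurable_funM.
  apply: measurable_funM; first exact: (measurableT_comp mzetaT measurable_snd).
  by apply: measurableT_comp => //; exact: drift_joint.
apply: (measurableT_comp (cmeas (kc_continuous e01 a0))).
exact: (measurable_funB (proxy_joint k m) (measurable_cst z)).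
Qed.

Lemma response_measurable k m z : measurable_fun [set: measurableTypeR R] (response k m z).
Proof.
apply: (@measurable_Rintegral_param R _ (measurableTypeR R) _ _ P setT
  (fun w r => zeta w * `|drift k m r w| * kc eta a (proxy k m r w - z))) => //.
apply: (measurableT_comp (response_integrand_measurable k m z) (_ : measurable_fun setT (fun q : T * measurableTypeR R => (q.2, q.1)))).
by apply/measurable_fun_pairP; split => /=; [exact: measurable_snd|exact: measurable_fst].
Qed.

Lemma response_ge0 k m z r : 0 <= response k m z r.
Proof. by apply: Rintegral_ge0 => w _; rewrite !mulr_ge0// kc_ge0. Qed.

(* Conditionally on time [r], the increment of [L] after [r] smooths [G] and
   [dG]. *)
Lemma duhamel k m z t : s0 < t -> t - s0 <= 1 ->
  (`|\int[P]_w (zeta w * G (proxy k m t w - z))|%:E <=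
   (Ag * (t - s0) `^ (- kap) * \int[P]_w zeta w)%:E +
   Ag%:E * \int[mu]_(r in `[s0, t[) (((t - r) `^ (- kap)) * response k m z r)%:E)%E.
Proof.
move=> s0t ts1.
have [tf1 GE GC dGK dGC] := tf.
set C1 := Ag * a `^ (eta - 1) in dGC.
have A0 : 0 <= Ag.
  have h : 0 < a `^ (eta - 1) by rewrite powR_gt0.
  by rewrite -(pmulr_lge0 _ h); exact: le_trans (dGC 0).
have C10 : 0 <= C1 by apply: le_trans (dGC 0).
have t0 : 0 <= t by exact: le_trans s00 (ltW s0t).
(* The terminal position with the drift accumulated after [s0] removed. Almost surely it is
   [X s0 - z] plus the increment of [L] over [[s0, t]], and the chain rule along [push] starts from
   it. *)
pose U w := A s0 w + X t w - A t w - z.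
have mU : measurable_fun [set: T] (U : T -> measurableTypeR R).
  have mXt := filtration_measurableT (@mX t).
  exact: (measurable_funB (measurable_funB (measurable_funD (mA s0) mXt) (mA t)) (measurable_cst z)).
have UE : {ae P, forall w, U w = X s0 w - z + (L t w - L s0 w)}.
  apply: filterS XLA => w h; rewrite /U (h t t0).
  by rewrite [X s0 w]h//; ring.
have ZE r : 0 <= r -> {ae P, forall w, proxy k m r w = X s0 w + L r w - L s0 w + push k m r w}.
  move=> r0; apply: filterS XLA => w h; rewrite /proxy (h r r0).
  by rewrite [X s0 w]h//; ring.
pose I r w := zeta w * (dG (U w + push k m r w) * drift k m r w).
have mI : measurable_fun [set: T * measurableTypeR R] (fun p => I p.2 p.1).
  apply: measurable_funM; first exact: (measurableT_comp mzetaT measurable_fst).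
  have sw : measurable_fun [set: T * measurableTypeR R] (fun p => (p.2, p.1) : measurableTypeR R * T).
    by apply/measurable_fun_pairP; split => /=; [exact: measurable_snd|exact: measurable_fst].
  apply: measurable_funM; last exact: (measurableT_comp (drift_joint k m) sw).
  apply: (measurableT_comp (cmeas cdG)); apply: measurable_funD.
    exact: (measurableT_comp mU measurable_fst).
  exact: (measurableT_comp (push_joint k m) sw).
have IC r w : `|I r w| <= Cz * (C1 * Cb k).
  rewrite normrM; apply: ler_pM => //; rewrite normrM.
  by apply: ler_pM => //; exact: drift_le.
have pathwise w : zeta w * G (proxy k m t w - z) = zeta w * G (U w) + \int[mu]_(r in `[s0, t]) I r w.
  have -> : proxy k m t w - z = U w + push k m t w by rewrite /proxy /U; ring.
  have h := chain_rule (drift_path k m w) (fun x => drift_le k m x w) (U w) GE dGK (ltW s0t).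
  rewrite -[G (U w + _)](subrK (G (U w))) h mulrDr addrC; congr (_ + _).
  rewrite -RintegralZl//.
  have mD : measurable_fun [set: R] (fun r => dG (U w + push k m r w) * drift k m r w).
    apply: measurable_funM; last exact: drift_path.
    apply: (measurableT_comp (cmeas cdG)); apply: measurable_funD => //.
    exact: (measurableT_comp (push_joint k m) (measurable_pair2 w)).
  by apply: (integrable_itv mD (C := C1 * Cb k)) => r _; rewrite normrM; apply: ler_pM => //; exact: drift_le.
have i1 : P.-integrable setT (EFin \o (fun w => zeta w * G (U w))).
  apply: (@bounded_integrable _ _ _ P _ _ (Cz * C)) => //.
    by apply: measurable_funM => //; exact: (measurableT_comp (cmeas cG) mU).
  by move=> w _; rewrite normrM ler_pM.
have i2 : P.-integrable setT (EFin \o (fun w => \int[mu]_(r in `[s0, t]) I r w)).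
  apply: (@bounded_integrable _ _ _ P _ _ (Cz * (C1 * Cb k) * (t - s0))) => //.
    apply: (@measurable_Rintegral_param R _ T _ _ mu _ (fun r w => I r w)) => //.
    apply: (measurableT_comp mI (_ : measurable_fun setT (fun q : measurableTypeR R * T => (q.2, q.1)))).
    by apply/measurable_fun_pairP; split => /=; [exact: measurable_snd|exact: measurable_fst].
  move=> w _; apply: Rintegral_itv_le; first exact: ltW.
    exact: (measurableT_comp mI (measurable_pair1 w)).
  by move=> r _; exact: IC.
under eq_Rintegral do rewrite pathwise.
rewrite (RintegralD measurableT i1 i2).
rewrite (@Rintegral_swap _ _ T (measurableTypeR R) R P mu `[s0, t]%classic (fun w r => I r w) (cst (Cz * (C1 * Cb k))))//; last first.
  by apply: (@integrable_itv _ _ _ _ (Cz * (C1 * Cb k))) => // x _ /=; rewrite ger0_norm//; exact: mulr_ge0 Cz0 (mulr_ge0 C10 (Cb0 k)).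
apply: (@le_trans _ _ (`|\int[P]_w (zeta w * G (U w))|%:E + `|\int[mu]_(r in `[s0, t]) \int[P]_w I r w|%:E)%E).
  by rewrite -EFinD lee_fin ler_normD.
apply: leeD.
  rewrite lee_fin (@ae_eq_Rintegral _ _ _ P _ (fun w => zeta w * G (X s0 w - z + (L t w - L s0 w)))).
  - have mXz : measurable_fun [set: g_sigma_algebraType (F s0)] ((fun w => X s0 w - z) : T -> measurableTypeR R).
      by apply: measurable_funB => //; exact: mX.
    have [h _] := smooth s00 s0t ts1 mzeta mXz nzeta a0 tf.
    apply: (le_trans h); rewrite le_eqVlt; apply/orP; left; apply/eqP; congr (_ * _).
    by apply: eq_Rintegral => w _; rewrite ger0_norm.
  - by apply: measurable_funM => //; exact: (measurableT_comp (cmeas cG) mU).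
  - apply: measurable_funM => //; apply: (measurableT_comp (cmeas cG)).
    apply: measurable_funD; first by apply: measurable_funB => //; exact: filtration_measurableT (@mX s0).
    by apply: measurable_funB; exact: filtration_measurableT (@mL _).
  - by apply: filterS UE => w ->.
pose f r := \int[P]_w I r w.
have mf : measurable_fun [set: R] f.
  exact: (@measurable_Rintegral_param R _ (measurableTypeR R) _ _ P setT (fun w r => I r w)).
have fC r : `|f r| <= Cz * (C1 * Cb k).
  rewrite -[leRHS]mulr1 -(_ : fine (P setT) = 1); last by rewrite probability_setT.
  apply: (@Rintegral_le_bound _ _ _ P) => //.
  exact: (measurableT_comp mI (measurable_pair2 r)).
have if_ : mu.-integrable `[s0, t] (EFin \o f) by exact: integrable_itv mf (fun x _ => fC x).
(* The endpoint [r = t] is removed because smoothing requires [r < t]. *)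
have if' : mu.-integrable `[s0, t[ (EFin \o f).
  by apply: integrableS if_ => //; apply: subset_itvl; rewrite bnd_simp.
rewrite -Rintegral_itv_bndo_bndc//.
apply: (@le_trans _ _ (\int[mu]_(r in `[s0, t[) `|f r|)%:E); first by rewrite lee_fin le_normr_Rintegral.
rewrite fineK; last exact: (integrable_fin_num _ (integrable_norm if')).
have mresp : measurable_fun [set: measurableTypeR R] (fun r => (t - r) `^ (- kap) * response k m z r).
  apply: measurable_funM.
    apply: (@measurableT_comp _ _ _ _ _ _ (@powR R ^~ (- kap))) => //.
    exact: measurable_funB.
  exact: response_measurable.
have resp0 r : 0 <= (t - r) `^ (- kap) * response k m z r.
  by rewrite mulr_ge0 ?powR_ge0// response_ge0.
rewrite -ge0_integralZl_EFin//; last 2 first.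
- by move=> r _; rewrite lee_fin.
- by apply/measurable_EFinP; exact: measurable_funTS.
apply: ge0_le_integral => //.
- by apply/measurable_EFinP; apply: measurable_funTS; exact: measurableT_comp.
- by apply: measurable_funeM; apply/measurable_EFinP; exact: measurable_funTS.
move=> r; rewrite /= in_itv/= => /andP[s0r rt]; rewrite lee_fin.
have r0 : 0 <= r by exact: le_trans s0r.
have tr1 : t - r <= 1 by apply: le_trans ts1; rewrite lerB.
(* The part of [U + push r] known at time [r]: almost surely the sum equals [Zr] plus the increment
   of [L] over [[r, t]]. *)
pose Zr w := X s0 w + L r w - L s0 w + push k m r w - z.
have mZr : measurable_fun [set: g_sigma_algebraType (F r)] (Zr : T -> measurableTypeR R).
  have m1 := filtration_measurable s0r (@mX s0).
  have m2 := filtration_measurable s0r (@mL s0).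
  have m3 := measurable_funB (measurable_funD m1 (@mL r)) m2.
  have m4 := measurable_funD m3 (@push_adapted k m r).
  exact: (measurable_funB m4 (@measurable_cst _ _ (g_sigma_algebraType (F r)) (measurableTypeR R) setT z)).
have mxi : measurable_fun [set: g_sigma_algebraType (F r)] (fun w => zeta w * drift k m r w).
  apply: measurable_funM; last exact: drift_adapted.
  exact: (filtration_measurable s0r mzeta).
have xiC w : `|zeta w * drift k m r w| <= Cz * Cb k.
  by rewrite normrM; apply: ler_pM => //; exact: drift_le.
have [_ h] := smooth r0 rt tr1 mxi mZr xiC a0 tf.
rewrite mulrA.
have <- : \int[P]_w (`|zeta w * drift k m r w| * kc eta a (Zr w)) = response k m z r.
  apply: ae_eq_Rintegral.
  - apply: measurable_funM.
      by apply: measurableT_comp => //; exact: filtration_measurableT mxi.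
    by apply: (measurableT_comp (cmeas (kc_continuous e01 a0))); exact: filtration_measurableT mZr.
  - exact: (measurableT_comp (response_integrand_measurable k m z) (measurable_pair1 r)).
  - by apply: filterS (ZE r r0) => w ->; rewrite normrM ger0_norm.
apply: le_trans h; rewrite /f le_eqVlt; apply/orP; left; apply/eqP; congr (`|_|).
apply: ae_eq_Rintegral.
- exact: (measurableT_comp mI (measurable_pair2 r)).
- apply: measurable_funM; first exact: filtration_measurableT mxi.
  apply: (measurableT_comp (cmeas cdG)); apply: measurable_funD; first exact: filtration_measurableT mZr.
  by apply: measurable_funB; exact: filtration_measurableT (@mL _).
- apply: filterS UE => w Uw; rewrite /I {}Uw /Zr [dG _ * _]mulrC mulrA; congr (_ * dG _); ring.
Qed.

Lemma expectation_proxy_measurable k m z :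
  measurable_fun [set: measurableTypeR R] (fun t => \int[P]_w (zeta w * G (proxy k m t w - z))).
Proof.
apply: (@measurable_Rintegral_param R _ (measurableTypeR R) _ _ P setT
  (fun w t => zeta w * G (proxy k m t w - z))) => //.
apply: measurable_funM; first exact: (measurableT_comp mzetaT measurable_fst).
apply: (measurableT_comp (cmeas cG)).
have sw : measurable_fun [set: T * measurableTypeR R] (fun p => (p.2, p.1) : measurableTypeR R * T).
  by apply/measurable_fun_pairP; split => /=; [exact: measurable_snd|exact: measurable_fst].
exact: (measurable_funB (measurableT_comp (proxy_joint k m) sw) (measurable_cst z)).
Qed.

Lemma duhamel_integrated k m z S h : s0 <= S -> S - s0 <= h -> h <= 1 ->
  (\int[mu]_(t in `[s0, S]) `|\int[P]_w (zeta w * G (proxy k m t w - z))|%:E <=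
   (Ag * (h `^ (1 - kap) / (1 - kap)) * \int[P]_w zeta w)%:E +
   (Ag * (h `^ (1 - kap) / (1 - kap)))%:E * \int[mu]_(r in `[s0, S]) (response k m z r)%:E)%E.
Proof.
move=> s0S Sh h1.
set c := h `^ (1 - kap) / (1 - kap).
have h0 : 0 <= h by apply: le_trans Sh; rewrite subr_ge0.
have c0 : 0 <= c by case/andP: kap01 => _ k1; rewrite /c divr_ge0 ?powR_ge0// subr_ge0 ltW.
have A0 : 0 <= Ag.
  have hh : 0 < a `^ (eta - 1) by rewrite powR_gt0.
  by case: tf => _ _ _ _ dGC; rewrite -(pmulr_lge0 _ hh); exact: le_trans (dGC 0).
set p := \int[P]_w zeta w.
have p0 : 0 <= p by apply: Rintegral_ge0.
pose D : set (measurableTypeR R) := `]s0, S]%classic.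
pose D' : set (measurableTypeR R) := `[s0, S]%classic.
have mD : measurable D by exact: measurable_itv.
have mD' : measurable D' by exact: measurable_itv.
(* The indicator builds the constraint [r < t] into a function of [t - r], so that the integrand is
   a convolution kernel on the full product space. *)
pose q (u : R) : R := u `^ (- kap) * \1_(`]0, +oo[%classic) u.
have mq : measurable_fun [set: R] q.
  apply: measurable_funM; first exact: measurable_powR.
  by apply: measurable_indic; exact: measurable_itv.
have q0 u : 0 <= q u by rewrite mulr_ge0 ?powR_ge0.
pose resp := response k m z.
have resp0 r : 0 <= resp r by exact: response_ge0.
have mresp : measurable_fun [set: measurableTypeR R] resp by exact: response_measurable.
pose H (o : measurableTypeR R * measurableTypeR R) : \bar R :=
  (\1_D o.1 * (q (o.1 - o.2) * (\1_D' o.2 * resp o.2)))%:E.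
have i0 (E : set (measurableTypeR R)) x : 0 <= \1_E x :> R by rewrite indicE ler0n.
have H0 o : (0 <= H o)%E.
  by rewrite lee_fin; apply: mulr_ge0 => //; apply: mulr_ge0 => //; exact: mulr_ge0.
have mH : measurable_fun setT H.
  apply/measurable_EFinP; apply: measurable_funM.
    exact: (measurableT_comp (measurable_indic mD) measurable_fst).
  apply: measurable_funM.
    apply: (measurableT_comp mq); apply: measurable_funB; [exact: measurable_fst|exact: measurable_snd].
  apply: (measurableT_comp (_ : measurable_fun [set: measurableTypeR R] (fun r => \1_D' r * resp r)) measurable_snd).
  by apply: measurable_funM => //; exact: measurable_indic.
have mE := expectation_proxy_measurable k m z.
have mabs : measurable_fun [set: measurableTypeR R] (fun t => `|\int[P]_w (zeta w * G (proxy k m t w - z))|%:E).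
  by apply/measurable_EFinP; apply: measurableT_comp.
(* The left endpoint is dropped since [duhamel] asks for [s0 < t]. *)
rewrite -integral_itv_obnd_cbnd; last exact: measurable_funTS.
have msh : measurable_fun [set: R] (fun t : R => (t - s0) `^ (- kap)).
  apply: (@measurableT_comp _ _ _ _ _ _ (@powR R ^~ (- kap))) => //.
  exact: measurable_funB.
have mFT := measurable_fun_fubini_tonelli_F (m2 := mu) H mH H0.
have FT0 t : (0 <= \int[mu]_r H (t, r))%E by exact: integral_ge0.
have DE f : (forall t, 0 <= f t)%E -> (\int[mu]_(t in D) f t = \int[mu]_t (f t * (\1_D t)%:E))%E.
  by move=> f0; rewrite integral_mkcond; apply: eq_integral => t _; rewrite epatch_indic.
apply: (@le_trans _ _ (\int[mu]_(t in D) ((Ag * p)%:E * ((t - s0) `^ (- kap))%:E + Ag%:E * \int[mu]_r H (t, r)))%E).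
  apply: ge0_le_integral => //.
  - exact: measurable_funTS.
  - apply: measurable_funTS; apply: emeasurable_funD.
      by apply: measurable_funeM; exact/measurable_EFinP.
    by apply: measurable_funeM; exact: mFT.
  - move=> t; rewrite /D/= in_itv/= => /andP[s0t tS].
    have ts1 : t - s0 <= 1 by apply: le_trans h1; apply: le_trans Sh; rewrite lerB.
    apply: (le_trans (duhamel k m z s0t ts1)); apply: leeD.
      by rewrite -EFinM lee_fin -/p mulrAC.
    apply: lee_wpmul2l; first by rewrite lee_fin.
    rewrite integral_mkcond; apply: ge0_le_integral; first exact: measurableT.
    + by move=> r _; apply: erestrict_ge0 => u _; rewrite lee_fin mulr_ge0 ?powR_ge0.
    + apply/(measurable_restrictT _ (measurable_itv _)); apply: measurable_funTS.
      apply/measurable_EFinP; apply: measurable_funM => //.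
      apply: (@measurableT_comp _ _ _ _ _ _ (@powR R ^~ (- kap))) => //.
      exact: measurable_funB.
    + exact: (measurableT_comp mH (measurable_pair1 t)).
    + move=> r _; rewrite epatch_indic /H/= -EFinM lee_fin [X in _ * X <= _]indicE.
      have [rD|rD] := boolP (r \in `[s0, t[%classic); last by rewrite mulr0 -lee_fin; exact: (H0 (t, r)).
      move: rD => /set_mem; rewrite /= in_itv/= => /andP[s0r rt].
      rewrite /q !indicE !mem_set ?mul1r ?mulr1 /q ?indicE ?mem_set ?mulr1//=; rewrite ?in_itv/= ?andbT ?s0r ?subr_gt0 ?s0t//=.
      * by rewrite /D'/= in_itv/= s0r (ltW (lt_le_trans rt tS)).
      * by rewrite /D/= in_itv/= s0t.
rewrite ge0_integralD//; last 4 first.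
- by move=> t _; rewrite -EFinM lee_fin !mulr_ge0 ?powR_ge0.
- by apply: measurable_funTS; apply: measurable_funeM; exact/measurable_EFinP.
- by move=> t _; rewrite mule_ge0.
- by apply: measurable_funTS; apply: measurable_funeM; exact: mFT.
rewrite ge0_integralZl_EFin//; last 3 first.
- by move=> t _; rewrite lee_fin powR_ge0.
- by apply/measurable_EFinP; exact: measurable_funTS.
- by rewrite mulr_ge0.
rewrite ge0_integralZl_EFin//; last exact: measurable_funTS.
apply: leeD.
  rewrite [leRHS](_ : _ = (Ag * p)%:E * c%:E)%E; last by rewrite -EFinM mulrAC.
  rewrite lee_wpmul2l ?lee_fin ?mulr_ge0//.
  apply: le_trans (powR_singular_integral s0 kap01 h0).
  apply: ge0_subset_integral => //.
  - by apply/measurable_EFinP; exact: measurable_funTS.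
  - by move=> t _; rewrite lee_fin powR_ge0.
  - by apply: subset_itvl; rewrite bnd_simp; lra.
rewrite EFinM -muleA lee_wpmul2l ?lee_fin//.
apply: (@le_trans _ _ (\int[mu]_t \int[mu]_r H (t, r))%E).
  by apply: ge0_subset_integral.
have -> : (\int[mu]_t \int[mu]_r H (t, r) = \int[mu]_r \int[mu]_t H (t, r))%E.
  exact: (fubini_tonelli (m1 := mu) (m2 := mu) _ mH H0).
have -> : (\int[mu]_(r in D') (resp r)%:E = \int[mu]_r (\1_D' r * resp r)%:E)%E.
  rewrite integral_mkcond; apply: eq_integral => r _; rewrite epatch_indic.
  by rewrite mulrC EFinM.
have mDr : measurable_fun [set: measurableTypeR R] (fun r => (\1_D' r * resp r)%:E).
  by apply/measurable_EFinP; apply: measurable_funM => //; exact: measurable_indic.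
rewrite -ge0_integralZl_EFin//; last by move=> r _; rewrite lee_fin mulr_ge0.
apply: ge0_le_integral; first exact: measurableT.
- by move=> r _; exact: integral_ge0.
- exact: (measurable_fun_fubini_tonelli_G (m1 := mu) H mH H0).
- exact: measurable_funeM.
move=> r _; have [rD|rD] := boolP (r \in D'); last first.
  rewrite (_ : (\int[mu]_t H (t, r))%E = 0%E); last first.
    by apply: integral0_eq => t _; rewrite /H/= [\1_D' r]indicE (negbTE rD) mul0r !mulr0.
  by rewrite [\1_D' r]indicE (negbTE rD) mul0r mule0.
have rS : s0 <= r <= S by move: rD => /set_mem; rewrite /D'/= in_itv.
rewrite indicE rD mul1r.
have mrh : measurable_fun [set: R] (fun t => (t - r) `^ (- kap) * \1_(`]r, (r + h)%R]%classic) t).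
  apply: measurable_funM; last by apply: measurable_indic; exact: measurable_itv.
  apply: (@measurableT_comp _ _ _ _ _ _ (@powR R ^~ (- kap))) => //.
  exact: measurable_funB.
apply: (@le_trans _ _ (\int[mu]_t ((resp r)%:E * ((t - r) `^ (- kap) * \1_(`]r, (r + h)%R]%classic) t)%:E))%E).
  apply: ge0_le_integral; first exact: measurableT.
  - by [].
  - exact: (measurableT_comp mH (measurable_pair2 r)).
  - by apply: measurable_funeM; apply/measurable_EFinP; exact: mrh.
  - move=> t _; rewrite /H/= -EFinM lee_fin [\1_D' r]indicE rD mul1r.
    have [tD|tD] := boolP (t \in D); last first.
      by rewrite indicE (negbTE tD) mul0r !mulr_ge0 ?powR_ge0.
    rewrite indicE tD mul1r mulrC ler_wpM2l// /q ler_wpM2l ?powR_ge0//.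
    rewrite !indicE; have [|tr] := boolP (t - r \in _); last by rewrite ler0n.
    move=> /set_mem; rewrite /= in_itv/= andbT subr_gt0 => rt.
    rewrite mem_set//= in_itv/= rt/=.
    move: tD => /set_mem; rewrite /D/= in_itv/= => /andP[_ tS].
    apply: (le_trans tS); rewrite -lerBlDl; apply: le_trans Sh.
    by case/andP: rS => s0r _; rewrite lerB.
rewrite ge0_integralZl_EFin//; last 2 first.
- by move=> t _; rewrite lee_fin mulr_ge0 ?powR_ge0.
- by apply/measurable_EFinP; exact: mrh.
rewrite muleC lee_wpmul2r ?lee_fin//.
apply: le_trans (powR_singular_integral r kap01 h0).
rewrite [leRHS]integral_mkcond le_eqVlt; apply/orP; left; apply/eqP; apply: eq_integral => t _.
by rewrite epatch_indic EFinM.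
Qed.

End duhamel.

(** * From the proxy back to the path *)

Definition path_integral k t w : R := \int[mu]_(v in `[0, t]) b k (X v w).

Hypothesis ucp : ucp_limit P path_integral A.

Lemma path_integral_measurable k t : measurable_fun [set: T] (path_integral k t : T -> measurableTypeR R).
Proof.
apply: (@measurable_Rintegral_param R _ T _ _ mu _ (fun u w => b k (X u w))) => //.
apply: (measurableT_comp (mb k)); exact: (process_measurable mX rcX).
Qed.

Lemma path_integral_continuous k w : continuous (path_integral k ^~ w).
Proof.
by apply: (@primitive_continuous R (fun u => b k (X u w)) 0 (Cb k)) => [|x]; [exact: mbX|exact: bC].
Qed.

Definition clamp (S v : R) : R := Num.max 0 (Num.min v S).

(** The event that the uniform distance on [[0, S]] exceeds [del], written as a countable union over
    clamped rationals to make it measurable. *)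
Definition deviation k (S del : R) : set T :=
  \bigcup_(q : rat) [set w | del < `|path_integral k (clamp S (ratr q)) w - A (clamp S (ratr q)) w|].

Lemma deviation_measurable k S del : measurable (deviation k S del).
Proof.
apply: countable_bigcupT_measurable; first exact: countableP.
move=> q; rewrite -[X in measurable X]setTI.
pose f w := `|path_integral k (clamp S (ratr q)) w - A (clamp S (ratr q)) w|.
have mf : measurable_fun [set: T] f.
  by apply: measurableT_comp => //; apply: measurable_funB; [exact: path_integral_measurable|exact: mA].
rewrite (_ : [set _ | _] = f @^-1` `]del, +oo[%classic); first exact: mf.
by apply/seteqP; split => w /=; rewrite in_itv/= andbT.
Qed.

Lemma clampE S v : 0 <= v <= S -> clamp S v = v.
Proof. by move=> /andP[v0 vS]; rewrite /clamp min_l// max_r. Qed.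

Lemma clamp_itv S v : 0 <= S -> 0 <= clamp S v <= S.
Proof.
by move=> S0; rewrite /clamp le_max lexx ge_max S0 ge_min lexx orbT.
Qed.

Lemma clamp_continuous S : continuous (clamp S).
Proof.
apply: (@lipschitz_cont R _ 1) => x y xy; rewrite mul1r /clamp.
have mx (p q : R) : p <= q -> `|Num.max 0 q - Num.max 0 p| <= q - p.
  by move=> pq; have [h3|h3] := leP 0 p; have [h4|h4] := leP 0 q; rewrite ler_norml; apply/andP; split; lra.
have mn : Num.min x S <= Num.min y S /\ Num.min y S - Num.min x S <= y - x.
  by have [h1|h1] := leP x S; have [h2|h2] := leP y S; split; lra.
by apply: le_trans mn.2; exact: mx mn.1.
Qed.

(** The strict inequality defines an open set of times by continuity of both paths, and a nonempty
    open set contains a rational. *)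
Lemma deviationP k S del w : 0 <= S ->
  deviation k S del w <-> exists2 v, 0 <= v <= S & del < `|path_integral k v w - A v w|.
Proof.
move=> S0; split=> [[q _ /= h]|[v vS h]].
  by exists (clamp S (ratr q)) => //; exact: clamp_itv.
pose f u := `|path_integral k (clamp S u) w - A (clamp S u) w|.
have cf : continuous f.
  move=> u; apply: cvg_norm; apply: cvgB.
    by apply: (@continuous_comp _ _ _ (clamp S) (path_integral k ^~ w)); [exact: clamp_continuous|exact: path_integral_continuous].
  by apply: (@continuous_comp _ _ _ (clamp S) (A ^~ w)); [exact: clamp_continuous|exact: cA].
have oU : open [set u | del < f u].
  apply: (@open_comp _ _ f [set y | del < y]); last exact: open_gt.
  by move=> u _; exact: cf.
have U0 : [set u | del < f u] !=set0 by exists v; rewrite /= /f clampE.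
have [u [hu [q _ qu]]] := @dense_rat R _ U0 oU.
by exists q => //; rewrite qu.
Qed.

Lemma deviation_cvg S del : 0 <= S -> 0 < del -> P (deviation k S del) @[k --> \oo] --> 0%E.
Proof.
move=> S0 d0; have := ucp S0 d0; apply: cvg_trans; apply: near_eq_cvg; near=> k.
congr (P _); apply/seteqP; split => w /=.
  move=> /ereal_sup_gt[_ [v vS <-]]; rewrite lte_fin => h.
  by apply/(deviationP _ _ _ S0); exists v => //; move: vS; rewrite /= in_itv.
move=> /(deviationP _ _ _ S0)[v vS h].
apply: (@lt_le_trans _ _ `|path_integral k v w - A v w|%:E); first by rewrite lte_fin.
by apply: ereal_sup_ubound; exists v => //=; rewrite in_itv.
Unshelve. all: by end_near.
Qed.

(** First [del] is made small against the Lipschitz cost [K]; then convergence in probability makes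
    the exceptional event small against [C] for all large [k]. *)
Lemma deviation_small S K C eps : 0 <= S -> 0 <= K -> 0 <= C -> 0 < eps ->
  exists2 del, 0 < del & \forall k \near \oo, K * del + C * fine (P (deviation k S del)) <= eps.
Proof.
move=> S0 K0 C0 eps0; pose del := eps / 2 / (K + 1).
have K1 : 0 < K + 1 by rewrite ltr_wpDl.
have C1 : 0 < C + 1 by rewrite ltr_wpDl.
have d0 : 0 < del by rewrite !divr_gt0.
exists del => //; have e0 : 0 < eps / 2 / (C + 1) by rewrite !divr_gt0.
have := deviation_cvg S0 d0.
move=> /fine_cvgP[_] /cvgrPdist_lt/(_ _ e0); apply: filterS => k /=.
rewrite sub0r normrN ger0_norm ?fine_ge0// => h.
have h1 : K * del <= eps / 2.
  by rewrite /del mulrCA ler_piMr ?divr_ge0 ?ltW// ltr_pdivrMr// mul1r ltrDl.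
have h2 : C * fine (P (deviation k S del)) <= eps / 2.
  apply: (@le_trans _ _ ((C + 1) * fine (P (deviation k S del)))).
    by rewrite ler_wpM2r ?fine_ge0// lerDl.
  by rewrite mulrC -ler_pdivlMr// ltW.
lra.
Qed.

(** While the cutoff is active, the proxy differs from [X] by the error of [path_integral] at [t]
    minus that at [s0], whence the factor [2]. *)
Lemma proxy_close k m t S del w : s0 <= t <= S -> cutoff m t w != 0 -> ~ deviation k S del w ->
  `|proxy k m t w - X t w| <= 2 * del.
Proof.
move=> /andP[s0t tS] act ndev.
have t0 := le_trans s00 s0t; have S0 := le_trans t0 tS.
have H v : 0 <= v <= S -> `|path_integral k v w - A v w| <= del.
  move=> vS; rewrite leNgt; apply/negP => h; apply: ndev.
  by apply/(deviationP _ _ _ S0); exists v.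
rewrite /proxy (push_active k s00 s0t act) -/(path_integral k t w) -/(path_integral k s0 w).
have -> : X t w - (A t w - A s0 w) + (path_integral k t w - path_integral k s0 w) - X t w =
   (path_integral k t w - A t w) - (path_integral k s0 w - A s0 w) by ring.
apply: (le_trans (ler_normB _ _)); rewrite mulr_natl mulr2n lerD// H//.
  by rewrite t0.
by rewrite s00 (le_trans s0t).
Qed.

(** Off the deviation event the Lipschitz bound applies; on it, the trivial bound [2 * C]. *)
Lemma cutoff_close (f : R -> R) K C k m t S del w z : 0 <= K -> 0 <= del ->
  (forall x y, `|f x - f y| <= K * `|x - y|) -> (forall x, `|f x| <= C) -> s0 <= t <= S ->
  cutoff m t w != 0 ->
  `|f (X t w - z) - f (proxy k m t w - z)| <= 2 * K * del + 2 * C * \1_(deviation k S del) w.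
Proof.
move=> K0 d0 fK fC ts act.
have C0 : 0 <= C by apply: le_trans (fC 0).
rewrite indicE; have [|/negP] := boolP (w \in deviation k S del).
  move=> _; rewrite mulr1; apply: (@le_trans _ _ (2 * C)); last by rewrite lerDr !mulr_ge0.
  by apply: (le_trans (ler_normB _ _)); rewrite mulr_natl mulr2n lerD.
rewrite inE mulr0 addr0 => ndev; apply: (le_trans (fK _ _)).
rewrite (_ : _ - z - _ = - (proxy k m t w - X t w)); last by ring.
rewrite normrN [2 * K]mulrC -mulrA ler_wpM2l//; exact: proxy_close ndev.
Qed.

(** The cutoff bounds the variations for all indices at once, so this weight and its functional
    [occ] do not depend on [k]. The iteration needs this, since it uses different indices at
    different steps. *)
Definition weight m S r w : R := zeta w * cutoff m r w * \1_(`[s0, S]%classic) r.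

Lemma weight_ge0 m S r w : 0 <= weight m S r w.
Proof. by rewrite /weight !mulr_ge0 ?cutoff_ge0// indicE ler0n. Qed.

Lemma weight_joint m S : measurable_fun [set: measurableTypeR R * T] (fun p => weight m S p.1 p.2).
Proof.
apply: measurable_funM.
  by apply: measurable_funM; [exact: (measurableT_comp mzetaT measurable_snd)|exact: cutoff_joint].
have mD : measurable (`[s0, S]%classic : set (measurableTypeR R)) by exact: measurable_itv.
exact: (measurableT_comp (measurable_indic mD) measurable_fst).
Qed.

Lemma weighted_drift k m S (g : T -> R) : 0 <= m -> measurable_fun [set: T] g ->
  (forall w, 0 <= g w) ->
  (\int[mu]_(r in `[s0, S]) \int[P]_w (g w * `|drift k m r w|)%:E <=
   m%:E * \int[P]_w (g w)%:E)%E.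
Proof.
move=> m0 mg g0.
pose D : set (measurableTypeR R) := `[s0, S]%classic.
have mD : measurable D by exact: measurable_itv.
have i0 x : 0 <= \1_D x :> R by rewrite indicE ler0n.
pose H (o : measurableTypeR R * T) : \bar R := (g o.2 * `|drift k m o.1 o.2| * \1_D o.1)%:E.
have H0 o : (0 <= H o)%E by rewrite lee_fin !mulr_ge0.
have mH : measurable_fun setT H.
  apply/measurable_EFinP; apply: measurable_funM.
    apply: measurable_funM; first exact: (measurableT_comp mg measurable_snd).
    by apply: measurableT_comp => //; exact: drift_joint.
  exact: (measurableT_comp (measurable_indic mD) measurable_fst).
have mgd r : measurable_fun [set: T] (fun w => (g w * `|drift k m r w|)%:E).
  apply/measurable_EFinP; apply: measurable_funM => //.
  by apply: measurableT_comp => //; exact: (measurableT_comp (drift_joint k m) (measurable_pair1 r)).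
have -> : (\int[mu]_(r in `[s0, S]) \int[P]_w (g w * `|drift k m r w|)%:E = \int[mu]_r \int[P]_w H (r, w))%E.
  rewrite integral_mkcond; apply: eq_integral => r _; rewrite epatch_indic.
  rewrite -ge0_integralZr//.
  - by move=> w _; rewrite lee_fin mulr_ge0.
  - by rewrite lee_fin.
have -> : (\int[mu]_r \int[P]_w H (r, w) = \int[P]_w \int[mu]_r H (r, w))%E.
  exact: (fubini_tonelli (m1 := mu) (m2 := P) _ mH H0).
rewrite -ge0_integralZl_EFin//; last 2 first.
- by move=> w _; rewrite lee_fin.
- exact/measurable_EFinP.
apply: ge0_le_integral; first exact: measurableT.
- by move=> w _; exact: integral_ge0.
- exact: (measurable_fun_fubini_tonelli_G (m1 := mu) H mH H0).
- by apply: measurable_funeM; exact/measurable_EFinP.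
move=> w _.
have mdw : measurable_fun [set: R] (fun r => `|drift k m r w|).
  by apply: measurableT_comp => //; exact: drift_path.
have -> : (\int[mu]_r H (r, w) = (g w)%:E * \int[mu]_(r in D) `|drift k m r w|%:E)%E.
  rewrite [in RHS]integral_mkcond -ge0_integralZl_EFin//.
  - by apply: eq_integral => r _; rewrite epatch_indic /H/= -!EFinM mulrA.
  - by move=> r _; apply: erestrict_ge0.
  - apply/(measurable_restrictT _ mD); apply/measurable_EFinP; exact: measurable_funTS.
rewrite muleC lee_wpmul2r ?lee_fin//.
apply: le_trans (drift_variation k S w m0).
apply: ge0_subset_integral => //.
- by apply/measurable_EFinP; exact: measurable_funTS.
- by apply: subset_itvr; rewrite bnd_simp.
Qed.

Lemma error_integral (E : set T) (c1 c2 : R) : measurable E -> 0 <= c1 -> 0 <= c2 ->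
  (\int[P]_w (Cz * (c1 + c2 * (\1_E w : R)))%:E = (Cz * (c1 + c2 * fine (P E)))%:E)%E.
Proof.
move=> mE c10 c20.
have mi : measurable_fun [set: T] (\1_E : T -> R) by exact: measurable_indic.
have m2 : measurable_fun [set: T] (fun w => c2 * (\1_E w : R)) by exact: measurable_funM.
under eq_integral do rewrite EFinM.
rewrite ge0_integralZl_EFin//; last 2 first.
- by move=> w _; rewrite lee_fin addr_ge0// mulr_ge0.
- by apply/measurable_EFinP; exact: measurable_funD.
rewrite EFinM; congr (_ * _)%E.
under eq_integral do rewrite EFinD.
rewrite ge0_integralD//; last 2 first.
- by move=> w _; rewrite lee_fin mulr_ge0.
- exact/measurable_EFinP.
rewrite integral_cst//= probability_setT mule1 EFinD; congr (_ + _)%E.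
under eq_integral do rewrite EFinM.
rewrite ge0_integralZl_EFin//; last exact/measurable_EFinP.
rewrite integral_indic// setIT EFinM fineK//.
by rewrite ge0_fin_numE//; exact: le_lt_trans (probability_le1 _ mE) (ltry _).
Qed.

Lemma cutoff_expectation_close (f : R -> R) K C k m t S del z : 0 <= K -> 0 <= del ->
  (forall x y, `|f x - f y| <= K * `|x - y|) -> (forall x, `|f x| <= C) -> continuous f ->
  s0 <= t <= S ->
  P.-integrable setT (EFin \o (fun w => zeta w * cutoff m t w * `|f (X t w - z) - f (proxy k m t w - z)|)) /\
  \int[P]_w (zeta w * cutoff m t w * `|f (X t w - z) - f (proxy k m t w - z)|) <=
  Cz * (2 * K * del + 2 * C * fine (P (deviation k S del))).
Proof.
move=> K0 d0 fK fC cf ts.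
have C0 : 0 <= C by apply: le_trans (fC 0).
have mdev := deviation_measurable k S del.
have mpt : measurable_fun [set: T] (proxy k m t).
  exact: (measurableT_comp (proxy_joint k m) (measurable_pair1 t)).
have mct : measurable_fun [set: T] (cutoff m t).
  exact: (measurableT_comp (cutoff_joint m) (measurable_pair1 t)).
have i1 : P.-integrable setT (EFin \o (fun w => zeta w * cutoff m t w * `|f (X t w - z) - f (proxy k m t w - z)|)).
  apply: (@bounded_integrable _ _ _ P _ _ (Cz * (C + C))) => //.
    apply: measurable_funM; first exact: measurable_funM.
    apply: measurableT_comp => //; apply: measurable_funB.
      by apply: (measurableT_comp (cmeas cf)); apply: measurable_funB => //; exact: filtration_measurableT (@mX t).
    by apply: (measurableT_comp (cmeas cf)); apply: measurable_funB.
  move=> w _; rewrite !normrM normr_id (ger0_norm (cutoff_ge0 _ _ _)); apply: ler_pM => //.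
  - by rewrite mulr_ge0 ?cutoff_ge0.
  - by rewrite -[leRHS]mulr1; apply: ler_pM => //; apply: cutoff_le1.
  - by apply: (le_trans (ler_normB _ _)); rewrite lerD.
have mR : measurable_fun [set: T] (fun w => 2 * C * (\1_(deviation k S del) w : R)).
  by apply: measurable_funM => //; exact: measurable_indic.
have i2 : P.-integrable setT (EFin \o (fun w => 2 * C * (\1_(deviation k S del) w : R))).
  apply: (@bounded_integrable _ _ _ P _ _ (2 * C)) => // w _.
  by rewrite indicE; case: (_ \in _); rewrite ?mulr1 ?mulr0 ?normr0 ?ger0_norm ?mulr_ge0.
have i3 : P.-integrable setT (EFin \o (cst (2 * K * del) : T -> R)).
  exact: finite_measure_integrable_cst.
have i4 : P.-integrable setT (EFin \o (fun w => 2 * K * del + 2 * C * (\1_(deviation k S del) w : R))).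
  exact: (integrableD measurableT i3 i2).
split=> //.
have h2K : 0 <= 2 * K * del by apply: mulr_ge0 => //; exact: mulr_ge0.
have h2C : 0 <= 2 * C by exact: mulr_ge0.
have E : Cz * (2 * K * del + 2 * C * fine (P (deviation k S del))) =
   \int[P]_w (Cz * (2 * K * del + 2 * C * (\1_(deviation k S del) w : R))).
  by rewrite /Rintegral error_integral.
rewrite E; apply: le_Rintegral => //.
  by apply: (integrableZl measurableT _ i4).
move=> w _; rewrite -mulrA; apply: ler_pM => //.
  by rewrite mulr_ge0 ?cutoff_ge0.
have [->|act] := eqVneq (cutoff m t w) 0.
  by rewrite mul0r addr_ge0 ?mulr_ge0// indicE ler0n.
apply: (@le_trans _ _ `|f (X t w - z) - f (proxy k m t w - z)|).
  by rewrite ler_piMl// cutoff_le1.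
exact: cutoff_close.
Qed.

Lemma occ_weight m S (f : R -> R) : continuous f -> (forall x, 0 <= f x) ->
  occ P (weight m S) X (EFin \o f) =
  (\int[mu]_(r in `[s0, S]) \int[P]_w (zeta w * cutoff m r w * f (X r w))%:E)%E.
Proof.
move=> cf f0; rewrite /occ [RHS]integral_mkcond; apply: eq_integral => r _.
rewrite epatch_indic -ge0_integralZr//.
- by apply: eq_integral => w _; rewrite /= /weight -!EFinM mulrAC.
- apply/measurable_EFinP; apply: measurable_funM.
    by apply: measurable_funM => //; exact: (measurableT_comp (cutoff_joint m) (measurable_pair1 r)).
  by apply: (measurableT_comp (cmeas cf)); exact: filtration_measurableT (@mX r).
- by move=> w _; rewrite lee_fin !mulr_ge0 ?cutoff_ge0.
- by rewrite lee_fin indicE ler0n.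
Qed.

(** The a priori finite input of the iteration, and the place where the level [m] enters it. *)
Lemma occ_drift_le k m S : 0 <= m ->
  (occ P (weight m S) X (fun x => `|b k x|%:E) <= (m * \int[P]_w zeta w)%:E)%E.
Proof.
move=> m0.
have cnb : continuous (fun x => `|b k x|).
  by move=> x; apply: cvg_norm; exact: cb.
rewrite (occ_weight m S cnb)// EFinM fineK; last first.
  by apply: (integrable_fin_num measurableT); apply: (@bounded_integrable _ _ _ P _ _ Cz).
apply: le_trans (weighted_drift k S m0 mzetaT zeta0).
rewrite le_eqVlt; apply/orP; left; apply/eqP; apply: eq_integral => r _; apply: eq_integral => w _.
by rewrite /drift normrM (ger0_norm (cutoff_ge0 _ _ _)) mulrA.
Qed.

(** Replaces the proxy by [X] inside the truncated kernel. The pointwise error is integrated against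
    the drift, whose total variation in time is at most [m] on every path. The constants blow up as
    [a] tends to [0], but [a] is fixed before [k] is chosen. *)
Lemma response_close a k m S del z : 0 < a -> 0 <= m -> 0 <= del ->
  (\int[mu]_(r in `[s0, S]) (response a k m z r)%:E <=
   occ P (weight m S) X (fun x => (kc eta a (x - z) * `|b k x|)%:E) +
   (m * (Cz * (2 * (a `^ (eta - 1) / a) * del + 2 * a `^ (eta - 1) * fine (P (deviation k S del)))))%:E)%E.
Proof.
move=> a0 m0 d0.
set K := a `^ (eta - 1) / a; set C := a `^ (eta - 1).
have C0 : 0 <= C by exact: powR_ge0.
have K0 : 0 <= K by rewrite divr_ge0// ltW.
have mdev := deviation_measurable k S del.
have h2K : 0 <= 2 * K * del by apply: mulr_ge0 => //; exact: mulr_ge0.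
have h2C : 0 <= 2 * C by exact: mulr_ge0.
pose g w := zeta w * (2 * K * del + 2 * C * (\1_(deviation k S del) w : R)).
have g0 w : 0 <= g w.
  by rewrite /g; apply: mulr_ge0 => //; apply: addr_ge0 => //; apply: mulr_ge0 => //; rewrite indicE ler0n.
have mg : measurable_fun [set: T] g.
  apply: measurable_funM => //; apply: measurable_funD => //.
  by apply: measurable_funM => //; exact: measurable_indic.
have cf : continuous (fun x => kc eta a (x - z) * `|b k x|).
  move=> x; apply: cvgM; last by apply: cvg_norm; exact: cb.
  apply: (@continuous_comp _ _ _ (fun x => x - z) (kc eta a)); last exact: kc_continuous.
  by apply: cvgB; [exact: cvg_id|exact: cvg_cst].
have f0 x : 0 <= kc eta a (x - z) * `|b k x| by rewrite mulr_ge0// kc_ge0.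
rewrite (occ_weight m S cf f0).
have mX1 r : measurable_fun [set: T] (X r) by exact: filtration_measurableT (@mX r).
have mct r : measurable_fun [set: T] (cutoff m r).
  exact: (measurableT_comp (cutoff_joint m) (measurable_pair1 r)).
have m1 : measurable_fun [set: measurableTypeR R * T]
    (fun p => (zeta p.2 * cutoff m p.1 p.2 * (kc eta a (X p.1 p.2 - z) * `|b k (X p.1 p.2)|))%:E).
  apply/measurable_EFinP; apply: measurable_funM.
    by apply: measurable_funM; [exact: (measurableT_comp mzetaT measurable_snd)|exact: cutoff_joint].
  exact: (measurableT_comp (cmeas cf) (process_measurable mX rcX)).
have m10 p : (0 <= (zeta p.2 * cutoff m p.1 p.2 * (kc eta a (X p.1 p.2 - z) * `|b k (X p.1 p.2)|))%:E)%E.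
  by rewrite lee_fin !mulr_ge0 ?cutoff_ge0 ?kc_ge0.
have m2 : measurable_fun [set: measurableTypeR R * T] (fun p => (g p.2 * `|drift k m p.1 p.2|)%:E).
  apply/measurable_EFinP; apply: measurable_funM; first exact: (measurableT_comp mg measurable_snd).
  by apply: measurableT_comp => //; exact: drift_joint.
have m20 p : (0 <= (g p.2 * `|drift k m p.1 p.2|)%:E)%E by rewrite lee_fin mulr_ge0.
have I1 := measurable_fun_fubini_tonelli_F (m2 := P) _ m1 m10.
have I2 := measurable_fun_fubini_tonelli_F (m2 := P) _ m2 m20.
apply: (@le_trans _ _ (\int[mu]_(r in `[s0, S])
   (\int[P]_w (zeta w * cutoff m r w * (kc eta a (X r w - z) * `|b k (X r w)|))%:E +
    \int[P]_w (g w * `|drift k m r w|)%:E))%E).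
  apply: ge0_le_integral => //.
  - by move=> r _; rewrite lee_fin; exact: response_ge0.
  - by apply/measurable_EFinP; apply: measurable_funTS; exact: response_measurable.
  - by apply: measurable_funTS; apply: emeasurable_funD; [exact: I1|exact: I2].
  move=> r; rewrite /= in_itv/= => rS.
  rewrite /response -ge0_integralD//; last 4 first.
  - by move=> w _; exact: (m10 (r, w)).
  - exact: (measurableT_comp m1 (measurable_pair1 r)).
  - by move=> w _; exact: (m20 (r, w)).
  - exact: (measurableT_comp m2 (measurable_pair1 r)).
  have mresp := measurableT_comp (response_integrand_measurable a0 k m z) (measurable_pair1 r).
  rewrite fineK; last first.
    apply: (integrable_fin_num measurableT).
    apply: (@bounded_integrable _ _ _ P _ _ (Cz * Cb k * C)) => //.
    move=> w _; rewrite normrM (normrM (zeta w)) normr_id (ger0_norm (kc_ge0 _ _ _)).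
    apply: ler_pM; [by rewrite mulr_ge0|exact: kc_ge0| |exact: kc_le].
    by apply: ler_pM => //; exact: drift_le.
  apply: ge0_le_integral; first exact: measurableT.
  - by move=> w _; rewrite lee_fin !mulr_ge0// kc_ge0.
  - exact/measurable_EFinP.
  - apply: emeasurable_funD; first exact: (measurableT_comp m1 (measurable_pair1 r)).
    exact: (measurableT_comp m2 (measurable_pair1 r)).
  move=> w _; rewrite -EFinD lee_fin /g.
  have hdr : `|drift k m r w| = cutoff m r w * `|b k (X r w)|.
    by rewrite /drift normrM (ger0_norm (cutoff_ge0 _ _ _)).
  have [ct|act] := eqVneq (cutoff m r w) 0.
    by rewrite hdr ct !(mul0r, mulr0) addr0.
  have kC x : `|kc eta a x| <= C by rewrite (ger0_norm (kc_ge0 _ _ _)) kc_le.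
  have := @cutoff_close (kc eta a) K C k m r S del w z K0 d0 (fun x y => kc_lipschitz x y e01 a0) kC rS act.
  set eps := (X in _ <= X) => /ler_normlP[he _].
  rewrite -/eps; move: eps he => eps he.
  rewrite [leRHS](_ : _ = zeta w * `|drift k m r w| * (kc eta a (X r w - z) + eps)); last by rewrite hdr; ring.
  by rewrite ler_wpM2l ?mulr_ge0//; move: he; lra.
rewrite ge0_integralD//; last 4 first.
- by move=> r _; apply: integral_ge0 => w _; exact: (m10 (r, w)).
- by apply: measurable_funTS; exact: I1.
- by move=> r _; apply: integral_ge0 => w _; exact: (m20 (r, w)).
- by apply: measurable_funTS; exact: I2.
apply: leeD => //.
apply: (le_trans (weighted_drift k S m0 mg g0)).
rewrite EFinM lee_wpmul2l ?lee_fin// -(error_integral mdev h2K h2C).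
apply: ge0_le_integral; first exact: measurableT.
- by move=> w _; rewrite lee_fin.
- exact/measurable_EFinP.
- apply/measurable_EFinP; apply: measurable_funM => //; apply: measurable_funD => //.
  by apply: measurable_funM => //; exact: measurable_indic.
- move=> w _; rewrite lee_fin ler_wpM2r//; apply: addr_ge0 => //; exact: mulr_ge0.
Qed.

Hypothesis bounded_variation : forall t, 0 < t ->
  {ae P, forall w, (ereal_sup (range (fun k => \int[mu]_(s in `[0%R, t]) `|b k (X s w)|%:E)) < +oo)%E}.

(** The events where the cutoff at level [n] has fallen to [0] by time [S] decrease in [n], and on
    their intersection the variations are unbounded in [k], which has probability zero. As the
    cutoff decreases in time, [S] controls all earlier times. *)
Lemma cutoff_exhausts S eps : 0 < S -> 0 < eps ->
  exists2 m, 0 <= m & forall t, t <= S -> \int[P]_w (zeta w * (1 - cutoff m t w)) <= eps.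
Proof.
move=> S0 eps0.
pose E (n : nat) : set T := [set w | cutoff n%:R S w = 0].
have mE n : measurable (E n).
  have mc : measurable_fun [set: T] (cutoff n%:R S).
    exact: (measurableT_comp (cutoff_joint n%:R) (measurable_pair1 S)).
  by rewrite -[E n]setTI; exact: (mc measurableT [set 0]).
have Edec : nonincreasing_seq E.
  move=> i j ij; apply/subsetPset => w; rewrite /E/= /cutoff.
  case: asboolP => [//= _ /eqP|h _]; first by rewrite oner_eq0.
  case: asboolP => // h'; exfalso; apply: h => k; apply: le_trans (h' k) _.
  by rewrite ler_nat.
have P0 : P (\bigcap_n E n) = 0%E.
  apply/negligibleP; first exact: bigcap_measurableType.
  have [N [mN N0 hN]] := bounded_variation S0.
  exists N; split => // w Ew; apply: hN => /= hw.
  have [C hC] : exists C : R, forall k, variation k S w <= C.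
    have fk k : (\int[mu]_(s in `[0%R, S]) `|b k (X s w)|%:E = (variation k S w)%:E)%E.
      have ii : mu.-integrable `[0, S] (EFin \o (fun s => `|b k (X s w)|)).
        by apply: (integrable_itv (mnbX k w) (C := Cb k)) => x _; rewrite normr_id.
      by rewrite /variation /Rintegral fineK//; exact: (integrable_fin_num _ ii).
    move: hw; rewrite (_ : (fun k => _) = fun k => (variation k S w)%:E); last by apply/funext => k; rewrite fk.
    set sp := ereal_sup _ => hsp.
    have h k : ((variation k S w)%:E <= sp)%E by apply: ereal_sup_ubound; exists k.
    have spf : sp \is a fin_num.
      by rewrite fin_numE (lt_eqF hsp) andbT gt_eqF//; apply: lt_le_trans (h 0%N); rewrite ltNyr.
    by exists (fine sp) => k; have := h k; rewrite -{1}(fineK spf) lee_fin.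
  have [n hn] : exists n : nat, C <= n%:R.
    exists (Num.bound `|C|); apply: (le_trans (ler_norm _)).
    by rewrite ltW// archi_boundP.
  have := Ew n I; rewrite /E/= /cutoff; case: asboolP => [_ /eqP|h]; first by rewrite oner_eq0.
  by exfalso; apply: h => k; apply: le_trans (hC k) hn.
have cv : P (E n) @[n --> \oo] --> 0%E.
  rewrite -P0; apply: nonincreasing_cvg_mu => //.
    exact: le_lt_trans (probability_le1 _ (mE 0%N)) (ltry _).
  exact: bigcap_measurableType.
have e1 : 0 < eps / (Cz + 1) by rewrite divr_gt0// ltr_wpDl.
move/fine_cvgP : cv => [_ /cvgrPdist_lt/(_ _ e1)[n _ /(_ n (leqnn n))]]/=.
rewrite sub0r normrN ger0_norm ?fine_ge0// => hn.
exists n%:R => // t tS.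
have mct : measurable_fun [set: T] (cutoff n%:R t).
  exact: (measurableT_comp (cutoff_joint n%:R) (measurable_pair1 t)).
have mi : measurable_fun [set: T] (fun w => Cz * (0 + 1 * (\1_(E n) w : R))).
  by apply: measurable_funM => //; apply: measurable_funD => //; apply: measurable_funM.
have b01 w : 0 <= zeta w * (1 - cutoff n%:R t w).
  by rewrite mulr_ge0// subr_ge0 cutoff_le1.
apply: (@le_trans _ _ (\int[P]_w (Cz * (0 + 1 * (\1_(E n) w : R))))).
  apply: le_Rintegral => //.
  - apply: (@bounded_integrable _ _ _ P _ _ Cz) => //.
      by apply: measurable_funM => //; exact: measurable_funB.
    move=> w _; rewrite ger0_norm// -[leRHS]mulr1; apply: ler_pM => //.
      by rewrite subr_ge0 cutoff_le1.
    by rewrite lerBlDr lerDl cutoff_ge0.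
  - apply: (@bounded_integrable _ _ _ P _ _ Cz) => // w _.
    by rewrite add0r mul1r indicE; case: (_ \in _); rewrite ?mulr1 ?mulr0 ?normr0 ?ger0_norm.
  - move=> w _; rewrite add0r mul1r; apply: ler_pM => //; first by rewrite subr_ge0 cutoff_le1.
    have := cutoff_mono n%:R w tS; have := cutoff01 n%:R t w.
    rewrite indicE; case: (boolP (w \in E n)) => [_ /andP[h1 h2] _|/negP] /=.
      by rewrite mulr1n; lra.
    rewrite inE /E/= mulr0n => cS /andP[h1 h2] h3.
    have : cutoff n%:R S w = 1.
      by move: cS; rewrite /cutoff; case: (asbool _) => //= h; case: h.
    by move=> cS1; rewrite subr_le0; move: h3; rewrite cS1.
rewrite /Rintegral error_integral// add0r mul1r/=.
apply: (@le_trans _ _ ((Cz + 1) * fine (P (E n)))).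
  by rewrite ler_wpM2r ?fine_ge0// lerDl.
by rewrite mulrC -ler_pdivlMr ?ltr_wpDl// ltW.
Qed.

(** * Closing the estimate on a short window *)

Variables (M h A1 : R).
Hypothesis M0 : 0 <= M.
Hypothesis bM : forall a k x, 0 < a -> (\int[mu]_y (kc eta a (x - y) * `|b k y|)%:E <= M%:E)%E.
Hypothesis h01 : 0 <= h <= 1.
Hypothesis A10 : 0 <= A1.
(** The integral of [u ^ (- kap)] over [[0, h]]. *)
Definition window_factor := h `^ (1 - kap) / (1 - kap).
Hypothesis cM : A1 * window_factor * M <= 2^-1.
Hypothesis pk_test : forall e, 0 < e <= 1 -> exists a C K, 0 < a /\ test_function al eta kap (pk e) (dpk e) A1 a C K.

Lemma window_factor_ge0 : 0 <= window_factor.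
Proof. by have := kap01; rewrite /window_factor => /andP[_ k1]; rewrite divr_ge0 ?powR_ge0// subr_ge0 ltW. Qed.

(** A single index [k], independent of [z], serves both replacements of the proxy by [X]: in the
    drift term of Duhamel's formula, and in the expectation of [G] itself. *)
Lemma test_function_error (G dG : R -> R) (Ag a C K : R) m S eps : 0 < a ->
  test_function al eta kap G dG Ag a C K -> 0 <= m -> s0 <= S -> S - s0 <= h -> 0 < eps ->
  exists k, forall z,
   (\int[mu]_(t in `[s0, S]) `|\int[P]_w (zeta w * G (proxy k m t w - z))|%:E <=
     (Ag * window_factor * \int[P]_w zeta w + eps)%:E + (Ag * window_factor)%:E *
       occ P (weight m S) X (fun x => (kc eta a (x - z) * `|b k x|)%:E))%E /\
   forall t, s0 <= t <= S ->
     P.-integrable setT (EFin \o (fun w => zeta w * cutoff m t w * `|G (X t w - z) - G (proxy k m t w - z)|)) /\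
     \int[P]_w (zeta w * cutoff m t w * `|G (X t w - z) - G (proxy k m t w - z)|) <= eps.
Proof.
move=> a0 tf m0 s0S Sh eps0.
have [_ GE GC dGK dGC] := tf.
set K1 := Ag * a `^ (eta - 1) in dGC.
have [cG _] := test_function_continuous tf.
have ap : 0 < a `^ (eta - 1) by rewrite powR_gt0.
have K10 : 0 <= K1 by apply: le_trans (dGC 0).
have A0 : 0 <= Ag by rewrite -(pmulr_lge0 _ ap); exact: le_trans (dGC 0).
have C0 : 0 <= C by apply: le_trans (GC 0).
have GK := bounded_derive_lipschitz GE dGC.
have S0 := le_trans s00 s0S.
have c0 := window_factor_ge0.
pose K2 := a `^ (eta - 1) / a.
have K20 : 0 <= K2 by rewrite divr_ge0// ltW.
pose cc := Ag * window_factor * m * Cz.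
have Ac0 : 0 <= Ag * window_factor by exact: mulr_ge0.
have cc0 : 0 <= cc by exact: mulr_ge0 (mulr_ge0 Ac0 m0) Cz0.
(* [KK] collects the Lipschitz costs and [CC] the supremum costs of the two replacements; the kernel
   part carries [cc], the product of the Duhamel constant, the level [m] and the bound of [zeta]. *)
pose KK := Cz * (2 * K1) + cc * (2 * K2).
pose CC := Cz * (2 * C) + cc * (2 * a `^ (eta - 1)).
have KK0 : 0 <= KK by apply: addr_ge0; apply: mulr_ge0 => //; exact: mulr_ge0.
have CC0 : 0 <= CC by apply: addr_ge0; apply: mulr_ge0 => //; apply: mulr_ge0 => //; exact: ltW.
have [del d0 [k _ /(_ k (leqnn k)) hk]] := deviation_small S0 KK0 CC0 eps0.
set q := fine _ in hk.
have q0 : 0 <= q by exact: fine_ge0.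
have e1 : Cz * (2 * K1 * del + 2 * C * q) <= eps.
  apply: le_trans hk; rewrite -subr_ge0.
  rewrite (_ : _ - _ = cc * (2 * (K2 * del) + 2 * (a `^ (eta - 1) * q))); last by rewrite /KK /CC; ring.
  by apply: mulr_ge0 => //; apply: addr_ge0; apply: mulr_ge0 => //; apply: mulr_ge0 => //; exact: ltW.
have e2 : Ag * window_factor * (m * (Cz * (2 * K2 * del + 2 * a `^ (eta - 1) * q))) <= eps.
  apply: le_trans hk; rewrite -subr_ge0.
  rewrite (_ : _ - _ = Cz * (2 * (K1 * del) + 2 * (C * q))); last by rewrite /KK /CC /cc; ring.
  by apply: mulr_ge0 => //; apply: addr_ge0; apply: mulr_ge0 => //; apply: mulr_ge0 => //; exact: ltW.
exists k => z; split; last first.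
  move=> t ts; have [i1 hh] := cutoff_expectation_close k m z K10 (ltW d0) GK GC cG ts.
  by split => //; apply: le_trans e1.
have h1 : h <= 1 by case/andP: h01.
apply: (le_trans (duhamel_integrated a0 tf k m z s0S Sh h1)).
rewrite -/window_factor.
apply: (@le_trans _ _ ((Ag * window_factor * \int[P]_w zeta w)%:E + (Ag * window_factor)%:E *
   (occ P (weight m S) X (fun x => (kc eta a (x - z) * `|b k x|)%:E) +
   (m * (Cz * (2 * K2 * del + 2 * a `^ (eta - 1) * q)))%:E))%E).
  rewrite leeD2l// lee_wpmul2l ?lee_fin//.
  exact: (response_close k S z a0 m0 (ltW d0)).
have o0 : (0 <= occ P (weight m S) X (fun x => (kc eta a (x - z) * `|b k x|)%:E))%E.
  apply: occ_ge0; first by move=> r w; exact: weight_ge0.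
  by move=> x; rewrite lee_fin mulr_ge0// kc_ge0.
have x0' : 0 <= m * (Cz * (2 * K2 * del + 2 * a `^ (eta - 1) * q)).
  apply: mulr_ge0 => //; apply: mulr_ge0 => //; apply: addr_ge0; apply: mulr_ge0 => //; try exact: ltW.
    exact: mulr_ge0.
  by apply: mulr_ge0 => //; exact: ltW.
rewrite ge0_muleDr ?lee_fin// addeCA -EFinM addeC EFinD leeD2r//.
by rewrite -EFinD lee_fin lerD2l.
Qed.

(** The Poisson kernels supply [H1], and [occ_drift_le] supplies [H2]. The resulting bound is free
    of [a], [k] and [m]. *)
Lemma window_kernel a k m S z : 0 < a -> 0 <= m -> s0 <= S -> S - s0 <= h ->
  (occ P (weight m S) X (fun x => (kc eta a (x - z) * `|b k x|)%:E) <=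
   (2 * (A1 * window_factor * \int[P]_w zeta w) * M)%:E)%E.
Proof.
move=> a0 m0 s0S Sh.
have p0 : 0 <= \int[P]_w zeta w by exact: Rintegral_ge0.
have c0 := window_factor_ge0.
have Ac0 : 0 <= A1 * window_factor by exact: mulr_ge0.
apply: (@occ_kernel_bound R d T P (weight m S) X (fun r w => weight_ge0 m S r w) (weight_joint m S)
  (process_measurable mX rcX) eta (fun k x => `|b k x|) Cb M (A1 * window_factor * \int[P]_w zeta w)
  (A1 * window_factor) (m * \int[P]_w zeta w)) => //.
- by move=> j x; apply: cvg_norm; exact: cb.
- exact: mulr_ge0.
- exact: mulr_ge0.
- move=> e e01'; have [a' [C [K [a'0 tf]]]] := pk_test e01'.
  have e0 : 0 < e by case/andP: e01'.
  exists a' => // eps eps0.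
  have eps2 : 0 < eps / 2 by rewrite divr_gt0.
  have [j hj] := test_function_error a'0 tf m0 s0S Sh eps2.
  exists j => y; have [h1 h2] := hj y.
  have cpk : continuous (@pk R e) by move=> x; exact: (is_derive_cvg (is_derive_pk x e0)).
  have cpky : continuous (fun x => pk e (x - y)).
    move=> x; apply: (@continuous_comp _ _ _ (fun x => x - y) (pk e)); last exact: cpk.
    by apply: cvgB; [exact: cvg_id|exact: cvg_cst].
  rewrite (occ_weight m S cpky); last by move=> x; exact: pk_ge0.
  pose E1 t := \int[P]_w (zeta w * pk e (proxy j m t w - y)).
  have mE1 := expectation_proxy_measurable tf j m y.
  have m1 : measurable_fun [set: measurableTypeR R * T]
      (fun p => (zeta p.2 * cutoff m p.1 p.2 * pk e (X p.1 p.2 - y))%:E).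
    apply/measurable_EFinP; apply: measurable_funM.
      by apply: measurable_funM; [exact: (measurableT_comp mzetaT measurable_snd)|exact: cutoff_joint].
    exact: (measurableT_comp (cmeas cpky) (process_measurable mX rcX)).
  have m10 p : (0 <= (zeta p.2 * cutoff m p.1 p.2 * pk e (X p.1 p.2 - y))%:E)%E.
    by rewrite lee_fin; apply: mulr_ge0; [rewrite mulr_ge0 ?cutoff_ge0|exact: pk_ge0].
  have I1 := measurable_fun_fubini_tonelli_F (m2 := P) _ m1 m10.
  apply: (@le_trans _ _ (\int[mu]_(t in `[s0, S]) (`|E1 t|%:E + (eps / 2)%:E))%E).
    apply: ge0_le_integral => //.
    + by move=> t _; apply: integral_ge0 => w _; exact: (m10 (t, w)).
    + by apply: measurable_funTS; exact: I1.
    + apply: measurable_funTS; apply: emeasurable_funD => //.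
      by apply/measurable_EFinP; apply: measurableT_comp => //; exact: mE1.
    move=> t; rewrite /= in_itv/= => ts; have [i2 h3] := h2 t ts.
    have [_ _ GC _ _] := tf.
    have mct : measurable_fun [set: T] (cutoff m t).
      exact: (measurableT_comp (cutoff_joint m) (measurable_pair1 t)).
    have i1 : P.-integrable setT (EFin \o (fun w => zeta w * cutoff m t w * pk e (X t w - y))).
      apply: (@bounded_integrable _ _ _ P _ _ (Cz * C)) => //.
        by apply/measurable_EFinP; exact: (measurableT_comp m1 (measurable_pair1 t)).
      move=> w _; rewrite normrM; apply: ler_pM => //.
      rewrite ger0_norm ?mulr_ge0 ?cutoff_ge0// -[leRHS]mulr1; apply: ler_pM => //; apply: cutoff_le1.
    have i3 : P.-integrable setT (EFin \o (fun w => zeta w * pk e (proxy j m t w - y))).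
      apply: (@bounded_integrable _ _ _ P _ _ (Cz * C)) => //.
        apply: measurable_funM => //; apply: (measurableT_comp (cmeas cpk)).
        apply: measurable_funB => //; exact: (measurableT_comp (proxy_joint j m) (measurable_pair1 t)).
      by move=> w _; rewrite normrM; apply: ler_pM.
    rewrite -EFinD.
    rewrite -[leLHS]fineK; last exact: (integrable_fin_num measurableT i1).
    rewrite lee_fin -/(Rintegral _ _ _).
    apply: (@le_trans _ _ (\int[P]_w (zeta w * pk e (proxy j m t w - y) + zeta w * cutoff m t w * `|pk e (X t w - y) - pk e (proxy j m t w - y)|))).
      apply: le_Rintegral => //.
        exact: (integrableD measurableT i3 i2).
      move=> w _.
      (* Positivity of the Poisson kernel allows the cutoff to be dropped in front of the proxy
         term, since an upper bound suffices. *)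
      have hp := pk_ge0 (proxy j m t w - y) e0.
      have hn := ler_norm (pk e (X t w - y) - pk e (proxy j m t w - y)).
      have hz := cutoff01 m t w.
      apply: (@le_trans _ _ (zeta w * cutoff m t w * pk e (proxy j m t w - y) + zeta w * cutoff m t w * `|pk e (X t w - y) - pk e (proxy j m t w - y)|)).
        rewrite -mulrDr; apply: ler_wpM2l; first by rewrite mulr_ge0 ?cutoff_ge0.
        by move: hn; lra.
      rewrite lerD2r ler_wpM2r// ler_piMr//; exact: cutoff_le1.
    rewrite (RintegralD measurableT i3 i2); apply: lerD => //.
    exact: ler_norm.
  rewrite ge0_integralD//; last 2 first.
  + by apply/measurable_EFinP; apply: measurable_funTS; apply: measurableT_comp => //; exact: mE1.
  + by move=> t _; rewrite lee_fin ltW.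
  have := h1; rewrite -/(E1 _).
  set I := (\int[mu]_(t in `[s0, S]) `|E1 t|%:E)%E.
  set o := occ _ _ _ _ => hI.
  have hc : (\int[mu]_(t in `[s0, S]) (eps / 2)%:E <= (eps / 2)%:E)%E.
    rewrite integral_cst//= lebesgue_measure_itv/= lte_fin.
    case: ifP => _; last by rewrite mule0 lee_fin ltW.
    rewrite -EFinB -EFinM lee_fin ler_piMr ?(ltW eps2)//.
    by case/andP: h01 => _ hh; apply: le_trans hh.
  apply: (le_trans (leeD hI hc)).
  by rewrite addeAC -EFinD -addrA -splitr.
- move=> j; exact: occ_drift_le.
Qed.

(** [G] may change sign, so the cutoff cannot be discarded by positivity; its level is chosen so
    high that the lost mass is negligible, and [k] is chosen afterwards. Once [window_kernel] is
    inserted, [cM] bounds the drift term by the free term, whence the factor [2]. *)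
Lemma window_bound (G dG : R -> R) (Ag a C K : R) S z : 0 < a ->
  test_function al eta kap G dG Ag a C K -> s0 <= S -> S - s0 <= h -> 0 < S ->
  (\int[mu]_(t in `[s0, S]) `|\int[P]_w (zeta w * G (X t w - z))|%:E <=
   (2 * (Ag * window_factor) * \int[P]_w zeta w)%:E)%E.
Proof.
move=> a0 tf s0S Sh S0.
have p0 : 0 <= \int[P]_w zeta w by exact: Rintegral_ge0.
have c0 := window_factor_ge0.
have [_ GE GC dGK dGC] := tf.
have [cG _] := test_function_continuous tf.
have ap : 0 < a `^ (eta - 1) by rewrite powR_gt0.
have A0 : 0 <= Ag by rewrite -(pmulr_lge0 _ ap); exact: le_trans (dGC 0).
have Ac0 : 0 <= Ag * window_factor by exact: mulr_ge0.
have C0 : 0 <= C by apply: le_trans (GC 0).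
apply/lee_addgt0Pr => eps eps0.
(* One third each for the Duhamel error, for the proxy while the cutoff is active, and for the paths
   past the cutoff, where the integrands differ by at most [2 * C]. *)
have e3 : 0 < eps / 3 by rewrite divr_gt0.
have e4 : 0 < eps / 3 / (2 * C + 1) by rewrite divr_gt0// ltr_wpDl// mulr_ge0.
have [m m0 hm] := cutoff_exhausts S0 e4.
have [k hk] := test_function_error a0 tf m0 s0S Sh e3.
have [h1 h2] := hk z.
pose E1 t := \int[P]_w (zeta w * G (proxy k m t w - z)).
have mE1 : measurable_fun [set: measurableTypeR R] E1 := expectation_proxy_measurable tf k m z.
have mGX : measurable_fun [set: T * measurableTypeR R] (fun p => zeta p.1 * G (X p.2 p.1 - z)).
  apply: measurable_funM; first exact: (measurableT_comp mzetaT measurable_fst).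
  apply: (measurableT_comp (cmeas cG)).
  have sw : measurable_fun [set: T * measurableTypeR R] (fun p => (p.2, p.1) : measurableTypeR R * T).
    by apply/measurable_fun_pairP; split => /=; [exact: measurable_snd|exact: measurable_fst].
  exact: (measurable_funB (measurableT_comp (process_measurable mX rcX) sw) (measurable_cst z)).
have mEX : measurable_fun [set: measurableTypeR R] (fun t => \int[P]_w (zeta w * G (X t w - z))).
  exact: (@measurable_Rintegral_param R _ (measurableTypeR R) _ _ P setT (fun w t => zeta w * G (X t w - z))).
apply: (@le_trans _ _ (\int[mu]_(t in `[s0, S]) (`|E1 t|%:E + (eps / 3 + eps / 3)%:E))%E).
  apply: ge0_le_integral => //.
  - by apply/measurable_EFinP; apply: measurable_funTS; apply: measurableT_comp.
  - apply: measurable_funTS; apply: emeasurable_funD => //.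
    by apply/measurable_EFinP; apply: measurableT_comp.
  move=> t; rewrite /= in_itv/= => ts; have [i2 h3] := h2 t ts.
  have tS : t <= S by case/andP: ts.
  have mct : measurable_fun [set: T] (cutoff m t).
    exact: (measurableT_comp (cutoff_joint m) (measurable_pair1 t)).
  have i1 : P.-integrable setT (EFin \o (fun w => zeta w * G (X t w - z))).
    apply: (@bounded_integrable _ _ _ P _ _ (Cz * C)) => //.
      exact: (measurableT_comp mGX (measurable_pair2 t)).
    by move=> w _; rewrite normrM; apply: ler_pM.
  have i3 : P.-integrable setT (EFin \o (fun w => zeta w * G (proxy k m t w - z))).
    apply: (@bounded_integrable _ _ _ P _ _ (Cz * C)) => //.
      apply: measurable_funM => //; apply: (measurableT_comp (cmeas cG)).
      apply: measurable_funB => //; exact: (measurableT_comp (proxy_joint k m) (measurable_pair1 t)).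
    by move=> w _; rewrite normrM; apply: ler_pM.
  have i4 : P.-integrable setT (EFin \o (fun w => zeta w * (1 - cutoff m t w))).
    apply: (@bounded_integrable _ _ _ P _ _ Cz) => //.
      by apply: measurable_funM => //; exact: measurable_funB.
    move=> w _; rewrite normrM -[leRHS]mulr1; apply: ler_pM => //.
    by rewrite ger0_norm ?subr_ge0 ?cutoff_le1// lerBlDr lerDl cutoff_ge0.
  have i5 : P.-integrable setT (EFin \o (fun w => 2 * C * (zeta w * (1 - cutoff m t w)))).
    exact: (integrableZl measurableT _ i4).
  rewrite -EFinD lee_fin -[X in `|X|](subrK (E1 t)).
  apply: (le_trans (ler_normD _ _)); rewrite addrC lerD2l.
  rewrite -(RintegralB measurableT i1 i3).
  have ib := integrableB measurableT i1 i3.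
  apply: (le_trans (le_normr_Rintegral measurableT ib)).
  apply: (@le_trans _ _ (\int[P]_w (zeta w * cutoff m t w * `|G (X t w - z) - G (proxy k m t w - z)| + 2 * C * (zeta w * (1 - cutoff m t w))))).
    apply: le_Rintegral => //.
    - exact: (integrable_norm ib).
    - exact: (integrableD measurableT i2 i5).
    - move=> w _; rewrite -mulrBr normrM (ger0_norm (zeta0 w)).
      set g := `|_ - _|.
      have gC : g <= 2 * C.
        by apply: (le_trans (ler_normB _ _)); rewrite mulr_natl mulr2n lerD.
      rewrite (_ : _ + _ = zeta w * (cutoff m t w * g + (1 - cutoff m t w) * (2 * C))); last by ring.
      apply: ler_wpM2l => //; rewrite -lerBlDl.
      rewrite (_ : g - _ = (1 - cutoff m t w) * g); last by ring.
      by rewrite ler_wpM2l// subr_ge0 cutoff_le1.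
  rewrite (RintegralD measurableT i2 i5) (RintegralZl _ measurableT i4); apply: lerD => //.
  apply: (@le_trans _ _ ((2 * C + 1) * \int[P]_w (zeta w * (1 - cutoff m t w)))).
    rewrite ler_wpM2r ?lerDl//; apply: Rintegral_ge0 => w _.
    by rewrite mulr_ge0// subr_ge0 cutoff_le1.
  by rewrite mulrC -ler_pdivlMr ?hm// ltr_wpDl// mulr_ge0.
rewrite ge0_integralD//; last 2 first.
- by apply/measurable_EFinP; apply: measurable_funTS; apply: measurableT_comp.
- by move=> t _; rewrite lee_fin addr_ge0// ltW.
have hc : (\int[mu]_(t in `[s0, S]) (eps / 3 + eps / 3)%:E <= (eps / 3 + eps / 3)%:E)%E.
  rewrite integral_cst//= lebesgue_measure_itv/= lte_fin.
  have e0 : 0 <= eps / 3 + eps / 3 by rewrite addr_ge0// ltW.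
  case: ifP => _; last by rewrite mule0 lee_fin.
  rewrite -EFinB -EFinM lee_fin ler_piMr//.
  by case/andP: h01 => _ hh; apply: le_trans hh.
apply: (le_trans (leeD h1 hc)).
apply: (@le_trans _ _ ((Ag * window_factor * \int[P]_w zeta w + eps / 3)%:E + (Ag * window_factor)%:E *
   (2 * (A1 * window_factor * \int[P]_w zeta w) * M)%:E + (eps / 3 + eps / 3)%:E)%E).
  by rewrite leeD2r// leeD2l// lee_wpmul2l ?lee_fin// window_kernel.
rewrite -EFinM -!EFinD lee_fin.
have := ler_wpM2l (mulr_ge0 Ac0 p0) cM.
lra.
Qed.

End controlled_paths.

(** * Exponential tails of additive functionals *)

Section discrete_maximal.
Context {R : realType} d (T : measurableType d) (P : probability T R).
Variables (G : nat -> set (set T)) (H : nat -> T -> R) (n : nat) (c : R).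
Hypothesis Gm : forall i, G i `<=` measurable.
Hypothesis GI : forall i A B, G i A -> G i B -> G i (A `&` B).
Hypothesis GC : forall i A, G i A -> G i (~` A).
Hypothesis GT : forall i, G i setT.
Hypothesis GS : forall i, G i `<=` G i.+1.
Hypothesis Hadapted : forall i j r, (i <= j)%N -> G j [set w | r < `|H j w - H i w|].
Hypothesis Hadapted0 : forall i r, G i [set w | r < `|H i w|].
Hypothesis c0 : 0 < c.
Hypothesis tail : forall i E, (i <= n)%N -> G i E ->
  fine (P (E `&` [set w | 2 * c < `|H n w - H i w|])) <= 4^-1 * fine (P E).
Hypothesis jump : forall i w, `|H i.+1 w - H i w| <= c.
Hypothesis H0 : forall w, H 0%N w = 0.

Notation p E := (fine (P E)).

Lemma fine_probability_split (E B : set T) : measurable E -> measurable B ->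
  p E = p (E `&` B) + p (E `&` ~` B).
Proof.
move=> mE mB; have f A : measurable A -> P A \is a fin_num.
  by move=> mA; rewrite ge0_fin_numE//; exact: le_lt_trans (probability_le1 _ mA) (ltry _).
have mEB : measurable (E `&` B) by exact: measurableI.
have mEC : measurable (E `&` ~` B) by apply: measurableI => //; exact: measurableC.
rewrite -fineD ?f// -measureU//; first by rewrite -setIUr setUv setIT.
by rewrite setIACA setICr setI0.
Qed.

Lemma le_fine_probability (E B : set T) : measurable E -> measurable B -> E `<=` B -> p E <= p B.
Proof.
move=> mE mB EB; have f A : measurable A -> P A \is a fin_num.
  by move=> mA; rewrite ge0_fin_numE//; exact: le_lt_trans (probability_le1 _ mA) (ltry _).
by rewrite fine_le ?f// le_measure ?inE.
Qed.

Lemma GmE i E : G i E -> measurable E. Proof. exact: Gm. Qed.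

(** An Ottaviani-type inequality, by backward induction on [i]. When the distance from [H i0] first
    exceeds [4 * c], either the final distance still exceeds [2 * c], or the remaining increment
    does. The latter has conditional probability at most [4^-1]. *)
Lemma maximal_from i0 i E : (i0 <= i)%N -> (i <= n)%N -> G i E ->
  measurable (E `&` [set w | exists2 l, (i <= l <= n)%N & 4 * c < `|H l w - H i0 w|]) /\
  p (E `&` [set w | exists2 l, (i <= l <= n)%N & 4 * c < `|H l w - H i0 w|]) <=
  p (E `&` [set w | 2 * c < `|H n w - H i0 w|]) + 4^-1 * p E.
Proof.
pose J i := [set w | exists2 l, (i <= l <= n)%N & 4 * c < `|H l w - H i0 w|].
pose Z := [set w | 2 * c < `|H n w - H i0 w|].
move=> i0i /subnK => e; move: e i0i; move: (n - i)%N => k.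
elim: k i E => [|k IH] i E.
  rewrite add0n => -> i0n GE.
  have JE : J n = [set w | 4 * c < `|H n w - H i0 w|].
    apply/seteqP; split => w; first by move=> [l]; rewrite -eqn_leq => /eqP <-.
    by exists n => //; rewrite leqnn.
  have GJ : G n (E `&` J n) by rewrite JE; apply: GI => //; exact: Hadapted.
  have GZ : G n (E `&` Z) by apply: GI => //; exact: Hadapted.
  split; first exact: GmE GJ.
  apply: (@le_trans _ _ (p (E `&` Z))); last by rewrite lerDl mulr_ge0 ?invr_ge0 ?fine_ge0.
  apply: le_fine_probability; [exact: GmE GJ|exact: GmE GZ|].
  move=> w [Ew hw]; split => //; have : J n w by exact: hw.
  by rewrite JE /= => h; apply: le_lt_trans h; rewrite ler_pM2r// ler_nat.
move=> kin i0i GE.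
have in_ : (i <= n)%N by rewrite -kin leq_addl.
pose B := [set w | 4 * c < `|H i w - H i0 w|].
have GB : G i B by exact: Hadapted.
have GEB : G i (E `&` B) by exact: GI.
have GEC : G i.+1 (E `&` ~` B) by apply/GS/GI => //; exact: GC.
have kin' : (k + i.+1 = n)%N by rewrite -kin addnS addSn.
have [mJ hJ] := IH i.+1 _ kin' (leqW i0i) GEC.
have mZ : measurable Z by apply: (@GmE n); apply: Hadapted; exact: leq_trans in_.
have mE := GmE GE; have mB := GmE GB.
have JB : E `&` J i `&` B = E `&` B.
  apply/seteqP; split => [w [[Ew _] Bw]//|w [Ew Bw]]; split => //; split => //.
  by exists i => //; rewrite leqnn.
have JC : E `&` J i `&` ~` B = E `&` ~` B `&` J i.+1.
  apply/seteqP; split => w.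
    move=> [[Ew [l /andP[il ln] hl]] nB]; split => //; exists l => //.
    rewrite ln andbT ltn_neqAle il andbT; apply/eqP => h; apply: nB.
    by rewrite /B/= h.
  move=> [[Ew nB] [l /andP[il ln] hl]]; split => //; split => //.
  by exists l => //; rewrite ln ltnW.
have mEJ : measurable (E `&` J i).
  rewrite -[E `&` J i]setIT -(setUv B) setIUr JB JC; apply: measurableU => //.
  exact: measurableI.
split=> //.
rewrite (fine_probability_split mEJ mB) JB JC.
have mEZ : measurable (E `&` Z) by exact: measurableI.
rewrite (fine_probability_split mEZ mB) (fine_probability_split mE mB) mulrDr addrACA.
have EZ : E `&` Z `&` ~` B = E `&` ~` B `&` Z by rewrite setIAC.
have EZ' : E `&` Z `&` B = E `&` B `&` Z by rewrite setIAC.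
rewrite EZ EZ'; apply: lerD; last exact: hJ.
have mEB := GmE GEB.
have hB := tail in_ GEB.
rewrite [leLHS](fine_probability_split mEB mZ) lerD2l.
apply: le_trans hB; apply: le_fine_probability.
- by apply: measurableI => //; exact: measurableC.
- by apply: measurableI => //; apply: (@GmE n); exact: Hadapted.
move=> w [[Ew Bw] nZ]; split => //=; move: Bw nZ; rewrite /B /Z/= => h1 /negP; rewrite -leNgt => h2.
(* From more than [4 * c] at time [i] down to at most [2 * c] at time [n]: the path moves by more
   than [2 * c]. *)
have := ler_normB (H n w - H i0 w) (H n w - H i w).
by rewrite (_ : _ - _ = H i w - H i0 w); [lra|ring].
Qed.

Lemma maximal_half i E : (i <= n)%N -> G i E ->
  measurable (E `&` [set w | exists2 l, (i <= l <= n)%N & 4 * c < `|H l w - H i w|]) /\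
  p (E `&` [set w | exists2 l, (i <= l <= n)%N & 4 * c < `|H l w - H i w|]) <= 2^-1 * p E.
Proof.
move=> in_ GE; have [h1 h2] := maximal_from (leqnn i) in_ GE.
split=> //; apply: (le_trans h2); have := tail in_ GE.
have : 0 <= p E by exact: fine_ge0.
lra.
Qed.

Let J i j := [set w | exists2 l, (i <= l <= n)%N & j%:R * (5 * c) < `|H l w|].

Lemma exceedance_measurable i j : (i <= n)%N -> measurable (J i j).
Proof.
move=> _; rewrite (_ : J i j = \bigcup_(l in [set l | (i <= l <= n)%N]) [set w | j%:R * (5 * c) < `|H l w|]).
  by apply: bigcup_measurable => l _; apply: (@GmE l); exact: Hadapted0.
by apply/seteqP; split => w [l h1 h2]; exists l.
Qed.

(* After the first passage above level [j], reaching level [j.+1] needs an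
   increment above [4 * c], which has conditional probability at most [2^-1]. *)
Lemma exceedance_step i j E : (i <= n)%N -> G i E ->
  (forall w, E w -> `|H i w| <= j%:R * (5 * c) + c) ->
  p (E `&` J i j.+1) <= 2^-1 * p (E `&` J i j).
Proof.
move=> /subnK; move: (n - i)%N => k.
have up w : j.+1%:R * (5 * c) < `|H n w| -> j%:R * (5 * c) + 5 * c < `|H n w|.
  by rewrite -natr1 mulrDl mul1r.
elim: k i E => [|k IH] i E.
  rewrite add0n => -> GE Ew.
  rewrite (_ : E `&` J n j.+1 = set0) ?measure0 ?mulr_ge0 ?fine_ge0//.
  apply/seteqP; split => // w [/Ew h [l]]; rewrite -eqn_leq => /eqP <- h2.
  have := up w h2; move: h; have := c0; lra.
move=> kin GE Ew.
have in_ : (i <= n)%N by rewrite -kin leq_addl.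
have in1 : (i.+1 <= n)%N by rewrite -kin addSn ltnS leq_addl.
pose B := [set w | j%:R * (5 * c) < `|H i w|].
have GB : G i B by exact: Hadapted0.
have GEB : G i (E `&` B) by exact: GI.
have GEC : G i.+1 (E `&` ~` B) by apply/GS/GI => //; exact: GC.
have kin' : (k + i.+1 = n)%N by rewrite -kin addnS addSn.
have mB := GmE GB; have mE := GmE GE.
have m1 : measurable (E `&` J i j.+1) by apply: measurableI => //; exact: exceedance_measurable.
have m2 : measurable (E `&` J i j) by apply: measurableI => //; exact: exceedance_measurable.
rewrite (fine_probability_split m1 mB) (fine_probability_split m2 mB) mulrDr.
apply: lerD.
  have -> : E `&` J i j `&` B = E `&` B.
    apply/seteqP; split => [w [[Ew' _] Bw]//|w [Ew' Bw]]; split => //; split => //.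
    by exists i => //; rewrite leqnn.
  have [m3 h] := maximal_half in_ GEB.
  apply: le_trans h; apply: le_fine_probability => //; first exact: measurableI.
  (* The spacing [5 * c] of the levels is the overshoot [c] allowed at time [i] plus the increment
     [4 * c] of [maximal_half]. *)
  move=> w [[Ew' [l lin hl]] Bw]; split => //; exists l => //.
  have := Ew w Ew'; have := ler_normD (H l w - H i w) (H i w).
  rewrite subrK; move: hl; rewrite -natr1 mulrDl mul1r; lra.
have JE q : (q = j \/ q = j.+1) -> E `&` J i q `&` ~` B = E `&` ~` B `&` J i.+1 q.
  move=> qj; have jq : j%:R * (5 * c) <= q%:R * (5 * c).
    by rewrite ler_wpM2r ?mulr_ge0 ?(ltW c0)// ler_nat; case: qj => ->.
  apply/seteqP; split => w.
    move=> [[Ew' [l /andP[il ln] hl]] nB]; split => //; exists l => //.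
    rewrite ln andbT ltn_neqAle il andbT; apply/eqP => h; apply: nB.
    by rewrite /B/= h; exact: le_lt_trans hl.
  move=> [[Ew' nB] [l /andP[il ln] hl]]; split => //; split => //.
  by exists l => //; rewrite ln ltnW.
rewrite !JE; [|by left|by right].
(* Below the level at time [i], a single jump leads at most [c] above it at [i.+1], as the induction
   hypothesis demands. *)
apply: IH => // w [Ew' /negP]; rewrite /B/= -leNgt => h.
have := jump i w; have := ler_normD (H i.+1 w - H i w) (H i w); rewrite subrK; lra.
Qed.

Lemma exceedance_le j : p (J 0%N j) <= 2^-1 ^+ j.
Proof.
elim: j => [|j IH].
  rewrite expr0; have mJ := exceedance_measurable 0 (leq0n n).
  by rewrite -lee_fin fineK ?probability_le1// ge0_fin_numE//; exact: le_lt_trans (probability_le1 _ mJ) (ltry _).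
rewrite exprS; apply: (@le_trans _ _ (2^-1 * p (J 0%N j))); last by rewrite ler_wpM2l// invr_ge0.
have := @exceedance_step 0%N j setT (leq0n n) (GT 0); rewrite !setTI; apply => w _.
by rewrite H0 normr0 addr_ge0 ?mulr_ge0// ltW.
Qed.

End discrete_maximal.

Lemma expectation_le_bound {R : realType} d (T : measurableType d) (P : probability T R)
  (Y : T -> R) c : measurable_fun setT Y -> (forall w, `|Y w| <= c) -> `|\int[P]_w Y w| <= c.
Proof.
move=> mY Yc.
have h : `|\int[P]_w Y w| <= c * fine (P setT).
  by apply: (@Rintegral_le_bound _ _ _ P) => //; rewrite (le_lt_trans (probability_le1 _ _))// ltry.
by move: h; rewrite probability_setT mulr1.
Qed.

(** * Conditional moments and tails of time integrals along the path *)

Section additive_functional.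
Context {R : realType} d (T : measurableType d) (P : probability T R).
Notation mu := (@lebesgue_measure R).
Variables (F : R -> set (set T)) (X : R -> T -> R).
Hypothesis sF : forall v, sigma_algebra setT (F v).
Hypothesis FT : forall v, F v `<=` measurable.
Hypothesis FF : forall s t, s <= t -> F s `<=` F t.
Hypothesis mX : forall v, measurable_fun [set: g_sigma_algebraType (F v)] (X v : T -> measurableTypeR R).
Hypothesis rcX : forall w v, X s w @[s --> v^'+] --> X v w.
Variable h : R.
Hypothesis h0 : 0 < h.

(** The absolute value lies outside the expectation, so cancellation in a signed [g] counts, and
    inside the time integral. Letting [zeta] range over bounded nonnegative variables known at time
    [s] makes this a conditional estimate. *)
Definition window_estimate (g : R -> R) (kappa : R) (tau : R) :=
  forall s t (zeta : T -> R) C, 0 <= s -> s <= t -> t - s <= tau ->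
  measurable_fun [set: g_sigma_algebraType (F s)] zeta ->
  (forall w, 0 <= zeta w) -> (forall w, zeta w <= C) ->
  (\int[mu]_(v in `[s, t]) `|\int[P]_w (zeta w * g (X v w))|%:E <= (kappa * \int[P]_w zeta w)%:E)%E.

Let finP : (P setT < +oo)%E.
Proof. by rewrite (le_lt_trans (probability_le1 _ _))// ltry. Qed.

Let cmeas (f : R -> R) : continuous f -> measurable_fun [set: measurableTypeR R] (f : measurableTypeR R -> measurableTypeR R).
Proof. exact: continuous_measurable_fun. Qed.

Let jX : measurable_fun [set: measurableTypeR R * T] (fun p => X p.1 p.2 : measurableTypeR R).
Proof. exact: (process_measurable sF FT mX rcX). Qed.

Let sw : measurable_fun [set: T * measurableTypeR R] (fun p => (p.2, p.1) : measurableTypeR R * T).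
Proof. by apply/measurable_fun_pairP; split => /=; [exact: measurable_snd|exact: measurable_fst]. Qed.

Section one_function.
Variables (g : R -> R) (Cg kappa : R).
Hypothesis cg : continuous g.
Hypothesis gC : forall x, `|g x| <= Cg.
Hypothesis kappa0 : 0 <= kappa.

Let Cg0 : 0 <= Cg. Proof. exact: le_trans (gC 0). Qed.

Let jg : measurable_fun [set: measurableTypeR R * T] (fun p => g (X p.1 p.2)).
Proof. exact: (measurableT_comp (cmeas cg) jX). Qed.

Let mexp (xi : T -> R) : measurable_fun [set: T] xi ->
  measurable_fun [set: measurableTypeR R] (fun v => \int[P]_w (xi w * g (X v w))).
Proof.
move=> mxi; apply: (@measurable_Rintegral_param R _ (measurableTypeR R) _ _ P setT (fun w v => xi w * g (X v w))) => //.
by apply: measurable_funM; [exact: (measurableT_comp mxi measurable_fst)|exact: (measurableT_comp jg sw)].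
Qed.

(** A weight known at time [s] is known at [s + h], so the estimates on consecutive windows add
    up. *)
Lemma window_estimate_iter (N : nat) : window_estimate g kappa h ->
  window_estimate g (N%:R * kappa) (N%:R * h).
Proof.
move=> wh; elim: N => [|N IH] s t zeta C s0 st.
  rewrite !mul0r subr_le0 => ts _ _ _; have -> : t = s by apply/eqP; rewrite eq_le ts st.
  by rewrite set_itv1 integral_set1.
move=> tsN mz z0 zC.
have mzT := filtration_measurableT sF FT mz.
have p0 : 0 <= \int[P]_w zeta w by exact: Rintegral_ge0.
have [tsh|tsh] := leP (t - s) h.
  apply: (le_trans (wh _ _ _ _ s0 st tsh mz z0 zC)).
  by rewrite lee_fin ler_wpM2r// ler_peMl// ler1n.
have sst : s + h <= t by move: tsh; lra.
have ss : s <= s + h by rewrite lerDl ltW.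
have U : `[s, t]%classic = `[s, s + h]%classic `|` `]s + h, t]%classic.
  by rewrite -itv_bndbnd_setU// bnd_simp.
have mI := mexp mzT.
have mA D : measurable_fun D (fun v => `|\int[P]_w (zeta w * g (X v w))|%:E).
  by apply/measurable_EFinP; apply: measurable_funTS; apply: measurableT_comp.
rewrite U ge0_integral_setU//; last first.
  apply/disj_setPS => y [/=]; rewrite 2!in_itv/= => /andP[_ yx] /andP[].
  by rewrite ltNge yx.
  exact: mA.
rewrite integral_itv_obnd_cbnd//.
have e1 : s + h - s <= h by rewrite addrAC subrr add0r.
have e2 : t - (s + h) <= N%:R * h by move: tsN; rewrite -natr1 mulrDl mul1r; lra.
have mz' := filtration_measurable sF FF ss mz.
apply: (le_trans (leeD (wh _ _ _ _ s0 ss e1 mz z0 zC) (IH _ _ _ _ (le_trans s0 ss) sst e2 mz' z0 zC))).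
by rewrite -EFinD lee_fin -mulrDl -natr1 [(_ + 1) * _]mulrDl mul1r addrC.
Qed.

Variable tau : R.
Hypothesis wg : window_estimate g kappa tau.

(** The positive and negative parts of [xi] are admissible weights, and their means add up to that
    of [|xi|]. *)
Lemma window_signed s t (xi : T -> R) C : 0 <= s -> s <= t -> t - s <= tau ->
  measurable_fun [set: g_sigma_algebraType (F s)] xi -> (forall w, `|xi w| <= C) ->
  `|\int[P]_w (xi w * \int[mu]_(v in `[s, t]) g (X v w))| <= kappa * \int[P]_w `|xi w|.
Proof.
move=> s0 st ts mxi xiC.
have C0 : 0 <= C by apply: le_trans (xiC point).
have mxiT := filtration_measurableT sF FT mxi.
have mD : measurable (`[s, t]%classic : set (measurableTypeR R)) by exact: measurable_itv.
have Dfin : (mu `[s, t]%classic < +oo)%E.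
  by rewrite /= lebesgue_measure_itv/= lte_fin; case: ifP => // _; rewrite -EFinB ltry.
have mgw w : measurable_fun [set: R] (fun v => g (X v w)).
  exact: (measurableT_comp jg (measurable_pair2 w)).
have E w : xi w * \int[mu]_(v in `[s, t]) g (X v w) = \int[mu]_(v in `[s, t]) (xi w * g (X v w)).
  rewrite RintegralZl//.
  by apply: (integrable_itv (mgw w) (C := Cg)) => v _.
under eq_Rintegral do rewrite E.
have mJ : measurable_fun [set: T * measurableTypeR R] (fun p => xi p.1 * g (X p.2 p.1)).
  by apply: measurable_funM; [exact: (measurableT_comp mxiT measurable_fst)|exact: (measurableT_comp jg sw)].
rewrite (@Rintegral_swap _ _ T (measurableTypeR R) R P mu `[s, t]%classic (fun w v => xi w * g (X v w)) (cst (C * Cg)))//; last 2 first.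
- by apply: (@integrable_itv _ _ _ _ (C * Cg)) => // x _ /=; rewrite ger0_norm// mulr_ge0.
- by move=> w v _; rewrite normrM ler_pM.
pose xp w := Num.max (xi w) 0; pose xn w := Num.max (- xi w) 0.
have mxp : measurable_fun [set: g_sigma_algebraType (F s)] xp by exact: measurable_maxr.
have mxn : measurable_fun [set: g_sigma_algebraType (F s)] xn.
  by apply: measurable_maxr => //; exact: measurableT_comp.
have xp0 w : 0 <= xp w by rewrite le_max lexx orbT.
have xn0 w : 0 <= xn w by rewrite le_max lexx orbT.
have xpC w : xp w <= C by have := xiC w; rewrite ler_norml ge_max C0 andbT => /andP[].
have xnC w : xn w <= C by have := xiC w; rewrite ler_norml ge_max C0 andbT lerNl => /andP[].
have xE w : xi w = xp w - xn w.
  by rewrite /xp /xn; have [h1|h1] := leP (xi w) 0; have [h2|h2] := leP (- xi w) 0; lra.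
have xA w : `|xi w| = xp w + xn w.
  rewrite /xp /xn; have [h1|h1] := leP (xi w) 0; have [h2|h2] := leP (- xi w) 0; rewrite ?(ler0_norm h1) ?(gtr0_norm h1); lra.
have mxpT := filtration_measurableT sF FT mxp.
have mxnT := filtration_measurableT sF FT mxn.
have ip v : P.-integrable setT (EFin \o (fun w => xp w * g (X v w))).
  apply: (@bounded_integrable _ _ _ P _ _ (C * Cg)) => //.
    by apply: measurable_funM => //; exact: (measurableT_comp jg (measurable_pair1 v)).
  by move=> w _; rewrite normrM ger0_norm// ler_pM.
have in_ v : P.-integrable setT (EFin \o (fun w => xn w * g (X v w))).
  apply: (@bounded_integrable _ _ _ P _ _ (C * Cg)) => //.
    by apply: measurable_funM => //; exact: (measurableT_comp jg (measurable_pair1 v)).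
  by move=> w _; rewrite normrM ger0_norm// ler_pM.
have ipx : P.-integrable setT (EFin \o xp).
  by apply: (@bounded_integrable _ _ _ P _ _ C) => // w _; rewrite ger0_norm.
have inx : P.-integrable setT (EFin \o xn).
  by apply: (@bounded_integrable _ _ _ P _ _ C) => // w _; rewrite ger0_norm.
have mI := mexp mxiT.
have bI v : `|\int[P]_w (xi w * g (X v w))| <= C * Cg.
  apply: expectation_le_bound; last by move=> w; rewrite normrM ler_pM.
  exact: (measurableT_comp mJ (measurable_pair2 v)).
have iI : mu.-integrable `[s, t] (EFin \o (fun v => \int[P]_w (xi w * g (X v w)))).
  exact: (integrable_itv mI (fun v _ => bI v)).
apply: (le_trans (le_normr_Rintegral _ iI)) => //.
have E2 : (\int[mu]_(v in `[s, t]) `|\int[P]_w (xi w * g (X v w))|)%:E =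
    (\int[mu]_(v in `[s, t]) `|\int[P]_w (xi w * g (X v w))|%:E)%E.
  by rewrite [in LHS]/Rintegral fineK//; exact: (integrable_fin_num _ (integrable_norm iI)).
rewrite -lee_fin {}E2.
apply: (@le_trans _ _ (\int[mu]_(v in `[s, t]) (`|\int[P]_w (xp w * g (X v w))|%:E + `|\int[P]_w (xn w * g (X v w))|%:E))%E).
  apply: ge0_le_integral => //.
  - by apply/measurable_EFinP; apply: measurable_funTS; apply: measurableT_comp.
  - by apply: measurable_funTS; apply: emeasurable_funD; apply/measurable_EFinP; apply: measurableT_comp => //; exact: mexp.
  - move=> v _; rewrite -EFinD lee_fin.
    rewrite (_ : \int[P]_w (xi w * g (X v w)) = \int[P]_w (xp w * g (X v w)) - \int[P]_w (xn w * g (X v w))).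
      exact: ler_normB.
    rewrite -(RintegralB measurableT (ip v) (in_ v)).
    by apply: eq_Rintegral => w _; rewrite xE mulrBl.
rewrite ge0_integralD//; last 2 first.
- by apply/measurable_EFinP; apply: measurable_funTS; apply: measurableT_comp => //; exact: mexp.
- by apply/measurable_EFinP; apply: measurable_funTS; apply: measurableT_comp => //; exact: mexp.
apply: (le_trans (leeD (wg s0 st ts mxp xp0 xpC) (wg s0 st ts mxn xn0 xnC))).
rewrite -EFinD lee_fin -mulrDr -(RintegralD measurableT ipx inx).
rewrite le_eqVlt; apply/orP; left; apply/eqP; congr (_ * _).
by apply: eq_Rintegral => w _; rewrite xA.
Qed.

End one_function.

Variables (f q : R -> R) (Cf Cq delta kappa tau : R).
Hypothesis cf : continuous f.
Hypothesis fC : forall x, `|f x| <= Cf.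
Hypothesis cq : continuous q.
Hypothesis qC : forall x, `|q x| <= Cq.
Hypothesis fq : forall x, `|f x| <= q x.
Hypothesis delta0 : 0 <= delta.
Hypothesis kappa0 : 0 <= kappa.
Hypothesis wf : window_estimate f delta tau.
Hypothesis wq : window_estimate q kappa tau.

Let Cf0 : 0 <= Cf. Proof. exact: le_trans (fC 0). Qed.

Definition functional t w : R := \int[mu]_(v in `[0, t]) f (X v w).

Let jf : measurable_fun [set: measurableTypeR R * T] (fun p => f (X p.1 p.2)).
Proof. exact: (measurableT_comp (cmeas cf) jX). Qed.

Let mfw w : measurable_fun [set: R] (fun v => f (X v w)).
Proof. exact: (measurableT_comp jf (measurable_pair2 w)). Qed.

Let fCw w v : `|f (X v w)| <= Cf. Proof. exact: fC. Qed.

Lemma functionalB w s t : 0 <= s -> s <= t ->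
  functional t w - functional s w = \int[mu]_(v in `[s, t]) f (X v w).
Proof. by move=> s0 st; exact: (primitiveB (mfw w) (fCw w)). Qed.

Lemma functional_lipschitz w s t : s <= t -> `|functional t w - functional s w| <= Cf * (t - s).
Proof. exact: (primitive_lipschitz 0 (mfw w) (fCw w)). Qed.

Lemma functional_continuous w : continuous (functional ^~ w).
Proof.
apply: (@primitive_continuous R (fun v => f (X v w)) 0 Cf); [exact: mfw|exact: fCw].
Qed.

Lemma functional_adapted t :
  measurable_fun [set: g_sigma_algebraType (F t)] (functional t : T -> measurableTypeR R).
Proof.
rewrite (_ : functional t = fun w => \int[mu]_(v in `[0, t]) f (X (Num.min v t) w)); last first.
  by apply/funext => w; apply: (stop_integral (fun u => f (X u w))).
apply: (@measurable_Rintegral_param R _ (g_sigma_algebraType (F t)) _ _ mu _ (fun u w => f (X (Num.min u t) w))) => //.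
by apply: (measurableT_comp (cmeas cf)); exact: (progressively_measurable sF FF mX rcX).
Qed.

(* The square of the increment over [[s, t]] is twice the integral over [r]
   of [f (X r)] times the increment over [[r, t]]; the latter is estimated
   conditionally at time [r]. *)
Lemma functional_second_moment s t (E : set T) : 0 <= s -> s <= t -> t - s <= tau -> F s E ->
  \int[P]_w (\1_E w * (functional t w - functional s w) ^+ 2) <= 2 * delta * kappa * fine (P E).
Proof.
move=> s0 st ts FE.
have mE : measurable E by exact: FT FE.
have mD : measurable (`[s, t]%classic : set (measurableTypeR R)) by exact: measurable_itv.
have mi : measurable_fun [set: g_sigma_algebraType (F s)] (\1_E : T -> R).
  by apply: measurable_indic; exact: sub_sigma_algebra.
have miT := filtration_measurableT sF FT mi.
have i1 w : 0 <= (\1_E w : R) <= 1 by rewrite indicE; case: (_ \in _); rewrite ?lexx ler01.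
have i0 w : 0 <= \1_E w :> R by case/andP: (i1 w).
have i1' w : (\1_E w : R) <= 1 by case/andP: (i1 w).
pose D r w := \1_E w * (f (X r w) * (functional t w - functional r w)).
have jfun : measurable_fun [set: measurableTypeR R * T] (fun p => functional p.1 p.2 : measurableTypeR R).
  apply: (process_measurable sF FT functional_adapted) => w v.
  by apply: cvg_at_right_filter; exact: functional_continuous.
have bfun w v : s <= v -> v <= t -> `|functional t w - functional v w| <= Cf * (t - s).
  move=> sv vt; apply: (le_trans (functional_lipschitz w vt)).
  by rewrite ler_wpM2l// lerB.
have square w : (functional t w - functional s w) ^+ 2 =
    \int[mu]_(r in `[s, t]) (2 * (f (X r w) * (functional t w - functional r w))).
  have mDw : measurable_fun [set: R] (fun r => 2 * (f (X r w) * (functional t w - functional r w))).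
    apply: measurable_funM => //; apply: measurable_funM => //; apply: measurable_funB => //.
    exact: (measurableT_comp jfun (measurable_pair2 w)).
  have iDw : mu.-integrable `[s, t] (EFin \o (fun r => 2 * (f (X r w) * (functional t w - functional r w)))).
    apply: (integrable_itv mDw (C := 2 * (Cf * (Cf * (t - s))))) => r /andP[sr rt].
    rewrite normrM ger0_norm// ler_wpM2l// normrM; apply: ler_pM => //.
    exact: bfun.
  have dG (x : R) : is_derive x (1 : R) (fun x : R => x ^+ 2) (2 * x).
    by apply: is_derive_eq; rewrite /GRing.scale/=; ring.
  have dGK (x y : R) : `|2 * x - 2 * y| <= 2 * `|x - y| by rewrite -mulrBr normrM ger0_norm.
  (* Starting the square at minus the total increment makes it end at [0]. The inner factor at [r]
     is then the increment after [r], which can be estimated conditionally on the past of [r]. *)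
  have := @chain_rule R (fun v => f (X v w)) s Cf (mfw w) (fCw w) _ _
    (- (functional t w - functional s w)) 2 t dG dGK st.
  rewrite -functionalB// addNr expr0n/= sub0r sqrrN => hc.
  rewrite -[LHS]opprK hc.
  transitivity (- \int[mu]_(r in `[s, t]) (- 1 * (2 * (f (X r w) * (functional t w - functional r w))))).
    congr (- _); apply: eq_Rintegral => r; rewrite inE/= in_itv/= => /andP[sr rt].
    by rewrite -functionalB//; ring.
  by rewrite (RintegralZl _ mD iDw) mulN1r opprK.
have jD : measurable_fun [set: T * measurableTypeR R] (fun p => 2 * D p.2 p.1).
  apply: measurable_funM => //; apply: measurable_funM; first exact: (measurableT_comp miT measurable_fst).
  apply: measurable_funM; first exact: (measurableT_comp jf sw).
  apply: measurable_funB; last exact: (measurableT_comp jfun sw).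
  exact: (measurableT_comp (measurableT_comp jfun (measurable_pair1 t)) measurable_fst).
have bD r w : s <= r <= t -> `|2 * D r w| <= 2 * (1 * (Cf * (Cf * (t - s)))).
  move=> /andP[sr rt]; rewrite normrM ger0_norm// ler_wpM2l// normrM (ger0_norm (i0 _)).
  apply: ler_pM => //; rewrite normrM; apply: ler_pM => //; exact: bfun.
have E1 : \int[P]_w (\1_E w * (functional t w - functional s w) ^+ 2) =
    \int[P]_w \int[mu]_(r in `[s, t]) (2 * D r w).
  apply: eq_Rintegral => w _; rewrite square -RintegralZl//.
    by apply: eq_Rintegral => r _; rewrite /D; ring.
  have mDw : measurable_fun [set: R] (fun r => 2 * (f (X r w) * (functional t w - functional r w))).
    apply: measurable_funM => //; apply: measurable_funM => //; apply: measurable_funB => //.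
    exact: (measurableT_comp jfun (measurable_pair2 w)).
  apply: (integrable_itv mDw (C := 2 * (Cf * (Cf * (t - s))))) => r /andP[sr rt].
  rewrite normrM ger0_norm// ler_wpM2l// normrM; apply: ler_pM => //.
  exact: bfun.
have B0 : 0 <= 2 * (1 * (Cf * (Cf * (t - s)))) by rewrite mul1r !mulr_ge0// subr_ge0.
rewrite E1 (@Rintegral_swap _ _ T (measurableTypeR R) R P mu `[s, t]%classic (fun w r => 2 * D r w) (cst (2 * (1 * (Cf * (Cf * (t - s)))))))//; last 2 first.
- apply: (@integrable_itv _ _ _ _ (2 * (1 * (Cf * (Cf * (t - s)))))) => // x _ /=.
  by rewrite ger0_norm.
- by move=> w r; rewrite /= in_itv/=; exact: bD.
have mI : measurable_fun [set: R] (fun r => \int[P]_w (2 * D r w)).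
  exact: (@measurable_Rintegral_param R _ (measurableTypeR R) _ _ P setT (fun w r => 2 * D r w)).
have iI : mu.-integrable `[s, t] (EFin \o (fun r => \int[P]_w (2 * D r w))).
  apply: (integrable_itv mI (C := 2 * (1 * (Cf * (Cf * (t - s)))))) => r rst.
  apply: expectation_le_bound; last by move=> w; exact: bD.
  exact: (measurableT_comp jD (measurable_pair2 r)).
apply: (le_trans (ler_norm _)); apply: (le_trans (le_normr_Rintegral _ iI)) => //.
have E2 : (\int[mu]_(r in `[s, t]) `|\int[P]_w (2 * D r w)|)%:E =
    (\int[mu]_(r in `[s, t]) `|\int[P]_w (2 * D r w)|%:E)%E.
  by rewrite [in LHS]/Rintegral fineK//; exact: (integrable_fin_num _ (integrable_norm iI)).
rewrite -lee_fin {}E2.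
have mq : measurable_fun [set: measurableTypeR R] (fun r => \int[P]_w (\1_E w * q (X r w))).
  apply: (@measurable_Rintegral_param R _ (measurableTypeR R) _ _ P setT (fun w r => \1_E w * q (X r w))) => //.
  apply: measurable_funM; first exact: (measurableT_comp miT measurable_fst).
  exact: (measurableT_comp (measurableT_comp (cmeas cq) jX) sw).
apply: (@le_trans _ _ (\int[mu]_(r in `[s, t]) ((2 * delta)%:E * `|\int[P]_w (\1_E w * q (X r w))|%:E))%E).
  apply: ge0_le_integral => //.
  - by apply/measurable_EFinP; apply: measurable_funTS; apply: measurableT_comp.
  - by apply: measurable_funTS; apply: measurable_funeM; apply/measurable_EFinP; apply: measurableT_comp.
  move=> r; rewrite /= in_itv/= => /andP[sr rt].
  have r0 : 0 <= r by exact: le_trans sr.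
  have tr : t - r <= tau by apply: le_trans ts; rewrite lerB.
  (* Known at time [r]: the signed estimate of the later increment yields [delta], and the remaining
     mean of [|f| <= q] yields [kappa] after integration in [r]. *)
  pose xi w := \1_E w * f (X r w).
  have mxi : measurable_fun [set: g_sigma_algebraType (F r)] xi.
    apply: measurable_funM; first exact: (filtration_measurable sF FF sr mi).
    by apply: (measurableT_comp (cmeas cf)); exact: mX.
  have xiC w : `|xi w| <= Cf.
    by rewrite /xi normrM (ger0_norm (i0 w)) -[leRHS]mul1r; apply: ler_pM.
  have hs := window_signed cf fC wf r0 rt tr mxi xiC.
  have ixi : P.-integrable setT (EFin \o (fun w => `|xi w|)).
    apply: (@bounded_integrable _ _ _ P _ _ Cf) => //.
      by apply: measurableT_comp => //; exact: (filtration_measurableT sF FT mxi).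
    by move=> w _; rewrite normr_id.
  have iq : P.-integrable setT (EFin \o (fun w => \1_E w * q (X r w))).
    apply: (@bounded_integrable _ _ _ P _ _ Cq) => //.
      apply: measurable_funM => //; apply: (measurableT_comp (cmeas cq)).
      exact: (measurableT_comp jX (measurable_pair1 r)).
    by move=> w _; rewrite normrM (ger0_norm (i0 w)) -[leRHS]mul1r; apply: ler_pM.
  have EN : \int[P]_w (2 * D r w) = 2 * \int[P]_w (xi w * \int[mu]_(v in `[r, t]) f (X v w)).
    rewrite -RintegralZl//.
      by apply: eq_Rintegral => w _; rewrite /D /xi functionalB// !mulrA.
    apply: (@bounded_integrable _ _ _ P _ _ (1 * (Cf * (Cf * (t - s))))) => //.
      rewrite (_ : (fun w => _) = (fun w => 2^-1 * (2 * D r w))).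
        by apply: measurable_funM => //; exact: (measurableT_comp jD (measurable_pair2 r)).
      by apply/funext => w; rewrite /D /xi -functionalB//; field.
    move=> w _; rewrite /xi -functionalB// -mulrA normrM (ger0_norm (i0 _)).
    by apply: ler_pM => //; rewrite normrM; apply: ler_pM => //; exact: bfun.
  rewrite -EFinM lee_fin EN normrM ger0_norm// -mulrA ler_wpM2l//.
  apply: (le_trans hs); rewrite ler_wpM2l//; apply: le_trans (ler_norm _).
  apply: le_Rintegral => // w _; rewrite /xi normrM (ger0_norm (i0 w)).
  by rewrite ler_wpM2l.
rewrite ge0_integralZl_EFin//; last 2 first.
- by apply/measurable_EFinP; apply: measurable_funTS; apply: measurableT_comp.
- exact: mulr_ge0.
have := wq s0 st ts mi i0 i1'.
have -> : \int[P]_w (\1_E w : R) = fine (P E) by rewrite /Rintegral integral_indic// setIT.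
move=> hq; have -> : (2 * delta * kappa * fine (P E))%:E = ((2 * delta)%:E * (kappa * fine (P E))%:E)%E.
  by rewrite -EFinM mulrA.
by apply: lee_wpmul2l => //; rewrite lee_fin mulr_ge0.
Qed.

(** Chebyshev's inequality at level [2 * c]: the second moment is at most [c ^ 2] times the
    probability of [E], a quarter of [(2 * c) ^ 2]. *)
Lemma functional_tail c s t (E : set T) : 0 < c -> 2 * delta * kappa <= c ^+ 2 ->
  0 <= s -> s <= t -> t - s <= tau -> F s E ->
  fine (P (E `&` [set w | 2 * c < `|functional t w - functional s w|])) <= 4^-1 * fine (P E).
Proof.
move=> c0 hc s0 st ts FE.
have mE : measurable E by exact: FT FE.
have mf v := filtration_measurableT sF FT (@functional_adapted v).
have mB : measurable [set w | 2 * c < `|functional t w - functional s w|].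
  have mn : measurable_fun [set: T] (fun w => `|functional t w - functional s w|).
    by apply: measurableT_comp => //; exact: (measurable_funB (mf t) (mf s)).
  rewrite (_ : [set _ | _] = (fun w => `|functional t w - functional s w|) @^-1` `]2 * c, +oo[%classic).
    by rewrite -[X in measurable X]setTI; exact: mn.
  by apply/seteqP; split => w /=; rewrite in_itv/= andbT.
have mEB : measurable (E `&` [set w | 2 * c < `|functional t w - functional s w|]) by exact: measurableI.
set EB := E `&` _ in mEB *.
have c20 : 0 < 4 * c ^+ 2 by rewrite mulr_gt0// exprn_gt0.
rewrite -(ler_pM2l c20) [leRHS](_ : _ = c ^+ 2 * fine (P E)); last by field.
apply: (@le_trans _ _ (2 * delta * kappa * fine (P E))); last by rewrite ler_wpM2r ?fine_ge0.
apply: le_trans (functional_second_moment s0 st ts FE).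
have iB : P.-integrable setT (EFin \o (\1_EB : T -> R)) by exact: integrable_indic.
have -> : fine (P EB) = \int[P]_w (\1_EB w : R) by rewrite /Rintegral integral_indic// setIT.
rewrite -RintegralZl//; apply: le_Rintegral => //.
- exact: (integrableZl measurableT _ iB).
- have mi : measurable_fun [set: T] (\1_E : T -> R) by exact: measurable_indic.
  apply: (@bounded_integrable _ _ _ P _ _ (1 * (Cf * (t - s)) ^+ 2)) => //.
    by apply: measurable_funM => //; apply: measurable_funX; exact: (measurable_funB (mf t) (mf s)).
  move=> w _; rewrite normrM; apply: ler_pM => //.
    by rewrite indicE; case: (_ \in _); rewrite ?normr1 ?normr0.
  rewrite normrX; apply: lerXn2r; rewrite ?nnegrE//; last exact: functional_lipschitz.
  by rewrite mulr_ge0// subr_ge0.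
move=> w _; rewrite !indicE; have [|wE] := boolP (w \in EB); last first.
  by rewrite mulr0 mulr_ge0// sqr_ge0.
rewrite inE => -[Ew /= hw]; rewrite mem_set// mulr1 mul1r.
rewrite -[leRHS]real_normK ?num_real// (_ : 4 * c ^+ 2 = (2 * c) ^+ 2); last by ring.
by apply: lerXn2r; rewrite ?nnegrE ?mulr_ge0// ltW.
Qed.

(** Discretization on a grid so fine that the path moves by at most [c] between neighbours. This
    gives the jump bound of the discrete argument and the additional [c] of the conclusion at
    intermediate times. *)
Lemma functional_sup c j : 0 < c -> 2 * delta * kappa <= c ^+ 2 -> 0 < tau ->
  exists B : set T, [/\ measurable B, fine (P B) <= 2^-1 ^+ j &
    forall w, ~ B w -> forall t, 0 <= t <= tau -> `|functional t w| <= j%:R * (5 * c) + c].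
Proof.
move=> c0 hc tau0.
pose n := Num.bound (Cf * tau / c).
have n0 : (0 : R) < n.+1%:R by rewrite ltr0n.
pose D := tau / n.+1%:R.
have D0 : 0 < D by rewrite divr_gt0.
have CD : Cf * D <= c.
  rewrite /D mulrA ler_pdivrMr// [leRHS]mulrC -ler_pdivrMr// ltW//.
  apply: (@lt_trans _ _ n%:R); last by rewrite ltr_nat.
  by rewrite archi_boundP// divr_ge0 ?mulr_ge0// ltW.
pose tt (i : nat) : R := i%:R * D.
have tt0 i : 0 <= tt i by rewrite mulr_ge0// ltW.
have ttm i k : (i <= k)%N -> tt i <= tt k by move=> ik; rewrite ler_wpM2r ?(ltW D0)// ler_nat.
have ttn : tt n.+1 = tau by rewrite /tt /D; field; rewrite gt_eqF.
have mad i (k : nat) r : (i <= k)%N -> F (tt k) [set w | r < `|functional (tt k) w - functional (tt i) w|].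
  move=> ik; have m1 := @functional_adapted (tt k).
  have m2 := filtration_measurable sF FF (ttm _ _ ik) (@functional_adapted (tt i)).
  have m3 : measurable_fun [set: g_sigma_algebraType (F (tt k))] (fun w => `|functional (tt k) w - functional (tt i) w| : measurableTypeR R).
    by apply: measurableT_comp => //; exact: (measurable_funB m1 m2).
  have := (sub_sigma_measurable (sF (tt k)) _).1 m3 `]r, +oo[%classic (measurable_itv _).
  by rewrite (_ : _ @^-1` _ = [set w | r < `|functional (tt k) w - functional (tt i) w|])//; apply/seteqP; split => w /=; rewrite in_itv/= andbT.
have f0 w : functional (tt 0%N) w = 0.
  by rewrite /functional /tt mul0r set_itv1 Rintegral_set1.
have mad0 (k : nat) r : F (tt k) [set w | r < `|functional (tt k) w|].
  have := mad 0%N k r (leq0n k).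
  by rewrite (_ : [set w | _] = [set w | r < `|functional (tt k) w|])//; apply/seteqP; split => w /=; rewrite f0 subr0.
have Fm i : F (tt i) `<=` measurable by exact: FT.
have FI i A B : F (tt i) A -> F (tt i) B -> F (tt i) (A `&` B).
  move=> FA FB; have : (F (tt i)).-sigma.-measurable (A `&` B : set (g_sigma_algebraType (F (tt i)))).
    by apply: measurableI; exact: sub_sigma_algebra.
  by rewrite /measurable/= (sigma_algebra_id (sF (tt i))).
have FC i A : F (tt i) A -> F (tt i) (~` A).
  move=> FA; have : (F (tt i)).-sigma.-measurable (~` A : set (g_sigma_algebraType (F (tt i)))).
    by apply: measurableC; exact: sub_sigma_algebra.
  by rewrite /measurable/= (sigma_algebra_id (sF (tt i))).
have FTT i : F (tt i) setT.
  have : (F (tt i)).-sigma.-measurable (setT : set (g_sigma_algebraType (F (tt i)))) by [].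
  by rewrite /measurable/= (sigma_algebra_id (sF (tt i))).
have FS i : F (tt i) `<=` F (tt i.+1) by apply: FF; exact: ttm.
have tl i E : (i <= n.+1)%N -> F (tt i) E ->
  fine (P (E `&` [set w | 2 * c < `|functional (tt n.+1) w - functional (tt i) w|])) <= 4^-1 * fine (P E).
  move=> ik FE; apply: functional_tail => //; first exact: ttm.
  by rewrite ttn lerBlDr lerDl.
have jmp i w : `|functional (tt i.+1) w - functional (tt i) w| <= c.
  apply: le_trans CD; apply: (le_trans (functional_lipschitz w (ttm _ _ (leqnSn i)))).
  by rewrite /tt -natr1 mulrDl mul1r addrAC subrr add0r.
exists [set w | exists2 l, (0 <= l <= n.+1)%N & j%:R * (5 * c) < `|functional (tt l) w|]; split.
- exact: (@exceedance_measurable R d T (fun i => F (tt i)) (fun i => functional (tt i)) n.+1 c Fm mad0 0%N j (leq0n _)).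
- exact: (@exceedance_le R d T P (fun i => F (tt i)) (fun i => functional (tt i)) n.+1 c Fm FI FC FTT FS mad mad0 c0 tl jmp f0).
move=> w nB t /andP[t0 ttau].
pose i := Num.trunc (t / D).
have /andP[it ti] : i%:R <= t / D < i.+1%:R.
  by apply: truncn_itv; rewrite divr_ge0// ltW.
have it' : tt i <= t by rewrite /tt -ler_pdivlMr.
have ti' : t <= tt i + D by move: ti; rewrite ltr_pdivrMr// -natr1 mulrDl mul1r => /ltW.
have i_n : (i <= n.+1)%N.
  rewrite -(ler_nat R); apply: (le_trans it); rewrite ler_pdivrMr//.
  by rewrite -/(tt n.+1) ttn.
have h1 : `|functional (tt i) w| <= j%:R * (5 * c).
  by rewrite leNgt; apply/negP => hh; apply: nB; exists i.
have h2 : `|functional t w - functional (tt i) w| <= c.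
  apply: (le_trans (functional_lipschitz w it')); apply: le_trans CD.
  by rewrite ler_wpM2l//; move: ti'; lra.
rewrite -[functional t w](subrK (functional (tt i) w)).
by apply: (le_trans (ler_normD _ _)); rewrite addrC lerD.
Qed.

End additive_functional.

(** * The density of the occupation measure of a path *)

Section path_density.
Context {R : realType}.
Notation mu := (@lebesgue_measure R).
Implicit Types (t y C theta : R).

(** Let [e n] be the tail of the geometric series. From [N] on, [u - e] increases and [u + e]
    decreases, so both enclose the limit; this gives convergence and the rate together. *)
Lemma geometric_cauchy (u : nat -> R) C theta N : 0 < theta < 1 ->
  (forall n, (N <= n)%N -> `|u n.+1 - u n| <= C * theta ^+ n) ->
  cvgn u /\ forall n, (N <= n)%N -> `|u n - limn u| <= C / (1 - theta) * theta ^+ n.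
Proof.
move=> /andP[th0 th1] hu.
have d0 : 0 < 1 - theta by rewrite subr_gt0.
pose e n := C / (1 - theta) * theta ^+ n.
have eS n : e n - e n.+1 = C * theta ^+ n.
  by rewrite /e exprS; field; rewrite gt_eqF.
have tn n : 0 < theta ^+ n by rewrite exprn_gt0.
have C0 : 0 <= C by have := le_trans (normr_ge0 _) (hu N (leqnn N)); rewrite pmulr_lge0.
have e0 n : 0 <= e n by rewrite /e mulr_ge0 ?(ltW (tn n))// divr_ge0// ltW.
pose v n := u (n + N)%N - e (n + N)%N.
have vnd : nondecreasing_seq v.
  apply/nondecreasing_seqP => n; rewrite /v addSn.
  have := hu (n + N)%N (leq_addl _ _); rewrite ler_norml => /andP[+ _].
  have := eS (n + N)%N; lra.
have wni n : u (n + N)%N + e (n + N)%N <= u N + e N.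
  elim: n => [//|n IH]; apply: le_trans IH; rewrite addSn.
  have := hu (n + N)%N (leq_addl _ _); rewrite ler_norml => /andP[_].
  have := eS (n + N)%N; lra.
have vb : has_ubound (range v).
  exists (u N + e N) => _ [n _ <-]; apply: le_trans (wni n); rewrite /v.
  have := e0 (n + N)%N; lra.
have cv : cvgn v by apply: nondecreasing_is_cvgn.
have ce : e n @[n --> \oo] --> (0 : R).
  rewrite -[X in _ --> X](mulr0 (C / (1 - theta))); apply: cvgM; first exact: cvg_cst.
  by apply: cvg_expr; rewrite ger0_norm// ltW.
have cu : u n @[n --> \oo] --> limn v.
  rewrite -(cvg_shiftn N) /=.
  have h1 : v n + e (n + N)%N @[n --> \oo] --> limn v + 0.
    by apply: cvgD => //; rewrite (cvg_shiftn N e).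
  have h2 : (fun n => v n + e (n + N)%N) = (fun n => u (n + N)%N).
    by apply/funext => n; rewrite /v subrK.
  by move: h1; rewrite addr0 h2.
have lu : limn u = limn v by apply/cvg_lim.
split; first by apply/cvg_ex; exists (limn v).
move=> n Nn; rewrite lu -/(e n).
have [k nk] : exists k, n = (k + N)%N by exists (n - N)%N; rewrite subnK.
have h1 : v k <= limn v by apply: nondecreasing_cvgn_le.
have h2 : limn v <= u n + e n.
  apply: limr_le => //; near=> j; apply: (@le_trans _ _ (u (j + N)%N + e (j + N)%N)).
    by rewrite /v; have := e0 (j + N)%N; lra.
  have kj : (k <= j)%N by near: j; exact: nbhs_infty_ge.
  rewrite nk -(subnK kj) -addnA; move: (j - k)%N => i.
  elim: i => [//|i IH]; apply: le_trans IH; rewrite addSn.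
  have := hu (i + (k + N))%N (leq_trans (leq_addl _ _) (leq_addl _ _)); rewrite ler_norml => /andP[_].
  have := eS (i + (k + N))%N; lra.
rewrite ler_norml; apply/andP; split; first by move: h2; lra.
by move: h1; rewrite /v -nk; lra.
Unshelve. all: by end_near.
Qed.

Variable x : R -> R.
Hypothesis mx : measurable_fun [set: R] x.

Definition smooth_density (n : nat) t y : R :=
  pi^-1 * \int[mu]_(r in `[0, t]) pk (2^-1 ^+ n) (x r - y).

Hypothesis cauchy : forall K : nat, exists C theta (N : nat), 0 < theta < 1 /\
  forall n t y, (N <= n)%N -> t <= K%:R -> `|y| <= K%:R ->
  `|smooth_density n.+1 t y - smooth_density n t y| <= C * theta ^+ n.

Definition density t y : R := limn (fun n => smooth_density n t y).

Lemma density_approx (K : nat) : exists C theta (N : nat), 0 < theta < 1 /\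
  forall t y, t <= K%:R -> `|y| <= K%:R ->
  cvgn (fun n => smooth_density n t y) /\
  forall n, (N <= n)%N -> `|smooth_density n t y - density t y| <= C * theta ^+ n.
Proof.
have [C [theta [N [th h]]]] := cauchy K.
exists (C / (1 - theta)), theta, N; split => // t y tK yK.
by apply: geometric_cauchy => // n Nn; exact: h.
Qed.

Lemma density_bound t y : exists K : nat, t <= K%:R /\ `|y| <= K%:R.
Proof.
exists (Num.bound (`|t| + `|y|)); have h : `|t| + `|y| < (Num.bound (`|t| + `|y|))%:R.
  by rewrite archi_boundP// addr_ge0.
have := ler_norm t; have := normr_ge0 y; have := normr_ge0 t; split; move: h; lra.
Qed.

Lemma density_cvg t y : smooth_density n t y @[n --> \oo] --> density t y.
Proof.
have [K [tK yK]] := density_bound t y.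
by have [C [theta [N [_ /(_ t y tK yK)[h _]]]]] := density_approx K.
Qed.

Let e0 n : 0 < 2^-1 ^+ n :> R. Proof. by rewrite exprn_gt0. Qed.

Let mpk n y : measurable_fun [set: R] (fun r => pk (2^-1 ^+ n) (x r - y)).
Proof.
apply: (@measurableT_comp _ _ _ _ _ _ (pk (2^-1 ^+ n))); last exact: measurable_funB.
by apply: continuous_measurable_fun => z; exact: (is_derive_cvg (is_derive_pk z (e0 n))).
Qed.

Let pk_bound n z : `|pk (2^-1 ^+ n : R) z| <= (2^-1 ^+ n)^-1.
Proof. by rewrite ger0_norm ?pk_ge0 ?pk_le. Qed.

Lemma smooth_density_ge0 n t y : 0 <= smooth_density n t y.
Proof.
apply: mulr_ge0; first by rewrite invr_ge0 pi_ge0.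
by apply: Rintegral_ge0 => r _; exact: pk_ge0.
Qed.

Lemma density_ge0 t y : 0 <= density t y.
Proof.
apply: limr_ge; first by apply/cvg_ex; exists (density t y); exact: density_cvg.
by near=> n; exact: smooth_density_ge0.
Unshelve. all: by end_near.
Qed.

Lemma pi_bounds : 0 <= pi^-1 :> R /\ pi^-1 <= 1 :> R.
Proof.
split; first by rewrite invr_ge0 pi_ge0.
by rewrite invf_le1 ?pi_gt0//; have := @pi_ge2 R; lra.
Qed.

Lemma smooth_density_lipschitz_space n t y y' :
  `|smooth_density n t y - smooth_density n t y'| <= Num.max 0 t * (2^-1 ^+ n) ^- 2 * `|y - y'|.
Proof.
have [p0 p1] := pi_bounds.
have [t0|t0] := ltP t 0.
  rewrite /smooth_density set_itv_ge ?Rintegral_set0; last by rewrite bnd_simp -ltNge.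
  by rewrite subrr normr0 mul0r.
rewrite /smooth_density -mulrBr normrM (ger0_norm p0).
have i1 z : mu.-integrable `[0, t] (EFin \o (fun r => pk (2^-1 ^+ n) (x r - z))).
  exact: (integrable_itv (mpk n z) (fun r _ => pk_bound n _)).
have mD : measurable (`[0, t]%classic : set (measurableTypeR R)) by exact: measurable_itv.
rewrite -(RintegralB mD (i1 y) (i1 y')).
have md : measurable_fun [set: R] (fun r => pk (2^-1 ^+ n) (x r - y) - pk (2^-1 ^+ n) (x r - y')).
  by apply: measurable_funB; exact: mpk.
rewrite -[leRHS]mul1r; apply: ler_pM => //.
rewrite -mulrA mulrC -[X in _ <= _ * X](subr0 t); apply: Rintegral_itv_le => // r _.
apply: (le_trans (bounded_derive_lipschitz (fun z => is_derive_pk z (e0 n)) (fun z => dpk_le z (e0 n)) _ _)).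
by rewrite (_ : _ - _ = y' - y); [rewrite distrC|ring].
Qed.

Lemma smooth_density_lipschitz_time n t t' y : t <= t' ->
  `|smooth_density n t' y - smooth_density n t y| <= (2^-1 ^+ n)^-1 * (t' - t).
Proof.
move=> tt'; have [p0 p1] := pi_bounds.
rewrite /smooth_density -mulrBr normrM (ger0_norm p0) -[leRHS]mul1r; apply: ler_pM => //.
exact: (primitive_lipschitz 0 (mpk n y) (fun r => pk_bound n _) tt').
Qed.

(** The approximations converge uniformly near the given point and are Lipschitz in time and space.
    Their Lipschitz constants explode with [n], so [n] is fixed before the neighbourhood; [K] is
    chosen to contain a unit neighbourhood. *)
Lemma density_continuous : continuous (fun p : R * R => density p.1 p.2).
Proof.
move=> [t0 y0]; apply/cvgrPdist_le => e e_gt0.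
have [K [tK yK]] := density_bound (`|t0| + 1) (`|y0| + 1).
have K0 : 0 <= K%:R :> R by [].
have [C [theta [N [th h]]]] := density_approx K.
have [n Nn hn] : exists2 n, (N <= n)%N & C * theta ^+ n <= e / 3.
  have ce : C * theta ^+ n @[n --> \oo] --> (0 : R).
    rewrite -[X in _ --> X](mulr0 C); apply: cvgM; first exact: cvg_cst.
    by case/andP: th => th0 th1; apply: cvg_expr; rewrite ger0_norm// ltW.
  have e3 : 0 < e / 3 by rewrite divr_gt0.
  move/cvgrPdist_lt/(_ _ e3): ce => [M _ hM]; exists (maxn N M); first exact: leq_maxl.
  have := hM (maxn N M) (leq_maxr _ _); rewrite /= sub0r normrN => hl.
  by apply: (le_trans (ler_norm _)); exact: ltW.
pose M := (2^-1 ^+ n)^-1 + K%:R * (2^-1 ^+ n) ^- 2 + 1 : R.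
have M1 : 0 <= (2^-1 ^+ n)^-1 :> R by rewrite invr_ge0 ltW.
have M2 : 0 <= K%:R * (2^-1 ^+ n) ^- 2 :> R by rewrite mulr_ge0// invr_ge0 exprn_ge0// ltW.
have M0 : 0 < M by rewrite /M ltr_wpDl// addr_ge0.
pose dd := Num.min 1 (e / 3 / M).
have d0 : 0 < dd by rewrite lt_min ltr01/= !divr_gt0.
have dM : dd * M <= e / 3 by rewrite -ler_pdivlMr// ge_min lexx orbT.
have d1 : dd <= 1 by rewrite ge_min lexx.
have H : \forall p \near (t0, y0), `|t0 - p.1| < dd /\ `|y0 - p.2| < dd.
  exists (ball t0 dd, ball y0 dd); first by split; exact: nbhsx_ballx.
  by move=> [t y] [].
apply: filterS H => -[t y] /= [ht hy].
have tK' : t <= K%:R.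
  apply: le_trans tK; have := ler_norm t0; have := ler_norm (- (t0 - t)); rewrite normrN.
  by move: ht d1; lra.
have yK' : `|y| <= K%:R.
  have := ler_normD (y - y0) y0; rewrite subrK distrC.
  by move: yK; rewrite ger0_norm ?addr_ge0//; move: hy d1; lra.
have t0K : t0 <= K%:R by apply: le_trans tK; have := ler_norm t0; lra.
have y0K : `|y0| <= K%:R by move: yK; rewrite ger0_norm ?addr_ge0//; lra.
have [_ /(_ n Nn) h1] := h t y tK' yK'.
have [_ /(_ n Nn) h2] := h t0 y0 t0K y0K.
have h3 : `|smooth_density n t0 y0 - smooth_density n t y0| <= (2^-1 ^+ n)^-1 * dd.
  have [tt|/ltW tt] := leP t t0.
    apply: (le_trans (smooth_density_lipschitz_time n y0 tt)); rewrite ler_wpM2l//.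
    by apply: le_trans (ltW ht); exact: ler_norm.
  rewrite distrC; apply: (le_trans (smooth_density_lipschitz_time n y0 tt)); rewrite ler_wpM2l//.
  by apply: le_trans (ltW ht); rewrite distrC; exact: ler_norm.
have h4 : `|smooth_density n t y0 - smooth_density n t y| <= K%:R * (2^-1 ^+ n) ^- 2 * dd.
  apply: (le_trans (smooth_density_lipschitz_space n t y0 y)).
  apply: ler_pM => //; last exact: ltW.
    by rewrite mulr_ge0// ?le_max ?lexx// invr_ge0 exprn_ge0// ltW.
  by rewrite ler_wpM2r ?invr_ge0 ?exprn_ge0 ?(ltW (e0 n))// ge_max K0.
have h5 : (2^-1 ^+ n)^-1 * dd + K%:R * (2^-1 ^+ n) ^- 2 * dd <= e / 3.
  by apply: le_trans dM; rewrite /M -mulrDl mulrC ler_wpM2l ?(ltW d0)// lerDl.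
rewrite distrC in h2.
have -> : density t0 y0 - density t y = (density t0 y0 - smooth_density n t0 y0) +
  ((smooth_density n t0 y0 - smooth_density n t y0) + (smooth_density n t y0 - smooth_density n t y)) +
  (smooth_density n t y - density t y) by ring.
apply: (le_trans (ler_normD _ _)); apply: (le_trans (lerD (ler_normD _ _) (lexx _))).
have := ler_normD (smooth_density n t0 y0 - smooth_density n t y0) (smooth_density n t y0 - smooth_density n t y).
by move: h1 h2 h3 h4 h5 hn; lra.
Qed.

Lemma measurable_smooth_density n t : measurable_fun [set: R] (smooth_density n t).
Proof.
apply: continuous_measurable_fun; apply: (@lipschitz_cont R _ (Num.max 0 t * (2^-1 ^+ n) ^- 2)) => y y' yy'.
by rewrite -(ger0_norm (_ : 0 <= y' - y)) ?subr_ge0//; exact: smooth_density_lipschitz_space.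
Qed.

Lemma measurable_density t : measurable_fun [set: R] (density t).
Proof.
apply: (@measurable_fun_cvg _ _ _ _ (fun n y => smooth_density n t y)) => [m|y _].
  exact: (measurable_smooth_density m t).
exact: density_cvg.
Qed.

(** Two expressions for [U n] have the two sides as limits. By Tonelli it is [pi^-1] times the time
    integral of the Poisson smoothing of [f], which is bounded by [pi] and tends to [pi * f]. By
    definition it is the integral of [f] against approximations that converge uniformly on
    [[a, b]]. *)
Lemma density_test (f : R -> R) t (a b : R) : 0 <= t -> a < b -> continuous f ->
  (forall z, 0 <= f z <= 1) -> (forall z, ~ (a <= z <= b) -> f z = 0) ->
  (\int[mu]_(r in `[0%R, t]) (f (x r))%:E = \int[mu]_z (f z * density t z)%:E)%E.
Proof.
move=> t0 ab cf f01 fab.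
have f0 z : 0 <= f z by case/andP: (f01 z).
have f1 z : f z <= 1 by case/andP: (f01 z).
have mf : measurable_fun [set: R] f by exact: continuous_measurable_fun.
have mAB : measurable (`[a, b]%classic : set (measurableTypeR R)) by exact: measurable_itv.
have mT : measurable (`[0, t]%classic : set (measurableTypeR R)) by exact: measurable_itv.
have fE z : f z = f z * \1_(`[a, b]%classic) z.
  rewrite indicE; have [|/negP zab] := boolP (z \in _); first by rewrite mulr1.
  by rewrite mulr0; apply: fab; move: zab; rewrite inE/= in_itv.
have fF : (\int[mu]_z (f z)%:E <= (b - a)%:E)%E.
  apply: (@le_trans _ _ (\int[mu]_z (\1_(`[a, b]%classic) z)%:E)%E).
    apply: ge0_le_integral => //.
    - by move=> z _; rewrite lee_fin.
    - exact/measurable_EFinP.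
    - by apply/measurable_EFinP; exact: measurable_indic.
    - by move=> z _; rewrite lee_fin fE ler_piMl// indicE ler0n.
  by rewrite integral_indic// setIT/= lebesgue_measure_itv/= lte_fin ab -EFinB.
have ba0 : 0 <= b - a by rewrite subr_ge0 ltW.
have pi0 : 0 <= pi :> R by exact: pi_ge0.
have [ip0 ip1] := pi_bounds.
pose W n r := (\int[mu]_z (pk (2^-1 ^+ n) (x r - z) * f z)%:E)%E.
pose U n := (\int[mu]_z (f z * smooth_density n t z)%:E)%E.
have cpk n : continuous (@pk R (2^-1 ^+ n)) by move=> z; exact: (is_derive_cvg (is_derive_pk z (e0 n))).
pose I n (o : measurableTypeR R * measurableTypeR R) : \bar R :=
  (pk (2^-1 ^+ n) (x o.1 - o.2) * f o.2)%:E.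
have I0 n o : (0 <= I n o)%E by rewrite lee_fin mulr_ge0 ?pk_ge0.
have mI n : measurable_fun setT (I n).
  apply/measurable_EFinP; apply: measurable_funM; last exact: (measurableT_comp mf measurable_snd).
  apply: (measurableT_comp (continuous_measurable_fun (cpk n))).
  apply: measurable_funB; [exact: (measurableT_comp mx measurable_fst)|exact: measurable_snd].
have mW n : measurable_fun [set: R] (W n).
  exact: (measurable_fun_fubini_tonelli_F (m2 := mu) (I n) (mI n) (I0 n)).
have W0 n r : (0 <= W n r)%E by apply: integral_ge0 => z _; exact: (I0 n (r, z)).
have WC n r : (W n r <= pi%:E)%E.
  rewrite -(integral_pk (x r) (e0 n)); apply: ge0_le_integral; first exact: measurableT.
  - by move=> z _; exact: (I0 n (r, z)).
  - exact: (measurableT_comp (mI n) (measurable_pair1 r)).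
  - apply/measurable_EFinP; apply: (measurableT_comp (continuous_measurable_fun (cpk n))).
    exact: measurable_funB.
  - by move=> z _; rewrite lee_fin ler_piMr// pk_ge0.
have UE n : U n = ((pi^-1)%:E * \int[mu]_(r in `[0%R, t]) W n r)%E.
  rewrite [in RHS]integral_mkcond.
  transitivity ((pi^-1)%:E * \int[mu]_r \int[mu]_z (I n (r, z) * (\1_(`[0, t]%classic) r)%:E))%E; last first.
    congr (_ * _)%E; apply: eq_integral => r _; rewrite epatch_indic /W -ge0_integralZr//.
    - exact: (measurableT_comp (mI n) (measurable_pair1 r)).
    - by move=> z _; exact: (I0 n (r, z)).
    - by rewrite lee_fin indicE ler0n.
  have mJ : measurable_fun [set: measurableTypeR R * measurableTypeR R] (fun o => (I n o * (\1_(`[0, t]%classic) o.1)%:E)%E).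
    apply: emeasurable_funM => //; apply/measurable_EFinP.
    exact: (measurableT_comp (measurable_indic mT) measurable_fst).
  have J0 (o : R * R) : (0 <= I n o * (\1_(`[0, t]%classic) o.1)%:E)%E.
    by rewrite mule_ge0// lee_fin indicE ler0n.
  have -> : (\int[mu]_r \int[mu]_z (I n (r, z) * (\1_(`[0, t]%classic) r)%:E) =
     \int[mu]_z \int[mu]_r (I n (r, z) * (\1_(`[0, t]%classic) r)%:E))%E.
    exact: (fubini_tonelli (m1 := mu) (m2 := mu) _ mJ J0).
  rewrite -ge0_integralZl_EFin//; last 2 first.
  - by move=> z _; apply: integral_ge0 => r _; exact: (J0 (r, z)).
  - exact: (measurable_fun_fubini_tonelli_G (m1 := mu) _ mJ J0).
  apply: eq_integral => z _.
  have ipz : mu.-integrable `[0, t] (EFin \o (fun r => pk (2^-1 ^+ n) (x r - z))).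
    exact: (integrable_itv (mpk n z) (fun r _ => pk_bound n _)).
  have -> : (f z * smooth_density n t z)%:E =
     ((pi^-1)%:E * ((f z)%:E * \int[mu]_(r in `[0%R, t]) (pk (2^-1 ^+ n) (x r - z))%:E))%E.
    rewrite /smooth_density mulrCA EFinM (EFinM (f z)) /Rintegral fineK//.
    exact: (integrable_fin_num mT ipz).
  congr (_ * _)%E; rewrite [in LHS]integral_mkcond -ge0_integralZl_EFin//.
  - by apply: eq_integral => r _; rewrite epatch_indic /I/= -!EFinM; congr EFin; ring.
  - by move=> r _; apply: erestrict_ge0 => v _; rewrite lee_fin pk_ge0.
  - apply/(measurable_restrictT _ mT); apply: measurable_funTS; apply/measurable_EFinP; exact: mpk.
have Wcvg r : W n r @[n --> \oo] --> (pi * f (x r))%:E.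
  have h := @pk_conv_cvg R f 1 f0 cf f1 (x r).
  (* The scale [2 ^ (- n)] is the scale [1 / (k + 1)] at [k = 2 ^ n - 1]. *)
  rewrite (_ : (fun n => W n r) = (fun k => (\int[mu]_z (pk (k.+1%:R^-1) (x r - z) * f z)%:E)%E) \o (fun n => (2 ^ n).-1)%N).
    apply: cvg_comp h; apply/cvgnyPge => A; near=> n.
    rewrite -ltnS prednK ?expn_gt0//.
    have An : (A <= n)%N by near: n; exact: nbhs_infty_ge.
    by apply: leq_ltn_trans An _; exact: ltn_expl.
  by apply/funext => n; rewrite /W /= prednK ?expn_gt0// natrX -exprVn.
have lim1 : U n @[n --> \oo] --> (\int[mu]_(r in `[0%R, t]) (f (x r))%:E)%E.
  under eq_cvg do rewrite UE.
  have -> : (\int[mu]_(r in `[0%R, t]) (f (x r))%:E = (pi^-1)%:E * \int[mu]_(r in `[0%R, t]) (pi * f (x r))%:E)%E.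
    rewrite -ge0_integralZl_EFin//.
    - by apply: eq_integral => r _; rewrite -EFinM mulKf// gt_eqF// pi_gt0.
    - by move=> r _; rewrite lee_fin mulr_ge0.
    - by apply/measurable_EFinP; apply: measurable_funTS; apply: measurable_funM => //; exact: measurableT_comp.
  apply: cvgeZl => //.
  have [] // := @dominated_convergence _ _ _ mu `[0, t]%classic mT W (fun r => (pi * f (x r))%:E) (cst pi%:E).
  - by move=> n; apply: measurable_funTS; exact: mW.
  - by apply/measurable_EFinP; apply: measurable_funTS; apply: measurable_funM => //; exact: measurableT_comp.
  - by apply: aeW => r _; exact: Wcvg.
  - apply/integrableP; split; first exact: measurable_cst.
    rewrite integral_cst//= lebesgue_measure_itv/= lte_fin.
    by case: ifP => _; rewrite ?mule0 ?ltry// -EFinB ger0_norm// -EFinM ltry.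
  - by apply: aeW => r n _; rewrite gee0_abs.
have lim2 : U n @[n --> \oo] --> (\int[mu]_z (f z * density t z)%:E)%E.
  have [K [tK abK]] := density_bound t (`|a| + `|b|).
  have [C [theta [N [th h]]]] := density_approx K.
  have inK z : a <= z <= b -> `|z| <= K%:R.
    move: abK; rewrite ger0_norm ?addr_ge0// => abK.
    move=> /andP[az zb]; apply: le_trans abK; rewrite ler_norml.
    have := ler_norm (- a); rewrite normrN; have := ler_norm b; have := normr_ge0 a; have := normr_ge0 b.
    by move: az zb => *; apply/andP; split; lra.
  have C0 : 0 <= C.
    have aab : a <= a <= b by rewrite lexx ltW.
    have [_ /(_ N (leqnn N)) hh] := h t a tK (inK a aab).
    have := le_trans (normr_ge0 _) hh.
    by rewrite pmulr_lge0// exprn_gt0//; case/andP: th.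
  (* Majorant of all approximations from [N] on over [[a, b]]: the [N]-th is at most its Lipschitz
     constant in time multiplied by [t], and it and the later ones lie within [C] of the limit. *)
  pose Q := (2^-1 ^+ N)^-1 * t + 2 * C.
  rewrite -(cvg_shiftn N).
  have msd n := measurable_smooth_density n t.
  have mden := measurable_density t.
  have th1 n : theta ^+ n <= 1 by case/andP: th => th0 th1; rewrite exprn_ile1// ltW.
  have sd0 y : smooth_density N t y <= (2^-1 ^+ N)^-1 * t.
    have := smooth_density_lipschitz_time N y t0; rewrite subr0.
    rewrite {2}/smooth_density set_itv1 Rintegral_set1 mulr0 subr0.
    by apply: le_trans; exact: ler_norm.
  have [] // := @dominated_convergence _ _ _ mu setT measurableT
    (fun n z => (f z * smooth_density (n + N)%N t z)%:E) (fun z => (f z * density t z)%:E)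
    (fun z => (Q * \1_(`[a, b]%classic) z)%:E).
  - by move=> n; apply/measurable_EFinP; exact: (measurable_funM mf (msd _)).
  - by apply/measurable_EFinP; exact: (measurable_funM mf mden).
  - apply: aeW => z _; apply: cvg_EFin; first by near=> n.
    by apply: cvgM; [exact: cvg_cst|rewrite (cvg_shiftn N (fun n => smooth_density n t z)); exact: density_cvg].
  - exact: (integrableZl measurableT _ (integrable_indic_itv a b true false)).
  - apply: aeW => z n _; rewrite /= lee_fin fE mulrAC normrM.
    rewrite [X in _ * X]ger0_norm; last by rewrite indicE ler0n.
    rewrite indicE; have [|_] := boolP (z \in _); last by rewrite !mulr0.
    rewrite inE/= in_itv/= => zab; rewrite !mulr1 (ger0_norm (mulr_ge0 (f0 z) (smooth_density_ge0 _ _ _))).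
    rewrite -[leRHS]mul1r; apply: ler_pM => //; first exact: smooth_density_ge0.
    have [_ hh] := h t z tK (inK z zab).
    have h1 := hh _ (leq_addl n N); have h2 := hh _ (leqnn N).
    have h3 := ler_wpM2l C0 (th1 (n + N)%N); have h4 := ler_wpM2l C0 (th1 N).
    have := sd0 z; rewrite /Q.
    have := ler_norm (smooth_density (n + N)%N t z - density t z).
    have := ler_norm (- (smooth_density N t z - density t z)); rewrite normrN.
    by move: h1 h2 h3 h4; rewrite mulr1; lra.
exact: (cvg_unique _ lim1 lim2).
Unshelve. all: by end_near.
Qed.

Lemma measure_eq_itvoo (m1 m2 : {measure set (measurableTypeR R) -> \bar R}) :
  (forall a b : R, a < b -> m1 `]a, b[%classic = m2 `]a, b[%classic) ->
  (forall a b : R, (m1 `]a, b[%classic < +oo)%E) ->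
  forall B : set (measurableTypeR R), measurable B -> m1 B = m2 B.
Proof.
move=> h hoo B mB.
apply: (@measure_unique _ R (measurableTypeR R) (@RGenOpens.G R)
  (fun k : nat => `](- k%:R)%R, k%:R[%classic) _ _ _ _ m1 m2 _ _ B mB).
- exact: RGenOpens.measurableE.
- move=> _ _ [a [b ->]] [a' [b' ->]].
  exists (Num.max a a'), (Num.min b b').
  by apply/seteqP; split => z /=; rewrite !in_itv/= gt_max lt_min;
    [move=> [/andP[-> ->] /andP[-> ->]]|move=> /andP[/andP[-> ->] /andP[-> ->]]].
- by move=> i; exists (- i%:R), i%:R.
- apply/seteqP; split => // z _; exists (Num.bound z) => //=; rewrite in_itv/=.
  have := archi_boundP (normr_ge0 z).
  have -> : Num.bound `|z| = Num.bound z by rewrite /Num.bound normr_id.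
  by rewrite ltr_norml.
- move=> _ [a [b ->]]; have [/h//|ba] := ltP a b.
  by rewrite set_itv_ge ?measure0// bnd_simp -leNgt.
- by move=> k; exact: hoo.
Qed.

(** Continuous trapezoidal functions increase to the indicator of an open interval, which is why
    open intervals are treated first. *)
Lemma density_itvoo t (a b : R) : 0 <= t -> a < b ->
  (mu (`[0%R, t]%classic `&` x @^-1` `]a, b[%classic) =
   \int[mu]_(z in `]a, b[%classic) (density t z)%:E)%E.
Proof.
move=> t0 ab.
pose f (k : nat) z := Num.min 1 (k%:R * Num.max 0 (Num.min (z - a) (b - z))) : R.
have u0 z : 0 <= Num.max 0 (Num.min (z - a) (b - z)) by rewrite le_max lexx.
have f0 k z : 0 <= f k z by rewrite le_min ler01/= mulr_ge0.
have f01 k z : 0 <= f k z <= 1 by rewrite f0 ge_min lexx.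
have foo z : ~ (a < z < b) -> Num.max 0 (Num.min (z - a) (b - z)) = 0.
  move/negP; rewrite negb_and -!leNgt => h; apply/max_idPl; rewrite ge_min.
  by case/orP: h => h; apply/orP; [left|right]; rewrite subr_le0.
have fab k z : ~ (a <= z <= b) -> f k z = 0.
  move=> h; rewrite /f foo ?mulr0 ?min_r// => /andP[az zb]; apply: h.
  by rewrite !ltW.
have cf k : continuous (f k).
  have c1 : continuous ((fun z => z - a) \min (fun z => b - z)).
    move=> z; apply: continuous_min.
      by apply: (@continuousB _ R^o); [exact: cvg_id|exact: cvg_cst].
    by apply: (@continuousB _ R^o); [exact: cvg_cst|exact: cvg_id].
  have c2 : continuous (cst 0 \max ((fun z => z - a) \min (fun z => b - z))).
    by move=> z; apply: continuous_max; [exact: cvg_cst|exact: c1].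
  have c3 : continuous (cst k%:R \* (cst 0 \max ((fun z => z - a) \min (fun z => b - z)))).
    by move=> z; apply: continuousM; [exact: cvg_cst|exact: c2].
  have c4 : continuous (cst 1 \min (cst k%:R \* (cst 0 \max ((fun z => z - a) \min (fun z => b - z))))).
    by move=> z; apply: continuous_min; [exact: cvg_cst|exact: c3].
  exact: c4.
have mf k : measurable_fun [set: R] (f k) by exact: continuous_measurable_fun.
have fnd z : {homo f^~ z : n m / (n <= m)%N >-> n <= m}.
  move=> n m nm; rewrite /f le_min ge_min lexx/= ge_min; apply/orP; right.
  by rewrite ler_wpM2r// ler_nat.
have flim z : (f k z)%:E @[k --> \oo] --> (\1_(`]a, b[%classic) z)%:E.
  rewrite indicE; have [zab|/negP zab] := boolP (z \in _).
    have /andP[az zb] : a < z < b by move: zab; rewrite inE/= in_itv.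
    pose u := Num.min (z - a) (b - z).
    have u1 : 0 < u by rewrite lt_min !subr_gt0 az.
    apply: cvg_near_cst; near=> k; congr EFin.
    rewrite /f (max_idPr (ltW u1))// min_l// -ler_pdivrMr//.
    by near: k; exact: nbhs_infty_ger.
  apply: cvg_near_cst; near=> k; congr EFin.
  by rewrite /f foo ?mulr0 ?min_r// => h; apply: zab; rewrite inE/= in_itv.
have mAB : measurable (`]a, b[%classic : set (measurableTypeR R)) by exact: measurable_itv.
have mT : measurable (`[0, t]%classic : set (measurableTypeR R)) by exact: measurable_itv.
have mden := measurable_density t.
have lim1 : (\int[mu]_(r in `[0%R, t]) (f k (x r))%:E)%E @[k --> \oo] -->
   mu (`[0%R, t]%classic `&` x @^-1` `]a, b[%classic).
  have := @cvg_monotone_convergence _ _ _ mu `[0, t]%classic mT (fun k r => (f k (x r))%:E) _ _ _.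
  have -> : (\int[mu]_(r in `[0%R, t]) limn (fun k => (f k (x r))%:E) =
     mu (`[0%R, t]%classic `&` x @^-1` `]a, b[%classic))%E.
    transitivity (\int[mu]_(r in `[0%R, t]) (\1_(x @^-1` `]a, b[%classic) r)%:E)%E.
      by apply: eq_integral => r _; apply/cvg_lim => //; exact: flim.
    rewrite integral_indic//; first by rewrite setIC.
    by rewrite -[X in measurable X]setTI; exact: mx.
  apply.
  - move=> k; apply/measurable_EFinP; apply: measurable_funTS; exact: (measurableT_comp (mf k) mx).
  - by move=> k r _; rewrite lee_fin.
  - by move=> r _ n m nm; rewrite lee_fin; exact: fnd.
have lim2 : (\int[mu]_z (f k z * density t z)%:E)%E @[k --> \oo] -->
   (\int[mu]_(z in `]a, b[%classic) (density t z)%:E)%E.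
  have := @cvg_monotone_convergence _ _ _ mu setT measurableT (fun k z => (f k z * density t z)%:E) _ _ _.
  have -> : (\int[mu]_z limn (fun k => (f k z * density t z)%:E) =
     \int[mu]_(z in `]a, b[%classic) (density t z)%:E)%E.
    rewrite [in RHS]integral_mkcond; apply: eq_integral => z _; apply/cvg_lim => //.
    under eq_cvg do rewrite EFinM.
    by rewrite epatch_indic muleC; apply: (@cvgeZr _ _ _ (fun k => (f k z)%:E) (\1_(`]a, b[%classic) z)%:E (density t z)%:E) => //; exact: flim.
  apply.
  - by move=> k; apply/measurable_EFinP; exact: (measurable_funM (mf k) mden).
  - by move=> k z _; rewrite lee_fin mulr_ge0// density_ge0.
  - by move=> z _ n m nm; rewrite lee_fin ler_wpM2r ?density_ge0// fnd.
rewrite -(cvg_lim _ lim1)// -(cvg_lim _ lim2)//; congr (limn _); apply/funext => k.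
exact: density_test t0 ab (cf k) (f01 k) (fab k).
Unshelve. all: by end_near.
Qed.

(** Both sides are measures in [B]; open intervals are stable under intersection and generate the
    Borel sets, and the left measure is finite on them. *)
Lemma density_occupation t (B : set (measurableTypeR R)) : 0 <= t -> measurable B ->
  (mu (`[0%R, t]%classic `&` x @^-1` B) = \int[mu]_(z in B) (density t z)%:E)%E.
Proof.
move=> t0 mB.
have mT : measurable (`[0, t]%classic : set (measurableTypeR R)) by exact: measurable_itv.
have mden : measurable_fun [set: measurableTypeR R] (fun z => (density t z)%:E).
  by apply/measurable_EFinP; exact: measurable_density.
have d0 z : (0 <= (density t z)%:E)%E by rewrite lee_fin density_ge0.
pose m1f (A : set (measurableTypeR R)) := mrestr mu mT (x @^-1` A).
have mpre (A : set (measurableTypeR R)) : measurable A -> measurable (x @^-1` A : set (measurableTypeR R)).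
  by move=> mA; have := mx measurableT mA; rewrite setTI.
have m1_0 : m1f set0 = 0%E by rewrite /m1f preimage_set0 measure0.
have m1_ge0 A : (0 <= m1f A)%E by exact: measure_ge0.
have m1_sa : semi_sigma_additive m1f.
  move=> G mG tG mUG; rewrite /m1f preimage_bigcup.
  apply: (@measure_semi_sigma_additive _ _ _ (mrestr mu mT) (fun n => x @^-1` G n)).
  - by move=> i; exact: mpre.
  - move/trivIsetP : tG => tG; apply/trivIsetP => i j _ _ ij.
    by rewrite -preimage_setI tG// preimage_set0.
  - by rewrite -preimage_bigcup; exact: mpre.
pose m1 : {measure set (measurableTypeR R) -> \bar R} :=
  HB.pack m1f (isMeasure.Build _ _ _ m1f m1_0 m1_ge0 m1_sa).
pose m2f (A : set (measurableTypeR R)) := (\int[mu]_(z in A) (density t z)%:E)%E.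
have m2_0 : m2f set0 = 0%E by rewrite /m2f integral_set0.
have m2_ge0 A : (0 <= m2f A)%E by apply: integral_ge0 => z _.
have m2_sa : semi_sigma_additive m2f by exact: (semi_sigma_additive_nng_induced mden d0).
pose m2 : {measure set (measurableTypeR R) -> \bar R} :=
  HB.pack m2f (isMeasure.Build _ _ _ m2f m2_0 m2_ge0 m2_sa).
have -> : mu (`[0%R, t]%classic `&` x @^-1` B) = m1 B by rewrite setIC.
apply: (@measure_eq_itvoo m1 m2) => // a b; first by move=> ab; have := density_itvoo t0 ab; rewrite setIC.
apply: (@le_lt_trans _ _ (mu (`[0, t]%classic))); last first.
  by rewrite lebesgue_measure_itv/= lte_fin; case: ifP => _; rewrite ?ltry// -EFinB ltry.
have : (mu (x @^-1` `]a, b[%classic `&` `[0%R, t]%classic) <= mu (`[0%R, t]%classic))%E; last by [].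
by apply: le_measure; rewrite ?inE//; apply: measurableI => //; apply: mpre.
Qed.

End path_density.

(** * Almost sure locally uniform convergence *)

Section borel_cantelli_grid.
Context {R : realType} d (T : measurableType d) (P : probability T R).
Variables (X : R -> T -> R) (K : nat) (C theta : R).
Hypothesis mX : forall w, measurable_fun [set: R] (X ^~ w : R -> R).
Hypothesis th : 0 < theta < 1.
Hypothesis C0 : 0 <= C.

Notation S n t z w := (smooth_density (X ^~ w) n t z).

Hypothesis tail : forall n z j, exists B : set T, [/\ measurable B, fine (P B) <= 2^-1 ^+ j &
  forall w, ~ B w -> forall t, 0 <= t <= K%:R ->
    `|S n.+1 t z w - S n t z w| <= C * j.+1%:R * (theta ^+ n) ^+ 2].

(** Each of [1, theta, ..., theta ^ (n - 1)] is at least [theta ^ n], and they sum to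
    [(1 - theta ^ n) / (1 - theta)]. It lets one factor [theta ^ n] absorb an exceedance level that
    grows linearly in [n]. *)
Lemma natmul_geometric n : n%:R * theta ^+ n <= (1 - theta)^-1.
Proof.
have /andP[t0 t1] := th.
rewrite -[leRHS]mul1r ler_pdivlMr ?subr_gt0//.
suff : n%:R * theta ^+ n * (1 - theta) <= 1 - theta ^+ n.
  by move/le_trans; apply; rewrite gerBl exprn_ge0// ltW.
elim: n => [|n IH]; first by rewrite !mul0r expr0 subrr.
have h : n%:R * theta ^+ n * (1 - theta) * theta <= (1 - theta ^+ n) * theta.
  by rewrite ler_wpM2r// ltW.
have tn1 : theta ^+ n * theta <= 1 by rewrite -exprSr exprn_ile1 ?ltW.
have h2 : theta ^+ n * theta * (1 - theta) <= 1 * (1 - theta) by rewrite ler_wpM2r// subr_ge0 ltW.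
rewrite exprSr -natr1; move: h h2; lra.
Qed.

Lemma grid_union n m : exists B : set T, [/\ measurable B, (P B <= (m%:R * 2^-1 ^+ (5 * n))%:E)%E &
  forall w, ~ B w -> forall i t, (i < m)%N -> 0 <= t <= K%:R ->
    `|S n.+1 t (- K%:R + i%:R * 8^-1 ^+ n) w - S n t (- K%:R + i%:R * 8^-1 ^+ n) w|
     <= C * (5 * n).+1%:R * (theta ^+ n) ^+ 2].
Proof.
elim: m => [|m [B [mB PB hB]]].
  by exists set0; split => //; rewrite measure0 mul0r.
have [B' [mB' PB' hB']] := tail n (- K%:R + m%:R * 8^-1 ^+ n) (5 * n).
exists (B `|` B'); split; first exact: measurableU.
  apply: (le_trans (measureU2 _ mB mB')); rewrite -natr1 mulrDl mul1r EFinD; apply: leeD => //.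
  by rewrite -(fineK (fin_num_measure P _ mB')) lee_fin.
move=> w /not_orP[Bw B'w] i t; rewrite ltnS leq_eqVlt => /orP[/eqP -> tK|im tK]; first exact: hB'.
exact: hB.
Qed.

(* Borel-Cantelli with exceedance level [5 * n] on a grid of mesh [8^-n];
   between grid points [smooth_density n] has Lipschitz constant of order
   [4^n]. *)
Lemma smooth_density_cauchy : {ae P, forall w, exists C' theta' (N : nat), 0 < theta' < 1 /\
  forall n t y, (N <= n)%N -> t <= K%:R -> `|y| <= K%:R ->
  `|S n.+1 t y w - S n t y w| <= C' * theta' ^+ n}.
Proof.
have /andP[t0 t1] := th.
(* The number of points of mesh [8^-n] covering [[-K, K]], both ends included. *)
pose m n := ((2 * K) * 8 ^ n).+1.
have [B hB] := choice (fun n => grid_union n (m n)).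
have mB n : measurable (B n) by case: (hB n).
have sumB : (\sum_(0 <= n <oo) P (B n) < +oo)%E.
  have e0 : 0 <= (2 * (2 * K).+1%:R : R) by [].
  apply: le_lt_trans (ltry (2 * (2 * K).+1%:R)).
  apply: le_trans (epsilon_trick0 xpredT e0); apply: lee_nneseries => [n _ _|n _]; first exact: measure_ge0.
  have [_ PB _] := hB n; apply: le_trans PB _; rewrite lee_fin.
  have -> : 2 * (2 * K).+1%:R / (2 ^ n.+1)%:R = (2 * K).+1%:R * 2^-1 ^+ n :> R.
    by rewrite natrX exprS invfM exprVn; field; rewrite expf_neq0.
  (* The level [5 * n] beats the growth [2 ^ (3 n)] of the grid and leaves [4 ^ (- n)], which is
     summable. *)
  have e8 : 8 ^+ n * 2^-1 ^+ (5 * n) = 2^-1 ^+ n * 2^-1 ^+ n :> R.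
    rewrite exprM -!exprMn; congr (_ ^+ n); lra.
  apply: (@le_trans _ _ ((2 * K).+1%:R * 8 ^+ n * 2^-1 ^+ (5 * n))).
    rewrite ler_wpM2r ?exprn_ge0 ?invr_ge0//.
    by rewrite -natrX -natrM ler_nat mulSn /m -add1n leq_add2r expn_gt0.
  rewrite -mulrA e8; apply: ler_wpM2l => //.
  by rewrite ler_piMl ?exprn_ge0 ?invr_ge0// exprn_ile1 ?invr_ge0// invf_le1 ?ler1n.
have nul := lim_sup_set_cvg0 mB sumB.
exists (lim_sup_set B); split => //; first by
  apply: bigcap_measurableType => n _; apply: bigcup_measurable => j _; exact: mB.
move=> w /=; apply: contra_notP => hw.
have {hw} [N _ hN] : exists2 N, setT N & forall n, (N <= n)%N -> ~ B n w.
  apply: contrapT => hN; apply: hw => n _; apply: contrapT => hn; apply: hN.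
  by exists n => // j nj Bj; apply: hn; exists j.
(* The slower of two rates: [theta] at the grid points and [1 / 2] between them. *)
pose th' := Num.max theta 2^-1.
have th'1 : 0 < th' < 1 by rewrite lt_max t0/= gt_max t1 invf_lt1// ltr1n.
exists (C * (5 * (1 - theta)^-1 + 1) + 5 * K%:R), th', N; split => // n t y Nn tK yK.
have [tn|tn] := ltP t 0.
  rewrite /smooth_density set_itv_ge ?Rintegral_set0; last by rewrite bnd_simp -ltNge.
  rewrite mulr0 subrr normr0 mulr_ge0// ?exprn_ge0//; last by case/andP: th'1 => /ltW.
  by rewrite addr_ge0// mulr_ge0// addr_ge0// mulr_ge0// invr_ge0 subr_ge0 ltW.
have K0 : 0 <= K%:R :> R by [].
have /andP[yK1 yK2] : - K%:R <= y <= K%:R by rewrite -ler_norml.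
have p8 : 0 < 8^-1 ^+ n :> R by rewrite exprn_gt0// invr_gt0.
pose i := Num.truncn ((y + K%:R) * 8 ^+ n).
pose z := - K%:R + i%:R * 8^-1 ^+ n : R.
have yz0 : 0 <= (y + K%:R) * 8 ^+ n by rewrite mulr_ge0// ?exprn_ge0// -lerBlDr sub0r.
have e88 : 8 ^+ n * 8^-1 ^+ n = 1 :> R by rewrite -exprMn divff// expr1n.
have /andP[i1 i2] := truncn_itv yz0.
have yz : `|y - z| <= 8^-1 ^+ n.
  have h1 : i%:R * 8^-1 ^+ n <= y + K%:R by have := ler_wpM2r (ltW p8) i1; rewrite -[X in _ <= X]mulrA e88 mulr1.
  have h2 : y + K%:R <= i%:R * 8^-1 ^+ n + 8^-1 ^+ n.
    by have := ler_wpM2r (ltW p8) (ltW i2); rewrite -[X in X <= _]mulrA e88 mulr1 -natr1 mulrDl mul1r.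
  by rewrite /z ler_norml; apply/andP; split; move: h1 h2; lra.
have im : (i < m n)%N.
  rewrite ltnS -(@ler_nat R); apply: le_trans i1 _; rewrite natrM natrX ler_pM//.
    by rewrite -lerBlDr sub0r.
  by rewrite natrM mulr_natl mulr2n lerD.
have [_ _ /(_ w (hN n Nn) i t im) hg] := hB n.
have t0K : 0 <= t <= K%:R by rewrite tn.
have {hg} := hg t0K; rewrite -/z => hg.
(* Lipschitz constant [K * 4 ^ k] times the mesh: [K * 2 ^ (- n)] for [k = n] and four times as much
   for [k = n + 1], whence the [5 * K] in the constant. *)
have lip k : `|S k t y w - S k t z w| <= K%:R * (2^-1 ^+ k) ^- 2 * 8^-1 ^+ n.
  apply: (le_trans (smooth_density_lipschitz_space (mX w) k t y z)).
  apply: ler_pM => //; first by rewrite mulr_ge0 ?le_max ?lexx// invr_ge0 !exprn_ge0.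
  by rewrite ler_wpM2r ?ge_max ?K0// invr_ge0 !exprn_ge0.
have l1 := lip n; have l2 := lip n.+1.
have p2 : 0 < 2^-1 ^+ n :> R by rewrite exprn_gt0.
have p3 : 8^-1 ^+ n = (2^-1 ^+ n) ^+ 3 :> R.
  by rewrite -exprM mulnC exprM; congr (_ ^+ n); field.
have e1 : (2^-1 ^+ n) ^- 2 * 8^-1 ^+ n = 2^-1 ^+ n :> R.
  by rewrite p3; field; rewrite gt_eqF.
have e2 : (2^-1 ^+ n.+1) ^- 2 * 8^-1 ^+ n = 4 * 2^-1 ^+ n :> R.
  by rewrite p3 (exprS _ n); move: (2^-1 ^+ n) p2 => p p2; field; rewrite gt_eqF.
rewrite -mulrA e1 in l1; rewrite -mulrA e2 in l2.
have g1 : C * (5 * n).+1%:R * (theta ^+ n) ^+ 2 <= C * (5 * (1 - theta)^-1 + 1) * theta ^+ n.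
  rewrite expr2 -!mulrA; apply: ler_wpM2l => //; rewrite mulrA; apply: ler_wpM2r; first by rewrite exprn_ge0// ltW.
  rewrite -natr1 mulrDl mul1r natrM -mulrA; apply: lerD; last by rewrite exprn_ile1// ltW.
  by rewrite ler_wpM2l//; exact: natmul_geometric.
have g2 : theta ^+ n <= th' ^+ n by rewrite lerXn2r ?nnegrE ?le_max ?lexx ?(ltW t0)// (ltW (andP th'1).1).
have g3 : 2^-1 ^+ n <= th' ^+ n by rewrite lerXn2r ?nnegrE ?le_max ?lexx ?orbT ?(ltW t0) ?invr_ge0//.
have g4 : C * (5 * (1 - theta)^-1 + 1) * theta ^+ n <= C * (5 * (1 - theta)^-1 + 1) * th' ^+ n.
  by rewrite ler_wpM2l// mulr_ge0// addr_ge0// mulr_ge0// invr_ge0 subr_ge0 ltW.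
have g5 : 5 * K%:R * 2^-1 ^+ n <= 5 * K%:R * th' ^+ n by rewrite ler_wpM2l// mulr_ge0.
rewrite (_ : S n.+1 t y w - S n t y w = (S n.+1 t y w - S n.+1 t z w) +
  (S n.+1 t z w - S n t z w) - (S n t y w - S n t z w)); last by ring.
apply: (le_trans (ler_normB _ _)); apply: (le_trans (lerD (ler_normD _ _) (lexx _))).
by rewrite mulrDl; move: l1 l2 hg g1 g4 g5; lra.
Qed.

End borel_cantelli_grid.

(** * Tails of the differences at dyadic scales *)

Section dyadic_tail.
Context {R : realType} d (T : measurableType d) (P : probability T R).
Notation mu := (@lebesgue_measure R).
Variables (F : R -> set (set T)) (X : R -> T -> R).
Hypothesis sF : forall v, sigma_algebra setT (F v).
Hypothesis FT : forall v, F v `<=` measurable.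
Hypothesis FF : forall s t, s <= t -> F s `<=` F t.
Hypothesis mX : forall v, measurable_fun [set: g_sigma_algebraType (F v)] (X v : T -> measurableTypeR R).
Hypothesis rcX : forall w v, X s w @[s --> v^'+] --> X v w.
Variables (h g D D' : R).
Hypothesis h0 : 0 < h.
Hypothesis g0 : 0 < g.
Hypothesis D0 : 0 <= D.
Hypothesis D'0 : 0 <= D'.
Hypothesis window_pk : forall e z, 0 < e <= 1 -> window_estimate P F X (fun x => pk e (x - z)) D' h.
Hypothesis window_pkB : forall e z, 0 < e <= 1 ->
  window_estimate P F X (fun x => pk (e / 2) (x - z) - pk e (x - z)) (D * e `^ g) h.

Lemma pk_continuous (e z : R) : 0 < e -> continuous (fun x => pk e (x - z)).
Proof.
move=> e0; apply: (@lipschitz_cont _ _ (e ^- 2)) => x y xy.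
apply: (le_trans (bounded_derive_lipschitz (fun z => is_derive_pk z e0) (fun z => dpk_le z e0) _ _)).
by rewrite (_ : y - z - (x - z) = y - x) ?ger0_norm ?subr_ge0//; ring.
Qed.

Lemma window_estimateD (f1 f2 : R -> R) C1 C2 k1 k2 tau : continuous f1 -> continuous f2 ->
  (forall x, `|f1 x| <= C1) -> (forall x, `|f2 x| <= C2) ->
  window_estimate P F X f1 k1 tau -> window_estimate P F X f2 k2 tau ->
  window_estimate P F X (fun x => f1 x + f2 x) (k1 + k2) tau.
Proof.
move=> c1 c2 f1C f2C w1 w2 s t zeta C s0 st tst mz z0 zC.
have jX : measurable_fun [set: measurableTypeR R * T] (fun p => X p.1 p.2 : measurableTypeR R).
  exact: (process_measurable sF FT mX rcX).
have mzT : measurable_fun [set: T] zeta by exact: (filtration_measurableT sF FT mz).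
have sw : measurable_fun [set: T * measurableTypeR R] (fun p => (p.2, p.1) : measurableTypeR R * T).
  by apply/measurable_fun_pairP; split => /=; [exact: measurable_snd|exact: measurable_fst].
have mexp (f : R -> R) : continuous f -> measurable_fun [set: measurableTypeR R]
    (fun v => `|\int[P]_w (zeta w * f (X v w))|%:E).
  move=> cf; apply/measurable_EFinP; apply: measurableT_comp => //.
  apply: (@measurable_Rintegral_param R _ (measurableTypeR R) _ _ P setT (fun w v => zeta w * f (X v w))) => //.
  apply: measurable_funM; first exact: (measurableT_comp mzT measurable_fst).
  exact: (measurableT_comp (continuous_measurable_fun cf) (measurableT_comp jX sw)).
have mI : measurable (`[s, t]%classic : set (measurableTypeR R)) by exact: measurable_itv.
have finP : (P setT < +oo)%E by rewrite (le_lt_trans (probability_le1 _ _))// ltry.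
have iz (f : R -> R) (B v : R) : continuous f -> (forall x, `|f x| <= B) ->
    P.-integrable setT (EFin \o (fun w => zeta w * f (X v w))).
  move=> cf fB.
  have mm : measurable_fun setT (fun w => zeta w * f (X v w)).
    apply: measurable_funM => //.
    exact: (measurableT_comp (continuous_measurable_fun cf) (measurableT_comp jX (measurable_pair1 v))).
  have bb w : setT w -> `|zeta w * f (X v w)| <= C * B.
    by move=> _; rewrite normrM ler_pM// ger0_norm.
  exact: (bounded_integrable measurableT finP mm bb).
apply: (@le_trans _ _ (\int[mu]_(v in `[s, t]) (`|\int[P]_w (zeta w * f1 (X v w))|%:E + `|\int[P]_w (zeta w * f2 (X v w))|%:E))%E).
  apply: ge0_le_integral; first exact: mI.
  - by move=> v _; rewrite lee_fin.
  - apply: measurable_funTS; apply: (mexp (fun x => f1 x + f2 x)) => x; apply: (@continuousD _ R^o); [exact: c1|exact: c2].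
  - by apply: emeasurable_funD; apply: measurable_funTS; exact: mexp.
  - move=> v _; rewrite -EFinD lee_fin.
    have -> : \int[P]_w (zeta w * (f1 (X v w) + f2 (X v w))) =
        \int[P]_w (zeta w * f1 (X v w)) + \int[P]_w (zeta w * f2 (X v w)).
      rewrite -(RintegralD measurableT (iz _ _ v c1 f1C) (iz _ _ v c2 f2C)).
      by apply: eq_Rintegral => w _; rewrite mulrDr.
    exact: ler_normD.
rewrite ge0_integralD//; last 2 first.
- by apply: measurable_funTS; exact: mexp.
- by apply: measurable_funTS; exact: mexp.
rewrite mulrDl EFinD; apply: leeD; first exact: (w1 _ _ _ C).
exact: (w2 _ _ _ C).
Qed.

(** Windows of length [h] are chained to cover [[0, K]]. [functional_sup] then applies with [delta]
    of order [e ^ g] and [kappa] of order [1], so [c ^ 2] has to be of order [e ^ g]. With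
    [theta = 2 ^ (- g / 4)] one has [e ^ g = theta ^ (4 n)], and [c] is of order [theta ^ (2 n)];
    the square in the conclusion leaves one factor to spend on the growth of [j]. *)
Lemma dyadic_tail (K : nat) : exists C theta, [/\ 0 <= C, 0 < theta < 1 &
  forall n z j, exists B : set T, [/\ measurable B, fine (P B) <= 2^-1 ^+ j &
  forall w, ~ B w -> forall t, 0 <= t <= K%:R ->
    `|smooth_density (X ^~ w) n.+1 t z - smooth_density (X ^~ w) n t z|
      <= C * j.+1%:R * (theta ^+ n) ^+ 2]].
Proof.
pose N := (Num.bound (K%:R / h)).+1.
have N0 : (0 : R) < N%:R by rewrite ltr0n.
have NK : K%:R <= N%:R * h.
  rewrite -ler_pdivrMr// ltW//; apply: (lt_le_trans (archi_boundP _)); first by rewrite divr_ge0// ltW.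
  by rewrite ler_nat.
(* [2 * delta * kappa = E * e ^ g] for the chained estimates: [q] is a sum of two Poisson kernels
   and contributes [D' + D'], and each chaining contributes a factor [N]. *)
pose E := 4 * N%:R ^+ 2 * D * D'.
have E0 : 0 <= E by rewrite /E !mulr_ge0// exprn_ge0.
pose theta : R := expR (g / 4 * ln 2^-1).
have g4 : 0 < g / 4 by rewrite divr_gt0.
have th0 : 0 < theta by exact: expR_gt0.
have th1 : theta < 1.
  rewrite expR_lt1 pmulr_rlt0// ln_lt0//.
  by apply/andP; split; [rewrite invr_gt0|rewrite invf_lt1// ltr1n].
have thE n : (2^-1 ^+ n) `^ g = (theta ^+ n) ^+ 4.
  rewrite /theta -!expRM_natl /powR gt_eqF ?exprn_gt0// lnXn//.
  by congr expR; rewrite -mulr_natl; field.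
exists (5 * (E + 1)), theta; split.
- by rewrite mulr_ge0// addr_ge0.
- by rewrite th0.
move=> n z j.
have en : 0 < 2^-1 ^+ n :> R by rewrite exprn_gt0.
have en1 : 0 < (2^-1 ^+ n : R) <= 1 by rewrite en exprn_ile1// ?invr_ge0// invf_le1// ler1n.
have en2 : 0 < (2^-1 ^+ n / 2 : R) <= 1 by case/andP: en1 => _ ?; apply/andP; split; lra.
pose e : R := 2^-1 ^+ n.
rewrite -/e in en en1 en2.
have e20 : 0 < e / 2 by rewrite divr_gt0.
pose f x := pk (e / 2) (x - z) - pk e (x - z).
pose q x := pk (e / 2) (x - z) + pk e (x - z).
have pkn (e' x : R) : 0 < e' -> `|pk e' (x - z)| <= e'^-1 by move=> e'0; rewrite ger0_norm ?pk_ge0 ?pk_le.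
have cf : continuous f.
  by rewrite /f => x; apply: cvgB; exact: pk_continuous.
have cq : continuous q.
  by rewrite /q => x; apply: cvgD; exact: pk_continuous.
have fC x : `|f x| <= (e / 2)^-1 + e^-1.
  by apply: (le_trans (ler_normB _ _)); apply: lerD; exact: pkn.
have qC x : `|q x| <= (e / 2)^-1 + e^-1.
  by apply: (le_trans (ler_normD _ _)); apply: lerD; exact: pkn.
have fq x : `|f x| <= q x.
  apply: (le_trans (ler_normB _ _)).
  by rewrite !ger0_norm ?pk_ge0.
have eg0 : 0 <= D * e `^ g by rewrite mulr_ge0// powR_ge0.
have wf : window_estimate P F X f (N%:R * (D * e `^ g)) (N%:R * h).
  exact: (window_estimate_iter sF FT FF mX rcX h0 cf eg0 (window_pkB z en1)).
have wq : window_estimate P F X q (N%:R * (D' + D')) (N%:R * h).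
  apply: (window_estimate_iter sF FT FF mX rcX h0 cq (addr_ge0 D'0 D'0)).
  exact: (window_estimateD (@pk_continuous _ z e20) (@pk_continuous _ z en)
    (fun x => pkn _ x e20) (fun x => pkn _ x en) (window_pk z en2) (window_pk z en1)).
have del0 : 0 <= N%:R * (D * e `^ g) by rewrite mulr_ge0// ltW.
pose c := (E + 1) * (theta ^+ n) ^+ 2.
have c0 : 0 < c by rewrite mulr_gt0 ?exprn_gt0// ltr_wpDl.
have hc : 2 * (N%:R * (D * e `^ g)) * (N%:R * (D' + D')) <= c ^+ 2.
  rewrite /e thE /c; have := exprn_gt0 n th0; move: (theta ^+ n) => u u0.
  rewrite (_ : _ * (N%:R * (D' + D')) = E * u ^+ 4); last by rewrite /E; ring.
  rewrite (_ : (_ * _) ^+ 2 = (E + 1) ^+ 2 * u ^+ 4); last by ring.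
  by apply: ler_wpM2r; [rewrite exprn_ge0// ltW|move: (E) E0 => E' E'0; nra].
have tau0 : 0 < N%:R * h by rewrite mulr_gt0.
have [B [mB PB hB]] := functional_sup sF FT FF mX rcX cf fC cq qC fq del0 wf wq j c0 hc tau0.
exists B; split => // w Bw t /andP[t0 tK].
have := hB w Bw t; rewrite t0 (le_trans tK NK) => /(_ isT) hf.
have [ip0 ip1] := @pi_bounds R.
have -> : smooth_density (X ^~ w) n.+1 t z - smooth_density (X ^~ w) n t z = pi^-1 * functional X f t w.
  rewrite /smooth_density -mulrBr exprS (mulrC _ (2^-1 ^+ n)) -/e; congr (_ * _).
  have mx : measurable_fun [set: R] (X ^~ w : R -> R).
    exact: (measurableT_comp (process_measurable sF FT mX rcX) (measurable_pair2 w)).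
  have i1 (e' : R) : 0 < e' -> mu.-integrable `[0, t] (EFin \o (fun v => pk e' (X v w - z))).
    move=> e'0; apply: (integrable_itv _ (fun v _ => pkn e' (X v w) e'0)).
    exact: (measurableT_comp (continuous_measurable_fun (@pk_continuous _ z e'0)) mx).
  have mI : measurable (`[0, t]%classic : set (measurableTypeR R)) by exact: measurable_itv.
  exact: (esym (RintegralB mI (i1 _ e20) (i1 _ en))).
rewrite normrM (ger0_norm ip0) -[leRHS]mul1r; apply: ler_pM => //.
apply: (le_trans hf).
rewrite (_ : 5 * (E + 1) * _ * _ = j.+1%:R * (5 * c)); last by rewrite /c; ring.
by rewrite -(natr1 (R := R) j); move: (c) (j%:R : R) c0 => c' j' c'0; lra.
Qed.
End dyadic_tail.

(** * Mollified Kato measures *)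

Section mollification_bounds.
Context {R : realType}.
Notation mu := (@lebesgue_measure R).
Notation mR := (measurableTypeR R).

Variables (phi : R -> R).
Hypothesis mphi : mollifier phi.

Lemma mollifier_continuous : continuous phi.
Proof.
case: mphi => dphi _ _ _ _ x; have := dphi 0%N x; rewrite /derive1n/= => h.
by apply: differentiable_continuous; apply/derivable1_diffP.
Qed.

Lemma mollifier_ge0 x : 0 <= phi x. Proof. by case: mphi. Qed.

Lemma mollifier_bounded : exists2 C, 0 <= C & forall x, `|phi x| <= C.
Proof.
have [|c _ hc] := @EVT_max R phi (-1) 1 _ (continuous_subspaceT mollifier_continuous); first by lra.
exists (phi c) => [|x]; first exact: mollifier_ge0.
rewrite ger0_norm ?mollifier_ge0//.
have [/hc//|xn] := boolP (x \in `[(-1 : R), 1]).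
have [_ _ _ clo _] := mphi.
have [->|px] := eqVneq (phi x) 0; first exact: mollifier_ge0.
by have : closure [set x | phi x != 0] x by [exact: subset_closure]; rewrite clo/= (negbTE xn).
Qed.

Let p2 n : 0 < 2 ^+ n :> R. Proof. by rewrite exprn_gt0. Qed.

Lemma mollifier_n_continuous n y : continuous (fun x => mollifier_n phi n (x - y)).
Proof.
move=> x; apply: cvgM; first exact: cvg_cst.
apply: (@continuous_comp _ _ _ (fun x => 2 ^+ n * (x - y)) phi); last exact: mollifier_continuous.
by apply: cvgM; [exact: cvg_cst|apply: cvgB; [exact: cvg_id|exact: cvg_cst]].
Qed.

Lemma mollifier_n_continuousN n x : continuous (fun y => mollifier_n phi n (x - y)).
Proof.
move=> y; apply: cvgM; first exact: cvg_cst.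
apply: (@continuous_comp _ _ _ (fun y => 2 ^+ n * (x - y)) phi); last exact: mollifier_continuous.
by apply: cvgM; [exact: cvg_cst|apply: cvgB; [exact: cvg_cst|exact: cvg_id]].
Qed.

Lemma mollifier_n_ge0 n x : 0 <= mollifier_n phi n x.
Proof. by rewrite mulr_ge0// ?mollifier_ge0// ltW. Qed.

Section finite_measure.
Variable nu : {finite_measure set mR -> \bar R}.

Let fin : (nu setT < +oo)%E. Proof. by have := fin_num_measure nu setT measurableT; rewrite ge0_fin_numE. Qed.

Lemma mollifier_integrable n x : nu.-integrable setT (EFin \o (fun y => mollifier_n phi n (x - y))).
Proof.
have [C C0 hC] := mollifier_bounded.
apply: (@bounded_integrable _ _ _ nu setT _ (2 ^+ n * C)) => //.
  exact: (continuous_measurable_fun (@mollifier_n_continuousN n x)).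
by move=> y _; rewrite normrM ger0_norm ?(ltW (p2 n))// ler_wpM2l// ltW.
Qed.

Lemma mollified_continuous n : continuous (fun x => \int[nu]_y mollifier_n phi n (x - y)).
Proof.
move=> x; have [C C0 hC] := mollifier_bounded.
have h := @continuity_under_integral R _ mR nu (fun x y => mollifier_n phi n (x - y)) setT measurableT
  (x - 1) (x + 1) (fun x _ => mollifier_integrable n x).
have xI : x \in `]x - 1, x + 1[%classic by rewrite inE/= in_itv/=; apply/andP; split; lra.
apply: (h _ (cst (2 ^+ n * C)) _ _ x xI).
- by apply: aeW => y _ z _; exact: mollifier_n_continuous.
- apply: (@bounded_integrable _ _ _ nu setT _ (2 ^+ n * C)) => //.
  by move=> y _; rewrite ger0_norm// mulr_ge0// ltW.
- move=> z _; apply: aeW => y _.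
  by rewrite normrM ger0_norm ?(ltW (p2 n))// ler_wpM2l// ltW.
Qed.

Lemma mollified_bounded n : exists C, forall x, `|\int[nu]_y mollifier_n phi n (x - y)| <= C.
Proof.
have [C C0 hC] := mollifier_bounded.
exists (2 ^+ n * C * fine (nu setT)) => x.
have mi := mollifier_integrable n x.
apply: (le_trans (le_normr_Rintegral measurableT mi)).
have -> : 2 ^+ n * C * fine (nu setT) = \int[nu]_y (cst (2 ^+ n * C) y).
  by rewrite Rintegral_cst// mulrC.
apply: le_Rintegral => //.
- exact: (integrable_norm mi).
- apply: (@bounded_integrable _ _ _ nu setT _ (2 ^+ n * C)) => //.
  by move=> y _; rewrite ger0_norm// mulr_ge0// ltW.
by move=> y _; rewrite normrM ger0_norm ?(ltW (p2 n))// ler_wpM2l// ltW.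
Qed.

(* Substitute [z = y + 2^-n u] and integrate in [y] first. *)
Lemma mollified_kernel (k : R -> R) M n x : continuous k -> (forall z, 0 <= k z) ->
  (forall x, (\int[nu]_y (k (x - y))%:E <= M%:E)%E) ->
  (\int[mu]_z (k (x - z) * \int[nu]_y mollifier_n phi n (z - y))%:E <= M%:E)%E.
Proof.
move=> ck k0 hM.
have M0 : 0 <= M by rewrite -lee_fin; apply: le_trans (hM 0); apply: integral_ge0 => y _; rewrite lee_fin.
have mk := continuous_measurable_fun ck.
have mphi' := continuous_measurable_fun mollifier_continuous.
have mpn : measurable_fun [set: R] (mollifier_n phi n).
  by apply: measurable_funM => //; apply: measurableT_comp => //; exact: measurable_funM.
pose J (o : mR * mR) : \bar R := (k (x - o.1) * mollifier_n phi n (o.1 - o.2))%:E.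
have J0 o : (0 <= J o)%E by rewrite lee_fin mulr_ge0// mollifier_n_ge0.
have mJ : measurable_fun setT J.
  apply/measurable_EFinP; apply: measurable_funM.
    by apply: (measurableT_comp mk); apply: measurable_funB => //; exact: measurable_fst.
  by apply: (measurableT_comp mpn); apply: measurable_funB; [exact: measurable_fst|exact: measurable_snd].
have -> : (\int[mu]_z (k (x - z) * \int[nu]_y mollifier_n phi n (z - y))%:E =
   \int[mu]_z \int[nu]_y J (z, y))%E.
  apply: eq_integral => z _; rewrite EFinM /Rintegral fineK; last first.
    exact: (integrable_fin_num measurableT (mollifier_integrable n z)).
  rewrite -ge0_integralZl_EFin//.
  - by move=> y _; rewrite lee_fin mollifier_n_ge0.
  - by apply/measurable_EFinP; exact: (continuous_measurable_fun (@mollifier_n_continuousN n z)).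
rewrite (fubini_tonelli (m1 := mu) (m2 := nu) _ mJ J0).
pose H (o : mR * mR) : \bar R := (k (x - o.1 - 2^-1 ^+ n * o.2) * phi o.2)%:E.
have H0 o : (0 <= H o)%E by rewrite lee_fin mulr_ge0// mollifier_ge0.
have mH : measurable_fun setT H.
  apply/measurable_EFinP; apply: measurable_funM; last exact: (measurableT_comp mphi' measurable_snd).
  apply: (measurableT_comp mk); apply: measurable_funB.
    by apply: measurable_funB => //; exact: measurable_fst.
  by apply: measurable_funM => //; exact: measurable_snd.
have -> : (\int[nu]_y \int[mu]_z J (z, y) = \int[nu]_y \int[mu]_u H (y, u))%E.
  apply: eq_integral => y _.
  have e0 : 0 < 2^-1 ^+ n :> R by rewrite exprn_gt0.
  have c1 : continuous (fun z => k (x - z) * mollifier_n phi n (z - y)).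
    move=> z; apply: cvgM; last exact: mollifier_n_continuous.
    apply: (@continuous_comp _ _ _ (fun z => x - z) k); last exact: ck.
    by apply: cvgB; [exact: cvg_cst|exact: cvg_id].
  have c2 z : 0 <= k (x - z) * mollifier_n phi n (z - y) by rewrite mulr_ge0// mollifier_n_ge0.
  rewrite [LHS](integral_affine y e0 c1 c2).
  apply: eq_integral => u _; congr EFin; rewrite /mollifier_n /=.
  have e1 : 2 ^+ n * 2^-1 ^+ n = 1 :> R by rewrite -exprMn divff// expr1n.
  rewrite opprD addrA (_ : 2 ^+ n * (y + 2^-1 ^+ n * u - y) = u); last first.
    by rewrite addrAC subrr add0r mulrA e1 mul1r.
  by rewrite -!mulrA (mulrC (phi u)) (mulrA (2 ^+ n)) e1 mul1r.
rewrite (fubini_tonelli (m1 := nu) (m2 := mu) _ mH H0).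
have -> : (M%:E = M%:E * \int[mu]_u (phi u)%:E)%E by case: mphi => _ _ _ _ ->; rewrite mule1.
rewrite -ge0_integralZl_EFin//; last 2 first.
- by move=> y _; rewrite lee_fin mollifier_ge0.
- exact/measurable_EFinP.
apply: ge0_le_integral; first exact: measurableT.
- by move=> u _; apply: integral_ge0 => y _; exact: H0.
- exact: (measurable_fun_fubini_tonelli_G (m1 := nu) _ mH H0).
- by apply/measurable_EFinP; exact: measurable_funM.
move=> u _; under eq_integral do rewrite /H/= mulrC EFinM.
rewrite ge0_integralZl_EFin//; last 3 first.
- by move=> y _; rewrite lee_fin.
- apply/measurable_EFinP; apply: (measurableT_comp mk); apply: measurable_funB => //; exact: measurable_funB.
- exact: mollifier_ge0.
rewrite muleC; apply: lee_wpmul2r; first by rewrite lee_fin mollifier_ge0.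
apply: le_trans (hM (x - 2^-1 ^+ n * u)).
by under eq_integral do rewrite addrAC.
Qed.

End finite_measure.

Variables (nu : {charge set mR -> \bar R}) (eta : R).
Hypothesis e01 : 0 < eta < 1.

Local Notation Jp := (jordan_pos (hahn_posneg nu)).
Local Notation Jn := (jordan_neg (hahn_posneg nu)).

Lemma mollification_continuous n : continuous (mollification phi nu n).
Proof. by move=> x; apply: cvgB; exact: mollified_continuous. Qed.

Lemma mollification_bounded n : exists C, forall x, `|mollification phi nu n x| <= C.
Proof.
have [C hC] := mollified_bounded Jp n; have [C' hC'] := mollified_bounded Jn n.
by exists (C + C') => x; apply: (le_trans (ler_normB _ _)); exact: lerD.
Qed.

Lemma total_variation_integral (f : R -> R) : measurable_fun [set: R] f -> (forall y, 0 <= f y) ->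
  (\int[total_variation_measure nu]_y (f y)%:E = \int[Jp]_y (f y)%:E + \int[Jn]_y (f y)%:E)%E.
Proof.
move=> mf f0; rewrite -(ge0_integral_measure_add Jp Jn)//; last exact/measurable_EFinP.
  by apply: (@eq_measure_integral _ _ _ _ (measure_add Jp Jn)) => A mA _; exact: (esym (measure_addE Jp Jn A)).
by move=> y _; rewrite lee_fin.
Qed.

(** At distance less than [r] the truncated kernel lies below the Kato kernel, and [r] is chosen
    with modulus at most [1]; farther away it is at most [r ^ (eta - 1)], integrated against a
    finite measure. Neither part depends on [a]. *)
Lemma kato_kernel_bound : finite_kato_class eta nu -> exists2 M, 0 <= M &
  forall a x, 0 < a -> (\int[total_variation_measure nu]_y (kc eta a (x - y))%:E <= M%:E)%E.
Proof.
move=> kato.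
have [r r0 hr] : exists2 r, 0 < r & (kato_modulus nu eta r <= 1)%E.
  have n1 : nbhs (0%E : \bar R) [set u | (u < 1)%E] by apply: open_ereal_lt'; rewrite lte_fin.
  have : \forall r \near (0 : R)^'+, 0 < r /\ (kato_modulus nu eta r < 1)%E.
    by near=> r; split; near: r; [exact: nbhs_right_gt|exact: (kato _ n1)].
  by move=> /filter_ex[r [r0 /ltW hr]]; exists r.
have mass : (0 <= total_variation_measure nu setT)%E by exact: measure_ge0.
have mfin : total_variation_measure nu setT \is a fin_num.
  by rewrite /total_variation_measure/=; exact: fin_num_measure.
pose V := fine (total_variation_measure nu setT).
exists (1 + r `^ (eta - 1) * V).
  by rewrite addr_ge0// mulr_ge0 ?powR_ge0// fine_ge0.
move=> a x a0.
have mkc : measurable_fun [set: R] (fun y => kc eta a (x - y)).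
  apply: (measurableT_comp (continuous_measurable_fun (kc_continuous e01 a0))); exact: measurable_funB.
have mb : measurable (ball x r : set mR) by exact: measurable_ball.
have -> : [set: mR] = (ball x r : set mR) `|` ~` (ball x r : set mR) by rewrite setUv.
rewrite ge0_integral_setU//; last 4 first.
- exact: measurableC.
- by apply: measurable_funTS; exact/measurable_EFinP.
- by move=> y _; rewrite lee_fin kc_ge0.
- by rewrite disj_set2E setICr.
rewrite EFinD; apply: leeD.
  apply: le_trans hr; apply: (@le_trans _ _ (\int[total_variation_measure nu]_(y in (ball x r : set mR)) ((`|x - y| `^ (1 - eta))%:E^-1))%E).
    apply: ge0_le_integral => //.
    - by move=> y _; rewrite lee_fin kc_ge0.
    - by apply: measurable_funTS; exact/measurable_EFinP.
    - apply: measurable_funTS.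
      (* At [y = x] the inverse in the extended reals is [+oo], hence the case distinction. *)
      rewrite (_ : (fun y => _) = fun y => if y == x then +oo%E else (`|x - y| `^ (eta - 1))%:E).
        apply: measurable_fun_ifT => //; first exact: measurable_fun_eqr.
        apply/measurable_EFinP; apply: (measurableT_comp (measurable_powR _)).
        by apply: measurableT_comp => //; exact: measurable_funB.
      apply/funext => y; rewrite inver powR_eq0 normr_eq0 subr_eq0 eq_sym -powRN opprB.
      by rewrite (_ : 1 - eta != 0) ?andbT//; have := e01 => h; rewrite gt_eqF// subr_gt0; case/andP: h.
    - by move=> y _; exact: kc_le_kernel.
  by apply: ereal_sup_ubound; exists x.
apply: (@le_trans _ _ (\int[total_variation_measure nu]_(y in ~` (ball x r : set mR)) (r `^ (eta - 1))%:E)%E).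
  apply: ge0_le_integral => //.
  - exact: measurableC.
  - by move=> y _; rewrite lee_fin kc_ge0.
  - by apply: measurable_funTS; exact/measurable_EFinP.
  - move=> y; rewrite /ball/= => /negP; rewrite -leNgt => ry; rewrite lee_fin.
    by apply: npowR_antitone => //; [rewrite le_max ry orbT|have := e01; lra].
rewrite integral_cst; last exact: measurableC.
rewrite EFinM; apply: lee_wpmul2l; first by rewrite lee_fin powR_ge0.
by rewrite /V fineK//; apply: le_measure; rewrite ?inE//; exact: measurableC.
Unshelve. all: by end_near.
Qed.

(** Each Jordan part is dominated by the total variation, and mollification averages the potential
    over translates, so each part contributes at most [M], uniformly in [n] and [a]. *)
Lemma mollification_kernel_bound : finite_kato_class eta nu -> exists2 M, 0 <= M &
  forall a n x, 0 < a -> (\int[mu]_y (kc eta a (x - y) * `|mollification phi nu n y|)%:E <= M%:E)%E.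
Proof.
move=> /kato_kernel_bound[M M0 hM]; exists (M + M); first exact: addr_ge0.
move=> a n x a0.
have ck := kc_continuous e01 a0.
have kn z : 0 <= kc eta a z by exact: kc_ge0.
have mkc y : measurable_fun [set: R] (fun z => kc eta a (y - z)).
  apply: (measurableT_comp (continuous_measurable_fun ck)); exact: measurable_funB.
have hp y : (\int[Jp]_z (kc eta a (y - z))%:E <= M%:E)%E.
  apply: le_trans (hM a y a0); rewrite total_variation_integral// leeDl//.
  by apply: integral_ge0 => z _; rewrite lee_fin.
have hn y : (\int[Jn]_z (kc eta a (y - z))%:E <= M%:E)%E.
  apply: le_trans (hM a y a0); rewrite total_variation_integral// leeDr//.
  by apply: integral_ge0 => z _; rewrite lee_fin.
have m0 (m : {finite_measure set mR -> \bar R}) z : 0 <= \int[m]_y mollifier_n phi n (z - y).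
  by apply: Rintegral_ge0 => y _; exact: mollifier_n_ge0.
have mm (m : {finite_measure set mR -> \bar R}) : measurable_fun [set: R] (fun z => \int[m]_y mollifier_n phi n (z - y)).
  by apply: continuous_measurable_fun; exact: mollified_continuous.
apply: le_trans (_ : _ <= _ + _)%E _; last first.
  rewrite EFinD; apply: leeD; [exact: (mollified_kernel n x ck kn hp)|exact: (mollified_kernel n x ck kn hn)].
rewrite -ge0_integralD//; last 4 first.
- by move=> y _; rewrite lee_fin mulr_ge0.
- by apply/measurable_EFinP; exact: (measurable_funM (mkc x) (mm Jp)).
- by move=> y _; rewrite lee_fin mulr_ge0.
- by apply/measurable_EFinP; exact: (measurable_funM (mkc x) (mm Jn)).
apply: ge0_le_integral; first exact: measurableT.
- by move=> y _; rewrite lee_fin mulr_ge0.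
- apply/measurable_EFinP; apply: (measurable_funM (mkc x)); apply: measurableT_comp => //.
  by apply: continuous_measurable_fun; exact: mollification_continuous.
- apply: emeasurable_funD; apply/measurable_EFinP.
    exact: (measurable_funM (mkc x) (mm Jp)).
  exact: (measurable_funM (mkc x) (mm Jn)).
move=> y _; rewrite -EFinD lee_fin -mulrDr ler_wpM2l//.
rewrite /mollification /charge_integral; apply: (le_trans (ler_normB _ _)).
by rewrite (ger0_norm (m0 Jp y)) (ger0_norm (m0 Jn y)).
Qed.

End mollification_bounds.

(** * Choice of the truncation distance and of the window length *)

Section test_functions.
Context {R : realType}.
Implicit Types (al eta g e A B : R).

(** As [eta < 1], the power [a ^ (eta - 1)] takes every positive value; the witness solves
    [A * a ^ (eta - 1) = B + 1], where the [1] keeps the base positive for [B = 0]. *)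
Lemma powR_scale eta A B : eta < 1 -> 0 < A -> 0 <= B -> exists2 a, 0 < a & B <= A * a `^ (eta - 1).
Proof.
move=> e1 A0 B0.
have B1 : 0 < (B + 1) / A by rewrite divr_gt0// ltr_wpDl.
have e0 : eta - 1 != 0 by rewrite lt_eqF// subr_lt0.
exists (((B + 1) / A) `^ (eta - 1)^-1); first exact: powR_gt0.
rewrite -powRrM mulVf// powRr1 ?ltW// mulrC divfK ?gt_eqF//.
by rewrite ltrDl.
Qed.

Lemma dpk_lipschitz e : 0 < e -> exists K, forall x y : R, `|dpk e x - dpk e y| <= K * `|x - y|.
Proof.
move=> e0; exists (10 * e * (e ^- 2) ^+ 2).
exact: (bounded_derive_lipschitz (fun x => is_derive_dpk x e0) (fun x => ddpk_le x e0)).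
Qed.

(** The target [q] is such that [h ^ (1 - kap) <= q] gives [B * window_factor kap h <= B / (2 * (B +
    1))]; adding [1] to [B] avoids a division by zero. *)
Lemma small_window kap B : 0 <= kap < 1 -> 0 <= B ->
  exists2 h, 0 < h <= 1 & B * window_factor kap h <= 2^-1.
Proof.
move=> /andP[k0 k1] B0; have k10 : 0 < 1 - kap by rewrite subr_gt0.
pose q := (1 - kap) / (2 * (B + 1)).
have B1 : 0 < B + 1 by rewrite ltr_wpDl.
have q0 : 0 < q by rewrite divr_gt0// mulr_gt0.
exists (Num.min 1 (q `^ (1 - kap)^-1)); first by rewrite lt_min ltr01 powR_gt0//= ge_min lexx.
have h1 : Num.min 1 (q `^ (1 - kap)^-1) `^ (1 - kap) <= q.
  have qE : (q `^ (1 - kap)^-1) `^ (1 - kap) = q by rewrite -powRrM mulVf ?lt0r_neq0// powRr1// ltW.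
  rewrite -[leRHS]qE; apply: ge0_ler_powR; rewrite ?(ltW k10) ?nnegrE ?le_min ?ler01 ?powR_ge0//.
  by rewrite ge_min lexx orbT.
apply: (@le_trans _ _ (B * (q / (1 - kap)))).
  by rewrite /window_factor; apply: ler_wpM2l => //; rewrite ler_pM2r ?invr_gt0.
rewrite (_ : B * (q / (1 - kap)) = 2^-1 * (B / (B + 1))); last first.
  by rewrite /q; field; rewrite !gt_eqF.
by rewrite ler_piMr ?invr_ge0// ler_pdivrMr// mul1r lerDl.
Qed.

Variables (al eta g : R).
Hypothesis al12 : 1 < al < 2.
Hypothesis eta0 : 0 < eta.
Hypothesis g0 : 0 < g.
Hypothesis gE : 4 * g <= al - 1 - eta.

Let eta1 : eta < 1.
Proof. by have := al12; have := g0; have := gE => h1 h2 /andP[h3 h4]; lra. Qed.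

Lemma pk_test_function e : 0 < e <= 1 -> exists a C K, 0 < a /\
  test_function al eta ((1 + eta + 2 * g) / al) (pk e) (dpk e) (288 / g) a C K.
Proof.
move=> e01; have /andP[e0 _] := e01; have /andP[a1 a2] := al12.
have c0 : 0 < 288 :> R by rewrite ltr0n.
have A0 : 0 < 288 / g := divr_gt0 c0 g0.
have B0 : 0 <= e ^- 2 by rewrite invr_ge0 exprn_ge0// ltW.
have [a a0 ha] := powR_scale eta1 A0 B0.
have [K hK] := dpk_lipschitz e0.
exists a, e^-1, K; split; first exact: a0.
split.
- exact: pk_law_test.
- by move=> x; exact: is_derive_pk.
- by move=> x; rewrite ger0_norm ?pk_ge0 ?pk_le.
- exact: hK.
- by move=> x; apply: le_trans ha; exact: dpk_le.
Qed.

Lemma pkB_test_function e : 0 < e <= 1 -> exists a C K, 0 < a /\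
  test_function al eta ((1 + eta + 2 * g) / al) (fun x => pk (e / 2) x - pk e x)
    (fun x => dpk (e / 2) x - dpk e x) (576 / g * e `^ g) a C K.
Proof.
move=> e01; have /andP[e0 e1] := e01; have /andP[a1 a2] := al12.
have f0 : 0 < e / 2 by rewrite divr_gt0.
have c0 : 0 < 576 :> R by rewrite ltr0n.
have A0 : 0 < 576 / g * e `^ g := mulr_gt0 (divr_gt0 c0 g0) (powR_gt0 g e0).
have B0 : 0 <= (e / 2) ^- 2 + e ^- 2 by rewrite addr_ge0// invr_ge0 exprn_ge0// ltW.
have [a a0 ha] := powR_scale eta1 A0 B0.
have [K hK] := dpk_lipschitz e0; have [K' hK'] := dpk_lipschitz f0.
exists a, ((e / 2)^-1 + e^-1), (K' + K); split; first exact: a0.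
split.
- exact: pkB_law_test.
- by move=> x; apply: is_deriveB; exact: is_derive_pk.
- by move=> x; apply: (le_trans (ler_normB _ _)); rewrite !ger0_norm ?pk_ge0// lerD// pk_le.
- move=> x y; rewrite (_ : _ - _ = (dpk (e / 2) x - dpk (e / 2) y) - (dpk e x - dpk e y)); last by ring.
  by apply: (le_trans (ler_normB _ _)); rewrite mulrDl; apply: lerD; [exact: hK'|exact: hK].
- by move=> x; apply: le_trans ha; apply: (le_trans (ler_normB _ _)); apply: lerD; exact: dpk_le.
Qed.

End test_functions.

(** * Extension of paths to negative times *)

Section clamped_paths.
Context {R : realType}.
Implicit Types (f : R -> R) (v t : R).

Lemma clamped_right_continuous f v : cadlag_path f ->
  (fun s => f (Num.max 0 s)) s @[s --> v^'+] --> f (Num.max 0 v).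
Proof.
move=> [rc _]; have [v0|v0] := leP 0 v.
  have h : f s @[s --> v^'+] --> f v by exact: rc.
  apply: cvg_trans h; apply: near_eq_cvg; near=> s.
  rewrite max_r//; apply: le_trans v0 _; apply: ltW; near: s; exact: nbhs_right_gt.
apply: cvg_near_cst; near=> s.
rewrite max_l// ltW//; near: s; exact: nbhs_right_lt.
Unshelve. all: by end_near.
Qed.

Lemma clamped_continuous f : {within `[0, +oo[, continuous f} ->
  continuous (fun s : R => f (Num.max 0 s)).
Proof.
move=> /subspace_continuousP cf v.
have m0 : `[0, +oo[%classic (Num.max 0 v) by rewrite /= in_itv/= andbT le_max lexx.
apply: cvg_comp (cf _ m0).
have cm : Num.max 0 s @[s --> v] --> Num.max 0 v.
  by apply: (@continuous_max _ _ (cst 0) id); [exact: cvg_cst|exact: cvg_id].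
move=> S hS; have h2 : \forall s \near v, `[0, +oo[%classic (Num.max 0 s) -> S (Num.max 0 s) := cm _ hS.
apply: filterS h2 => s; apply.
by rewrite /= in_itv/= andbT le_max lexx.
Qed.

Lemma clamped_itv (f : R -> R) t v : `[0, t]%classic v -> f (Num.max 0 v) = f v.
Proof. by rewrite /= in_itv/= => /andP[v0 _]; rewrite max_r. Qed.

End clamped_paths.

(** * Local time of the solution *)

Section assembly.
Context {R : realType} {d : measure_display} {T : measurableType d} (P : probability T R).
Notation mu := (@lebesgue_measure R).
Variables (alpha eta x0 : R) (phi : R -> R)
  (nu : {charge set (measurableTypeR R) -> \bar R})
  (F : R -> set (set T)) (L X : R -> T -> R).
Hypothesis al12 : 1 < alpha < 2.
Hypothesis mphi : mollifier phi.
Hypothesis eta01 : 0 < eta < alpha - 1.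
Hypothesis kato : finite_kato_class eta nu.
Hypothesis sol : sde_solution P alpha F L phi nu x0 X.

(* The hypotheses only concern nonnegative times; stopping at [0] before them
   defines filtration and paths for all real times. *)
Local Notation clamped Y := (fun v : R => Y (Num.max 0 v)).

Let max0_ge0 v : 0 <= Num.max 0 v :> R. Proof. by rewrite le_max lexx. Qed.

Let sF v : sigma_algebra setT (clamped F v).
Proof. by case: sol => -[h _ _] _ _ _ _; exact: h. Qed.

Let FT v : clamped F v `<=` measurable.
Proof. by case: sol => -[_ h _] _ _ _ _; exact: h. Qed.

Let FF (s t : R) : s <= t -> clamped F s `<=` clamped F t.
Proof.
by case: sol => -[_ _ h] _ _ _ _ st; apply: h => //; rewrite ge_max le_max lexx/= le_max st orbT.
Qed.

Let mX v : measurable_fun [set: g_sigma_algebraType (clamped F v)] (clamped X v : T -> measurableTypeR R).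
Proof. by apply/(sub_sigma_measurable (sF v)); case: sol => _ _ h _ _; exact: h. Qed.

Let mL v : measurable_fun [set: g_sigma_algebraType (clamped F v)] (clamped L v : T -> measurableTypeR R).
Proof. by apply/(sub_sigma_measurable (sF v)); case: sol => _ [[h _ _ _ _] _] _ _ _; exact: h. Qed.

Let rcX w v : clamped X s w @[s --> v^'+] --> clamped X v w.
Proof. by case: sol => _ _ _ h _; exact: clamped_right_continuous (h w). Qed.

(** The window length is determined by the exponents and the Kato bound alone, not by the starting
    time, so windows can be chained. Absorption is carried out with the Poisson kernels; its outcome
    then bounds the drift term for their differences, which retain the gain [e ^ g]. *)
Lemma solution_windows : exists h g D D', [/\ 0 < h, 0 < g, 0 <= D, 0 <= D' &
  (forall e z, 0 < e <= 1 -> window_estimate P (clamped F) (clamped X) (fun x => pk e (x - z)) D' h) /\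
  (forall e z, 0 < e <= 1 -> window_estimate P (clamped F) (clamped X)
     (fun x => pk (e / 2) (x - z) - pk e (x - z)) (D * e `^ g) h)].
Proof.
have /andP[al1 al2] := al12; have /andP[eta0 etaa] := eta01.
have e01 : 0 < eta < 1 by rewrite eta0; move: al2 etaa; lra.
pose g := (alpha - 1 - eta) / 4.
have g0 : 0 < g by rewrite divr_gt0// subr_gt0.
have gE : 4 * g <= alpha - 1 - eta by rewrite /g mulrC divfK.
pose kap := (1 + eta + 2 * g) / alpha.
have a0 : 0 < alpha by apply: lt_trans al1.
have kap01 : 0 <= kap < 1.
  have n0 : 0 <= 1 + eta + 2 * g by move: (g) g0 eta0 => g' g'0; lra.
  rewrite (divr_ge0 n0 (ltW a0))/= ltr_pdivrMr// mul1r.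
  by rewrite /g; move: etaa; lra.
have [M M0 hM] := mollification_kernel_bound mphi e01 kato.
pose A1 := 288 / g.
have A10 : 0 <= A1 := divr_ge0 (ler0n _ _) (ltW g0).
have AM0 : 0 <= A1 * M by exact: mulr_ge0.
have [h h01 hw] := small_window kap01 AM0.
have [h0 h1] := andP h01.
have h01' : 0 <= h <= 1 by rewrite h1 ltW.
have cM : A1 * window_factor kap h * M <= 2^-1 by rewrite mulrAC.
case: sol => filF levyL aX cX [A [[mA cA] XLA ucp [nk nkS bv]]].
(* The variations are bounded only along the subsequence [nk]; convergence to [A] passes to it
   because [nk k >= k]. *)
pose b k := mollification phi nu (nk k).
have cb k : continuous (b k) by exact: mollification_continuous.
have [Cb bC] := choice (fun k => mollification_bounded mphi nu (nk k)).
have bM a k x : 0 < a -> (\int[mu]_y (kc eta a (x - y) * `|b k y|)%:E <= M%:E)%E by exact: hM.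
have mA' v : measurable_fun [set: T] (clamped A v : T -> measurableTypeR R) by exact: mA.
have cA' w : continuous (fun v : R => clamped A v w) by exact: (clamped_continuous (cA w)).
have XLA' : {ae P, forall w, forall t, 0 <= t -> clamped X t w = x0 + clamped L t w + clamped A t w}.
  by apply: filterS XLA => w h' t t0; exact: h'.
have smooth := levy_smoothing (eta := eta) (kap := kap) e01 (andP kap01).1 filF levyL.
have ucp' : ucp_limit P (path_integral (clamped X) b) (clamped A).
  move=> t t0 e e0.
  have nkge k : (k <= nk k)%N by elim: k => // k IH; exact: (leq_ltn_trans IH (nkS _ _ (ltnSn k))).
  have nkoo : nk k @[k --> \oo] --> \oo.
    apply/cvgnyPge => N; near=> k; apply: leq_trans (nkge k); near: k; exact: nbhs_infty_ge.
  have h' := cvg_comp _ _ nkoo (ucp t t0 e e0).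
  apply: cvg_trans h'; apply: near_eq_cvg; near=> k; congr (P _); apply: eq_set => w.
  have E : [set `|path_integral (clamped X) b k s w - clamped A s w|%:E | s in `[0%R, t]] =
     [set `|\int[mu]_(r in `[0, s]) mollification phi nu (nk k) (X r w) - A s w|%:E | s in `[0%R, t]].
    apply: eq_imagel => s s0; rewrite (clamped_itv (A ^~ w) s0).
    have -> // : path_integral (clamped X) b k s w = \int[mu]_(r in `[0, s]) mollification phi nu (nk k) (X r w).
    apply: eq_Rintegral => r; rewrite inE => r0.
    by rewrite /b (clamped_itv (X ^~ w) r0).
  by rewrite E.
have bv' t : 0 < t -> {ae P, forall w, (ereal_sup (range (fun k => \int[mu]_(s in `[0%R, t]) `|b k (clamped X s w)|%:E)) < +oo)%E}.
  move=> t0; apply: filterS (bv t t0) => w hw'.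
  have E : (fun k => \int[mu]_(s in `[0%R, t]) `|b k (clamped X s w)|%:E)%E =
    (fun k => \int[mu]_(s in `[0%R, t]) `|mollification phi nu (nk k) (X s w)|%:E)%E.
    apply/funext => k; apply: eq_integral => s; rewrite inE => s0.
    by rewrite /b (clamped_itv (X ^~ w) s0).
  by rewrite E; exact: hw'.
have pkt := pk_test_function al12 eta0 g0 gE.
have W G dG Ag a C K : 0 < a -> test_function alpha eta kap G dG Ag a C K -> forall z,
    window_estimate P (clamped F) (clamped X) (fun x => G (x - z)) (2 * (Ag * window_factor kap h)) h.
  move=> a0' tf z s t zeta Cz s0 st ts mz z0 zC.
  (* The degenerate window [s = t = 0] is separated, since [window_bound] asks for a positive end
     time. *)
  have [t0|t0] := eqVneq t 0.
    have -> : s = t by apply/eqP; rewrite eq_le st t0.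
    rewrite set_itv1 integral_set1 lee_fin; apply: mulr_ge0; last exact: Rintegral_ge0.
    apply: mulr_ge0 => //; apply: mulr_ge0; last exact: window_factor_ge0.
    have ap : 0 < a `^ (eta - 1) by rewrite powR_gt0.
    have [_ _ _ _ dGC] := tf.
    by rewrite -(pmulr_lge0 _ ap); exact: le_trans (dGC 0).
  have t0' : 0 < t by rewrite lt_neqAle eq_sym t0 (le_trans s0).
  exact: (window_bound sF FT FF mX rcX cb bC e01 kap01 mA' cA' mL XLA' smooth s0 mz z0 zC ucp' bv' M0 bM h01' A10 cM pkt z a0' tf st ts t0').
exists h, g, (2 * (576 / g * window_factor kap h)), (2 * (A1 * window_factor kap h)).
have wf0 : 0 <= window_factor kap h by exact: window_factor_ge0.
split; [exact: h0|exact: g0| | |split => e z e01'].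
- exact: (mulr_ge0 (ler0n _ _) (mulr_ge0 (divr_ge0 (ler0n _ _) (ltW g0)) wf0)).
- exact: (mulr_ge0 (ler0n _ _) (mulr_ge0 A10 wf0)).
- by have [a [C [K [a0' tf]]]] := pkt e e01'; exact: (W _ _ _ _ _ _ a0' tf z).
have [a [C [K [a0' tf]]]] := pkB_test_function al12 eta0 g0 gE e01'.
have := W _ _ _ _ _ _ a0' tf z.
by rewrite (_ : 2 * (576 / g * e `^ g * _) = 2 * (576 / g * window_factor kap h) * e `^ g); [|ring].
Unshelve. all: by end_near.
Qed.

(* The limit superior makes [local_time] measurable without discarding the
   null set on which the approximations need not converge. *)
Definition local_time (t x : R) (w : T) : R :=
  fine (limn_esup (fun n => (smooth_density (clamped X ^~ w) n t x)%:E)).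

Lemma clamped_path w : measurable_fun [set: R] (fun v : R => clamped X v w).
Proof. exact: (measurableT_comp (process_measurable sF FT mX rcX) (measurable_pair2 w)). Qed.

Lemma local_time_measurable t x : measurable_fun setT (local_time t x).
Proof.
apply: (measurableT_comp (fine_measurable measurableT)) => //.
apply: measurable_fun_limn_esup => n; apply/measurable_EFinP.
apply: measurable_funM => //.
apply: (@measurable_Rintegral_param R _ T _ _ mu `[0, t]%classic (fun r w => pk (2^-1 ^+ n) (clamped X r w - x))).
  exact: measurable_itv.
have e0 : 0 < 2^-1 ^+ n :> R by rewrite exprn_gt0.
apply: (measurableT_comp (continuous_measurable_fun (@pk_continuous _ _ x e0))).
exact: (process_measurable sF FT mX rcX).
Qed.

Lemma local_time_density : {ae P, forall w,
  (forall K : nat, exists C theta (N : nat), 0 < theta < 1 /\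
    forall n t y, (N <= n)%N -> t <= K%:R -> `|y| <= K%:R ->
    `|smooth_density (clamped X ^~ w) n.+1 t y - smooth_density (clamped X ^~ w) n t y| <= C * theta ^+ n)}.
Proof.
have [h [g [D [D' [h0 g0 D0 D'0 [wpk wpkB]]]]]] := solution_windows.
apply: ae_foralln => K.
have [C [theta [C0 th tail]]] := dyadic_tail sF FT FF mX rcX h0 g0 D0 D'0 wpk wpkB K.
exact: (smooth_density_cauchy clamped_path th C0 tail).
Qed.

Lemma local_timeE w : (forall K : nat, exists C theta (N : nat), 0 < theta < 1 /\
    forall n t y, (N <= n)%N -> t <= K%:R -> `|y| <= K%:R ->
    `|smooth_density (clamped X ^~ w) n.+1 t y - smooth_density (clamped X ^~ w) n t y| <= C * theta ^+ n) ->
  forall t x, local_time t x w = density (clamped X ^~ w) t x.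
Proof.
move=> cauchy t x; rewrite /local_time.
have h : (smooth_density (clamped X ^~ w) n t x)%:E @[n --> \oo] --> (density (clamped X ^~ w) t x)%:E.
  by apply: cvg_EFin; [exact: nearW|exact: density_cvg].
by rewrite is_cvg_limn_esupE ?(cvg_lim _ h)//; apply/cvg_ex; eexists; exact: h.
Qed.

Lemma local_time_occupation : occupation_density P X local_time.
Proof.
split => [t x _|]; first exact: local_time_measurable.
apply: filterS local_time_density => w cauchy t t0.
have E : (fun x => local_time t x w) = density (clamped X ^~ w) t.
  by apply/funext => x; exact: local_timeE.
split.
- by rewrite E; exact: (measurable_density (clamped_path w) cauchy).
- by move=> x; rewrite local_timeE//; exact: (density_ge0 cauchy).
move=> B mB.
have -> : (\int[mu]_(x in B) (local_time t x w)%:E = \int[mu]_(x in B) (density (clamped X ^~ w) t x)%:E)%E.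
  by apply: eq_integral => x _; rewrite local_timeE.
rewrite -(density_occupation (clamped_path w) cauchy t0 mB) /occupation_measure.
congr (mu _); apply/seteqP; split => s [s0 Bs]; split => //; move: Bs; rewrite /preimage /=.
  by rewrite (clamped_itv (X ^~ w) s0).
by rewrite (clamped_itv (X ^~ w) s0).
Qed.

Lemma local_time_continuous : jointly_continuous P local_time.
Proof.
apply: filterS local_time_density => w cauchy; apply: continuous_subspaceT.
rewrite (_ : (fun p : R * R => local_time p.1 p.2 w) = fun p => density (clamped X ^~ w) p.1 p.2).
  exact: (density_continuous (clamped_path w) cauchy).
by apply/funext => p; exact: local_timeE.
Qed.

End assembly.

Theorem proposition3p11 (R : realType) (d : measure_display)
  (T : measurableType d) (P : probability T R)
  (alpha eta x0 : R) (phi : R -> R)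
  (mu : {charge set (measurableTypeR R) -> \bar R})
  (F : R -> set (set T)) (L X : R -> T -> R) :
  1 < alpha < 2 ->
  mollifier phi ->
  0 < eta < alpha - 1 ->
  finite_kato_class eta mu ->
  sde_solution P alpha F L phi mu x0 X ->
  exists ell : R -> R -> T -> R,
    occupation_density P X ell /\ jointly_continuous P ell.
Proof.
move=> al12 mphi eta01 kato sol; exists (local_time X).
split; first exact: (local_time_occupation al12 mphi eta01 kato sol).
exact: (local_time_continuous al12 mphi eta01 kato sol).
Qed.
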